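(* The solution $u=\{u(t,x);\,t\ge0,\,x\in\mathbb{R}^d\}$ of the linear stochastic heat equation $$\frac{\partial u}{\partial t}(t,x)=\frac12\Delta u(t,x)+\dot W(t,x),\ t>0,\,x\in\mathbb{R}^d,\qquad u(0,x)=0,\ x\in\mathbb{R}^d,$$ exists if and only if the measure $\mu$ satisfies $$\int_{\mathbb{R}^d}\left(\frac{1}{1+|\xi|^2}\right)^{2H}\mu(d\xi)<\infty.$$ In this case, for all $p\ge2$ and $T>0$, $$\sup_{t\in[0,T]}\sup_{x\in\mathbb{R}^d}E|u(t,x)|^p<\infty,$$ and the solution is $L^2(\Omega)$-continuous, i.e. the map $(t,x)\mapsto u(t,x)$ is continuous from $\mathbb{R}_+\times\mathbb{R}^d$ into $L^2(\Omega)$.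
   Context: Fix $d\ge 1$ and $H\in(1/2,1)$; put $\alpha_H=H(2H-1)$ and $R_H(t,s)=\frac12(t^{2H}+s^{2H}-|t-s|^{2H})$. $\mathcal{F}\varphi(\xi)=\int_{\mathbb{R}^d}e^{-i\xi\cdot x}\varphi(x)\,dx$ is the Fourier transform in space. $\mu$ is a non-negative tempered measure on $\mathbb{R}^d$, i.e. $\int_{\mathbb{R}^d}(1+|\xi|^2)^{-l}\mu(d\xi)<\infty$ for some $l>0$, whose Fourier transform in $\mathcal{S}'(\mathbb{R}^d)$ is a function $f:\mathbb{R}^d\to\mathbb{R}_+$, i.e. $\int f\phi\,dx=\int\mathcal{F}\phi\,d\mu$ for all $\phi\in\mathcal{S}(\mathbb{R}^d)$. Noise: on a complete probability space, $W=\{W_t(A);\,t\ge0,\,A\subset\mathbb{R}^d\text{ bounded Borel}\}$ is a zero-mean Gaussian process with $E(W_t(A)W_s(B))=R_H(t,s)\int_A\int_Bf(x-y)\,dx\,dy=:\langle1_{[0,t]\times A},1_{[0,s]\times B}\rangle_{\mathcal{HP}}$. $\mathcal{E}$ is the set of linear combinations of the functions $1_{[0,t]\times A}$, and $\mathcal{HP}$ is the Hilbert space closure of $\mathcal{E}$ for $\langle\cdot,\cdot\rangle_{\mathcal{HP}}$. On $\mathcal{E}$, $$\|\varphi\|_{\mathcal{HP}}^2=\alpha_H\int_{\mathbb{R}^d}\int_0^\infty\int_0^\infty\mathcal{F}\varphi(u,\cdot)(\xi)\overline{\mathcal{F}\varphi(v,\cdot)(\xi)}|u-v|^{2H-2}\,du\,dv\,\mu(d\xi).$$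 The map $1_{[0,t]\times A}\mapsto W_t(A)$ extends to an isometry $\varphi\mapsto W(\varphi)=\int_0^\infty\int_{\mathbb{R}^d}\varphi(t,x)W(dt,dx)$ from $\mathcal{HP}$ into $L^2(\Omega)$. A map $t\mapsto\varphi(t,\cdot)\in\mathcal{S}'(\mathbb{R}^d)$ vanishing for $t$ outside a bounded interval, with $\mathcal{F}\varphi(t,\cdot)(\xi)$ a jointly measurable function bounded in $t$ for each $\xi$, is said to belong to $\mathcal{HP}$ if it is the limit of elements of $\mathcal{E}$ in the norm given by the displayed formula; it is then identified with the corresponding element of $\mathcal{HP}$. Solution: let $G_2(t,x)=(2\pi t)^{-d/2}\exp(-|x|^2/(2t))$, $t>0$, be the fundamental solution of $u_t-\frac12\Delta u=0$, so $\mathcal{F}G_2(t,\cdot)(\xi)=\exp(-t|\xi|^2/2)$. The solution is the process $u(t,x)=\int_0^t\int_{\mathbb{R}^d}G_2(t-s,x-y)W(ds,dy)=W(g_{tx})$, where $g_{tx}(s,\cdot)=G_2(t-s,x-\cdot)$ for $s\in[0,t)$ and $0$ otherwise. By definition $u(t,x)$ exists if and only if $g_{tx}\in\mathcal{HP}$; the solution $u$ exists if this holds for all $(t,x)$. *)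

(* Defs.v *)
From HB Require Import structures.
From mathcomp Require Import all_boot all_order all_algebra.
From mathcomp Require Import complex.
From mathcomp Require Import all_classical all_reals all_analysis.
From mathcomp Require Import measurable_realfun.

Set Implicit Arguments.
Unset Strict Implicit.
Unset Printing Implicit Defensive.

Import Order.TTheory GRing.Theory Num.Theory.
Import numFieldNormedType.Exports.

Local Open Scope classical_set_scope.
Local Open Scope complex_scope.
Local Open Scope ring_scope.

Section borel_rV.
Variables (R : realType) (n : nat).

Definition borel_rV : set (set 'rV[R]_n) := <<s @open 'rV[R]_n >>.

Let borel0 : borel_rV set0. Proof. exact: sigma_algebra0. Qed.

Let borelC A : borel_rV A -> borel_rV (~` A).
Proof. exact: sigma_algebraC. Qed.

Let borel_bigcup (F : (set 'rV[R]_n)^nat) : (forall i, borel_rV (F i)) ->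
  borel_rV (\bigcup_i (F i)).
Proof. exact: sigma_algebra_bigcup. Qed.

HB.instance Definition _ := @isMeasurable.Build default_measure_display
  'rV[R]_n borel_rV borel0 borelC borel_bigcup.

End borel_rV.

Lemma open_rV_measurable (R : realType) n (U : set 'rV[R]_n) :
  open U -> measurable U.
Proof. exact: sub_sigma_algebra. Qed.

Lemma measurable_coord (R : realType) n (i : 'I_n) :
  measurable_fun [set: 'rV[R]_n] (fun v => v ord0 i).
Proof.
apply: (@measurability _ _ _ _ _ _ (@RGenOpens.G R)).
  exact: RGenOpens.measurableE.
move=> _ [_ [a [b ->] <-]]; rewrite setTI; apply: open_rV_measurable.
apply: open_comp; last exact: interval_open.
by move=> v _; exact: coord_continuous.
Qed.

Lemma measurable_fun_rV (R : realType) d (T : measurableType d) n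
    (g : T -> 'rV[R]_n) :
  (forall i, measurable_fun setT (fun x => g x ord0 i)) ->
  measurable_fun setT g.
Proof.
move=> mg; apply: (@measurability _ _ _ _ _ _ (@open 'rV[R]_n)) => //.
move=> _ [U oU <-]; rewrite setTI.
pose box (q : 'rV[rat]_n * nat) : set 'rV[R]_n :=
  [set v | forall i, `|ratr (q.1 ord0 i) - v ord0 i| < q.2.+1%:R^-1].
have UE : U = \bigcup_(q in [set q | box q `<=` U]) box q.
  apply/seteqP; split => [v Uv|v [q /= qU]]; last exact: qU.
  have /nbhs_ballP[e /= e0 eU] : nbhs v U by exact: open_nbhs_nbhs.
  have [k ke] : exists k : nat, (k.+1%:R^-1 : R) < e / 2.
    have /cvgrPdist_lt/(_ (e / 2)) := @cvg_harmonic R.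
    rewrite divr_gt0// => /(_ isT) [k _ /(_ k (leqnn k))].
    by rewrite /harmonic/= sub0r normrN ger0_norm// => ?; exists k.
  have hq i : {q : rat | `|ratr q - v ord0 i| < (k.+1%:R^-1 : R)}.
    apply/cid; have [|q qi] := @rat_in_itvoo R (v ord0 i - k.+1%:R^-1)
        (v ord0 i + k.+1%:R^-1).
      by rewrite ltrBlDr -addrA ltrDl addr_gt0.
    by exists q; move: qi; rewrite in_itv/= ltr_distl.
  exists (\row_i sval (hq i), k) => /=.
    move=> w bw; apply: eU; split=> // i j; rewrite (ord1 i).
    have := bw j; have := svalP (hq j); rewrite /= !mxE.
    move: (ratr _) => r h1 h2; rewrite /ball/= [e]splitr.
    rewrite (le_lt_trans (ler_distD r _ _))// ltrD//; last exact: lt_trans ke.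
    by rewrite distrC; exact: lt_trans ke.
  by move=> i; rewrite !mxE; exact: (svalP (hq i)).
rewrite UE preimage_bigcup bigcup_mkcond; apply: countable_bigcupT_measurable.
  exact: countableP.
move=> q; case: ifP => // _.
have -> : g @^-1` box q = \bigcap_(i in [set: 'I_n])
    ((fun x => g x ord0 i) @^-1` [set y | `|ratr (q.1 ord0 i) - y| < q.2.+1%:R^-1]).
  by apply/seteqP; split => x /= h i; [move=> _|]; exact: h.
apply: fin_bigcap_measurable => [|i _]; first exact: finite_finset.
rewrite -[X in measurable X]setTI; apply: mg => //.
apply: open_measurable; exact: (@ball_open R R).
Qed.

Section lebesgue_rV.
Variable R : realType.

Definition cons_rV n (p : measurableTypeR R * 'rV[R]_n) : 'rV[R]_n.+1 :=
  row_mx (const_mx p.1 : 'rV_1) p.2.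

Lemma cons_rVl n p (j : 'I_1) : @cons_rV n p ord0 (lshift n j) = p.1.
Proof. by apply: etrans (row_mxEl _ _ _ _) _; rewrite mxE. Qed.

Lemma cons_rVr n p (j : 'I_n) : @cons_rV n p ord0 (rshift 1 j) = p.2 ord0 j.
Proof. exact: row_mxEr. Qed.

Lemma measurable_cons_rV n : measurable_fun setT (@cons_rV n).
Proof.
apply: measurable_fun_rV => i.
have [[j ->]|[j ->]] : (exists j, i = lshift n (j : 'I_1)) \/
    (exists j, i = rshift 1 (j : 'I_n)).
  by case: (@split_ordP 1 n i) => j ->; [left|right]; exists j.
- have -> : (fun p => cons_rV p ord0 (lshift n j)) = fst.
    by apply/funext => p; rewrite (cons_rVl p j).
  exact: measurable_fst.
- have -> : (fun p => cons_rV p ord0 (rshift 1 j)) =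
      (fun v : 'rV[R]_n => v ord0 j) \o snd.
    by apply/funext => p; exact: cons_rVr.
  exact: measurableT_comp (@measurable_coord R n j) measurable_snd.
Qed.

HB.instance Definition _ n := isMeasurableFun.Build _ _ _ _
  (@cons_rV n) (@measurable_cons_rV n).

Definition uncons_rV n (v : 'rV[R]_n.+1) : measurableTypeR R * 'rV[R]_n :=
  (v ord0 ord0, @rsubmx R 1 1 n v).

Lemma cons_rVK n : cancel (@cons_rV n) (@uncons_rV n).
Proof.
case=> x v; congr pair; last exact: row_mxKr.
rewrite -[RHS](cons_rVl (x, v) ord0).
by congr (cons_rV _ _ _); exact: val_inj.
Qed.

Lemma measurable_uncons_rV n : measurable_fun setT (@uncons_rV n).
Proof.
apply/measurable_fun_pairP; split; first exact: measurable_coord.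
apply: measurable_fun_rV => i.
have -> : (fun v => (snd \o @uncons_rV n) v ord0 i) =
    (fun v : 'rV[R]_(1 + n) => v ord0 (rshift 1 i)).
  by apply/funext => v /=; rewrite mxE.
exact: measurable_coord.
Qed.

Section step.
Variables (n : nat) (m : {sigma_finite_measure set 'rV[R]_n -> \bar R}).

Definition lebesgue_step : set 'rV[R]_n.+1 -> \bar R :=
  pushforward (lebesgue_measure \x m)%E (@cons_rV n).

Let step0 : lebesgue_step set0 = 0%E.
Proof. exact: measure0. Qed.

Let step_ge0 A : (0 <= lebesgue_step A)%E.
Proof. exact: measure_ge0. Qed.

Let step_sigma_additive : semi_sigma_additive lebesgue_step.
Proof. exact: measure_semi_sigma_additive. Qed.

HB.instance Definition _ := isMeasure.Build _ _ _ lebesgue_step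
  step0 step_ge0 step_sigma_additive.

Let step_sigma_finite : sigma_finite setT lebesgue_step.
Proof.
have /sigma_finiteP[F [TF ndF Foo]] := sigma_finiteT (@lebesgue_measure R).
have /sigma_finiteP[G [TG ndG Goo]] := sigma_finiteT m.
exists (fun k => @uncons_rV n @^-1` (F k `*` G k)).
  apply/seteqP; split => // v _; have [i _ Fi] : (\bigcup_i F i) (v ord0 ord0).
    by rewrite -TF.
  have [j _ Gj] : (\bigcup_j G j) (@rsubmx R 1 1 n v) by rewrite -TG.
  exists (maxn i j) => //; split => /=.
    by move: Fi; exact/subsetPset/ndF/leq_maxl.
  by move: Gj; exact/subsetPset/ndG/leq_maxr.
move=> k; have [mF Fk] := Foo k; have [mG Gk] := Goo k; split.
  rewrite -[X in measurable X]setTI; apply: measurable_uncons_rV => //.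
  exact: measurableX.
rewrite /lebesgue_step /pushforward -comp_preimage.
rewrite (_ : _ \o _ = id) ?preimage_id; last by apply/funext; exact: cons_rVK.
by rewrite product_measure1E// lte_mul_pinfty// ge0_fin_numE.
Qed.


HB.instance Definition _ := Measure_isSigmaFinite.Build _ _ _ lebesgue_step
  step_sigma_finite.
End step.

Fixpoint lebesgue_rV n : {sigma_finite_measure set 'rV[R]_n -> \bar R} :=
  if n is n.+1 then lebesgue_step (lebesgue_rV n) else \d_(0 : 'rV[R]_0).

End lebesgue_rV.

Section box_volume.
Local Open Scope ereal_scope.
Variable R : realType.

Lemma lebesgue_rV_box n (A : 'I_n -> set R) : (forall i, measurable (A i)) ->
  lebesgue_rV R n [set v : 'rV[R]_n | forall i, A i (v ord0 i)] =
  \prod_(i < n) (@lebesgue_measure R) (A i).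
Proof.
elim: n A => [A _|n IH A mA].
  rewrite big_ord0 /= diracE mem_set//.
  by case.
rewrite big_ord_recl /= /lebesgue_step /pushforward.
set B := [set v : 'rV[R]_n | forall i, A (lift ord0 i) (v ord0 i)].
have mB : measurable B.
  have -> : B = \bigcap_(i in [set: 'I_n])
      ((fun v : 'rV[R]_n => v ord0 i) @^-1` A (lift ord0 i)).
    by apply/seteqP; split => v /= h i; [move=> _|]; exact: h.
  apply: fin_bigcap_measurable => [|i _]; first exact: finite_finset.
  by rewrite -[X in measurable X]setTI; exact: measurable_coord.
have -> : @cons_rV R n @^-1` [set v : 'rV[R]_n.+1 | forall i, A i (v ord0 i)] =
    A ord0 `*` B; last first.
  have -> : \prod_(i < n) lebesgue_measure (A (lift ord0 i)) = lebesgue_rV R n B.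
    by apply/esym; apply: IH.
  exact: (product_measure1E (@lebesgue_measure R) (lebesgue_rV R n)
    (mA ord0) mB).
have l0 : @ord0 n = @lshift 1 n ord0 by exact: val_inj.
have lS (i : 'I_n) : @lift n.+1 ord0 i = @rshift 1 n i by exact: val_inj.
have c0 (p : measurableTypeR R * 'rV[R]_n) : cons_rV p ord0 ord0 = p.1.
  by rewrite -(cons_rVl p ord0) -l0.
have cS (p : measurableTypeR R * 'rV[R]_n) i :
  cons_rV p ord0 (lift ord0 i) = p.2 ord0 i.
  by rewrite -(cons_rVr p i) -lS.
apply/seteqP; split => -[x v] /=.
  move=> h; split => [|i]; first by have := h ord0; rewrite c0.
  by have := h (lift ord0 i); rewrite cS.
by case=> hx hv i; case: (unliftP ord0 i) => [j ->|->]; rewrite ?cS ?c0//;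
  exact: hv.
Qed.

End box_volume.

Section complex_integral.
Context d (T : measurableType d) (R : realType).
Implicit Types (m : {measure set T -> \bar R}) (D : set T) (g : T -> R[i]).

Definition cintegrable m D g : Prop :=
  m.-integrable D (fun x => (complex.Re (g x))%:E) /\
  m.-integrable D (fun x => (complex.Im (g x))%:E).

Definition cintegral m D g : R[i] :=
  Rintegral m D (fun x => complex.Re (g x)) +i*
  Rintegral m D (fun x => complex.Im (g x)).

End complex_integral.

Section fourier.
Variables (R : realType) (d : nat).
Local Notation Rd := 'rV[R]_d.
Implicit Types (x y xi : Rd).

Definition dotv x y : R := \sum_(i < d) x ord0 i * y ord0 i.

(* the squared Euclidean norm; `|x| on 'rV[R]_d is the sup norm *)
Definition sqnorm x : R := dotv x x.

Definition expi (t : R) : R[i] := cos t +i* sin t.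

Definition fourier (phi : Rd -> R[i]) xi : R[i] :=
  cintegral (lebesgue_rV R d) setT (fun x => expi (- dotv xi x) * phi x).

Definition partials (s : seq 'I_d) (phi : Rd -> R) : Rd -> R :=
  foldr (fun i g x => 'D_(delta_mx ord0 i) g x) phi s.

(* Existence and boundedness of the iterated partial derivatives of all orders
   makes each of them Lipschitz, so that phi is of class C^oo. *)
Definition schwartz (phi : Rd -> R) : Prop :=
  forall s : seq 'I_d,
    (forall i x, derivable (partials s phi) x (delta_mx ord0 i)) /\
    (forall k : nat, exists C : R,
      forall x, (1 + sqnorm x) ^+ k * `|partials s phi x| <= C).

Definition cschwartz (phi : Rd -> R[i]) : Prop :=
  schwartz (fun x => complex.Re (phi x)) /\
  schwartz (fun x => complex.Im (phi x)).

Definition tempered (mu : {measure set Rd -> \bar R}) : Prop :=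
  exists2 l : R, 0 < l &
    (\int[mu]_xi ((1 + sqnorm xi) `^ (- l))%:E < +oo)%E.

(* Rintegral takes junk values on non-integrable functions, whence the
   explicit requirement that f phi be integrable. *)
Definition is_fourier_transform (mu : {measure set Rd -> \bar R})
    (f : Rd -> R) : Prop :=
  measurable_fun setT f /\
  forall phi : Rd -> R[i], cschwartz phi ->
    cintegrable (lebesgue_rV R d) setT (fun x => (f x)%:C * phi x) /\
    cintegral (lebesgue_rV R d) setT (fun x => (f x)%:C * phi x) =
    cintegral mu setT (fourier phi).

End fourier.

Section space_HP.
Variables (R : realType) (d : nat).
Local Notation Rd := 'rV[R]_d.

Definition alphaH (H : R) : R := H * (2 * H - 1).

Definition RH (H t s : R) : R :=
  (t `^ (2 * H) + s `^ (2 * H) - `|t - s| `^ (2 * H)) / 2.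

Record cylinder := Cylinder {
  cyl_time : R;
  cyl_base : set Rd;
  cyl_time_ge0 : 0 <= cyl_time;
  cyl_measurable : measurable cyl_base;
  cyl_bounded : bounded_set cyl_base }.

(* formal linear combinations of the indicators 1_([0, t] x A) *)
Definition elementary := seq (R * cylinder).

Definition elem_fun (e : elementary) (t : R) (x : Rd) : R :=
  \sum_(c <- e) c.1 * (\1_`[0, cyl_time c.2] t * \1_(cyl_base c.2) x).

Definition spatial_fourier (phi : R -> Rd -> R) (t : R) (xi : Rd) : R[i] :=
  fourier (fun x => (phi t x)%:C) xi.

(* The double time integral is a nonnegative real number, because
   |u - v| `^ (2 * H - 2) is a positive definite kernel. *)
Definition hp_norm2 (H : R) (mu : {measure set Rd -> \bar R})
    (phi : R -> Rd -> R) : \bar R :=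
  ((alphaH H)%:E * \int[mu]_xi (complex.Re
    (cintegral lebesgue_measure `[0, +oo[ (fun v =>
      cintegral lebesgue_measure `[0, +oo[ (fun u =>
        spatial_fourier phi u xi * conjc (spatial_fourier phi v xi)
        * (`|u - v| `^ (2 * H - 2))%:C))))%:E)%E.

(* An S'-valued map t |-> phi t is represented here by integrable functions,
   so that its spatial Fourier transform is given by the integral. *)
Definition hp_admissible (phi : R -> Rd -> R) : Prop :=
  [/\ exists T : R, forall t, t \notin `[0, T] -> forall x, phi t x = 0,
      forall t, (lebesgue_rV R d).-integrable setT (fun x => (phi t x)%:E),
      measurable_fun setT
        (fun p : R * Rd => complex.Re (spatial_fourier phi p.1 p.2)),
      measurable_fun setT
        (fun p : R * Rd => complex.Im (spatial_fourier phi p.1 p.2)) &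
      forall xi, exists M : R,
        forall t, `|spatial_fourier phi t xi| <= M%:C].

Definition approximates (H : R) (mu : {measure set Rd -> \bar R})
    (e : nat -> elementary) (phi : R -> Rd -> R) : Prop :=
  hp_norm2 H mu (fun t x => phi t x - elem_fun (e n) t x)
    @[n --> \oo] --> 0%E.

Definition in_HP (H : R) (mu : {measure set Rd -> \bar R})
    (phi : R -> Rd -> R) : Prop :=
  hp_admissible phi /\ exists e, approximates H mu e phi.

End space_HP.

Section noise.
Context (R : realType) (d : nat) (dO : measure_display)
  (O : measurableType dO) (P : probability O R).
Local Notation Rd := 'rV[R]_d.
Implicit Types (W : R -> set Rd -> {RV P >-> R}) (u : R -> Rd -> {RV P >-> R}).

(* normal_prob 0 0 is not the Dirac measure, hence the case distinction *)
Definition centered_gaussian (X : O -> R) : Prop :=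
  exists2 s : R, 0 <= s & forall B : set R, measurable B ->
    P (X @^-1` B) = if s == 0 then \d_(0 : R) B else normal_prob 0 s B.

Definition elem_noise W (e : elementary R d) (w : O) : R :=
  \sum_(c <- e) c.1 * W (cyl_time c.2) (cyl_base c.2) w.

Definition gaussian_noise (H : R) (f : Rd -> R) W : Prop :=
  (forall e : elementary R d, centered_gaussian (elem_noise W e)) /\
  (forall (t s : R) (A B : set Rd), 0 <= t -> 0 <= s ->
    measurable A -> bounded_set A -> measurable B -> bounded_set B ->
    ('E_P[(fun w => W t A w * W s B w)%R] =
     (RH H t s)%:E * \int[lebesgue_rV R d]_(x in A)
                       \int[lebesgue_rV R d]_(y in B) (f (x - y))%:E)%E).

(* The isometric extension of 1_([0, t] x A) |-> W t A to HP: X is the L^2-limit of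
   the images of every sequence of elementary functions converging to phi. *)
Definition is_wiener_integral (H : R) (mu : {measure set Rd -> \bar R}) W
    (phi : R -> Rd -> R) (X : {RV P >-> R}) : Prop :=
  [/\ in_HP H mu phi,
      ('E_P[(fun w => (X w) ^+ 2)%R] < +oo)%E &
      forall e, approximates H mu e phi ->
        'E_P[(fun w => (elem_noise W (e n) w - X w) ^+ 2)%R]%E
          @[n --> \oo] --> 0%E].

Definition heat_kernel (t : R) (x : Rd) : R :=
  (2 * pi * t) `^ (- (d%:R / 2)) * expR (- (sqnorm x / (2 * t))).

Definition heat_integrand (t : R) (x : Rd) (s : R) (y : Rd) : R :=
  if 0 <= s < t then heat_kernel (t - s) (x - y) else 0.

Definition solution_exists (H : R) (mu : {measure set Rd -> \bar R}) : Prop :=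
  forall t x, 0 <= t -> in_HP H mu (heat_integrand t x).

Definition is_solution (H : R) (mu : {measure set Rd -> \bar R}) W u : Prop :=
  forall t x, 0 <= t -> is_wiener_integral H mu W (heat_integrand t x) (u t x).

Definition L2_continuous u : Prop :=
  forall (t : R) (x : Rd), 0 <= t ->
    'E_P[(fun w => (u q.1 q.2 w - u t x w) ^+ 2)%R]%E
      @[q --> within [set q : R * Rd | 0 <= q.1] (nbhs (t, x))] --> 0%E.

Definition sup_moment u (p T : R) : \bar R :=
  ereal_sup [set 'E_P[(fun w => `|u q.1 q.2 w| `^ p)%R]%E |
    q in [set q : R * Rd | 0 <= q.1 <= T]].

End noise.

(* Main.v *)
Require Import Defs.
From HB Require Import structures.
From mathcomp Require Import all_boot all_order all_algebra.
From mathcomp Require Import complex.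
From mathcomp Require Import all_classical all_reals all_analysis.
From mathcomp Require Import measurable_realfun.
From mathcomp Require Import ring lra.

Set Implicit Arguments.
Unset Strict Implicit.
Unset Printing Implicit Defensive.

Import Order.TTheory GRing.Theory Num.Theory.
Import numFieldNormedType.Exports.

Local Open Scope classical_set_scope.
Local Open Scope ring_scope.


(** Everything is computed in the frequency domain. Write k(u, v) for the kernel
    |u - v| `^ (2H - 2), which is positive definite, and energy D for the double integral
    of D(u) D(v) k(u, v). Expanding the Hermitian product (hp_norm2E), the squared norm of
    an integrand is alphaH H times the integral against mu of the energies of the real and
    imaginary parts of its spatial Fourier transform, seen as functions of time. For the
    heat integrand g at (t, x) this transform is exp(- i xi . x) exp(- (t - s) |xi|^2 / 2),
    so that the phase disappears and only the energy of a decaying exponential of rate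
    |xi|^2 / 2 remains. That energy is of the order of (1 + |xi|^2) `^ (- 2H): the lower
    bound at time 1 is energy_heat_profile_ge, the upper bound, locally uniform in t, is
    energy_decay_le.

    Necessity (in_HP_dalang): elements of the Hilbert space have finite norm, because
    elementary functions do, and the lower bound turns this into the integrability
    condition.

    Sufficiency (approximable_heat): g has to be approximated by elementary functions.
    Freezing the heat kernel on the cells of a time grid gives functions whose transforms
    converge pointwise under the same exponential envelope; the upper bound and the
    condition on mu allow dominated convergence in frequency. It remains to approximate
    one heat kernel by spatial step functions (heat_kernel_step_approx). This rests on
    Parseval's identity for indicators of bounded Borel sets (parseval_indic), which is
    obtained by testing the relation between f and mu on heat kernels
    (schwartz_heat_kernel, smoothE), integrating over the two sets and letting the heat
    kernel shrink; the translates of a bounded Borel set depend continuously on the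
    translation in measure (excess_cvg0).

    On elementary functions Parseval's identity and energy2_box, which recognizes the
    covariance of fractional Brownian motion, show that the noise is an isometry
    (elem_noise_isometry). Completeness of the square-integrable functions then yields the
    Wiener integral and its independence of the approximating sequence
    (wiener_integral_exists). Moments of the approximating Gaussian variables are bounded by
    their variances (gaussian_moment_le), hence by the norm of g, uniformly in x and locally
    uniformly in t, and Fatou's lemma transfers the bound to the solution. Continuity
    follows from the isometry and from the continuity of (t, x) |-> g in norm
    (hp_heat_cvg), again by dominated convergence. *)

(** * Integrals of real functions over a whole space *)

Lemma measurable_fst_comp d d1 d2 (T : measurableType d) (T1 : measurableType d1)
    (T2 : measurableType d2) (f : T -> T1 * T2) :
  measurable_fun setT f -> measurable_fun setT (fun x => (f x).1).
Proof. exact: measurableT_comp measurable_fst. Qed.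

Lemma measurable_snd_comp d d1 d2 (T : measurableType d) (T1 : measurableType d1)
    (T2 : measurableType d2) (f : T -> T1 * T2) :
  measurable_fun setT f -> measurable_fun setT (fun x => (f x).2).
Proof. exact: measurableT_comp measurable_snd. Qed.

Lemma measurable_pair_comp d d1 d2 (T : measurableType d) (T1 : measurableType d1)
    (T2 : measurableType d2) (f : T -> T1) (g : T -> T2) :
  measurable_fun setT f -> measurable_fun setT g ->
  measurable_fun setT (fun x => (f x, g x)).
Proof. by move=> mf mg; apply/measurable_fun_pairP; split. Qed.

Lemma measurable_b2r d (T : measurableType d) (R : realType) (P : T -> bool) :
  measurable_fun setT P -> measurable_fun setT (fun x => (P x)%:R : R).
Proof.
move=> mP; rewrite (_ : (fun x => _) = (fun x => if P x then 1 else 0)); last first.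
  by apply/funext => x; case: (P x).
by apply: measurable_fun_if.
Qed.

Ltac mfun := repeat first
  [ assumption | solve [trivial]
  | exact: measurable_fst | exact: measurable_snd
  | apply: measurable_pair_comp
  | apply: measurable_fst_comp | apply: measurable_snd_comp
  | apply: measurable_indic
  | apply: measurable_b2r | apply: measurable_and
  | apply: measurable_fun_ltr | apply: measurable_fun_ler
  | apply: measurable_funM | apply: measurable_funD | apply: measurable_funN
  | apply: measurable_funX
  | (apply: measurableT_comp; [exact: measurable_expR|])
  | (apply: measurableT_comp; [exact: normr_measurable|]) ].

Section toolkit.
Context d (T : measurableType d) (R : realType) (m : {measure set T -> \bar R}).
Implicit Types f g h : T -> R.

Lemma ge0_le_int f g : measurable_fun setT f -> measurable_fun setT g ->
  (forall x, 0 <= f x) -> (forall x, f x <= g x) ->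
  (\int[m]_x (f x)%:E <= \int[m]_x (g x)%:E)%E.
Proof.
move=> mf mg f0 fg; apply: ge0_le_integral => //.
- by move=> x _; rewrite lee_fin.
- exact/measurable_EFinP.
- exact/measurable_EFinP.
- by move=> x _; rewrite lee_fin.
Qed.

Lemma dom_integrable f g : measurable_fun setT f ->
  (forall x, `|f x| <= g x) -> m.-integrable setT (EFin \o g) ->
  m.-integrable setT (EFin \o f).
Proof.
move=> mf fg; apply: le_integrable => //; first exact/measurable_EFinP.
by move=> x _; rewrite /= lee_fin (le_trans (fg x))// ler_norm.
Qed.

Lemma integrable_ge0P f : measurable_fun setT f -> (forall x, 0 <= f x) ->
  m.-integrable setT (EFin \o f) <-> (\int[m]_x (f x)%:E < +oo)%E.
Proof.
move=> mf f0; have fE : (\int[m]_x `|(f x)%:E| = \int[m]_x (f x)%:E)%E.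
  by apply: eq_integral => x _; rewrite gee0_abs// lee_fin.
split=> [/integrableP[_]|h]; first by rewrite fE.
by apply/integrableP; split; [exact/measurable_EFinP|rewrite fE].
Qed.

Lemma integrable_ge0 f : measurable_fun setT f -> (forall x, 0 <= f x) ->
  (\int[m]_x (f x)%:E < +oo)%E -> m.-integrable setT (EFin \o f).
Proof. by move=> mf f0 h; apply/integrable_ge0P. Qed.

Lemma integrable_ge0_lty f : (forall x, 0 <= f x) ->
  m.-integrable setT (EFin \o f) -> (\int[m]_x (f x)%:E < +oo)%E.
Proof.
by move=> f0 fi; apply/integrable_ge0P => //; apply/measurable_EFinP; case/integrableP: fi.
Qed.

Lemma EFin_Rintegral f : m.-integrable setT (EFin \o f) ->
  (\int[m]_x f x)%:E = (\int[m]_x (f x)%:E)%E.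
Proof. by move=> fi; rewrite /Rintegral fineK//; exact: integrable_fin_num. Qed.

Lemma integrable_measurable f : m.-integrable setT (EFin \o f) ->
  measurable_fun setT f.
Proof. by move=> /integrableP[/measurable_EFinP]. Qed.

Lemma Rint_integrableD f g : m.-integrable setT (EFin \o f) ->
  m.-integrable setT (EFin \o g) ->
  m.-integrable setT (EFin \o (fun x => f x + g x)).
Proof. by move=> fi gi; have := integrableD measurableT fi gi. Qed.

Lemma Rint_integrableB f g : m.-integrable setT (EFin \o f) ->
  m.-integrable setT (EFin \o g) ->
  m.-integrable setT (EFin \o (fun x => f x - g x)).
Proof. by move=> fi gi; have := integrableB measurableT fi gi. Qed.

Lemma Rint_integrableZ r f : m.-integrable setT (EFin \o f) ->
  m.-integrable setT (EFin \o (fun x => r * f x)).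
Proof.
move=> fi; have := integrableZl measurableT r fi.
by apply: eq_integrable.
Qed.

Lemma Rint_cvg (f_ : nat -> T -> R) f g :
  (forall n, measurable_fun setT (f_ n)) -> measurable_fun setT f ->
  {ae m, forall x, f_ n x @[n --> \oo] --> f x} ->
  m.-integrable setT (EFin \o g) -> (forall n x, `|f_ n x| <= g x) ->
  m.-integrable setT (EFin \o f) /\
  \int[m]_x f_ n x @[n --> \oo] --> \int[m]_x f x.
Proof.
move=> mf_ mf f_f gi f_g.
have [|||||fi _ fc] := @dominated_convergence _ _ _ m setT measurableT
   (fun n => EFin \o f_ n) (EFin \o f) (EFin \o g).
- by move=> n; exact/measurable_EFinP.
- exact/measurable_EFinP.
- by apply: filterS f_f => x fx _; apply: cvg_EFin => //; exact: nearW.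
- exact: gi.
- by apply: aeW => x n _; rewrite /= lee_fin.
split=> //; apply: fine_cvg.
by rewrite EFin_Rintegral.
Qed.

Lemma ge0_int_cvg (f_ : nat -> T -> R) f g :
  (forall n, measurable_fun setT (f_ n)) -> measurable_fun setT f ->
  {ae m, forall x, f_ n x @[n --> \oo] --> f x} ->
  m.-integrable setT (EFin \o g) -> (forall n x, `|f_ n x| <= g x) ->
  (\int[m]_x (f_ n x)%:E @[n --> \oo] --> \int[m]_x (f x)%:E)%E.
Proof.
move=> mf_ mf f_f gi f_g.
have [|||||//] := @dominated_convergence _ _ _ m setT measurableT
   (fun n => EFin \o f_ n) (EFin \o f) (EFin \o g).
- by move=> n; exact/measurable_EFinP.
- exact/measurable_EFinP.
- by apply: filterS f_f => x fx _; apply: cvg_EFin => //; exact: nearW.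
- exact: gi.
- by apply: aeW => x n _; rewrite /= lee_fin.
Qed.

Lemma ge0_int_sqrD f g : measurable_fun setT f -> measurable_fun setT g ->
  (\int[m]_x ((f x + g x) ^+ 2)%:E <=
   2%:E * \int[m]_x ((f x) ^+ 2)%:E + 2%:E * \int[m]_x ((g x) ^+ 2)%:E)%E.
Proof.
move=> mf mg.
rewrite -!ge0_integralZl//; last 4 first.
- by apply/measurable_EFinP; mfun.
- by move=> x _; rewrite lee_fin sqr_ge0.
- by apply/measurable_EFinP; mfun.
- by move=> x _; rewrite lee_fin sqr_ge0.
rewrite -ge0_integralD//; last 4 first.
- by move=> x _; rewrite lee_fin mulr_ge0// sqr_ge0.
- by apply/measurable_EFinP; mfun.
- by move=> x _; rewrite lee_fin mulr_ge0// sqr_ge0.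
- by apply/measurable_EFinP; mfun.
apply: ge0_le_integral => //.
- by move=> x _; rewrite lee_fin sqr_ge0.
- by apply/measurable_EFinP; mfun.
- by apply/measurable_EFinP; mfun.
by move=> x _; rewrite lee_fin; have := sqr_ge0 (f x - g x); nra.
Qed.

(** Fatou's lemma in the form used for approximating sequences, whose integrals are
    known only through upper bounds. *)
Lemma ge0_fatou (f_ : nat -> T -> R) f (c_ : nat -> \bar R) (c : \bar R) :
  (forall n, measurable_fun setT (f_ n)) -> (forall n x, 0 <= f_ n x) ->
  measurable_fun setT f -> {ae m, forall x, f_ n x @[n --> \oo] --> f x} ->
  (forall n, \int[m]_x (f_ n x)%:E <= c_ n)%E -> (c_ n @[n --> \oo] --> c)%E ->
  (\int[m]_x (f x)%:E <= c)%E.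
Proof.
move=> mf_ f0 mf ff fc cc.
have mE n : measurable_fun setT (EFin \o f_ n) by exact/measurable_EFinP.
have E0 n x : [set: T] x -> (0 <= (EFin \o f_ n) x)%E by move=> _; rewrite lee_fin.
have hF := fatou m measurableT mE E0.
rewrite -(@ae_eq_integral _ _ _ m setT (EFin \o f) (fun x => limn_einf (fun n => (f_ n x)%:E)))//.
- apply: (le_trans hF); rewrite limn_einf_lim -(cvg_lim _ cc)//.
  apply: lee_lim; [exact: is_cvg_einfs|by apply/cvg_ex; exists c|].
  apply: nearW => n; apply: le_trans (fc n).
  by apply: ereal_inf_lbound; exists n => //=; exact: leqnn.
- rewrite (_ : (fun x => _) = fun x => (- limn_esup (fun n => - (f_ n x)%:E))%E).
    apply: measurableT_comp => //; apply: measurable_fun_limn_esup => n.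
    by apply: measurableT_comp => //; exact: mE.
  by apply/funext => x; rewrite (limn_esupN (fun n => (f_ n x)%:E)) oppeK.
- exact/measurable_EFinP.
- apply: filterS ff => x fx _; apply/esym.
  have h : ((f_ n x)%:E @[n --> \oo] --> (f x)%:E)%E by apply: cvg_EFin => //; exact: nearW.
  by have [-> _] := cvg_limn_einf_sup h.
Qed.

End toolkit.

Section product_sigma_finite.
Local Open Scope ereal_scope.
Context d1 d2 (T1 : measurableType d1) (T2 : measurableType d2) (R : realType).
Variables (m1 : {sigma_finite_measure set T1 -> \bar R})
  (m2 : {sigma_finite_measure set T2 -> \bar R}).

(** The product measure, packaged as a sigma-finite measure so that Fubini's
    theorem can be applied to triple products. *)
Definition prodm : set (T1 * T2) -> \bar R := m1 \x m2.

Let prodm0 : prodm set0 = 0. Proof. exact: measure0. Qed.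

Let prodm_ge0 A : 0 <= prodm A. Proof. exact: measure_ge0. Qed.

Let prodm_sigma_additive : semi_sigma_additive prodm.
Proof. exact: measure_semi_sigma_additive. Qed.

HB.instance Definition _ := isMeasure.Build _ _ _ prodm
  prodm0 prodm_ge0 prodm_sigma_additive.

Let prodm_sigma_finite : sigma_finite setT prodm.
Proof.
have /sigma_finiteP[F [TF ndF Foo]] := sigma_finiteT m1.
have /sigma_finiteP[G [TG ndG Goo]] := sigma_finiteT m2.
exists (fun n => F n `*` G n).
  apply/seteqP; split => // -[x y] _.
  have [n _ Fnx] : (\bigcup_i F i) x by rewrite -TF.
  have [k _ Gky] : (\bigcup_i G i) y by rewrite -TG.
  exists (maxn n k) => //; split => /=.
    by move: Fnx; exact/subsetPset/ndF/leq_maxl.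
  by move: Gky; exact/subsetPset/ndG/leq_maxr.
move=> k; have [? ?] := Foo k; have [? ?] := Goo k.
split; first exact: measurableX.
by rewrite /prodm product_measure1E// lte_mul_pinfty// ge0_fin_numE.
Qed.

HB.instance Definition _ := Measure_isSigmaFinite.Build _ _ _ prodm
  prodm_sigma_finite.

End product_sigma_finite.

Section fubini.
Context d1 d2 (T1 : measurableType d1) (T2 : measurableType d2) (R : realType).
Variables (m1 : {sigma_finite_measure set T1 -> \bar R})
  (m2 : {sigma_finite_measure set T2 -> \bar R}).
Implicit Types F : T1 * T2 -> R.

Lemma measurable_sec1 F x : measurable_fun setT F ->
  measurable_fun setT (fun y => F (x, y)).
Proof. by move=> mF; exact: measurableT_comp mF (@pair1_measurable _ _ T1 T2 x). Qed.

Lemma measurable_sec2 F y : measurable_fun setT F ->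
  measurable_fun setT (fun x => F (x, y)).
Proof. by move=> mF; exact: measurableT_comp mF (@pair2_measurable _ _ T1 T2 y). Qed.

Lemma measurable_Rint2 F : measurable_fun setT F ->
  measurable_fun setT (fun x => \int[m2]_y F (x, y)).
Proof.
move=> mF.
rewrite (_ : (fun x => _) = fun x => fine
   ((\int[m2]_y (EFin \o F)^\+ (x, y)) - (\int[m2]_y (EFin \o F)^\- (x, y)))%E).
  apply: measurableT_comp; first exact: fine_measurable.
  apply: emeasurable_funB.
    apply: (measurable_fun_fubini_tonelli_F (EFin \o F)^\+)%E => //.
    by apply: measurable_funepos; exact/measurable_EFinP.
  apply: (measurable_fun_fubini_tonelli_F (EFin \o F)^\-)%E => //.
  by apply: measurable_funeneg; exact/measurable_EFinP.
by apply/funext => x; rewrite /Rintegral [in LHS]integralE;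
  congr (fine (_ - _)); apply: eq_integral => y _; rewrite ?funeposE ?funenegE.
Qed.

Lemma Rint_prod F : (prodm m1 m2).-integrable setT (EFin \o F) ->
  (forall x, m2.-integrable setT (fun y => (F (x, y))%:E)) ->
  \int[m1]_x \int[m2]_y F (x, y) = \int[(prodm m1 m2)]_p F p.
Proof.
move=> Fi Fx; rewrite /Rintegral -integral12_prod_meas1//; congr fine.
by apply: eq_integral => x _; rewrite fineK//; exact: integrable_fin_num.
Qed.

Lemma Rint_prod2 F : (prodm m1 m2).-integrable setT (EFin \o F) ->
  (forall y, m1.-integrable setT (fun x => (F (x, y))%:E)) ->
  \int[m2]_y \int[m1]_x F (x, y) = \int[(prodm m1 m2)]_p F p.
Proof.
move=> Fi Fy; rewrite /Rintegral -integral21_prod_meas1//; congr fine.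
by apply: eq_integral => y _; rewrite fineK//; exact: integrable_fin_num.
Qed.

Lemma prod_integrableM (f : T1 -> R) (g : T2 -> R) :
  m1.-integrable setT (EFin \o f) -> m2.-integrable setT (EFin \o g) ->
  (prodm m1 m2).-integrable setT (EFin \o (fun p => f p.1 * g p.2)).
Proof.
move=> fi gi; have mf := integrable_measurable fi; have mg := integrable_measurable gi.
apply/integrable12ltyP.
  by apply/measurable_EFinP; apply: measurable_funM; apply: measurableT_comp.
rewrite /=; have -> : (\int[m1]_x \int[m2]_y `|(f x * g y)%:E| =
   \int[m1]_x `|(f x)%:E| * \int[m2]_y `|(g y)%:E|)%E.
  rewrite -ge0_integralZr//; last 2 first.
  - by apply: measurableT_comp => //; exact/measurable_EFinP.
  - exact: integral_ge0.
  apply: eq_integral => x _; rewrite -ge0_integralZl//; last first.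
    by apply: measurableT_comp => //; exact/measurable_EFinP.
  by apply: eq_integral => y _ /=; rewrite normrM.
have /integrableP[_ fy] := fi; have /integrableP[_ gy] := gi.
by rewrite lte_mul_pinfty//; [exact: integral_ge0|rewrite ge0_fin_numE//; exact: integral_ge0].
Qed.

(** Fubini's theorem in the form used throughout: the integrand is dominated by
    a product, which makes all the sections integrable as well. *)
Lemma Rint_swap F (f : T1 -> R) (g : T2 -> R) : measurable_fun setT F ->
  (forall x y, `|F (x, y)| <= f x * g y) ->
  m1.-integrable setT (EFin \o f) -> m2.-integrable setT (EFin \o g) ->
  [/\ (prodm m1 m2).-integrable setT (EFin \o F),
      \int[m1]_x \int[m2]_y F (x, y) = \int[(prodm m1 m2)]_p F p &
      \int[m2]_y \int[m1]_x F (x, y) = \int[(prodm m1 m2)]_p F p].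
Proof.
move=> mF Fle fi gi.
have Fi : (prodm m1 m2).-integrable setT (EFin \o F).
  by apply: dom_integrable (prod_integrableM fi gi) => // -[x y] /=.
split=> //.
- apply: Rint_prod => // x; apply: (dom_integrable (g := fun y => f x * g y)) => //.
    exact: measurable_sec1.
  exact: Rint_integrableZ.
- apply: Rint_prod2 => // y; apply: (dom_integrable (g := fun x => g y * f x)) => //.
    exact: measurable_sec2.
  by move=> x; rewrite mulrC.
  exact: Rint_integrableZ.
Qed.

End fubini.

Section sequences.
Context (R : realType) (T : pseudoMetricType R).

(** Convergence to a point of a metric space can be tested on sequences, which is
    what makes dominated convergence available. *)
Lemma cvg_within_seq (U : uniformType) (D : set T) (a : T) (G : T -> U) (l : U) :
  (forall q : nat -> T, (forall n, D (q n)) -> q n @[n --> \oo] --> a ->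
     G (q n) @[n --> \oo] --> l) ->
  G q @[q --> within D (nbhs a)] --> l.
Proof.
move=> h V /= lV; apply: contrapT => nV.
have /choice[q qP] : forall n : nat, exists x, [/\ D x, ball a n.+1%:R^-1 x & ~ V (G x)].
  move=> n; apply: contrapT => nx; apply: nV.
  rewrite /nbhs/= /within/=; apply/nbhs_ballP; exists n.+1%:R^-1 => //=.
  move=> x ax Dx; apply: contrapT => nVx; apply: nx; by exists x.
have qa : q n @[n --> \oo] --> a.
  apply/cvg_ballP => e e0; have /cvgrPdist_lt/(_ e e0) := @cvg_harmonic R.
  apply: filterS => n; rewrite /harmonic/= sub0r normrN ger0_norm// => ne.
  have [_ + _] := qP n; exact: le_ball (ltW ne) _.
have := h q (fun n => let: And3 x _ _ := qP n in x) qa _ lV.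
by case=> N _ /(_ N (leqnn N)); have [_ _] := qP N.
Qed.

End sequences.

(** * The time kernel *)

Section lebesgue_line.
Variable R : realType.
Local Notation leb := (@lebesgue_measure R).

Lemma lebesgue_measure_shift (a : R) (A : set R) : measurable A ->
  pushforward leb (fun x : measurableTypeR R => (x + a : measurableTypeR R)) A = leb A.
Proof.
move=> mA; apply/esym.
have mphi : measurable_fun setT (fun x : measurableTypeR R => (x + a : measurableTypeR R)).
  exact: measurable_funD.
pose phi : {mfun measurableTypeR R >-> measurableTypeR R} :=
  HB.pack (fun x : measurableTypeR R => (x + a : measurableTypeR R))
    (isMeasurableFun.Build _ _ _ _ _ mphi).
apply: (@lebesgue_measure_unique R (pushforward leb phi)) => //= _ [[x y]] _ <-.
rewrite /pushforward/=.
have -> : (fun z : R => z + a) @^-1` `]x, y]%classic = `]x - a, y - a]%classic.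
  by apply/seteqP; split => z /=; rewrite !in_itv/= ltrBlDr lerBrDr.
rewrite !lebesgue_measure_itv/= !lte_fin ltrD2r; case: ifP => // _.
by rewrite -!EFinB; congr EFin; ring.
Qed.

Lemma ge0_int_shift (f : R -> \bar R) a : measurable_fun setT f ->
  (forall x, (0 <= f x)%E) ->
  (\int[leb]_x f (x + a)%R = \int[leb]_x f x)%E.
Proof.
move=> mf f0.
have mphi : measurable_fun setT (fun x : measurableTypeR R => (x + a : measurableTypeR R)).
  exact: measurable_funD.
rewrite -[LHS](@ge0_integral_pushforward _ _ _ _ R _ mphi leb setT f)//.
apply: eq_measure_integral => A mA _; exact: lebesgue_measure_shift.
Qed.

Lemma ge0_int_opp (f : R -> \bar R) : measurable_fun setT f ->
  (forall x, (0 <= f x)%E) ->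
  (\int[leb]_x f (- x)%R = \int[leb]_x f x)%E.
Proof.
move=> mf f0.
have mphi : measurable_fun setT (fun x : measurableTypeR R => (- x : measurableTypeR R)).
  exact: measurable_funN.
rewrite -[LHS](@ge0_integral_pushforward _ _ _ _ R _ mphi leb setT f)//.
apply: eq_measure_integral => A mA _; exact: lebesgue_measureN.
Qed.

Lemma int_mkcond (A : set R) (f : R -> R) (P : R -> bool) :
  (forall x, P x <-> A x) ->
  (\int[leb]_(x in A) (f x)%:E = \int[leb]_x ((P x)%:R * f x)%:E)%E.
Proof.
move=> PA; rewrite integral_mkcond; apply: eq_integral => x _.
rewrite patchE; case: ifPn => [/set_mem/PA ->|]; first by rewrite mul1r.
by case: (boolP (P x)) => [/PA/mem_set ->//|]; rewrite mul0r.
Qed.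

End lebesgue_line.

Section power_kernel.
Variables (R : realType) (b : R).
Hypothesis b0 : 0 < b.
Local Notation leb := (@lebesgue_measure R).

Lemma int_powR (r : R) : 0 <= r ->
  (\int[leb]_w ((0 < w <= r)%R%:R * w `^ (b - 1))%:E = (r `^ b / b)%:E)%E.
Proof.
rewrite le_eqVlt => /predU1P[<-|r0].
  rewrite powR0 ?gt_eqF// mul0r; apply: integral0_eq => x _.
  by rewrite ltNge; case: leP; rewrite ?mul0r.
pose F n := `[r * n.+1%:R^-1, r]%classic.
have FE : \bigcup_n F n = `]0, r]%classic.
  apply/seteqP; split => [x [n _]|x] /=; rewrite /F/= !in_itv/=.
    by move=> /andP[nx ->]; rewrite andbT (lt_le_trans _ nx)// mulr_gt0.
  move=> /andP[x0 xr].
  have [n nx] : exists n : nat, n.+1%:R^-1 < x / r.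
    have /cvgrPdist_lt/(_ (x / r)) := @cvg_harmonic R.
    rewrite divr_gt0// => /(_ isT) [k _ /(_ k (leqnn k))].
    by rewrite /harmonic/= sub0r normrN ger0_norm// => ?; exists k.
  exists n => //=; rewrite in_itv/= xr andbT.
  by rewrite mulrC -ler_pdivlMr// ltW.
have mp : measurable_fun setT (fun w : R => w `^ (b - 1)) by exact: measurable_powR.
rewrite -(@int_mkcond _ `]0, r]%classic); last by move=> x; rewrite /= in_itv.
rewrite -FE.
have ndF : nondecreasing_seq F.
  apply/nondecreasing_seqP => n; apply/subsetPset => x; rewrite /F/= !in_itv/=.
  move=> /andP[nx ->]; rewrite andbT (le_trans _ nx)// ler_pM2l//.
  by rewrite lef_pV2 ?posrE// ler_nat.
have mF i : measurable (F i) by exact: measurable_itv.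
have mf i : measurable_fun (F i) (fun w : R => (w `^ (b - 1))%:E).
  by apply/measurable_EFinP; exact: measurable_funS mp.
have cv : (\int[leb]_(w in F n) (w `^ (b - 1))%:E @[n --> \oo] -->
    \int[leb]_(w in \bigcup_n F n) (w `^ (b - 1))%:E)%E.
  apply: ge0_nondecreasing_set_cvg_integral => // i x _.
  by rewrite lee_fin powR_ge0.
apply: (cvg_unique _ cv) => //.
apply: cvg_trans (_ : (r `^ b / b - (r * n.+1%:R^-1) `^ b / b)%:E @[n --> \oo] --> _).
  apply: near_eq_cvg; exists 1%N => // n /= n1.
  have rn : r * n.+1%:R^-1 < r.
    by rewrite -[ltRHS]mulr1 ltr_pM2l// invf_lt1// ltr1n ltnS.
  have rn0 : 0 < r * n.+1%:R^-1 by rewrite mulr_gt0.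
  have bE : b - 1 + 1 = b by ring.
  have dF (x : R) : 0 < x -> is_derive x 1 (fun w : R => w `^ b * b^-1) (x `^ (b - 1)).
    move=> x0; have := is_derive1_powR b x0 => h.
    apply: is_derive_eq.
    by rewrite scaler0 add0r /GRing.scale/= mulrA mulVf ?mul1r// gt_eqF.
  have cF (x : R) : 0 < x -> {for x, continuous (fun w : R => w `^ b * b^-1)}.
    move=> x0; have [dx _] := dF x x0.
    exact/differentiable_continuous/derivable1_diffP.
  rewrite (@continuous_FTC2 _ _ (fun w => w `^ b / b) _ _ rn)//.
  - apply: derivable_within_continuous => x; rewrite in_itv/= => /andP[rx _].
    apply: derivable_powR; rewrite in_itv/= andbT; exact: lt_le_trans rx.
  - split => [x| |].
    + rewrite in_itv/= => /andP[rx _]; have x0 : 0 < x by exact: lt_trans rx.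
      by have [] := dF x x0.
    + by apply: cvg_at_right_filter; exact: cF.
    + by apply: cvg_at_left_filter; exact: cF.
  - move=> x; rewrite in_itv/= => /andP[rx _]; have x0 : 0 < x by exact: lt_trans rx.
    by rewrite derive1E; have [_ ->] := dF x x0.
apply: cvg_EFin; first exact: nearW.
rewrite -[X in _ --> X]subr0; apply: cvgB; first exact: cvg_cst.
rewrite -(mul0r b^-1); apply: cvgMl.
have := powR_cvg0 b0 => /cvg_at_rightP; apply; split => [n|].
  by rewrite mulr_gt0.
by rewrite -(mulr0 r); apply: cvgMr; exact: cvg_harmonic.
Qed.

Lemma int_kernel (x y v : R) : 0 <= x -> 0 <= y ->
  (\int[leb]_u (((v - x <= u <= v + y)%R%:R * `|u - v| `^ (b - 1)))%:E =
   ((x `^ b + y `^ b) / b)%:E)%E.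
Proof.
move=> x0 y0.
have mp : measurable_fun setT (fun w : R => w `^ (b - 1)) by exact: measurable_powR.
pose g (w : R) := ((- x <= w <= y)%R%:R * `|w| `^ (b - 1)).
have mle (c : R) : measurable_fun setT (fun w : R => c <= w) by exact: measurable_fun_ler.
have mge (c : R) : measurable_fun setT (fun w : R => w <= c) by exact: measurable_fun_ler.
have mlt (c : R) : measurable_fun setT (fun w : R => c < w) by exact: measurable_fun_ltr.
have mgt (c : R) : measurable_fun setT (fun w : R => w < c) by exact: measurable_fun_ltr.
have mg : measurable_fun setT g.
  apply: measurable_funM.
    by apply: measurable_b2r; exact: measurable_and.
  exact: measurableT_comp mp (@normr_measurable R setT).
have -> : (\int[leb]_u (((v - x <= u <= v + y)%R%:R * `|u - v| `^ (b - 1)))%:E =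
   \int[leb]_u (g (u + - v))%:E)%E.
  apply: eq_integral => u _; rewrite /g; congr (((_ && _)%:R * _)%:E).
    by rewrite lerBrDr addrC.
  by rewrite lerBlDr addrC.
rewrite (@ge0_int_shift _ (fun w => (g w)%:E))//; last 2 first.
- exact/measurable_EFinP.
- by move=> w; rewrite lee_fin mulr_ge0// powR_ge0.
pose g1 (w : R) := (0 < w <= y)%R%:R * w `^ (b - 1).
pose g2 (w : R) := (0 < w <= x)%R%:R * w `^ (b - 1).
have mg1 : measurable_fun setT g1.
  by apply: measurable_funM => //; apply: measurable_b2r; exact: measurable_and.
have mg2 : measurable_fun setT g2.
  by apply: measurable_funM => //; apply: measurable_b2r; exact: measurable_and.
have g10 w : 0 <= g1 w by rewrite mulr_ge0// powR_ge0.
have g20 w : 0 <= g2 w by rewrite mulr_ge0// powR_ge0.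
have -> : (\int[leb]_w (g w)%:E = \int[leb]_w ((g1 w)%:E + (g2 (- w))%:E))%E.
  apply: ae_eq_integral => //; first exact/measurable_EFinP.
    apply: emeasurable_funD; first exact/measurable_EFinP.
    by apply/measurable_EFinP; exact: measurableT_comp.
  exists [set 0]; split => //; first exact: lebesgue_measure_set1.
  move=> w /=; apply: contra_notP => /eqP w0 _.
  rewrite -EFinD; congr EFin; rewrite /g /g1 /g2.
  rewrite oppr_gt0 lerNl.
  case: (ltrgtP w 0) => [wn|wp|w00]; last by rewrite w00 eqxx in w0.
  - by rewrite (le_trans (ltW wn) y0) andbT ltr0_norm// mul0r add0r.
  - have -> : - w <= x by rewrite (le_trans _ x0)// oppr_le0 ltW.
    by rewrite gtr0_norm// mul0r addr0.
rewrite ge0_integralD//; last 4 first.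
- by move=> w _; rewrite lee_fin.
- exact/measurable_EFinP.
- by move=> w _; rewrite lee_fin.
- by apply/measurable_EFinP; exact: measurableT_comp.
rewrite (@ge0_int_opp _ (fun w => (g2 w)%:E))//; last exact/measurable_EFinP.
by rewrite int_powR// int_powR// -EFinD -mulrDl addrC.
Qed.

End power_kernel.

(** * The energy of a function of time *)

Section power_tail.
Variable R : realType.
Local Notation leb := (@lebesgue_measure R).

Lemma powRN_cvgy (s : R) : 0 < s -> x `^ (- s) @[x --> +oo] --> 0.
Proof.
move=> s0; apply/cvgrPdist_le => e e0; near=> x.
have x0 : 0 < x by near: x; exact: nbhs_pinfty_gt.
rewrite sub0r normrN ger0_norm ?powR_ge0// powRN.
rewrite invf_ple ?posrE ?powR_gt0//.
have -> : e^-1 = (e^-1 `^ s^-1) `^ s.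
  by rewrite -powRrM mulVf ?gt_eqF// powRr1// invr_ge0 ltW.
apply: ge0_ler_powR; [exact: ltW|by rewrite nnegrE powR_ge0|by rewrite nnegrE ltW|].
by near: x; apply: nbhs_pinfty_ge; rewrite num_real.
Unshelve. all: by end_near. Qed.

(** The power kernel is a mixture of the tent functions (l - r)_+. *)
Lemma int_tent (b r : R) : b < 1 -> 0 < r ->
  (\int[leb]_l ((r <= l)%R%:R * (l `^ (b - 3) * (l - r)))%:E =
   (r `^ (b - 1) / ((1 - b) * (2 - b)))%:E)%E.
Proof.
move=> b1 r0.
rewrite -(@int_mkcond _ `[r, +oo[%classic); last by move=> x; rewrite /= in_itv/= andbT.
pose F (l : R) := (b - 1)^-1 * l `^ (b - 1) - r * (b - 2)^-1 * l `^ (b - 2).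
have b1n : b - 1 != 0 by rewrite subr_eq0 lt_eqF.
have b2n : b - 2 != 0 by rewrite subr_eq0 lt_eqF// (lt_trans b1)// ltr1n.
have dF (l : R) : 0 < l -> is_derive l 1 F (l `^ (b - 3) * (l - r)).
  move=> l0; have h1 := is_derive1_powR (b - 1) l0.
  have h2 := is_derive1_powR (b - 2) l0.
  have -> : F = (fun l => (b - 1)^-1 *: l `^ (b - 1)) - (fun l => (r * (b - 2)^-1) *: l `^ (b - 2)).
    by [].
  apply: is_derive_eq; rewrite /GRing.scale/=.
  have -> : b - 1 - 1 = b - 3 + 1 by ring.
  have -> : b - 2 - 1 = b - 3 by ring.
  have -> : l `^ (b - 3 + 1) = l `^ (b - 3) * l.
    by rewrite powRD ?powRr1 ?ltW// (gt_eqF l0) implybT.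
  by field; rewrite b1n b2n.
have cF (l : R) : 0 < l -> {for l, continuous F}.
  move=> l0; have [dl _] := dF l l0.
  exact/differentiable_continuous/derivable1_diffP.
have cf (l : R) : 0 < l -> {for l, continuous (fun l : R => l `^ (b - 3) * (l - r))}.
  move=> l0; apply: cvgM.
    have hc : {for l, continuous (fun l : R => l `^ (b - 3))}.
      apply/differentiable_continuous/derivable1_diffP/derivable_powR.
      by rewrite in_itv/= andbT.
    exact: hc.
  by apply: cvgB; [exact: cvg_id|exact: cvg_cst].
rewrite (@ge0_continuous_FTC2y _ _ F r 0).
- rewrite sub0e -EFinN; congr EFin; rewrite /F.
  have -> : r * (b - 2)^-1 * r `^ (b - 2) = (b - 2)^-1 * r `^ (b - 1).
    have -> : b - 1 = b - 2 + 1 by ring.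
    have -> : r `^ (b - 2 + 1) = r `^ (b - 2) * r.
      by rewrite powRD ?powRr1 ?ltW// (gt_eqF r0) implybT.
    by ring.
  have n1b : 1 - b != 0 by rewrite subr_eq0 gt_eqF.
  have n2b : 2 - b != 0 by rewrite subr_eq0 gt_eqF// (lt_trans b1)// ltr1n.
  field; rewrite ?b1n ?b2n ?n1b ?n2b//.
- by move=> x rx; rewrite mulr_ge0 ?powR_ge0 ?subr_ge0.
- apply/continuous_within_itvcyP; split.
    by move=> x; rewrite in_itv/= andbT => rx; apply: cf; exact: lt_trans rx.
  by apply: cvg_at_right_filter; exact: cf.
- have l1 : x `^ (b - 1) @[x --> +oo] --> (0 : R).
    by rewrite (_ : b - 1 = - (1 - b)); [apply: powRN_cvgy; rewrite subr_gt0|ring].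
  have l2 : x `^ (b - 2) @[x --> +oo] --> (0 : R).
    rewrite (_ : b - 2 = - (2 - b)); last by ring.
    by apply: powRN_cvgy; rewrite subr_gt0 (lt_trans b1)// ltr1n.
  rewrite (_ : 0 = (b - 1)^-1 * 0 - r * (b - 2)^-1 * 0); last by ring.
  by apply: cvgB; [apply: cvgMr; exact: l1|apply: cvgMr; exact: l2].
- by move=> x rx; have [] := dF x (lt_trans r0 rx).
- by apply: cvg_at_right_filter; exact: cF.
- move=> x; rewrite in_itv/= andbT => rx.
  by rewrite derive1E; have [_ ->] := dF x (lt_trans r0 rx).
Qed.

Lemma diagonal_null : (prodm leb leb).-negligible [set p : R * R | p.1 = p.2].
Proof.
have mD : measurable [set p : R * R | p.1 = p.2].
  have -> : [set p : R * R | p.1 = p.2] = setT `&` (fun p : R * R => p.1 - p.2) @^-1` [set 0].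
    by apply/seteqP; split => -[x y] /=; [move=> ->; rewrite subrr|
      move=> [_ /eqP]; rewrite subr_eq0 => /eqP].
  have m12 : measurable_fun setT (fun p : R * R => p.1 - p.2) by mfun.
  exact: m12.
exists [set p : R * R | p.1 = p.2]; split => //.
rewrite /prodm /product_measure1 integral0_eq// => x _ /=.
have -> : xsection [set p : R * R | p.1 = p.2] x = [set x].
  by apply/seteqP; split => y /=; rewrite /xsection/= ?inE/= ?mem_setE => ->//; exact/mem_set.
exact: lebesgue_measure_set1.
Qed.

End power_tail.

Section mixture.
Context d1 d2 (X : measurableType d1) (Y : measurableType d2) (R : realType).
Variables (m : {sigma_finite_measure set X -> \bar R})
  (n : {sigma_finite_measure set Y -> \bar R}).
Variables (D : X -> R) (S : X -> Y -> R).

(** A mixture of the rank one kernels S(x, y) S(x', y) is positive definite. *)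
Lemma mixture_ge0 :
  (prodm m m \x n)%E.-integrable setT (fun z : (X * X) * Y =>
     (D z.1.1 * D z.1.2 * (S z.1.1 z.2 * S z.1.2 z.2))%:E) ->
  (forall y, m.-integrable setT (EFin \o (fun x => D x * S x y))) ->
  (0 <= \int[prodm m m]_p \int[n]_y
         (D p.1 * D p.2 * (S p.1 y * S p.2 y))%:E)%E.
Proof.
move=> iF iD.
set F := (fun z : (X * X) * Y => _) in iF.
have := Fubini iF; rewrite /fubini_F/fubini_G => E.
rewrite [leRHS]E {E}; apply: integral_ge0 => y _; rewrite /F {F iF}.
have iP := prod_integrableM (iD y) (iD y).
have -> : (\int[(prodm m m)]_p (D p.1 * D p.2 * (S p.1 y * S p.2 y))%:E)%E =
    ((\int[m]_x (D x * S x y)) ^+ 2)%:E.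
  have iZ x : m.-integrable setT (fun x' => (D x * S x y * (D x' * S x' y))%:E).
    exact: Rint_integrableZ (iD y).
  have E := Rint_prod iP iZ.
  have E2 : \int[m]_x \int[m]_x' (D x * S x y * (D x' * S x' y)) =
      (\int[m]_x (D x * S x y)) ^+ 2.
    under eq_Rintegral do rewrite RintegralZl//.
    by rewrite RintegralZr.
  rewrite -E2 E EFin_Rintegral//.
  by apply: eq_integral => p _; congr EFin; ring.
by rewrite lee_fin sqr_ge0.
Qed.

End mixture.

Section energy.
Variables (R : realType) (H : R).
Hypotheses (H_gt : 1 / 2 < H) (H_lt : H < 1).
Local Notation leb := (@lebesgue_measure R).
Local Notation leb2 := (prodm leb leb).
Implicit Types (D E : R -> R) (T M t s u v : R).

Local Notation b := (2 * H - 1).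

Definition kern (p : R * R) : R := `|p.1 - p.2| `^ (2 * H - 2).

Definition box T u : R := (0 <= u <= T)%R%:R.

Definition tbd T M D : Prop :=
  measurable_fun setT D /\ forall u, `|D u| <= M * box T u.

Definition energy2 D E : R := \int[leb2]_p (D p.1 * E p.2 * kern p).

Definition energy D : R := energy2 D D.

Let b_gt0 : 0 < b. Proof. by move: H_gt; lra. Qed.
Let b_lt1 : b < 1. Proof. by move: H_lt; lra. Qed.
Let kernE p : kern p = `|p.1 - p.2| `^ (b - 1).
Proof. by rewrite /kern; congr (_ `^ _); ring. Qed.

Lemma kern_ge0 p : 0 <= kern p. Proof. exact: powR_ge0. Qed.

Lemma measurable_kern : measurable_fun setT kern.
Proof.
have m1 : measurable_fun setT (fun p : R * R => `|p.1 - p.2|) by mfun.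
exact: measurableT_comp (measurable_powR _) m1.
Qed.
Hint Extern 0 (measurable_fun _ kern) => solve [exact: measurable_kern] : core.

Lemma measurable_itvb (x y : R) : measurable_fun setT (fun u : R => (x <= u <= y)%R%:R : R).
Proof.
by apply: measurable_b2r; apply: measurable_and; exact: measurable_fun_ler.
Qed.

Lemma measurable_box T : measurable_fun setT (box T).
Proof. exact: measurable_itvb. Qed.
Hint Extern 0 (measurable_fun _ (box _)) => solve [exact: measurable_box] : core.

Lemma box_ge0 T u : 0 <= box T u. Proof. exact: ler0n. Qed.

Lemma box_le1 T u : box T u <= 1. Proof. by rewrite /box; case: (_ && _). Qed.

Lemma box_le T T' u : T <= T' -> box T u <= box T' u.
Proof.
move=> TT'; rewrite /box; case: (boolP (0 <= u <= T)) => [/andP[u0 uT]|_] //.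
  by rewrite u0 (le_trans uT TT').
Qed.

Lemma int_box (T : R) : 0 <= T -> (\int[leb]_u (box T u)%:E = T%:E)%E.
Proof.
move=> T0.
have -> : (\int[leb]_u (box T u)%:E = \int[leb]_(u in `[0%R, T]) (cst 1%R u)%:E)%E.
  rewrite (@int_mkcond R `[0, T]%classic (cst 1) (fun u => 0 <= u <= T)).
    by apply: eq_integral => u _; rewrite mulr1.
  by move=> u; rewrite /= in_itv.
apply: (etrans (integral_cst leb (measurable_itv `[0, T]) 1%E)).
rewrite mul1e /= lebesgue_measure_itv/= lte_fin.
by move: T0; rewrite le_eqVlt => /predU1P[<-|->]; rewrite ?ltxx// sube0.
Qed.

Lemma box_integrable T : leb.-integrable setT (EFin \o box T).
Proof.
apply: integrable_ge0; [exact: measurable_box|exact: box_ge0|].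
have [T0|T0] := leP 0 T; first by rewrite int_box// ltry.
rewrite integral0_eq// => u _; rewrite /box; case: (boolP (_ && _)) => // /andP[u0 uT].
by have := le_lt_trans (le_trans u0 uT) T0; rewrite ltxx.
Qed.

Lemma tbd_integrable T M D : tbd T M D -> leb.-integrable setT (EFin \o D).
Proof.
move=> [mD DM]; apply: dom_integrable; [exact: mD|exact: DM|].
exact/Rint_integrableZ/box_integrable.
Qed.

Lemma tbdD T M M' D E : tbd T M D -> tbd T M' E -> tbd T (M + M') (fun u => D u + E u).
Proof.
move=> [mD DM] [mE EM]; split; first by mfun.
by move=> u; rewrite mulrDl (le_trans (ler_normD _ _))// lerD.
Qed.

Lemma tbdZ T M D c : tbd T M D -> tbd T (`|c| * M) (fun u => c * D u).
Proof.
move=> [mD DM]; split; first by mfun.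
by move=> u; rewrite normrM -mulrA ler_wpM2l.
Qed.

Lemma tbd_box T t : t <= T -> tbd T 1 (box t).
Proof.
by move=> tT; split => // u; rewrite ger0_norm ?box_ge0// mul1r box_le.
Qed.

Lemma tbdW T T' M D : T <= T' -> 0 <= M -> tbd T M D -> tbd T' M D.
Proof.
move=> TT' M0 [mD DM]; split => // u.
by rewrite (le_trans (DM u))// ler_wpM2l// box_le.
Qed.

Lemma int_kern_box T v : 0 <= v <= T ->
  (\int[leb]_u (box T u * kern (u, v))%:E = ((v `^ b + (T - v) `^ b) / b)%:E)%E.
Proof.
move=> /andP[v0 vT].
have vT0 : 0 <= T - v by rewrite subr_ge0.
apply: etrans (@int_kernel _ _ b_gt0 v (T - v) v v0 vT0).
apply: eq_integral => u _; rewrite kernE subrr.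
by rewrite (_ : v + (T - v) = T); [|ring].
Qed.

Definition pot T : R := 2 * T `^ b / b.

Lemma pot_ge0 T : 0 <= pot T.
Proof. by rewrite /pot divr_ge0 ?mulr_ge0 ?powR_ge0// ltW. Qed.

Lemma int_kern_box_le T v :
  (\int[leb]_u (box T u * kern (u, v) * box T v)%:E <= (pot T * box T v)%:E)%E.
Proof.
rewrite {2 3}/box; case: (boolP (0 <= v <= T)) => [vT|_]; last first.
  by rewrite mulr0; rewrite integral0_eq// => u _; rewrite mulr0.
under eq_integral do rewrite mulr1.
rewrite int_kern_box// lee_fin mulr1 /pot ler_pM2r ?invr_gt0//.
move: vT => /andP[v0 vT].
rewrite (_ : 2 * T `^ b = T `^ b + T `^ b); last by ring.
apply: lerD.
  apply: ge0_ler_powR => //; first exact: ltW.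
  by rewrite nnegrE (le_trans v0 vT).
apply: ge0_ler_powR; first exact: ltW.
- by rewrite nnegrE subr_ge0.
- by rewrite nnegrE (le_trans v0 vT).
by rewrite gerBl.
Qed.

Lemma kern_box_integrable T :
  leb2.-integrable setT (EFin \o (fun p => box T p.1 * box T p.2 * kern p)).
Proof.
have m1 : measurable_fun setT (fun p : R * R => box T p.1 * box T p.2 * kern p).
  by do 2 apply: measurable_funM => //; apply: measurableT_comp.
have ge0 p : 0 <= box T p.1 * box T p.2 * kern p.
  by rewrite !mulr_ge0 ?box_ge0 ?kern_ge0.
apply/integrable21ltyP; first exact/measurable_EFinP.
apply: (@le_lt_trans _ _ (\int[leb]_v (pot T * box T v)%:E)%E).
  apply: ge0_le_integral => //.
  - by move=> v _; exact: integral_ge0.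
  - have := @measurable_fun_fubini_tonelli_G _ _ _ _ R leb
      (fun p => `|(box T p.1 * box T p.2 * kern p)%:E|)%E.
    apply=> //; apply: measurableT_comp => //; exact/measurable_EFinP.
  - by apply/measurable_EFinP; mfun.
  - move=> v _; apply: le_trans (int_kern_box_le T v).
    rewrite le_eqVlt; apply/orP; left; apply/eqP.
    apply: eq_integral => u _; rewrite gee0_abs ?lee_fin ?ge0//=.
    by rewrite mulrAC.
apply: integrable_ge0_lty; last exact: Rint_integrableZ (box_integrable T).
by move=> v; rewrite mulr_ge0 ?pot_ge0 ?box_ge0.
Qed.

Lemma measurable_energy_integrand D E : measurable_fun setT D -> measurable_fun setT E ->
  measurable_fun setT (fun p : R * R => D p.1 * E p.2 * kern p).
Proof.
move=> mD mE; do 2 apply: measurable_funM => //.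
  exact: measurableT_comp mD measurable_fst.
exact: measurableT_comp mE measurable_snd.
Qed.

Lemma tbd_prod_le T M M' D E p : tbd T M D -> tbd T M' E ->
  `|D p.1 * E p.2 * kern p| <= M * M' * (box T p.1 * box T p.2 * kern p).
Proof.
move=> [_ DM] [_ EM]; rewrite !normrM (ger0_norm (kern_ge0 p)).
have -> : M * M' * (box T p.1 * box T p.2 * kern p) =
   (M * box T p.1) * (M' * box T p.2) * kern p by ring.
by rewrite ler_wpM2r ?kern_ge0// ler_pM.
Qed.

Lemma energy_integrable T M M' D E : tbd T M D -> tbd T M' E ->
  leb2.-integrable setT (EFin \o (fun p => D p.1 * E p.2 * kern p)).
Proof.
move=> hD hE.
apply: (@dom_integrable _ _ _ leb2 _ (fun p => M * M' * (box T p.1 * box T p.2 * kern p))).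
- by apply: measurable_energy_integrand; [case: hD|case: hE].
- by move=> p; exact: tbd_prod_le.
- exact/Rint_integrableZ/kern_box_integrable.
Qed.

Lemma energy_sec_integrable T M M' D E v : tbd T M D -> tbd T M' E ->
  leb.-integrable setT (fun u => (D u * E v * kern (u, v))%:E).
Proof.
move=> hD hE.
have mk : measurable_fun setT (fun u => kern (u, v)) by exact: measurable_sec2.
apply: (@dom_integrable _ _ _ leb _ (fun u => M * M' * (box T u * box T v * kern (u, v)))).
- by mfun; case: hD.
- by move=> u; exact: (tbd_prod_le (u, v) hD hE).
apply: Rint_integrableZ; apply: integrable_ge0; first by mfun.
  by move=> u; rewrite !mulr_ge0 ?box_ge0 ?kern_ge0.
apply: le_lt_trans (ltry (pot T * box T v)); apply: le_trans (int_kern_box_le T v).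
by rewrite le_eqVlt; apply/orP; left; apply/eqP; apply: eq_integral => u _; rewrite mulrAC.
Qed.

Lemma energy2_iter T M M' D E : tbd T M D -> tbd T M' E ->
  \int[leb]_v \int[leb]_u (D u * E v * kern (u, v)) = energy2 D E.
Proof.
move=> hD hE.
rewrite (@Rint_prod2 _ _ _ _ _ leb leb (fun p => D p.1 * E p.2 * kern p))//.
  exact: energy_integrable hD hE.
by move=> v; exact: (energy_sec_integrable _ hD hE).
Qed.

Lemma energy2_suml (I : Type) (r : seq I) (T : R) (M : I -> R) (M' : R) (D : I -> R -> R) E :
  (forall i, tbd T (M i) (D i)) -> tbd T M' E ->
  energy2 (fun u => \sum_(i <- r) D i u) E = \sum_(i <- r) energy2 (D i) E.
Proof.
move=> hD hE; elim: r => [|i r IH].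
  rewrite big_nil /energy2 /Rintegral integral0_eq// => p _.
  by rewrite big_nil !mul0r.
rewrite big_cons -IH /energy2 -RintegralD//.
- by apply: eq_Rintegral => p _; rewrite big_cons; ring.
- exact: energy_integrable (hD i) hE.
have : exists M0, tbd T M0 (fun u => \sum_(j <- r) D j u).
  elim: (r) => [|j r' [M0 h0]].
    exists 0; split=> [|u].
      by rewrite (_ : (fun u => _) = cst 0)//; apply/funext => u; rewrite big_nil.
    by rewrite big_nil normr0 mul0r.
  exists (M j + M0); have := tbdD (hD j) h0.
  by congr tbd; apply/funext => u; rewrite big_cons.
by move=> [M0 h0]; exact: energy_integrable h0 hE.
Qed.

Lemma energy2C T M M' D E : tbd T M D -> tbd T M' E -> energy2 D E = energy2 E D.
Proof.
move=> hD hE; transitivity (\int[leb]_u \int[leb]_v (D u * E v * kern (u, v))).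
  symmetry; apply: (@Rint_prod _ _ _ _ _ leb leb (fun p => D p.1 * E p.2 * kern p)).
    exact: energy_integrable hD hE.
  move=> v; have := energy_sec_integrable v hE hD.
  by apply: eq_integrable => // u _; rewrite /kern/= distrC; congr EFin; ring.
rewrite -(energy2_iter hE hD).
apply: eq_Rintegral => v _; apply: eq_Rintegral => u _.
by rewrite /kern /= distrC; ring.
Qed.

Lemma energy2Zl T M M' D E c : tbd T M D -> tbd T M' E ->
  energy2 (fun u => c * D u) E = c * energy2 D E.
Proof.
move=> hD hE; rewrite /energy2 -RintegralZl//; last exact: energy_integrable hD hE.
by apply: eq_Rintegral => p _; ring.
Qed.

Lemma energyZ T M D c : tbd T M D -> energy (fun u => c * D u) = c ^+ 2 * energy D.
Proof.
move=> hD; rewrite /energy /energy2 -RintegralZl//; last exact: (energy_integrable hD hD).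
by apply: eq_Rintegral => p _; ring.
Qed.

Lemma energy_parallelogram T M M' D E : tbd T M D -> tbd T M' E ->
  energy (fun u => D u + E u) + energy (fun u => D u + - 1 * E u) =
  2 * energy D + 2 * energy E.
Proof.
move=> hD hE; rewrite /energy /energy2.
have hN := tbdZ (- 1) hE.
have iDD := energy_integrable hD hD; have iEE := energy_integrable hE hE.
have i1 := energy_integrable (tbdD hD hE) (tbdD hD hE).
have i2 := energy_integrable (tbdD hD hN) (tbdD hD hN).
rewrite -RintegralD//= -RintegralZl// -RintegralZl// -RintegralD//; last 2 first.
- exact: Rint_integrableZ iDD.
- exact: Rint_integrableZ iEE.
by apply: eq_Rintegral => p _; ring.
Qed.

Lemma energy_le T M D : tbd T M D ->
  energy D <= M * pot T * \int[leb]_v `|D v|.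
Proof.
move=> hD; have [mD DM] := hD.
have M0 v : D v != 0 -> 0 <= M.
  move=> Dv; have := DM v; rewrite leNgt => /negP h; rewrite leNgt; apply/negP => M0.
  apply: h; rewrite (@le_lt_trans _ _ 0) ?normr_gt0//.
  by rewrite mulr_le0_ge0 ?box_ge0// ltW.
have aD : tbd T M (fun v => `|D v|).
  by split => [|u]; [exact: measurableT_comp|rewrite normr_id].
apply: (@le_trans _ _ (energy (fun v => `|D v|))).
  apply: le_Rintegral => //; first exact: (energy_integrable hD hD).
    exact: (energy_integrable aD aD).
  move=> p _; rewrite (le_trans (ler_norm _))// !normrM.
  by rewrite (ger0_norm (kern_ge0 p)).
rewrite -lee_fin -RintegralZl//; last exact: tbd_integrable aD.
rewrite EFin_Rintegral; last exact: (energy_integrable aD aD).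
rewrite EFin_Rintegral; last exact: Rint_integrableZ (tbd_integrable aD).
have mF := measurable_energy_integrand (proj1 aD) (proj1 aD).
rewrite [leLHS](@fubini_tonelli2 _ _ _ _ _ leb leb
  (fun p => (`|D p.1| * `|D p.2| * kern p)%:E)); last 2 first.
- exact/measurable_EFinP.
- by move=> p; rewrite lee_fin !mulr_ge0// kern_ge0.
apply: ge0_le_integral => //.
- by move=> v _; apply: integral_ge0 => u _; rewrite lee_fin !mulr_ge0// kern_ge0.
- apply: (@measurable_fun_fubini_tonelli_G _ _ _ _ R leb
    (fun p => (`|D p.1| * `|D p.2| * kern p)%:E)).
    exact/measurable_EFinP.
  by move=> p; rewrite lee_fin !mulr_ge0// kern_ge0.
- by apply/measurable_EFinP; mfun.
move=> v _; rewrite /fubini_G /=.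
have [Dv0|/M0 Mge0] := eqVneq (D v) 0.
  rewrite Dv0 normr0 mulr0 integral0_eq// => u _.
  by rewrite mulr0 mul0r.
apply: (@le_trans _ _ (\int[leb]_u (M * `|D v| * (box T u * kern (u, v) * box T v))%:E)%E).
  apply: ge0_le_int.
  - by mfun; exact: measurable_sec2.
  - by mfun; exact: measurable_sec2.
  - by move=> u; rewrite !mulr_ge0// kern_ge0.
  move=> u; have [uv|] := boolP (0 <= v <= T).
    have -> : box T v = 1 by rewrite /box uv.
    have := DM u => h; rewrite mulr1.
    have -> : M * `|D v| * (box T u * kern (u, v)) = M * box T u * `|D v| * kern (u, v) by ring.
    by rewrite ler_wpM2r ?kern_ge0// ler_wpM2r.
  move=> uv; have := DM v; rewrite /box (negbTE uv) mulr0 normr_le0 => /eqP ->.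
  by rewrite normr0 !mulr0 !mul0r.
under eq_integral do rewrite EFinM.
rewrite ge0_integralZl//; last 3 first.
- by apply/measurable_EFinP; mfun; exact: measurable_sec2.
- by move=> u _; rewrite lee_fin !mulr_ge0 ?box_ge0 ?kern_ge0.
- by rewrite lee_fin mulr_ge0.
apply: (@le_trans _ _ ((M * `|D v|)%:E * (pot T * box T v)%:E)%E).
  by rewrite lee_wpmul2l ?lee_fin ?mulr_ge0// int_kern_box_le.
rewrite -EFinM lee_fin.
have -> : M * `|D v| * (pot T * box T v) = M * pot T * `|D v| * box T v by ring.
apply: ler_piMr; last exact: box_le1.
by apply: mulr_ge0 => //; apply: mulr_ge0 => //; exact: pot_ge0.
Qed.

End energy.
#[export] Hint Extern 0 (measurable_fun _ (kern _)) => solve [exact: measurable_kern] : core.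
#[export] Hint Extern 0 (measurable_fun _ (box _)) => solve [exact: measurable_box] : core.

Section energy_bounds.
Variables (R : realType) (H : R).
Hypotheses (H_gt : 1 / 2 < H) (H_lt : H < 1).
Local Notation leb := (@lebesgue_measure R).
Local Notation leb2 := (prodm leb leb).
Implicit Types (D E : R -> R) (T M t s u v : R).

Local Notation b := (2 * H - 1).
Local Notation kern := (kern H).
Local Notation energy := (energy H).
Local Notation energy2 := (energy2 H).

Let b_gt0 : 0 < b. Proof. by move: H_gt; lra. Qed.
Let b_lt1 : b < 1. Proof. by move: H_lt; lra. Qed.
Let kernE p : kern p = `|p.1 - p.2| `^ (b - 1).
Proof. by have -> : b - 1 = 2 * H - 2 by ring. Qed.

(** The window ]w, w + l[ weighted by the square root of l `^ (b - 3) *)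
Let win u (y : R * R) : R :=
  (0 < y.1)%R%:R * y.1 `^ ((b - 3) / 2) * ((y.2 < u) && (u < y.2 + y.1))%R%:R.

Let measurable_win : measurable_fun setT (fun z : R * (R * R) => win z.1 z.2).
Proof.
apply: measurable_funM.
  apply: measurable_funM.
    by apply: measurable_b2r; apply: measurable_fun_ltr => //; exact: measurableT_comp.
  have m1 : measurable_fun setT (fun z : R * (R * R) => z.2.1) by exact: measurableT_comp.
  exact: measurableT_comp (measurable_powR _) m1.
apply: measurable_b2r; apply: measurable_and; apply: measurable_fun_ltr => //;
  try exact: measurableT_comp.
by apply: measurable_funD; exact: measurableT_comp.
Qed.

Let win_ge0 u y : 0 <= win u y.
Proof. by rewrite /win !mulr_ge0 ?powR_ge0. Qed.

Let int_winwin u v : u != v ->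
  (\int[leb2]_y (win u y * win v y)%:E =
   (((1 - b) * (2 - b))^-1 * kern (u, v))%:E)%E.
Proof.
move=> uv.
have mw x : measurable_fun setT (win x).
  exact: measurableT_comp measurable_win (@pair1_measurable _ _ _ _ x).
have r0 : 0 < `|u - v| by rewrite normr_gt0 subr_eq0.
rewrite (@fubini_tonelli1 _ _ _ _ _ leb leb (fun y => (win u y * win v y)%:E)); last 2 first.
- by apply/measurable_EFinP; apply: measurable_funM; exact: mw.
- by move=> y; rewrite lee_fin mulr_ge0.
rewrite kernE /= -[RHS]/((_ * _)%:E) mulrC -(int_tent b_lt1 r0).
apply: eq_integral => l _; rewrite /fubini_F.
have [l0|l0] := leP l 0.
  rewrite integral0_eq; last first.
    by move=> w _; rewrite /win /= ltNge l0 !mul0r.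
  by rewrite leNgt (le_lt_trans l0 r0) mul0r.
have -> : (\int[leb]_w (win u (l, w) * win v (l, w))%:E =
    \int[leb]_w ((l `^ (b - 3))%:E * (\1_(`]Num.max u v - l, Num.min u v[%classic) w)%:E))%E.
  apply: eq_integral => w _; rewrite -EFinM; congr EFin; rewrite /win/= l0 !mul1r.
  rewrite mulrACA -powRD; last by rewrite (gt_eqF l0) implybT.
  rewrite (_ : (b - 3) / 2 + (b - 3) / 2 = b - 3); last by field.
  congr (_ * _); rewrite -natrM mulnb indicE; congr (_%:R); congr nat_of_bool.
  apply/idP/idP => [/andP[/andP[wu uw] /andP[wv vw]]|].
    rewrite inE/= in_itv/= lt_min wu wv ltrBlDr andbT.
    by rewrite gt_max uw vw.
  rewrite inE/= in_itv/= lt_min ltrBlDr gt_max.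
  by move=> /andP[/andP[-> ->] /andP[-> ->]].
rewrite ge0_integralZl//; last 2 first.
- by apply/measurable_EFinP; exact: measurable_indic.
- by rewrite lee_fin powR_ge0.
rewrite integral_indic// setIT.
have E : Num.min u v - (Num.max u v - l) = l - `|u - v|.
  by case: (ltP u v) => h; [rewrite ltr0_norm ?subr_lt0//|rewrite ger0_norm ?subr_ge0//]; ring.
rewrite [X in (_ * X)%E](_ : _ = ((`|u - v| <= l)%R%:R * (l - `|u - v|))%:E)%E.
  by rewrite -EFinM; congr EFin; ring.
apply: etrans (lebesgue_measure_itv _) _; rewrite /= lte_fin -EFinB E.
rewrite -subr_gt0 E subr_gt0 le_eqVlt.
have [->|_] := eqVneq `|u - v| l; first by rewrite ltxx subrr mulr0.
by case: ifP; rewrite /= ?mul1r ?mul0r.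
Qed.

(** |u - v| `^ (2H - 2) is a positive definite kernel: up to a constant, it is
    the integral over all windows I of l(I) `^ (2H - 4) 1_I(u) 1_I(v). *)
Lemma energy_ge0 T M D : tbd T M D -> 0 <= energy D.
Proof.
move=> hD; have [mD DM] := hD.
set c := ((1 - b) * (2 - b))^-1.
have c0 : 0 < c by rewrite invr_gt0 mulr_gt0// subr_gt0// (lt_trans b_lt1)// ltr1n.
have mww : measurable_fun setT
    (fun z : (R * R) * (R * R) => win z.1.1 z.2 * win z.1.2 z.2).
  apply: measurable_funM.
    apply: (measurableT_comp measurable_win
      (g := fun z : (R * R) * (R * R) => (z.1.1, z.2))).
    by mfun.
  apply: (measurableT_comp measurable_win
    (g := fun z : (R * R) * (R * R) => (z.1.2, z.2))).
  by mfun.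
have mF : measurable_fun setT (fun z : (R * R) * (R * R) =>
    (D z.1.1 * D z.1.2 * (win z.1.1 z.2 * win z.1.2 z.2))).
  by do 2 apply: measurable_funM => //; apply: (measurableT_comp mD); mfun.
have msw (p : R * R) : measurable_fun setT (fun y => win p.1 y * win p.2 y).
  exact: (@measurable_sec1 _ _ _ _ _ _ p mww).
have key (h : R -> R) p : p.1 != p.2 ->
    (\int[leb2]_y (h (D p.1 * D p.2) * (win p.1 y * win p.2 y))%:E =
     (h (D p.1 * D p.2) * (c * kern p))%:E)%E.
  move=> p12; under eq_integral do rewrite EFinM.
  rewrite integralZl//; first by rewrite int_winwin// -EFinM; case: p p12.
  apply: integrable_ge0; [exact: msw|by move=> y; rewrite mulr_ge0|].
  by rewrite int_winwin// ltry.
have FI : (prodm leb2 leb2).-integrable setT (fun z : (R * R) * (R * R) =>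
    (D z.1.1 * D z.1.2 * (win z.1.1 z.2 * win z.1.2 z.2))%:E).
  apply/integrable12ltyP; first exact/measurable_EFinP.
  have I1 := Rint_integrableZ c (energy_integrable H_gt hD hD).
  have /integrableP[_] := I1; apply: le_lt_trans.
  apply: ae_ge0_le_integral => //.
  - by move=> p _; exact: integral_ge0.
  - apply: (@measurable_fun_fubini_tonelli_F _ _ _ _ R leb2
      (fun z => `|(D z.1.1 * D z.1.2 * (win z.1.1 z.2 * win z.1.2 z.2))%:E|%E)) => //.
    by apply: measurableT_comp => //; exact/measurable_EFinP.
  - by apply: measurableT_comp => //; exact: measurable_int I1.
  have [N [mN N0 hN]] := @diagonal_null R.
  exists N; split => // p; apply: contra_notP => pN /= _.
  have p12 : p.1 != p.2 by apply/eqP => pp; apply: pN; exact: hN.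
  rewrite le_eqVlt; apply/orP; left; apply/eqP.
  transitivity (\int[leb2]_y (`|D p.1 * D p.2| * (win p.1 y * win p.2 y))%:E)%E.
    apply: eq_integral => y _; rewrite /= normrM.
    by rewrite [X in _ * X]ger0_norm// mulr_ge0.
  rewrite (key Num.norm)//; congr EFin.
  rewrite [RHS]normrM [X in _ = _ * X]normrM (ger0_norm (kern_ge0 _ _)) (gtr0_norm c0).
  by ring.
have winI y : leb.-integrable setT (EFin \o (fun x => D x * win x y)).
  apply: (@dom_integrable _ _ _ leb _ (fun x => `|y.1 `^ ((b - 3) / 2)| * `|D x|)).
  - apply: measurable_funM => //.
    exact: measurableT_comp measurable_win (@pair2_measurable _ _ _ _ y).
  - move=> x; rewrite normrM mulrC ler_wpM2r// /win !normrM.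
    have h (q : bool) : `|q%:R : R| <= 1 by case: q; rewrite ?normr1 ?normr0.
    rewrite -[leRHS]mul1r -[leRHS]mulr1; apply: ler_pM => //.
    by rewrite ler_wpM2r.
  - apply: Rint_integrableZ; apply: integrable_norm => //.
    exact: tbd_integrable hD.
have := mixture_ge0 FI winI.
have -> : (\int[leb2]_p \int[leb2]_y (D p.1 * D p.2 * (win p.1 y * win p.2 y))%:E =
    \int[leb2]_p (c * (D p.1 * D p.2 * kern p))%:E)%E.
  have I1 := Rint_integrableZ c (energy_integrable H_gt hD hD).
  apply: ae_eq_integral => //.
  - exact: measurable_fubini_F FI.
  - exact: measurable_int I1.
  have [N [mN N0 hN]] := @diagonal_null R.
  exists N; split => // p; apply: contra_notP => pN /= _.
  have p12 : p.1 != p.2 by apply/eqP => pp; apply: pN; exact: hN.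
  by rewrite (key id)//; congr EFin; ring.
have I0 := energy_integrable H_gt hD hD.
rewrite -EFin_Rintegral; last exact: Rint_integrableZ I0.
by rewrite RintegralZl// lee_fin pmulr_rge0.
Qed.

End energy_bounds.

Lemma eq_ler (R : realType) (x y : R) : x = y -> x <= y.
Proof. by move=> ->. Qed.

Section energy_estimates.
Variables (R : realType) (H : R).
Hypotheses (H_gt : 1 / 2 < H) (H_lt : H < 1).
Local Notation leb := (@lebesgue_measure R).
Local Notation leb2 := (prodm leb leb).
Implicit Types (D E : R -> R) (T M t s u v : R).

Local Notation b := (2 * H - 1).
Local Notation kern := (kern H).
Local Notation energy := (energy H).
Local Notation energy2 := (energy2 H).

Let b_gt0 : 0 < b. Proof. by move: H_gt; lra. Qed.
Let b_lt1 : b < 1. Proof. by move: H_lt; lra. Qed.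
Let kernE p : kern p = `|p.1 - p.2| `^ (b - 1).
Proof. by have -> : b - 1 = 2 * H - 2 by ring. Qed.

Lemma energyD_le T M M' D E : tbd T M D -> tbd T M' E ->
  energy (fun u => D u + E u) <= 2 * energy D + 2 * energy E.
Proof.
move=> hD hE; have := energy_parallelogram H_gt hD hE.
have := energy_ge0 H_gt H_lt (tbdD hD (tbdZ (- 1) hE)); lra.
Qed.

Lemma EFin_energy T M D : tbd T M D ->
  (energy D)%:E = (\int[leb2]_p (D p.1 * D p.2 * kern p)%:E)%E.
Proof. by move=> hD; rewrite EFin_Rintegral//; exact: (energy_integrable H_gt hD hD). Qed.

Lemma int_kernel_window (c v : R) : 0 < c ->
  (\int[leb]_u ((`|u - v| <= c^-1)%R%:R * kern (u, v))%:E = (2 * c `^ (- b) / b)%:E)%E.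
Proof.
move=> c0; have ci : 0 <= c^-1 by rewrite invr_ge0 ltW.
apply: etrans (etrans (@int_kernel _ _ b_gt0 c^-1 c^-1 v ci ci) _).
  apply: eq_integral => u _; rewrite kernE; congr ((_%:R * _)%:E); congr nat_of_bool.
  by rewrite ler_distl.
congr (_%:E); congr (_ / _).
rewrite -powR_inv1 ?ltW// -powRrM mulN1r; ring.
Qed.

(** The common envelope of the time profiles met below. *)
Definition decay (t c u : R) : R := box t u * expR (- ((t - u) * c)).

Lemma measurable_decay t c : measurable_fun setT (decay t c).
Proof. by rewrite /decay; mfun. Qed.
Hint Extern 0 (measurable_fun _ (decay _ _)) => solve [exact: measurable_decay] : core.

Lemma decay_ge0 t c u : 0 <= decay t c u.
Proof. by rewrite mulr_ge0 ?box_ge0 ?expR_ge0. Qed.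

Lemma decay_le_box t c u : 0 <= c -> decay t c u <= box t u.
Proof.
move=> c0; rewrite /decay /box; case: (boolP (0 <= u <= t)) => [/andP[u0 ut]|_]; last first.
  by rewrite mul0r.
by rewrite mul1r -expR0 ler_expR oppr_le0 mulr_ge0// subr_ge0.
Qed.

Lemma int_decay t c : 0 < c -> (\int[leb]_u (decay t c u)%:E <= (c^-1)%:E)%E.
Proof.
move=> c0; have [t0|t0|t0] := ltrgtP t 0.
- rewrite integral0_eq ?lee_fin ?invr_ge0 ?ltW// => u _; rewrite /decay /box.
  case: (boolP (0 <= u <= t)) => [/andP[u0 ut]|_]; last by rewrite mul0r.
  by have := le_lt_trans (le_trans u0 ut) t0; rewrite ltxx.
- rewrite -(@int_mkcond _ `[0, t]%classic); last by move=> u; rewrite /= in_itv.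
  have dF (u : R) : is_derive u 1 (fun u => c^-1 * expR (- ((t - u) * c))) (expR (- ((t - u) * c))).
    apply: is_derive_eq; rewrite /GRing.scale/=.
    by field; rewrite gt_eqF.
  have cF (u : R) : {for u, continuous (fun u => c^-1 * expR (- ((t - u) * c)))}.
    have [dl _] := dF u; exact/differentiable_continuous/derivable1_diffP.
  have cf (u : R) : {for u, continuous (fun u => expR (- ((t - u) * c)))}.
    have dG : is_derive u 1 (fun u => expR (- ((t - u) * c))) (c * expR (- ((t - u) * c))).
      by apply: is_derive_eq; rewrite /GRing.scale/=; ring.
    have [dl _] := dG; exact/differentiable_continuous/derivable1_diffP.
  rewrite (@continuous_FTC2 _ _ (fun u => c^-1 * expR (- ((t - u) * c))) _ _ t0)//.
  + rewrite -EFinB lee_fin subrr mul0r oppr0 expR0 mulr1 gerBl.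
    by rewrite mulr_ge0 ?expR_ge0// invr_ge0 ltW.
  + by apply: continuous_subspaceT => u; exact: cf.
  + split => [u _| |].
    * by have [] := dF u.
    * by apply: cvg_at_right_filter; exact: cF.
    * by apply: cvg_at_left_filter; exact: cF.
  + by move=> u _; rewrite derive1E; have [_ ->] := dF u.
- apply: (@le_trans _ _ (\int[leb]_u (box t u)%:E)%E).
    apply: ge0_le_int => //; [exact: decay_ge0|].
    by move=> u; apply: decay_le_box; exact: ltW.
  by rewrite int_box t0// lee_fin invr_ge0 ltW.
Qed.

Lemma ge0_int2M (f : R * R -> R) (g : R -> R) K : measurable_fun setT f ->
  measurable_fun setT g -> (forall p, 0 <= f p) -> (forall v, 0 <= g v) ->
  (forall v, \int[leb]_u (f (u, v))%:E <= K%:E)%E ->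
  (\int[leb2]_p (g p.2 * f p)%:E <= K%:E * \int[leb]_v (g v)%:E)%E.
Proof.
move=> mf mg f0 g0 fK.
have mgf : measurable_fun setT (fun p : R * R => (g p.2 * f p)%:E).
  by apply/measurable_EFinP; apply: measurable_funM => //; apply: (measurableT_comp mg); mfun.
have gf0 (p : R * R) : (0 <= (g p.2 * f p)%:E)%E by rewrite lee_fin mulr_ge0.
rewrite (@fubini_tonelli2 _ _ _ _ _ leb leb (fun p => (g p.2 * f p)%:E))//.
rewrite -ge0_integralZl//; last 3 first.
- exact/measurable_EFinP.
- by move=> v _; rewrite lee_fin.
- by apply: le_trans (fK 0); apply: integral_ge0 => u _; rewrite lee_fin.
apply: ge0_le_integral => //.
- by move=> v _; exact: integral_ge0.
- exact: (@measurable_fun_fubini_tonelli_G _ _ _ _ R leb (fun p => (g p.2 * f p)%:E)).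
- by apply/measurable_EFinP; mfun.
move=> v _; rewrite /fubini_G /=; under eq_integral do rewrite EFinM.
rewrite ge0_integralZl//.
- by rewrite muleC lee_wpmul2r// lee_fin.
- by apply/measurable_EFinP; exact: measurable_sec2.
- by move=> u _; rewrite lee_fin.
- by rewrite lee_fin.
Qed.

(** The energy of an exponential of rate c >= 1 is of order c `^ (- 2H). Points
    at distance at most 1 / c contribute at most the mass 1 / c times the order
    c `^ (1 - 2H) of the kernel's integral over such a window; for the others the
    kernel is at most c `^ (2 - 2H), to be multiplied by the squared mass. *)
Lemma energy_decay_exp c t : 0 < c ->
  (\int[leb2]_p (decay t c p.1 * decay t c p.2 * kern p)%:E <=
   ((2 / b + 1) * c `^ (- (2 * H)))%:E)%E.
Proof.
move=> c0; have ci : 0 < c^-1 by rewrite invr_gt0.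
pose w (p : R * R) : R := (`|p.1 - p.2| <= c^-1)%R%:R.
have mw : measurable_fun setT w.
  by rewrite /w; apply: measurable_b2r; apply: measurable_fun_ler; mfun.
have md1 : measurable_fun setT (fun p : R * R => decay t c p.1).
  exact: measurableT_comp (measurable_decay _ _) measurable_fst.
have md2 : measurable_fun setT (fun p : R * R => decay t c p.2).
  exact: measurableT_comp (measurable_decay _ _) measurable_snd.
have mk := measurable_kern H.
apply: (@le_trans _ _ (\int[leb2]_p ((decay t c p.2 * (w p * kern p))%:E +
    (decay t c p.2 * (c `^ (1 - b) * decay t c p.1))%:E))%E).
  apply: ge0_le_integral => //.
  - by move=> p _; rewrite lee_fin !mulr_ge0 ?decay_ge0 ?kern_ge0.
  - by apply/measurable_EFinP; mfun.
  - by apply: emeasurable_funD; apply/measurable_EFinP; mfun.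
  move=> p _; rewrite -EFinD lee_fin.
  have d1 := decay_ge0 t c p.1; have d2 := decay_ge0 t c p.2.
  have d1l : decay t c p.1 <= 1.
    by apply: le_trans (decay_le_box _ _ (ltW c0)) (box_le1 _ _).
  have k0 := kern_ge0 H p.
  rewrite /w; have [pc|pc] := leP `|p.1 - p.2| c^-1.
    rewrite mul1r (mulrC (decay t c p.1)) -mulrA.
    apply: (@le_trans _ _ (decay t c p.2 * kern p)).
      by rewrite ler_wpM2l// ler_piMl.
    by rewrite lerDl !mulr_ge0 ?powR_ge0.
  rewrite mul0r mulr0 add0r (mulrC (decay t c p.1)) -mulrA ler_wpM2l// mulrC ler_wpM2r//.
  rewrite kernE (_ : b - 1 = - (1 - b)); last by ring.
  have -> : c `^ (1 - b) = (c^-1 `^ (1 - b))^-1.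
    by rewrite -(powR_inv1 (ltW c0)) -powRrM mulN1r powRN invrK.
  rewrite powRN lef_pV2 ?posrE ?powR_gt0//; last exact: lt_trans pc.
  apply: ge0_ler_powR; last exact: ltW.
  - by rewrite subr_ge0 ltW.
  - by rewrite nnegrE ltW.
  - by rewrite nnegrE.
rewrite ge0_integralD//; last 4 first.
- by move=> p _; rewrite lee_fin !mulr_ge0 ?decay_ge0 ?kern_ge0// ler0n.
- by apply/measurable_EFinP; mfun.
- by move=> p _; rewrite lee_fin !mulr_ge0 ?decay_ge0 ?powR_ge0.
- by apply/measurable_EFinP; mfun.
set X := c `^ (- (2 * H)); rewrite (_ : (2 / b + 1) * X = 2 / b * X + X); last by ring.
rewrite EFinD; apply: leeD; rewrite /X {X}.
  apply: (le_trans (@ge0_int2M (fun p => w p * kern p) (decay t c) (2 * c `^ (- b) / b) _ _ _ _ _)) => //.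
  - by mfun.
  - by move=> p; rewrite mulr_ge0 ?kern_ge0// ler0n.
  - exact: decay_ge0.
  - by move=> v; rewrite int_kernel_window.
  apply: le_trans (lee_wpmul2l _ (int_decay t c0)) _.
    by rewrite lee_fin !mulr_ge0 ?powR_ge0 ?invr_ge0 ?ltW.
  rewrite -EFinM lee_fin -[in leLHS](powR_inv1 (ltW c0)).
  rewrite (_ : - (2 * H) = - b + -1); last by ring.
  rewrite powRD; last by rewrite (gt_eqF c0) implybT.
  by apply: eq_ler; ring.
apply: (le_trans (@ge0_int2M (fun p => c `^ (1 - b) * decay t c p.1) (decay t c) (c `^ (1 - b) * c^-1) _ _ _ _ _)) => //.
- by mfun.
- by move=> p; rewrite mulr_ge0 ?decay_ge0 ?powR_ge0.
- exact: decay_ge0.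
- move=> v /=; under eq_integral do rewrite EFinM.
  rewrite ge0_integralZl ?lee_fin ?powR_ge0//; last 2 first.
  + by apply/measurable_EFinP.
  + by move=> u _; rewrite lee_fin decay_ge0.
  by rewrite EFinM lee_wpmul2l ?lee_fin ?powR_ge0// int_decay.
apply: le_trans (lee_wpmul2l _ (int_decay t c0)) _.
  by rewrite lee_fin !mulr_ge0 ?powR_ge0 ?invr_ge0 ?ltW.
rewrite -EFinM lee_fin -[in leLHS](powR_inv1 (ltW c0)).
rewrite (_ : - (2 * H) = (1 - b) + -1 + -1); last by ring.
by rewrite !powRD; rewrite ?(gt_eqF c0) ?implybT.
Qed.

Lemma energy_decay_le T M bt t D : measurable_fun setT D -> 0 <= M -> 0 <= bt -> t <= T ->
  (forall u, `|D u| <= M * decay t bt u) ->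
  energy D <= M ^+ 2 * expR (2 * T) * (2 / b + 1) * (1 + bt) `^ (- (2 * H)).
Proof.
move=> mD M0 bt0 tT DM.
have c0 : 0 < 1 + bt by rewrite ltr_pwDl.
have hD : tbd T M D.
  split => // u; rewrite (le_trans (DM u))// ler_wpM2l//.
  by apply: le_trans (decay_le_box _ _ bt0) (box_le _ tT).
have dle u : decay t bt u <= expR T * decay t (1 + bt) u.
  rewrite /decay mulrCA /box; case: (boolP (0 <= u <= t)) => [/andP[u0 ut]|_]; last first.
    by rewrite !mul0r.
  rewrite !mul1r -expRD ler_expR.
  rewrite (_ : (t - u) * (1 + bt) = (t - u) + (t - u) * bt); last by ring.
  by move: ((t - u) * bt) => q; move: u0 tT; lra.
rewrite -lee_fin (EFin_energy hD) -mulrA EFinM.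
apply: (@le_trans _ _ ((M ^+ 2 * expR (2 * T))%:E *
    \int[leb2]_p (decay t (1 + bt) p.1 * decay t (1 + bt) p.2 * kern p)%:E)%E); last first.
  by rewrite lee_wpmul2l ?lee_fin ?mulr_ge0 ?sqr_ge0 ?expR_ge0// energy_decay_exp.
have md := measurable_energy_integrand H (measurable_decay t (1 + bt)) (measurable_decay t (1 + bt)).
rewrite -ge0_integralZl//; last 3 first.
- exact/measurable_EFinP.
- by move=> p _; rewrite lee_fin !mulr_ge0 ?decay_ge0 ?kern_ge0.
- by rewrite lee_fin mulr_ge0 ?sqr_ge0 ?expR_ge0.
have I0 := energy_integrable H_gt hD hD.
apply: (@le_trans _ _ (\int[leb2]_p (`|D p.1| * `|D p.2| * kern p)%:E)%E).
  have aD : tbd T M (fun v => `|D v|).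
    split => [|u]; [exact: measurableT_comp|rewrite normr_id; exact: (proj2 hD)].
  rewrite -EFin_Rintegral// -EFin_Rintegral; last exact: (energy_integrable H_gt aD aD).
  rewrite lee_fin; apply: le_Rintegral => //; first exact: (energy_integrable H_gt aD aD).
  by move=> p _; rewrite ler_wpM2r ?kern_ge0// (le_trans (ler_norm _))// normrM.
have maD : measurable_fun setT (fun u => `|D u|) by exact: measurableT_comp.
have m1 := measurable_energy_integrand H maD maD.
apply: ge0_le_integral => //.
- by move=> p _; rewrite lee_fin !mulr_ge0 ?kern_ge0.
- exact/measurable_EFinP.
- by apply/measurable_EFinP; exact: measurable_funM.
move=> p _; rewrite -EFinM lee_fin mulrA ler_wpM2r ?kern_ge0//.
apply: (@le_trans _ _ ((M * (expR T * decay t (1 + bt) p.1)) * (M * (expR T * decay t (1 + bt) p.2)))).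
  apply: ler_pM => //; rewrite (le_trans (DM _))//; exact: ler_wpM2l.
apply: eq_ler; rewrite (_ : 2 * T = T + T); last by ring.
by rewrite expRD; ring.
Qed.

End energy_estimates.
#[export] Hint Extern 0 (measurable_fun _ (decay _ _)) => solve [exact: measurable_decay] : core.

Section energy_examples.
Variables (R : realType) (H : R).
Hypotheses (H_gt : 1 / 2 < H) (H_lt : H < 1).
Local Notation leb := (@lebesgue_measure R).
Local Notation leb2 := (prodm leb leb).
Implicit Types (D E : R -> R) (T M t s u v : R).

Local Notation b := (2 * H - 1).
Local Notation kern := (kern H).
Local Notation energy := (energy H).
Local Notation energy2 := (energy2 H).

Let b_gt0 : 0 < b. Proof. by move: H_gt; lra. Qed.
Let b_lt1 : b < 1. Proof. by move: H_lt; lra. Qed.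
Let kernE p : kern p = `|p.1 - p.2| `^ (b - 1).
Proof. by have -> : b - 1 = 2 * H - 2 by ring. Qed.

Lemma energy_cvg0 T M (D_ : nat -> R -> R) : (forall n, tbd T M (D_ n)) ->
  {ae leb, forall u, D_ n u @[n --> \oo] --> 0} ->
  energy (D_ n) @[n --> \oo] --> 0.
Proof.
move=> hD D0.
apply: (@squeeze_cvgr _ _ _ _ (cst 0) (fun n => M * pot H T * \int[leb]_v `|D_ n v|)).
- by apply: nearW => n; rewrite /= (energy_ge0 H_gt H_lt (hD n)) (energy_le H_gt (hD n)).
- exact: cvg_cst.
rewrite -[X in _ --> X](mulr0 (M * pot H T)); apply: cvgMr.
have [|||||_] := @Rint_cvg _ _ R leb (fun n v => `|D_ n v|) (cst 0) (fun v => M * box T v).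
- by move=> n; apply: measurableT_comp => //; case: (hD n).
- by [].
- have [N [mN N0 hN]] := D0; exists N; split => //.
  apply: subset_trans hN; apply: subsetC => u Du /=.
  by rewrite -(normr0 R); exact: cvg_norm.
- exact: Rint_integrableZ (box_integrable T).
- by move=> n v; rewrite normr_id; case: (hD n).
by rewrite /Rintegral integral0.
Qed.

(** The spatial Fourier transform of the heat kernel, as a function of time. *)
Definition heat_profile t (bt : R) u : R := (0 <= u < t)%R%:R * expR (- ((t - u) * bt)).

Lemma measurable_heat_profile t bt : measurable_fun setT (heat_profile t bt).
Proof. by rewrite /heat_profile; mfun. Qed.
Hint Extern 0 (measurable_fun _ (heat_profile _ _)) => solve [exact: measurable_heat_profile] : core.

Lemma heat_profile_ge0 t bt u : 0 <= heat_profile t bt u.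
Proof. by rewrite mulr_ge0// expR_ge0. Qed.

Lemma heat_profile_le t bt u : heat_profile t bt u <= decay t bt u.
Proof.
rewrite ler_wpM2r ?expR_ge0// /box ler_nat; case: (0 <= u) => //=.
by case: ltP => // /ltW ->.
Qed.

Lemma tbd_heat_profile t bt : 0 <= bt -> tbd t 1 (heat_profile t bt).
Proof.
move=> bt0; split => // u; rewrite ger0_norm ?heat_profile_ge0// mul1r.
exact: le_trans (heat_profile_le _ _ _) (decay_le_box _ _ bt0).
Qed.

(** On the last time interval of length 1 / (1 + bt) before time 1 the profile
    is of order one, and there the kernel is at least (1 + bt) `^ (2 - 2H). *)
Lemma energy_heat_profile_ge bt : 0 <= bt ->
  expR (- 2) * (1 + bt) `^ (- (2 * H)) <= energy (heat_profile 1 bt).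
Proof.
move=> bt0; set c := 1 + bt; have c1 : 1 <= c by rewrite lerDl.
have c0 : 0 < c by rewrite ltr_pwDl.
have ci : 0 < c^-1 by rewrite invr_gt0.
have hD := tbd_heat_profile 1 bt0.
pose J (u : R) : R := (1 - c^-1 <= u < 1)%R%:R.
have mJ : measurable_fun setT J by rewrite /J; mfun.
have mJ1 : measurable_fun setT (fun p : R * R => J p.1) by apply: (measurableT_comp mJ); mfun.
have mJ2 : measurable_fun setT (fun p : R * R => J p.2) by apply: (measurableT_comp mJ); mfun.
have IJ : (\int[leb]_u (J u)%:E = (c^-1)%:E)%E.
  have -> : (\int[leb]_u (J u)%:E = \int[leb]_(u in `[(1 - c^-1)%R, 1%R[) (cst 1%R u)%:E)%E.
    rewrite (@int_mkcond R `[1 - c^-1, 1[%classic (cst 1) (fun u => 1 - c^-1 <= u < 1)).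
      by apply: eq_integral => u _; rewrite mulr1.
    by move=> u; rewrite /= in_itv.
  apply: (etrans (integral_cst leb (measurable_itv `[1 - c^-1, 1[) 1%E)).
  rewrite mul1e /= lebesgue_measure_itv/= lte_fin gtrBl ci -EFinB; congr EFin; ring.
have IJJ : (\int[leb2]_p (J p.2 * J p.1)%:E = (c^-1 * c^-1)%:E)%E.
  rewrite (@fubini_tonelli2 _ _ _ _ _ leb leb (fun p => (J p.2 * J p.1)%:E)); last 2 first.
  - by apply/measurable_EFinP; mfun.
  - by move=> p; rewrite lee_fin mulr_ge0 ?ler0n.
  rewrite /fubini_G /=.
  under eq_integral => v _.
    under eq_integral do rewrite EFinM.
    rewrite ge0_integralZl//; last 3 first.
    - exact/measurable_EFinP.
    - by move=> u _; rewrite lee_fin ler0n.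
    - by rewrite lee_fin ler0n.
    rewrite IJ muleC; over.
  rewrite ge0_integralZl//.
  - by rewrite IJ.
  - exact/measurable_EFinP.
  - by move=> v _; rewrite lee_fin ler0n.
  - by rewrite lee_fin ltW.
rewrite -lee_fin (EFin_energy H_gt hD).
apply: (@le_trans _ _ (\int[leb2]_p (expR (-2) * c `^ (1 - b) * (J p.2 * J p.1))%:E)%E).
  under eq_integral do rewrite EFinM.
  rewrite ge0_integralZl//; last 3 first.
  - by apply/measurable_EFinP; mfun.
  - by move=> p _; rewrite lee_fin mulr_ge0 ?ler0n.
  - by rewrite lee_fin mulr_ge0 ?expR_ge0 ?powR_ge0.
  rewrite IJJ -EFinM lee_fin -mulrA ler_wpM2l ?expR_ge0//.
  rewrite -[in leRHS](powR_inv1 (ltW c0)) -!powRD ?(gt_eqF c0) ?implybT//.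
  by rewrite (_ : 1 - b + (-1 + -1) = - (2 * H)) ?lexx//; ring.
apply: ae_ge0_le_integral => //.
- by move=> p _; rewrite lee_fin !mulr_ge0 ?expR_ge0 ?powR_ge0 ?ler0n.
- by apply/measurable_EFinP; mfun.
- by move=> p _; rewrite lee_fin !mulr_ge0 ?kern_ge0 ?heat_profile_ge0.
- by apply/measurable_EFinP; exact: measurable_energy_integrand.
have [N [mN N0 hN]] := @diagonal_null R.
exists N; split => // -[u v]; apply: contra_notP => pN /= _.
have uv : u != v by apply/eqP => pp; apply: pN; exact: hN.
rewrite lee_fin /J.
have rhs0 : 0 <= heat_profile 1 bt u * heat_profile 1 bt v * kern (u, v).
  by rewrite !mulr_ge0 ?kern_ge0 ?heat_profile_ge0.
case: (boolP (1 - c^-1 <= v < 1)) => [/andP[v1 v2]|_]; last by rewrite mul0r mulr0.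
case: (boolP (1 - c^-1 <= u < 1)) => [/andP[u1 u2]|_]; last by rewrite mul1r mulr0.
rewrite !mulr1.
have pl x : 1 - c^-1 <= x -> x < 1 -> expR (- 1) <= heat_profile 1 bt x.
  move=> x1 x2; rewrite /heat_profile x2 andbT.
  have -> : 0 <= x.
    by apply: le_trans x1; rewrite subr_ge0 invf_le1.
  rewrite mul1r ler_expR lerN2.
  have x3 : 1 - x <= c^-1 by move: x1; lra.
  apply: (@le_trans _ _ (c^-1 * bt)); first exact: ler_wpM2r.
  by rewrite mulrC ler_pdivrMr// mul1r lerDr.
rewrite (_ : - 2 = -1 + -1); last by ring.
rewrite expRD; apply: ler_pM; rewrite ?mulr_ge0 ?expR_ge0 ?powR_ge0//.
  by apply: ler_pM; rewrite ?expR_ge0// pl.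
rewrite kernE /= (_ : b - 1 = - (1 - b)); last by ring.
have -> : c `^ (1 - b) = (c^-1 `^ (1 - b))^-1.
  by rewrite -(powR_inv1 (ltW c0)) -powRrM mulN1r powRN invrK.
have uv0 : 0 < `|u - v| by rewrite normr_gt0 subr_eq0.
rewrite powRN lef_pV2 ?posrE ?powR_gt0//.
apply: ge0_ler_powR.
- by rewrite subr_ge0 ltW.
- by rewrite nnegrE.
- by rewrite nnegrE ltW.
by rewrite ler_norml; apply/andP; split; move: u1 u2 v1 v2; lra.
Qed.

Lemma energy2_box_le t s : 0 <= s <= t ->
  alphaH H * energy2 (box t) (box s) = RH H t s.
Proof.
move=> /andP[s0 st]; have t0 := le_trans s0 st.
have b1_gt0 : 0 < b + 1 by rewrite ltr_pwDl.
have ht := tbd_box (lexx t); have hs := tbd_box st.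
have int_pow x : 0 <= x ->
    (\int[leb]_v (box x v * v `^ b)%:E = (x `^ (b + 1) / (b + 1))%:E)%E.
  move=> x0; apply: etrans (int_powR b1_gt0 x0).
  apply: eq_integral => v _; rewrite addrK /box.
  have [v0|v0|<-] := ltgtP 0 v; rewrite ?mul0r//.
  by rewrite powR0 ?gt_eqF// !mulr0.
have E : (\int[leb]_v (box s v * (v `^ b + (t - v) `^ b))%:E =
    ((s `^ (b + 1) + t `^ (b + 1) - (t - s) `^ (b + 1)) / (b + 1))%:E)%E.
  pose h x (v : R) := box x v * v `^ b.
  have mp : measurable_fun setT (fun v : R => v `^ b) by exact: measurable_powR.
  have mh x : measurable_fun setT (h x) by apply: measurable_funM.
  have h0 x v : 0 <= h x v by rewrite mulr_ge0 ?box_ge0 ?powR_ge0.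
  have mtv : measurable_fun setT (fun v : R => t - v) by mfun.
  have int_h x : 0 <= x ->
      (\int[leb]_v (h x (t - v))%:E = (x `^ (b + 1) / (b + 1))%:E)%E.
    move=> x0; rewrite -int_pow// -[RHS](@ge0_int_opp R (fun v => (h x v)%:E))//; last 2 first.
    - exact/measurable_EFinP.
    - by move=> v; rewrite lee_fin.
    rewrite -[RHS](@ge0_int_shift R (fun v => (h x (- v))%:E) (- t))//; last 2 first.
    - by apply/measurable_EFinP; apply: (measurableT_comp (mh x)).
    - by move=> v; rewrite lee_fin.
    by apply: eq_integral => v _; rewrite opprB.
  pose f v : R := box s v * (t - v) `^ b.
  have mf : measurable_fun setT f.
    by apply: measurable_funM => //; exact: measurableT_comp mp mtv.
  have f0 v : 0 <= f v by rewrite mulr_ge0 ?box_ge0 ?powR_ge0.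
  have If : (\int[leb]_v (f v)%:E = ((t `^ (b + 1) - (t - s) `^ (b + 1)) / (b + 1))%:E)%E.
    have : (\int[leb]_v (h t (t - v))%:E =
        \int[leb]_v ((f v)%:E + (h (t - s) (t - v))%:E))%E.
      apply: ae_eq_integral => //.
      - by apply/measurable_EFinP; exact: measurableT_comp (mh t) mtv.
      - apply: emeasurable_funD; first exact/measurable_EFinP.
        by apply/measurable_EFinP; exact: measurableT_comp (mh (t - s)) mtv.
      exists [set s]; split => //; first exact: lebesgue_measure_set1.
      move=> v /=; apply: contra_notP => /eqP vs _.
      rewrite -EFinD; congr EFin; rewrite /h /f -mulrDl; congr (_ * _).
      rewrite /box subr_ge0 gerBl lerD2l lerN2.
      move: vs; case: (ltgtP v s) => // vs _.
        rewrite (le_trans (ltW vs) st) ?andbT addr0 /=.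
        by rewrite ?andbF /= ?addr0; case: (0 <= v).
      by rewrite (le_trans s0 (ltW vs)) andbF ?andbT add0r.
    rewrite ge0_integralD//; last 4 first.
    - by move=> v _; rewrite lee_fin.
    - exact/measurable_EFinP.
    - by move=> v _; rewrite lee_fin.
    - by apply/measurable_EFinP; exact: measurableT_comp (mh (t - s)) mtv.
    rewrite !int_h ?subr_ge0//; move=> e.
    rewrite mulrBl EFinB e addeK//.
  under eq_integral do rewrite mulrDr EFinD.
  rewrite ge0_integralD//; last 4 first.
  - by move=> v _; rewrite lee_fin -/(h s v).
  - by apply/measurable_EFinP; exact: mh.
  - by move=> v _; rewrite lee_fin -/(f v).
  - exact/measurable_EFinP.
  rewrite int_pow// If -EFinD; congr EFin; ring.
have -> : energy2 (box t) (box s) =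
  ((s `^ (b + 1) + t `^ (b + 1) - (t - s) `^ (b + 1)) / (b + 1)) / b.
  apply: EFin_inj; rewrite EFin_Rintegral; last exact: (energy_integrable H_gt ht hs).
  rewrite (@fubini_tonelli2 _ _ _ _ _ leb leb (fun p => (box t p.1 * box s p.2 * kern p)%:E)); last 2 first.
  - by apply/measurable_EFinP; exact: measurable_energy_integrand.
  - by move=> p; rewrite lee_fin !mulr_ge0 ?box_ge0 ?kern_ge0.
  rewrite mulrC EFinM -E -ge0_integralZl//; last 3 first.
  - apply/measurable_EFinP; apply: measurable_funM => //; apply: measurable_funD.
      exact: measurable_powR.
    have m1 : measurable_fun setT (fun v : R => t - v) by mfun.
    exact: measurableT_comp (measurable_powR _) m1.
  - by move=> v _; rewrite lee_fin !mulr_ge0 ?box_ge0 ?addr_ge0 ?powR_ge0.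
  - by rewrite lee_fin invr_ge0 ltW.
  apply: eq_integral => v _; rewrite /fubini_G /= -EFinM.
  have [/andP[v0 vs]|vs] := boolP (0 <= v <= s); last first.
    have -> : box s v = 0 by rewrite /box (negbTE vs).
    by rewrite mul0r mulr0 integral0_eq// => u _; rewrite mulr0 mul0r.
  have -> : box s v = 1 by rewrite /box v0 vs.
  rewrite mul1r mulrC -(int_kern_box H_gt); last by rewrite v0 (le_trans vs).
  by apply: eq_integral => u _; rewrite mulr1.
rewrite /alphaH /RH ger0_norm ?subr_ge0//.
rewrite (_ : b + 1 = 2 * H); last by ring.
have H0 : H != 0 by rewrite gt_eqF//; move: H_gt; lra.
have b0 : b != 0 by rewrite gt_eqF.
by field; rewrite H0 b0.
Qed.

Lemma energy2_box t s : 0 <= t -> 0 <= s ->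
  alphaH H * energy2 (box t) (box s) = RH H t s.
Proof.
move=> t0 s0; have [st|/ltW ts] := leP s t; first by rewrite energy2_box_le// s0.
rewrite (energy2C H_gt (tbd_box ts) (tbd_box (lexx s))).
by rewrite energy2_box_le ?t0// /RH distrC [t `^ _ + _]addrC.
Qed.

End energy_examples.

(** * Lebesgue measure on R^d *)

Section space.
Variable R : realType.
Local Notation leb := (@lebesgue_measure R).
Local Notation L n := (lebesgue_rV R n).

Lemma ge0_int_rVS n (F : 'rV[R]_n.+1 -> \bar R) : measurable_fun setT F ->
  (forall v, 0 <= F v)%E ->
  (\int[L n.+1]_v F v = \int[leb]_x \int[L n]_v F (cons_rV (x, v)))%E.
Proof.
move=> mF F0.
transitivity (\int[(leb \x L n)%E]_p (F \o @cons_rV R n) p)%E.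
  by apply: (@ge0_integral_pushforward _ _ _ _ R _ (@measurable_cons_rV R n) (leb \x L n)%E setT F).
apply: (@fubini_tonelli1 _ _ _ _ _ leb (L n) (F \o @cons_rV R n)).
  exact: measurableT_comp mF (@measurable_cons_rV R n).
by move=> p; exact: F0.
Qed.

Lemma ge0_int_rV0 (F : 'rV[R]_0 -> \bar R) : measurable_fun setT F ->
  (forall v, 0 <= F v)%E -> (\int[L 0]_v F v = F 0%R)%E.
Proof.
by move=> mF F0; rewrite /= integral_dirac// diracT mul1e.
Qed.

Lemma cons_rVD n (x y : R) (v w : 'rV[R]_n) :
  cons_rV (x + y, v + w) = cons_rV (x, v) + cons_rV (y, w).
Proof.
apply/rowP => i; rewrite [RHS]mxE.
have [[j ->]|[j ->]] : (exists j, i = lshift n (j : 'I_1)) \/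
    (exists j, i = rshift 1 (j : 'I_n)).
  by case: (@split_ordP 1 n i) => j ->; [left|right]; exists j.
- apply: etrans (cons_rVl (x + y, v + w) j) _.
  by congr (_ + _); apply: esym; [exact: (cons_rVl (x, v) j)|exact: (cons_rVl (y, w) j)].
- apply: etrans (cons_rVr (x + y, v + w) j) _; rewrite [LHS]mxE.
  by congr (_ + _); apply: esym; [exact: (cons_rVr (x, v) j)|exact: (cons_rVr (y, w) j)].
Qed.

Lemma cons_rVN n (x : R) (v : 'rV[R]_n) : cons_rV (- x, - v) = - cons_rV (x, v).
Proof.
apply/rowP => i; rewrite [RHS]mxE.
have [[j ->]|[j ->]] : (exists j, i = lshift n (j : 'I_1)) \/
    (exists j, i = rshift 1 (j : 'I_n)).
  by case: (@split_ordP 1 n i) => j ->; [left|right]; exists j.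
- apply: etrans (cons_rVl (- x, - v) j) _.
  by congr (- _); apply: esym; exact: (cons_rVl (x, v) j).
- apply: etrans (cons_rVr (- x, - v) j) _; rewrite [LHS]mxE.
  by congr (- _); apply: esym; exact: (cons_rVr (x, v) j).
Qed.

Lemma cons_rV_surj n (a : 'rV[R]_n.+1) : exists x v, a = cons_rV (x, v).
Proof.
exists (a ord0 ord0), (@rsubmx R 1 1 n a).
apply/rowP => i.
have [[j ->]|[j ->]] : (exists j, i = lshift n (j : 'I_1)) \/
    (exists j, i = rshift 1 (j : 'I_n)).
  by case: (@split_ordP 1 n i) => j ->; [left|right]; exists j.
- apply: esym; apply: etrans (cons_rVl (_, _) j) _ => /=.
  by congr (a _ _); apply: val_inj => /=; rewrite (ord1 j).
- by apply: esym; apply: etrans (cons_rVr (_, _) j) _; rewrite /= mxE.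
Qed.

Lemma measurable_rVD d (T : measurableType d) n (f g : T -> 'rV[R]_n) :
  measurable_fun setT f -> measurable_fun setT g ->
  measurable_fun setT (fun x => f x + g x).
Proof.
move=> mf mg; apply: measurable_fun_rV => i.
rewrite (_ : (fun x => _) = (fun x => f x ord0 i + g x ord0 i)); last first.
  by apply/funext => x; rewrite mxE.
by apply: measurable_funD; [exact: measurableT_comp (@measurable_coord _ _ i) mf|
  exact: measurableT_comp (@measurable_coord _ _ i) mg].
Qed.

Lemma measurable_rVN d (T : measurableType d) n (f : T -> 'rV[R]_n) :
  measurable_fun setT f -> measurable_fun setT (fun x => - f x).
Proof.
move=> mf; apply: measurable_fun_rV => i.
rewrite (_ : (fun x => _) = (fun x => - f x ord0 i)); last first.
  by apply/funext => x; rewrite mxE.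
by apply: measurable_funN; exact: measurableT_comp (@measurable_coord _ _ i) mf.
Qed.

Lemma measurable_rVB d (T : measurableType d) n (f g : T -> 'rV[R]_n) :
  measurable_fun setT f -> measurable_fun setT g ->
  measurable_fun setT (fun x => f x - g x).
Proof. by move=> mf mg; apply: measurable_rVD => //; exact: measurable_rVN. Qed.

Lemma measurable_dotv d (T : measurableType d) n (f g : T -> 'rV[R]_n) :
  measurable_fun setT f -> measurable_fun setT g ->
  measurable_fun setT (fun x => dotv (f x) (g x)).
Proof.
move=> mf mg; rewrite /dotv; apply: measurable_sum => i.
by apply: measurable_funM; [exact: measurableT_comp (@measurable_coord _ _ i) mf|
  exact: measurableT_comp (@measurable_coord _ _ i) mg].
Qed.

Lemma ge0_int_rVD n (F : 'rV[R]_n -> \bar R) a : measurable_fun setT F ->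
  (forall v, 0 <= F v)%E -> (\int[L n]_v F (v + a)%R = \int[L n]_v F v)%E.
Proof.
have mD k (F0 : 'rV[R]_k -> \bar R) c : measurable_fun setT F0 ->
    measurable_fun setT (fun v : 'rV[R]_k => F0 (v + c)).
  by move=> mF0; apply: (measurableT_comp mF0); exact: measurable_rVD.
elim: n F a => [F a mF F0|n IH F a mF F0].
  by rewrite !ge0_int_rV0//; [congr F; exact: thinmx0|exact: mD].
have [x0 [v0 ->]] := cons_rV_surj a.
rewrite ge0_int_rVS//; last exact: mD.
rewrite [RHS]ge0_int_rVS//.
have mFc (x : R) : measurable_fun setT (fun v : 'rV[R]_n => F (cons_rV (x, v))).
  apply: (measurableT_comp mF); apply: (measurableT_comp (@measurable_cons_rV R n)).
  by apply: measurable_pair_comp.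
transitivity (\int[leb]_x \int[L n]_v F (cons_rV ((x + x0)%R, v)))%E.
  apply: eq_integral => x _; rewrite -[RHS](IH _ v0)//.
  by apply: eq_integral => v _; rewrite cons_rVD.
apply: (@ge0_int_shift R (fun x => \int[L n]_v F (cons_rV (x, v)))%E x0).
  apply: (@measurable_fun_fubini_tonelli_F _ _ _ _ _ (L n) (F \o @cons_rV R n)).
    exact: measurableT_comp mF (@measurable_cons_rV R n).
  by move=> p; exact: F0.
by move=> x; apply: integral_ge0 => v _; exact: F0.
Qed.

Lemma ge0_int_rVN n (F : 'rV[R]_n -> \bar R) : measurable_fun setT F ->
  (forall v, 0 <= F v)%E -> (\int[L n]_v F (- v)%R = \int[L n]_v F v)%E.
Proof.
have mN k (F0 : 'rV[R]_k -> \bar R) : measurable_fun setT F0 ->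
    measurable_fun setT (fun v : 'rV[R]_k => F0 (- v)).
  by move=> mF0; apply: (measurableT_comp mF0); exact: measurable_rVN.
elim: n F => [F mF F0|n IH F mF F0].
  by rewrite !ge0_int_rV0//; [congr F; exact: thinmx0|exact: mN].
rewrite ge0_int_rVS//; last exact: mN.
rewrite [RHS]ge0_int_rVS//.
have mFc (x : R) : measurable_fun setT (fun v : 'rV[R]_n => F (cons_rV (x, v))).
  apply: (measurableT_comp mF); apply: (measurableT_comp (@measurable_cons_rV R n)).
  by apply: measurable_pair_comp.
transitivity (\int[leb]_x \int[L n]_v F (cons_rV ((- x)%R, v)))%E.
  apply: eq_integral => x _; rewrite -[RHS]IH//.
  by apply: eq_integral => v _; rewrite cons_rVN.
apply: (@ge0_int_opp R (fun x => \int[L n]_v F (cons_rV (x, v)))%E).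
  apply: (@measurable_fun_fubini_tonelli_F _ _ _ _ _ (L n) (F \o @cons_rV R n)).
    exact: measurableT_comp mF (@measurable_cons_rV R n).
  by move=> p; exact: F0.
by move=> x; apply: integral_ge0 => v _; exact: F0.
Qed.

Lemma ge0_int_rV_refl n (F : 'rV[R]_n -> \bar R) a : measurable_fun setT F ->
  (forall v, 0 <= F v)%E -> (\int[L n]_v F (a - v)%R = \int[L n]_v F v)%E.
Proof.
move=> mF F0; have mF1 : measurable_fun setT (fun v : 'rV[R]_n => F (v + a)).
  by apply: (measurableT_comp mF); exact: measurable_rVD.
rewrite -(ge0_int_rVD a mF F0) -(ge0_int_rVN mF1)//.
by apply: eq_integral => v _; rewrite addrC.
Qed.

End space.

(** * The heat kernel and its Fourier transform *)

Section heat_kernel.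
Variable R : realType.
Local Notation leb := (@lebesgue_measure R).
Local Notation L n := (lebesgue_rV R n).

Lemma measurable_sqnorm n : measurable_fun setT (@sqnorm R n).
Proof. exact: measurable_dotv. Qed.

Lemma sqnorm_ge0 n (x : 'rV[R]_n) : 0 <= sqnorm x.
Proof. by apply: sumr_ge0 => i _; rewrite -expr2 sqr_ge0. Qed.

Lemma dotv_cons n (x y : R) (v w : 'rV[R]_n) :
  dotv (cons_rV (x, v)) (cons_rV (y, w)) = x * y + dotv v w.
Proof.
rewrite /dotv (@big_split_ord _ _ _ 1 n) /= big_ord1.
rewrite (cons_rVl (x, v)) (cons_rVl (y, w)); congr (_ + _).
by apply: eq_bigr => i _; rewrite (cons_rVr (x, v)) (cons_rVr (y, w)).
Qed.

Lemma sqnorm_cons n (x : R) (v : 'rV[R]_n) :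
  sqnorm (cons_rV (x, v)) = x ^+ 2 + sqnorm v.
Proof. by rewrite /sqnorm dotv_cons expr2. Qed.

Lemma dotvC n (x y : 'rV[R]_n) : dotv x y = dotv y x.
Proof. by apply: eq_bigr => i _; rewrite mulrC. Qed.

Lemma dotvDr n (x y z : 'rV[R]_n) : dotv x (y + z) = dotv x y + dotv x z.
Proof. by rewrite /dotv -big_split; apply: eq_bigr => i _; rewrite mxE mulrDr. Qed.

Lemma dotvNr n (x y : 'rV[R]_n) : dotv x (- y) = - dotv x y.
Proof. by rewrite /dotv -sumrN; apply: eq_bigr => i _; rewrite mxE mulrN. Qed.

Lemma dotvBr n (x y z : 'rV[R]_n) : dotv x (y - z) = dotv x y - dotv x z.
Proof. by rewrite dotvDr dotvNr. Qed.

Lemma sqnormN n (x : 'rV[R]_n) : sqnorm (- x) = sqnorm x.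
Proof. by rewrite /sqnorm dotvNr dotvC dotvNr opprK. Qed.

Lemma sqnormD_le n (x y : 'rV[R]_n) : sqnorm (x + y) <= 2 * sqnorm x + 2 * sqnorm y.
Proof.
rewrite /sqnorm /dotv !mulr_sumr -big_split; apply: ler_sum => i _ /=.
by rewrite !mxE; have := sqr_ge0 (x ord0 i - y ord0 i); rewrite expr2; nra.
Qed.

Lemma heat_kernel_ge0 n t (x : 'rV[R]_n) : 0 <= heat_kernel t x.
Proof. by rewrite /heat_kernel mulr_ge0 ?powR_ge0 ?expR_ge0. Qed.

Lemma measurable_heat_kernel n t : measurable_fun setT (@heat_kernel R n t).
Proof.
rewrite /heat_kernel; apply: measurable_funM => //.
apply: measurableT_comp; first exact: measurable_expR.
apply: measurable_funN; apply: measurable_funM => //; exact: measurable_sqnorm.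
Qed.

Definition gauss t (x : R) : R := normal_pdf 0 (Num.sqrt t) x.

Lemma gaussE t x : 0 < t ->
  gauss t x = (2 * pi * t) `^ (- 2^-1) * expR (- (x ^+ 2 / (2 * t))).
Proof.
move=> t0; rewrite /gauss normal_pdfE ?gt_eqF ?sqrtr_gt0//.
rewrite /normal_peak /normal_fun sqr_sqrtr ?ltW// subr0.
rewrite powRN powR12_sqrt ?mulr_ge0 ?pi_ge0 ?ltW//.
rewrite -[t * pi *+ 2]mulr_natl -[t *+ 2]mulr_natl mulNr; congr (_^-1 * _).
by congr Num.sqrt; ring.
Qed.

Lemma heat_kernel_cons n t (x : R) (v : 'rV[R]_n) : 0 < t ->
  heat_kernel t (cons_rV (x, v)) = gauss t x * heat_kernel t v.
Proof.
move=> t0; rewrite gaussE// /heat_kernel sqnorm_cons.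
have pt : 2 * pi * t != 0 :> R by rewrite !mulf_neq0 ?gt_eqF ?pi_gt0.
rewrite (_ : - (n.+1%:R / 2) = - 2^-1 + - (n%:R / 2)); last by rewrite -natr1; field.
rewrite powRD ?pt ?implybT// mulrACA -expRD; congr (_ * expR _).
by rewrite mulrDl opprD.
Qed.

Lemma heat_kernel0 t : heat_kernel t (0 : 'rV[R]_0) = 1.
Proof.
by rewrite /heat_kernel mul0r oppr0 powRr0 mul1r /sqnorm /dotv big_ord0 mul0r oppr0 expR0.
Qed.

Lemma int_heat_kernel n t : 0 < t -> (\int[L n]_x (heat_kernel t x)%:E = 1)%E.
Proof.
move=> t0; elim: n => [|n IH].
  rewrite ge0_int_rV0; first by rewrite heat_kernel0.
    apply/measurable_EFinP; exact: measurable_heat_kernel.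
  by move=> v; rewrite lee_fin heat_kernel_ge0.
rewrite ge0_int_rVS; last 2 first.
- by apply/measurable_EFinP; exact: measurable_heat_kernel.
- by move=> v; rewrite lee_fin heat_kernel_ge0.
transitivity (\int[leb]_x (gauss t x)%:E)%E.
  apply: eq_integral => x _; under eq_integral do rewrite heat_kernel_cons// EFinM.
  rewrite ge0_integralZl ?IH ?mule1//.
  - by apply/measurable_EFinP; exact: measurable_heat_kernel.
  - by move=> v _; rewrite lee_fin heat_kernel_ge0.
  - by rewrite lee_fin normal_pdf_ge0.
by rewrite integral_normal_pdf.
Qed.

Lemma heat_kernel_integrable n t : 0 < t ->
  (L n).-integrable setT (EFin \o @heat_kernel R n t).
Proof.
move=> t0; apply: integrable_ge0; [exact: measurable_heat_kernel|exact: heat_kernel_ge0|].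
by rewrite int_heat_kernel// ltry.
Qed.

End heat_kernel.

Section gauss_fourier.
Variable R : realType.
Local Notation leb := (@lebesgue_measure R).
Local Notation L n := (lebesgue_rV R n).
Variable t : R.
Hypothesis t0 : 0 < t.

Local Notation g := (gauss t).
Implicit Types (x xi th : R).

Let g_ge0 x : 0 <= g x. Proof. exact: normal_pdf_ge0. Qed.

Lemma measurable_gauss s : measurable_fun setT (@gauss R s).
Proof. exact: measurable_normal_pdf. Qed.

Lemma gauss_integrable s : leb.-integrable setT (EFin \o @gauss R s).
Proof. exact: integrable_normal_pdf. Qed.

Let gauss_x_le : exists C, forall x, `|x| * g x <= C * gauss (2 * t) x.
Proof.
pose k s : R := (2 * pi * s) `^ (- 2^-1).
have t20 : 0 < 2 * t by rewrite mulr_gt0.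
have k0 s : 0 < s -> 0 < k s by move=> s0; rewrite powR_gt0// !mulr_gt0// pi_gt0.
exists ((1 + 4 * t) * k t / k (2 * t)) => x.
rewrite !gaussE// -/(k t) -/(k (2 * t)).
set y := x ^+ 2 / (2 * (2 * t)).
have y0 : 0 <= y by rewrite divr_ge0 ?sqr_ge0 ?mulr_ge0 ?ltW.
have xy : x ^+ 2 = 4 * t * y by rewrite /y; field; rewrite gt_eqF.
have -> : - (x ^+ 2 / (2 * t)) = - y + - y by rewrite /y; field; rewrite gt_eqF.
rewrite (_ : (1 + 4 * t) * k t / k (2 * t) * (k (2 * t) * expR (- y)) =
  (1 + 4 * t) * k t * expR (- y)); last by field; rewrite gt_eqF// k0.
rewrite expRD; set E := expR (- y).
have E0 : 0 <= E by exact: expR_ge0.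
suff xE : `|x| * E <= 1 + 4 * t.
  rewrite (_ : `|x| * (k t * (E * E)) = k t * E * (`|x| * E)); last by ring.
  rewrite (_ : (1 + 4 * t) * k t * E = k t * E * (1 + 4 * t)); last by ring.
  by rewrite ler_wpM2l// mulr_ge0// ltW// k0.
rewrite -ler_pdivlMr ?expR_gt0// /E expRN invrK.
apply: (@le_trans _ _ ((1 + 4 * t) * (1 + y))).
  have hx : `|x| <= 1 + 4 * t * y.
    rewrite -xy -real_normK ?num_real//; have := sqr_ge0 (`|x| - 1).
    by have := normr_ge0 x; nra.
  rewrite (_ : (1 + 4 * t) * (1 + y) = 1 + 4 * t * y + (4 * t + y)); last by ring.
  by rewrite (le_trans hx)// lerDl addr_ge0// mulr_ge0// ltW.
by rewrite ler_wpM2l ?expR_ge1Dx// addr_ge0// mulr_ge0// ltW.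
Qed.

Let mx_gauss_integrable : leb.-integrable setT (EFin \o (fun x => `|x| * g x)).
Proof.
have [C hC] := gauss_x_le.
apply: (@dom_integrable _ _ _ leb _ (fun x => C * gauss (2 * t) x)).
- by apply: measurable_funM; [exact: normr_measurable|exact: measurable_gauss].
- by move=> x; rewrite ger0_norm ?mulr_ge0.
- exact: Rint_integrableZ (gauss_integrable _).
Qed.

Let is_derive_g x : is_derive x 1 g (- (x / t) * g x).
Proof.
have -> : g = (fun x => (2 * pi * t) `^ (- 2^-1) * expR (- (x ^+ 2 / (2 * t)))).
  by apply/funext => y; rewrite gaussE.
apply: is_derive_eq; rewrite /GRing.scale/=.
by field; rewrite gt_eqF.
Qed.

Let continuous_g : continuous g.
Proof. by apply: continuous_normal_pdf; rewrite gt_eqF// sqrtr_gt0. Qed.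

Let mcos xi th : measurable_fun setT (fun x : R => cos (xi * x + th)).
Proof.
apply: (measurableT_comp (continuous_measurable_fun (@continuous_cos R))).
by apply: measurable_funD => //; exact: measurable_funM.
Qed.

Let msin xi th : measurable_fun setT (fun x : R => sin (xi * x + th)).
Proof.
apply: (measurableT_comp (continuous_measurable_fun (@continuous_sin R))).
by apply: measurable_funD => //; exact: measurable_funM.
Qed.

Let cosg_integrable xi th : leb.-integrable setT (EFin \o (fun x => cos (xi * x + th) * g x)).
Proof.
apply: (@dom_integrable _ _ _ leb _ g); last exact: gauss_integrable.
- exact: measurable_funM (mcos xi th) (measurable_gauss t).
- by move=> x; rewrite normrM (ger0_norm (g_ge0 x)) ler_piMl// cos_max.
Qed.

Let xsing_integrable xi th :
  leb.-integrable setT (EFin \o (fun x => x * sin (xi * x + th) * g x)).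
Proof.
apply: (@dom_integrable _ _ _ leb _ (fun x => `|x| * g x)) => //.
- have m1 : measurable_fun setT (fun x : R => x * sin (xi * x + th)).
    by apply: measurable_funM => //; exact: msin.
  exact: measurable_funM m1 (measurable_gauss t).
- move=> x; rewrite !normrM (ger0_norm (g_ge0 x)) ler_wpM2r// ler_piMr//.
  exact: sin_max.
Qed.

(* integration by parts: the derivative of sin (xi x + th) g(x) has integral 0 *)
Let gauss_parts xi th :
  \int[leb]_x (x * sin (xi * x + th) * g x) =
  t * xi * \int[leb]_x (cos (xi * x + th) * g x).
Proof.
pose F x := sin (xi * x + th) * g x.
pose f x := xi * (cos (xi * x + th) * g x) - t^-1 * (x * sin (xi * x + th) * g x).
have dF x : is_derive x 1 F (f x).
  have h1 := is_derive_g x.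
  have h2 : is_derive x 1 (fun x => sin (xi * x + th)) (xi * cos (xi * x + th)).
    have h3 : is_derive x 1 (fun x : R => xi * x + th) xi.
      apply: is_derive_eq; by rewrite /GRing.scale/=; ring.
    have h4 : is_derive (xi * x + th) 1 sin (cos (xi * x + th)) by exact: is_derive_sin.
    have := @is_derive1_comp _ sin (fun x : R => xi * x + th) x _ _ h4 h3.
    by rewrite mulrC.
  have [d1 d2] : is_derive x 1 F _ := is_deriveM h2 h1.
  split; first exact: d1.
  by rewrite d2 /f /GRing.scale/=; field; rewrite gt_eqF.
have fi : leb.-integrable setT (EFin \o f).
  by apply: Rint_integrableB; apply: Rint_integrableZ.
have cF x : {for x, continuous F}.
  by have [dl _] := dF x; exact/differentiable_continuous/derivable1_diffP.
have cf x : {for x, continuous f}.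
  have cl : continuous (fun x : R => xi * x + th).
    by move=> y; apply: cvgD; [apply: cvgMr; exact: cvg_id|exact: cvg_cst].
  apply: cvgB; apply: cvgMr; apply: cvgM; try exact: continuous_g.
    by apply: (@cvg_comp _ _ _ (fun x : R => xi * x + th) cos _ _ _ (cl x)); exact: continuous_cos.
  apply: cvgM; first exact: cvg_id.
  by apply: (@cvg_comp _ _ _ (fun x : R => xi * x + th) sin _ _ _ (cl x)); exact: continuous_sin.
have If : \int[leb]_x f x = 0.
  pose fn (n : nat) x := (- n.+1%:R <= x <= n.+1%:R)%R%:R * f x.
  have mf := integrable_measurable fi.
  have [|||||_ c1] := @Rint_cvg _ _ R leb fn f (fun x => `|f x|).
  - by move=> n; apply: measurable_funM => //; exact: measurable_itvb.
  - exact: mf.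
  - apply: aeW => x; apply/cvgrPdist_lt => e e0; near=> n.
    have xn : `|x| <= n.+1%:R.
      by near: n; apply: filterS (nbhs_infty_ger `|x|) => n /le_trans; apply; rewrite ler_nat.
    by rewrite /fn -ler_norml xn mul1r subrr normr0.
  - exact: integrable_norm.
  - move=> n x; rewrite /fn normrM; by case: (_ && _); rewrite ?normr1 ?normr0 ?mul1r ?mul0r.
  have [C hC] := gauss_x_le.
  pose K := C * normal_peak (Num.sqrt (2 * t)).
  have gK x : `|x| * g x <= `|K|.
    have t20 : Num.sqrt (2 * t) != 0 by rewrite gt_eqF// sqrtr_gt0 mulr_gt0.
    have g20 : 0 <= gauss (2 * t) x by exact: normal_pdf_ge0.
    apply: le_trans (hC x) _; rewrite /K normrM.
    apply: (@le_trans _ _ (`|C| * gauss (2 * t) x)).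
      by rewrite ler_wpM2r// ler_norm.
    by apply: ler_wpM2l => //; apply: le_trans (normal_pdf_ub 0 x t20) (ler_norm _).
  have c2 : \int[leb]_x fn n x @[n --> \oo] --> 0.
    apply/cvgrPdist_le => e e0.
    have cK : `|K| * 2 * n.+1%:R^-1 @[n --> \oo] --> (0 : R).
      by rewrite -(mulr0 (`|K| * 2)); apply: cvgMr; exact: cvg_harmonic.
    move/cvgrPdist_le : cK => /(_ e e0); apply: filterS => n.
    rewrite !sub0r !normrN => hn.
    have n0 : (0 : R) < n.+1%:R by [].
    have nn : - n.+1%:R < n.+1%:R :> R by rewrite gtrN.
    have -> : \int[leb]_x fn n x = F n.+1%:R - F (- n.+1%:R).
      rewrite /Rintegral -(@int_mkcond R `[- n.+1%:R, n.+1%:R]%classic); last first.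
        by move=> ?; rewrite /= in_itv.
      rewrite (@continuous_FTC2 _ f F _ _ nn)//.
      + by apply: continuous_subspaceT => u; exact: cf.
      + split => [u _| |].
        * by have [] := dF u.
        * by apply: cvg_at_right_filter; exact: cF.
        * by apply: cvg_at_left_filter; exact: cF.
      + by move=> u _; rewrite derive1E; have [_ ->] := dF u.
    have FK z : `|F z| * `|z| <= `|K|.
      rewrite /F normrM (ger0_norm (g_ge0 z)) mulrC mulrCA (le_trans _ (gK z))//.
      by rewrite ler_piMl ?mulr_ge0// sin_max.
    apply: le_trans (ler_normB _ _) _; apply: le_trans hn.
    rewrite [leRHS]ger0_norm ?mulr_ge0 ?invr_ge0//.
    have h1 := FK n.+1%:R; have h2 := FK (- n.+1%:R).
    rewrite normrN (ger0_norm (ltW n0)) in h1 h2.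
    rewrite -!ler_pdivlMr// in h1 h2.
    by rewrite mulrAC (_ : forall a : R, a * 2 = a + a) ?lerD// => a; ring.
  exact: (cvg_unique _ c1 c2).
move: If; rewrite RintegralB//; last 2 first.
- exact: Rint_integrableZ.
- exact: Rint_integrableZ.
rewrite RintegralZl// RintegralZl// => /eqP; rewrite subr_eq0 => /eqP e.
rewrite -mulrA e; field; rewrite gt_eqF//.
Unshelve. all: by end_near. Qed.

(** The function phi(xi) on the left has derivative - t xi phi(xi). *)
Lemma gauss_cos xi th :
  \int[leb]_x (cos (xi * x + th) * g x) = cos th * expR (- (t * xi ^+ 2 / 2)).
Proof.
pose f (z x : R) : R := cos (z * x + th) * g x.
pose phi z := \int[leb]_x f z x.
have dfz (z x : R) : is_derive z 1 (f ^~ x) (- (x * sin (z * x + th) * g x)).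
  have h3 : is_derive z 1 (fun z : R => z * x + th) x.
    by apply: is_derive_eq; rewrite /GRing.scale/= ; ring.
  have h4 : is_derive (z * x + th) 1 cos (- sin (z * x + th)) by exact: is_derive_cos.
  have h5 := @is_derive1_comp _ cos (fun z : R => z * x + th) z _ _ h4 h3.
  rewrite (_ : f ^~ x = fun z => g x *: cos (z * x + th)); last first.
    by apply/funext => y; rewrite /f mulrC.
  by apply: is_derive_eq; rewrite /GRing.scale/=; ring.
have dfE (z x : R) : partial1of2 f z x = - (x * sin (z * x + th) * g x).
  by rewrite partial1of2E; have [_ ->] := dfz z x.
have dphi (z : R) : is_derive z 1 phi (- t * z * phi z).
  have Iz : `](z - 1), (z + 1)[%classic z by rewrite /= in_itv/=; apply/andP; split; lra.
  have intf x : `](z - 1), (z + 1)[%classic x -> leb.-integrable setT (EFin \o f x).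
    by move=> _; exact: cosg_integrable.
  have G0 x : 0 <= `|x| * g x by rewrite mulr_ge0.
  have bd z' x : `](z - 1), (z + 1)[%classic z' -> setT x -> `|partial1of2 f z' x| <= `|x| * g x.
    move=> _ _; rewrite dfE normrN !normrM (ger0_norm (g_ge0 x)) ler_wpM2r//.
    by rewrite ler_piMr// sin_max.
  have dd z' x : `](z - 1), (z + 1)[%classic z' -> setT x -> derivable (f ^~ x) z' 1.
    by move=> _ _; have [] := dfz z' x.
  split.
    exact: (derivable_under_integral measurableT Iz intf dd G0 mx_gauss_integrable bd).
  rewrite -derive1E.
  rewrite (differentiation_under_integral measurableT Iz intf dd G0 mx_gauss_integrable bd).
  transitivity (\int[leb]_x (-1 * (x * sin (z * x + th) * g x))).
    by apply: eq_Rintegral => x _; rewrite dfE mulN1r.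
  by rewrite RintegralZl// gauss_parts /phi /f; ring.
pose psi z := phi z * expR (t * z ^+ 2 / 2).
have dpsi (z : R) : is_derive z 1 psi 0.
  have h1 := dphi z.
  have h2 : is_derive z 1 (fun z : R => expR (t * z ^+ 2 / 2)) (t * z * expR (t * z ^+ 2 / 2)).
    by apply: is_derive_eq; rewrite /GRing.scale/=; field.
  have [d1 d2] : is_derive z 1 psi _ := is_deriveM h1 h2.
  split; first exact: d1.
  by rewrite d2 /GRing.scale/=; ring.
have := is_derive_0_is_cst xi 0 dpsi; rewrite /psi.
rewrite expr0n/= mulr0 mul0r expR0 mulr1.
have -> : phi 0 = cos th.
  rewrite /phi /f; transitivity (\int[leb]_x (cos th * g x)).
    by apply: eq_Rintegral => x _; rewrite mul0r add0r.
  rewrite RintegralZl//; last exact: gauss_integrable.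
  by rewrite /Rintegral integral_normal_pdf mulr1.
by move=> <-; rewrite -[RHS]mulrA -expRD subrr expR0 mulr1.
Qed.

End gauss_fourier.

(** * Spatial Fourier transforms in real form *)

Section ftr.
Variables (R : realType).
Local Notation leb := (@lebesgue_measure R).
Local Notation L n := (lebesgue_rV R n).

Lemma Rint_rV_refl n (F : 'rV[R]_n -> R) a : measurable_fun setT F ->
  \int[L n]_v F (a - v) = \int[L n]_v F v.
Proof.
move=> mF; have mE : measurable_fun setT (EFin \o F) by exact/measurable_EFinP.
rewrite /Rintegral [in LHS]integralE [in RHS]integralE; congr (fine (_ - _)).
- rewrite -(@ge0_int_rV_refl R n (EFin \o F)^\+ a)%E//; last exact: measurable_funepos.
  by apply: eq_integral => v _; rewrite !funeposE.
- rewrite -(@ge0_int_rV_refl R n (EFin \o F)^\- a)%E//; last exact: measurable_funeneg.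
  by apply: eq_integral => v _; rewrite !funenegE.
Qed.

Lemma Rint_rVS n (F : 'rV[R]_n.+1 -> R) : (L n.+1).-integrable setT (EFin \o F) ->
  \int[L n.+1]_v F v = \int[prodm leb (L n)]_p F (cons_rV p).
Proof.
move=> Fi; have mF := measurable_int _ Fi.
rewrite /Rintegral; congr fine.
apply: (@integral_pushforward _ _ _ _ R _ (@measurable_cons_rV R n) (prodm leb (L n)) setT (EFin \o F)) => //.
apply/integrableP; split; first exact: measurableT_comp mF (@measurable_cons_rV R n).
have /integrableP[_] := Fi; apply: le_lt_trans.
have mA : measurable_fun setT (fun v => `|(F v)%:E|)%E by exact: measurableT_comp.
by rewrite [leRHS](@ge0_integral_pushforward _ _ _ _ R _ (@measurable_cons_rV R n) (prodm leb (L n)) setT (fun v => `|(F v)%:E|)%E).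
Qed.

Lemma measurable_cos_comp d (T : measurableType d) (f : T -> R) :
  measurable_fun setT f -> measurable_fun setT (fun x => cos (f x)).
Proof. exact: measurableT_comp (continuous_measurable_fun (@continuous_cos R)). Qed.

Lemma measurable_cos_dotv n (xi : 'rV[R]_n) th :
  measurable_fun setT (fun x : 'rV[R]_n => cos (dotv xi x + th)).
Proof.
by apply: measurable_cos_comp; apply: measurable_funD => //; exact: measurable_dotv.
Qed.

Lemma cos_integrable n (xi : 'rV[R]_n) th (m : {measure set 'rV[R]_n -> \bar R}) (phi : 'rV[R]_n -> R) :
  m.-integrable setT (EFin \o phi) ->
  m.-integrable setT (EFin \o (fun x => cos (dotv xi x + th) * phi x)).
Proof.
move=> pi; apply: (@dom_integrable _ _ _ m _ (fun x => `|phi x|)).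
- by apply: measurable_funM; [exact: measurable_cos_dotv|exact: integrable_measurable pi].
- by move=> x; rewrite normrM ler_piMl// cos_max.
- exact: integrable_norm.
Qed.

Lemma heat_kernel_cos n t (xi : 'rV[R]_n) th : 0 < t ->
  \int[L n]_x (cos (dotv xi x + th) * heat_kernel t x) =
  cos th * expR (- (t * sqnorm xi / 2)).
Proof.
move=> t0; elim: n xi th => [|n IH] xi th.
  have -> : xi = 0 by exact: thinmx0.
  have d0 (x : 'rV[R]_0) : dotv x x = 0 by rewrite /dotv big_ord0.
  rewrite /sqnorm d0 mulr0 mul0r oppr0 expR0.
  transitivity (\int[L 0]_x (cos th * heat_kernel t x)).
    apply: eq_Rintegral => x _; congr (cos _ * _).
    by rewrite /dotv big_ord0 add0r.
  rewrite RintegralZl//; last exact: heat_kernel_integrable.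
  by rewrite /Rintegral int_heat_kernel.
have [x0 [v0 ->]] := cons_rV_surj xi.
rewrite Rint_rVS; last by apply: cos_integrable; exact: heat_kernel_integrable.
have mF : measurable_fun setT (fun p : measurableTypeR R * 'rV[R]_n =>
    cos (dotv (cons_rV (x0, v0)) (cons_rV p) + th) * heat_kernel t (cons_rV p)).
  apply: (measurableT_comp (f := fun x => cos (dotv (cons_rV (x0, v0)) x + th) * heat_kernel t x)).
    by apply: measurable_funM; [exact: measurable_cos_dotv|exact: measurable_heat_kernel].
  exact: measurable_cons_rV.
have hF (x : measurableTypeR R) v :
    `|cos (dotv (cons_rV (x0, v0)) (cons_rV (x, v)) + th) * heat_kernel t (cons_rV (x, v))|
    <= gauss t x * heat_kernel t v.
  rewrite heat_kernel_cons// normrM [X in _ * X]ger0_norm; last first.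
    by rewrite mulr_ge0 ?heat_kernel_ge0// normal_pdf_ge0.
  by rewrite ler_piMl ?cos_max// mulr_ge0 ?heat_kernel_ge0// normal_pdf_ge0.
have [_ <- _] := @Rint_swap _ _ _ _ _ leb (L n) _ (gauss t) (@heat_kernel R n t) mF
  hF (gauss_integrable t) (heat_kernel_integrable n t0).
transitivity (\int[leb]_x (expR (- (t * sqnorm v0 / 2)) * (cos (x0 * x + th) * gauss t x))).
  apply: eq_Rintegral => x _.
  transitivity (\int[L n]_v (gauss t x * (cos (dotv v0 v + (x0 * x + th)) * heat_kernel t v))).
    apply: eq_Rintegral => v _; rewrite heat_kernel_cons// dotv_cons.
    by rewrite (_ : x0 * x + dotv v0 v + th = dotv v0 v + (x0 * x + th)); ring.
  rewrite RintegralZl//; last by apply: cos_integrable; exact: heat_kernel_integrable.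
  by rewrite IH; ring.
rewrite RintegralZl//; last first.
  apply: (@dom_integrable _ _ _ leb _ (gauss t)); last exact: gauss_integrable.
    apply: measurable_funM; last exact: measurable_gauss.
    by apply: measurable_cos_comp; apply: measurable_funD => //; exact: measurable_funM.
  move=> x; rewrite normrM [X in _ * X]ger0_norm ?normal_pdf_ge0//.
  by rewrite ler_piMl ?cos_max// normal_pdf_ge0.
rewrite gauss_cos// mulrCA -expRD sqnorm_cons; congr (_ * expR _); ring.
Qed.

(** The transform against cos (xi . x + th); the phases th = 0 and th = - pi / 2
    give the real part, and minus the imaginary part, of the Fourier transform. *)
Definition ftr n (th : R) (phi : 'rV[R]_n -> R) (xi : 'rV[R]_n) : R :=
  \int[L n]_x (cos (dotv xi x + th) * phi x).

Definition sin_phase : R := - (pi / 2).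

Lemma ftr_heat_kernel n t (a : 'rV[R]_n) th xi : 0 < t ->
  ftr th (fun y => heat_kernel t (a - y)) xi =
  cos (dotv xi a + th) * expR (- (t * sqnorm xi / 2)).
Proof.
move=> t0; have -> : expR (- (t * sqnorm xi / 2)) = expR (- (t * sqnorm (- xi) / 2)).
  by rewrite sqnormN.
rewrite -heat_kernel_cos//.
rewrite -(@Rint_rV_refl _ _ a); last first.
  by apply: measurable_funM; [exact: measurable_cos_dotv|exact: measurable_heat_kernel].
apply: eq_Rintegral => y _; congr (cos _ * _).
have -> : dotv (- xi) (a - y) = dotv xi y - dotv xi a.
  by rewrite dotvC dotvNr dotvC dotvBr opprB.
ring.
Qed.

Section ftr_theory.
Variable n : nat.
Implicit Types (phi psi : 'rV[R]_n -> R) (xi : 'rV[R]_n).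

Lemma measurable_ftr th phi : measurable_fun setT phi -> measurable_fun setT (ftr th phi).
Proof.
move=> mphi; apply: (@measurable_Rint2 _ _ _ _ R (L n)
  (fun p => cos (dotv p.1 p.2 + th) * phi p.2)).
apply: measurable_funM; last exact: measurableT_comp mphi measurable_snd.
apply: measurable_cos_comp; apply: measurable_funD => //; exact: measurable_dotv.
Qed.

Lemma ftr_le th phi xi : (L n).-integrable setT (EFin \o phi) ->
  `|ftr th phi xi| <= \int[L n]_x `|phi x|.
Proof.
move=> ip; apply: le_trans (le_normr_Rintegral measurableT _) _.
  exact: cos_integrable.
apply: le_Rintegral => //.
- by apply: integrable_norm => //; exact: cos_integrable.
- exact: integrable_norm.
- by move=> x _; rewrite normrM ler_piMl// cos_max.
Qed.

Lemma ftrB th phi psi xi : (L n).-integrable setT (EFin \o phi) ->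
  (L n).-integrable setT (EFin \o psi) ->
  ftr th (fun x => phi x - psi x) xi = ftr th phi xi - ftr th psi xi.
Proof.
move=> ip ips; rewrite /ftr -RintegralB//; try exact: cos_integrable.
by apply: eq_Rintegral => x _; ring.
Qed.

Lemma ftrZ th c phi xi : (L n).-integrable setT (EFin \o phi) ->
  ftr th (fun x => c * phi x) xi = c * ftr th phi xi.
Proof.
move=> ip; rewrite /ftr -RintegralZl//; last exact: cos_integrable.
by apply: eq_Rintegral => x _; ring.
Qed.

Lemma ftr_sum (I : Type) (r : seq I) th (phi : I -> 'rV[R]_n -> R) xi :
  (forall i, (L n).-integrable setT (EFin \o phi i)) ->
  ftr th (fun x => \sum_(i <- r) phi i x) xi = \sum_(i <- r) ftr th (phi i) xi.
Proof.
move=> ip; elim: r => [|i r IH].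
  rewrite big_nil /ftr /Rintegral integral0_eq// => x _.
  by rewrite big_nil mulr0.
have si : (L n).-integrable setT (EFin \o (fun x => \sum_(j <- r) phi j x)).
  have := @integrable_sum _ _ R (L n) setT measurableT I r xpredT (fun i => EFin \o phi i) (fun i => fun=> ip i).
  by apply: eq_integrable => // x _ /=; rewrite sumEFin.
rewrite big_cons -IH /ftr -RintegralD//; try exact: cos_integrable.
by apply: eq_Rintegral => x _; rewrite big_cons mulrDr.
Qed.

Lemma ftr_cvg th (phi_ : nat -> 'rV[R]_n -> R) phi psi xi :
  (forall k, measurable_fun setT (phi_ k)) -> measurable_fun setT phi ->
  (forall x, phi_ k x @[k --> \oo] --> phi x) ->
  (L n).-integrable setT (EFin \o psi) -> (forall k x, `|phi_ k x| <= psi x) ->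
  ftr th (phi_ k) xi @[k --> \oo] --> ftr th phi xi.
Proof.
move=> mp_ mp cp ipsi pp.
have mc := measurable_cos_dotv xi th.
have [|||||_] := @Rint_cvg _ _ R (L n) (fun k x => cos (dotv xi x + th) * phi_ k x)
  (fun x => cos (dotv xi x + th) * phi x) psi => //.
- by move=> k; exact: measurable_funM.
- exact: measurable_funM.
- by apply: aeW => x; apply: cvgMr; exact: cp.
- move=> k x; rewrite normrM; apply: le_trans (pp k x).
  by rewrite ler_piMl// cos_max.
Qed.

Lemma Re_fourier phi xi : complex.Re (fourier (fun x => (phi x)%:C%C) xi) = ftr 0 phi xi.
Proof.
rewrite /fourier /cintegral /ftr /=; apply: eq_Rintegral => x _ /=.
by rewrite cosN mulr0 subr0 addr0.
Qed.

Lemma Im_fourier phi xi : (L n).-integrable setT (EFin \o phi) ->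
  complex.Im (fourier (fun x => (phi x)%:C%C) xi) = - ftr sin_phase phi xi.
Proof.
move=> ip; rewrite /fourier /cintegral /ftr /= -mulN1r -RintegralZl//; last exact: cos_integrable.
apply: eq_Rintegral => x _ /=.
by rewrite /sin_phase cosBpihalf sinN mulr0 add0r mulNr mulN1r.
Qed.

End ftr_theory.
End ftr.

(** * Continuity of translations *)

Section translations.
Variables (R : realType) (d : nat).
Local Notation Rd := 'rV[R]_d.
Local Notation L := (lebesgue_rV R d).

Lemma cvge0P (T : Type) (F : set_system T) (FF : Filter F) (h : T -> \bar R) :
  (forall x, (0 <= h x)%E) ->
  (h @ F --> 0%E) <-> (forall e : R, 0 < e -> \forall x \near F, (h x <= e%:E)%E).
Proof.
move=> h0; split=> [hF e e0|hF].
  have : nbhs (0%E : \bar R) [set y | (y < e%:E)%E].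
    by apply: open_ereal_lt'; rewrite lte_fin.
  move=> /hF hV; have {}hV : F [set x | (h x < e%:E)%E] by exact: hV.
  by apply: filterS hV => x /= /ltW.
move=> V /= V0; have : nbhs (0 : R) (fun r => V r%:E) by exact: V0.
move=> /nbhs_ballP[e /= e0 eV].
have := hF (e / 2); rewrite divr_gt0// => /(_ isT).
apply: filterS => x; have := h0 x; rewrite /=; case: (h x) => [r| |]//.
rewrite !lee_fin => r0 re; apply: (eV r).
rewrite /ball/= sub0r normrN ger0_norm// (le_lt_trans re)//.
by rewrite ltr_pdivrMr// ltr_pMr// ltr1n.
Qed.

Lemma coord_le_norm (v : Rd) i : `|v ord0 i| <= `|v|.
Proof.
rewrite [leRHS]mx_normrE.
exact: (le_bigmax _ (fun j : 'I_1 * 'I_d => `|v j.1 j.2|) (ord0, i)).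
Qed.

Lemma bounded_set_norm (A : set Rd) : bounded_set A -> exists M : R, 0 < M /\
  forall v, A v -> `|v| <= M.
Proof.
move=> [M [_ hM]]; exists (Num.max M 0 + 1); split.
  by rewrite ltr_pwDr// le_max lexx orbT.
move=> v Av; apply: hM Av.
by rewrite (le_lt_trans (_ : _ <= Num.max M 0)) ?le_max ?lexx// ltrDl.
Qed.

Lemma bounded_setP (A : set Rd) : bounded_set A -> exists M : R, 0 < M /\
  forall v, A v -> forall i, `|v ord0 i| <= M.
Proof.
move=> /bounded_set_norm[M [M0 hM]]; exists M; split => // v Av i.
exact: le_trans (coord_le_norm _ _) (hM v Av).
Qed.

Lemma lebesgue_rV_bounded (A : set Rd) : measurable A -> bounded_set A -> (L A < +oo)%E.
Proof.
move=> mA /bounded_setP[M [M0 hM]].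
pose I (i : 'I_d) : set R := `[- M, M]%classic.
apply: (@le_lt_trans _ _ (L [set v : Rd | forall i, I i (v ord0 i)])).
  apply: le_measure; rewrite ?inE//.
    have -> : [set v : Rd | forall i, I i (v ord0 i)] = \bigcap_(i in [set: 'I_d])
        ((fun v : Rd => v ord0 i) @^-1` I i).
      by apply/seteqP; split => v /= h i; [move=> _|]; exact: h.
    apply: fin_bigcap_measurable => [|i _]; first exact: finite_finset.
    by rewrite -[X in measurable X]setTI; apply: measurable_coord => //; exact: measurable_itv.
  move=> v /hM h i; have := h i.
  by rewrite /I/= in_itv/= ler_norml.
rewrite lebesgue_rV_box; last by move=> i; exact: measurable_itv.
have -> : (\prod_(i < d) lebesgue_measure (I i) = (\prod_(i < d) (M + M))%:E)%E.
  have Ii i : lebesgue_measure (I i) = (M + M)%:E.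
    by rewrite /I lebesgue_measure_itv/= lte_fin gtrN// -EFinB opprK.
  by rewrite -prodEFin; apply: eq_bigr => i _; exact: Ii.
by rewrite ltry.
Qed.

Definition excess (B : set Rd) (w : Rd) : set Rd := [set x | B x /\ ~ B (x - w)].

Lemma measurable_shift (B : set Rd) w : measurable B -> measurable [set x | B (x - w)].
Proof.
move=> mB; have m1 : measurable_fun setT (fun x : Rd => x - w) by exact: measurable_rVB.
by have := m1 measurableT _ mB; rewrite setTI.
Qed.

Lemma measurable_excess B w : measurable B -> measurable (excess B w).
Proof.
move=> mB; have -> : excess B w = B `\` [set x | B (x - w)] by [].
by apply: measurableD => //; exact: measurable_shift.
Qed.

Lemma lebesgue_rV_shift (B : set Rd) w : measurable B -> L [set x | B (x + w)] = L B.
Proof.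
move=> mB.
have I A : measurable A -> (L A = \int[L]_x (\1_A x)%:E)%E.
  by move=> mA; rewrite integral_indic// setIT.
have mB' : measurable [set x | B (x + w)].
  have m1 : measurable_fun setT (fun x : Rd => x + w) by exact: measurable_rVD.
  by have := m1 measurableT _ mB; rewrite setTI.
rewrite !I// -[RHS](@ge0_int_rVD R d (fun x => (\1_B x)%:E) w)//.
exact/measurable_EFinP.
Qed.

Lemma excess_rev (B : set Rd) (w : Rd) : measurable B ->
  L [set x | ~ B x /\ B (x - w)] = L (excess B (- w)).
Proof.
move=> mB; rewrite -[RHS](lebesgue_rV_shift (- w)); last exact: measurable_excess.
by congr (L _); apply/seteqP; split => x /=; rewrite /excess/= opprK subrK => -[].
Qed.

Let stable (K : set Rd) (B : set Rd) := measurable B /\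
  forall w_ : nat -> Rd, w_ n @[n --> \oo] --> (0 : Rd) ->
    (L (excess (B `&` K) (w_ n)) @[n --> \oo] --> 0)%E.

Let stable_open (K : set Rd) (B : set Rd) : open K -> (L K < +oo)%E -> open B -> stable K B.
Proof.
move=> oK Koo oB; split; first exact: open_rV_measurable.
have oU : open (B `&` K) by exact: openI.
set U := B `&` K in oU *.
have mU : measurable U by exact: open_rV_measurable.
move=> w_ w0.
have Ui : L.-integrable setT (EFin \o (\1_U : Rd -> R)).
  apply: integrable_ge0; [exact: measurable_indic|by []|].
  rewrite integral_indic// setIT; apply: le_lt_trans Koo.
  apply: le_measure; rewrite ?inE; [exact: mU|exact: open_rV_measurable|].
  exact: subIsetr.
have E n : L (excess U (w_ n)) = (\int[L]_x (\1_(excess U (w_ n)) x)%:E)%E.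
  by rewrite integral_indic ?setIT//; exact: measurable_excess.
suff : (\int[L]_x (\1_(excess U (w_ n)) x)%:E @[n --> \oo] --> \int[L]_x (cst (0 : R) x)%:E)%E.
  by rewrite integral0; apply: cvg_trans; apply: near_eq_cvg; apply: nearW => n; rewrite E.
apply: (@ge0_int_cvg _ _ R L (fun n => \1_(excess U (w_ n))) (cst 0) (\1_U)) => //.
- by move=> n; apply: measurable_indic; exact: measurable_excess.
- apply: aeW => x; have [Ux|nUx] := pselect (U x); last first.
    apply: cvg_near_cst; apply: nearW => n; rewrite indicE memNset//.
    by move=> [].
  have cv : x - w_ n @[n --> \oo] --> x.
    by rewrite -[X in _ --> X]subr0; apply: cvgB => //; exact: cvg_cst.
  have nU : nbhs x U by exact: open_nbhs_nbhs.
  have hn : \forall n \near \oo, U (x - w_ n) by exact: (cv U nU).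
  apply: cvg_near_cst; apply: filterS hn => n Uxn.
  by rewrite indicE memNset// => -[].
- move=> n x; rewrite ger0_norm// !indicE ler_nat.
  by case: (boolP (x \in excess U (w_ n))) => // /set_mem[Ux _]; rewrite mem_set.
Qed.

Let stable_lambda (K : set Rd) : open K -> (L K < +oo)%E -> lambda_system setT (stable K).
Proof.
move=> oK Koo; have mK : measurable K by exact: open_rV_measurable.
have ex0 B w : (0 <= L (excess B w))%E by exact: measure_ge0.
split => //.
- by apply: stable_open => //; exact: openT.
- move=> A B BA [mA sA] [mB sB]; split; first exact: measurableD.
  move=> w_ w0; have w0' : - w_ n @[n --> \oo] --> (0 : Rd).
    by rewrite -oppr0; exact: cvgN.
  have mAK : measurable (A `&` K) by exact: measurableI.
  have mBK : measurable (B `&` K) by exact: measurableI.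
  apply: (@squeeze_cvge _ _ _ _ (cst 0%E) _ (fun n => L (excess (A `&` K) (w_ n)) +
      L (excess (B `&` K) (- w_ n)))%E); last 2 first.
  + exact: cvg_cst.
  + by rewrite -[X in _ --> X]adde0; apply: cvgeD => //; [exact: sA|exact: sB].
  apply: nearW => n; rewrite ex0/= -excess_rev//.
  have m1 : measurable (excess (A `&` K) (w_ n)) by exact: measurable_excess.
  have m2 : measurable [set x | ~ (B `&` K) x /\ (B `&` K) (x - w_ n)].
    rewrite (_ : [set x | _] = [set x | (B `&` K) (x - w_ n)] `\` (B `&` K)).
      by apply: measurableD => //; exact: measurable_shift.
    by apply/seteqP; split => x /= [].
  apply: le_trans (measureU2 _ m1 m2); apply: le_measure; rewrite ?inE.
  + by apply: measurable_excess; apply: measurableI => //; exact: measurableD.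
  + exact: measurableU.
  move=> x [[[Ax nBx] Kx] nx] /=.
  have [AKx|nAKx] := pselect ((A `&` K) (x - w_ n)); last by left.
  right; split; first by case.
  split; last by case: AKx.
  by apply: contrapT => nBxw; apply: nx; split; [split => //|]; case: AKx.
- move=> F ndF sF; have mF i : measurable (F i) by case: (sF i).
  have mUF : measurable (\bigcup_i F i) by exact: bigcup_measurable.
  split => // w_ w0; apply/cvge0P => // e e0.
  have ndFK : nondecreasing_seq (fun i => F i `&` K).
    by move=> m k mk; apply/subsetPset; apply: setSI; apply/subsetPset; exact: ndF.
  have cF : (L (F i `&` K) @[i --> \oo] --> L (\bigcup_i F i `&` K))%E.
    rewrite setI_bigcupl; apply: nondecreasing_cvg_mu => //.
      by move=> i; exact: measurableI.
    by apply: bigcup_measurable => i _; exact: measurableI.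
  have Ufin : L (\bigcup_i F i `&` K) \is a fin_num.
    rewrite ge0_fin_numE//; apply: le_lt_trans Koo.
    by apply: le_measure; rewrite ?inE//; exact: measurableI.
  have [i hi] : exists i, (L ((\bigcup_i F i `&` K) `\` (F i `&` K)) <= (e / 2)%:E)%E.
    have Fle i : (L (F i `&` K) <= L (\bigcup_i F i `&` K))%E.
      apply: le_measure; rewrite ?inE; [exact: measurableI|exact: measurableI|].
      by apply: setSI; exact: bigcup_sup.
    have hh i : (0 <= L (\bigcup_i F i `&` K) - L (F i `&` K))%E.
      by rewrite sube_ge0 ?Fle// Ufin orbT.
    have : (L (\bigcup_i F i `&` K) - L (F i `&` K) @[i --> \oo] --> 0)%E.
      rewrite -(subee Ufin); apply: cvgeB; [exact: fin_num_adde_defr|exact: cvg_cst|exact: cF].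
    move/(cvge0P _ hh) => /(_ (e / 2)); rewrite divr_gt0// => /(_ isT) [i _ hi].
    exists i; apply: le_trans (hi i (leqnn i)).
    have Fsub : F i `&` K `<=` \bigcup_i F i `&` K by apply: setSI; exact: bigcup_sup.
    rewrite measureD; [|exact: measurableI|exact: measurableI|by rewrite ltey_eq Ufin].
    by rewrite (_ : (\bigcup_i F i `&` K) `&` (F i `&` K) = F i `&` K)//; exact/setIidPr.
  have [_ /(_ _ w0) c0] := sF i.
  have e2 : 0 < e / 2 by rewrite divr_gt0.
  have hc : \forall n \near \oo, (L (excess (F i `&` K) (w_ n)) <= (e / 2)%:E)%E.
    by move: e2; move: (e / 2); apply/cvge0P.
  apply: filterS hc => n hn.
  have mFK : measurable (F i `&` K) by exact: measurableI.
  have m1 : measurable ((\bigcup_i F i `&` K) `\` (F i `&` K)).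
    by apply: measurableD => //; exact: measurableI.
  apply: (@le_trans _ _ (L ((\bigcup_i F i `&` K) `\` (F i `&` K)) + L (excess (F i `&` K) (w_ n)))%E).
    have m2 : measurable (excess (F i `&` K) (w_ n)) by exact: measurable_excess.
    apply: le_trans (measureU2 _ m1 m2); apply: le_measure; rewrite ?inE.
    + by apply: measurable_excess; exact: measurableI.
    + exact: measurableU.
    move=> x [UFx nUFx] /=; have [Fx|nFx] := pselect ((F i `&` K) x); last by left.
    right; split => // Fxw; apply: nUFx; case: Fxw => Fxw Kxw.
    by split => //; exists i.
  by rewrite (le_trans (leeD hi hn))// -EFinD -splitr.
Qed.

(** The sets for which this holds form a lambda-system inside any bounded open
    set, which contains the open sets by dominated convergence. *)
Lemma excess_cvg0 (B : set Rd) (w_ : nat -> Rd) : measurable B -> bounded_set B ->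
  w_ n @[n --> \oo] --> (0 : Rd) -> (L (excess B (w_ n)) @[n --> \oo] --> 0)%E.
Proof.
move=> mB bB w0; have [M [M0 hM]] := bounded_set_norm bB.
pose K : set Rd := ball (0 : Rd) (M + 1).
have KE v : K v <-> `|v| < M + 1.
  by rewrite /K -ball_normE /ball_/= sub0r normrN.
have oK : open K by apply: ball_open; rewrite addr_gt0.
have Koo : (L K < +oo)%E.
  apply: lebesgue_rV_bounded; first exact: open_rV_measurable.
  exists (M + 1); split; first exact: num_real.
  by move=> x Mx v /KE vM; apply: (le_trans (ltW vM)); exact: ltW.
have BK : B `&` K = B.
  by apply/setIidPl => v /hM Bv; apply/KE; rewrite (le_lt_trans Bv)// ltrDl.
have oI : setI_closed (@open Rd) by move=> X Y; exact: openI.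
have [_ h] : stable K B.
  by apply: (lambda_system_subset oI (stable_lambda oK Koo)) mB => // X oX; exact: stable_open.
by rewrite -BK; exact: h.
Qed.

End translations.

(** * Heat kernels are Schwartz functions *)

Lemma pow_le_expR (R : realType) (n : nat) (q : R) : 0 <= q ->
  (1 + q) ^+ n <= n%:R ^+ n * expR q.
Proof.
case: n => [|n] q0; first by rewrite !expr0 mul1r -expR0 ler_expR.
have n0 : 0 < n.+1%:R :> R by [].
have -> : expR q = expR (q / n.+1%:R) ^+ n.+1.
  by rewrite -expRM_natl; congr expR; rewrite mulrCA divff ?mulr1// gt_eqF.
rewrite -exprMn; apply: lerXn2r; rewrite ?nnegrE.
- by rewrite addr_ge0.
- by rewrite mulr_ge0// expR_ge0.
apply: (@le_trans _ _ (n.+1%:R * (1 + q / n.+1%:R))).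
  by rewrite mulrDr mulr1 mulrCA divff ?gt_eqF// mulr1 lerD2r ler1n.
by rewrite ler_wpM2l// expR_ge1Dx// (le_trans _ (divr_ge0 q0 (ltW n0))).
Qed.

Section schwartz_heat_kernel.
Variables (R : realType) (d : nat).
Local Notation Rd := 'rV[R]_d.

Definition prodf (h : 'I_d -> R -> R) (x : Rd) : R := \prod_(i < d) h i (x ord0 i).

Lemma is_derive_prodf (h h' : 'I_d -> R -> R) i (x : Rd) :
  (forall y : R, is_derive y 1 (h i) (h' i y)) ->
  is_derive x (delta_mx ord0 i : Rd) (prodf h)
    (prodf (fun j => if j == i then h' j else h j) x).
Proof.
move=> dh; pose c := \prod_(j < d | j != i) h j (x ord0 j).
have E (e : R) : e^-1 *: ((prodf h \o shift x) (e *: (delta_mx ord0 i : Rd)) - prodf h x) =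
    (e^-1 *: ((h i \o shift (x ord0 i)) (e *: (1 : R)) - h i (x ord0 i))) * c.
  rewrite /= /prodf (bigD1 i)//= [X in _ - X](bigD1 i)//=.
  rewrite !mxE !eqxx /GRing.scale/= !mulr1.
  have -> : \prod_(j < d | j != i) h j ((e *: delta_mx ord0 i + x) ord0 j) = c.
    by apply: eq_bigr => j ji; rewrite !mxE (negbTE ji) andbF mulr0 add0r.
  by rewrite -/c; ring.
have [d1 d2] := dh (x ord0 i).
have cv : e^-1 *: ((prodf h \o shift x) (e *: (delta_mx ord0 i : Rd)) - prodf h x)
    @[e --> 0^'] --> h' i (x ord0 i) * c.
  under eq_fun do rewrite E.
  by apply: cvgMl; rewrite -d2; exact: d1.
have -> : prodf (fun j => if j == i then h' j else h j) x = h' i (x ord0 i) * c.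
  rewrite /prodf (bigD1 i)//= eqxx; congr (_ * _).
  by apply: eq_bigr => j /negbTE ->.
split; first by apply/cvg_ex; eexists; exact: cv.
by rewrite /derive; apply/cvg_lim.
Qed.

Variables (t : R) (z : Rd).
Hypothesis t0 : 0 < t.

(** Polynomials times a Gaussian in each coordinate: a class stable by derivation,
    all of whose members decrease rapidly. *)
Let pg (P : 'I_d -> {poly R}) (j : 'I_d) (y : R) : R :=
  (P j).[y] * expR (- ((y - z ord0 j) ^+ 2 / (2 * t))).

Let dpg (P : 'I_d -> {poly R}) (j : 'I_d) : {poly R} :=
  (P j)^`() - P j * (t^-1 *: ('X - (z ord0 j)%:P)).

Let is_derive_pg P j (y : R) : is_derive y 1 (pg P j) (pg (dpg P) j y).
Proof.
have h1 := is_derive_poly (P j) y.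
have h2 : is_derive y 1 (fun y => expR (- ((y - z ord0 j) ^+ 2 / (2 * t))))
    (- ((y - z ord0 j) / t) * expR (- ((y - z ord0 j) ^+ 2 / (2 * t)))).
  apply: is_derive_eq; rewrite /GRing.scale/=.
  by field; rewrite gt_eqF.
have [d1 d2] : is_derive y 1 (pg P j) _ := is_deriveM h1 h2.
split; first exact: d1.
rewrite d2 /pg /dpg !hornerE /GRing.scale/=.
by field; rewrite gt_eqF.
Qed.

Let upd (P : 'I_d -> {poly R}) i : 'I_d -> {poly R} := fun j => if j == i then dpg P j else P j.

Let derive_prodf_pg (a : R) P i x :
  is_derive x (delta_mx ord0 i : Rd) (fun x => a * prodf (pg P) x)
    (a * prodf (pg (upd P i)) x).
Proof.
have h : is_derive x (delta_mx ord0 i : Rd) (prodf (pg P)) (prodf (pg (upd P i)) x).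
  have := @is_derive_prodf (pg P) (pg (dpg P)) i x (is_derive_pg P i).
  congr is_derive; apply: eq_bigr => j _; rewrite /pg /upd.
  by case: eqP.
exact: (is_deriveZ a h).
Qed.

Let partials_pg a s P : exists Q,
  partials s (fun x => a * prodf (pg P) x) = (fun x => a * prodf (pg Q) x).
Proof.
elim: s => [|i s [Q IH]]; first by exists P.
exists (upd Q i); rewrite /= IH; apply/funext => x.
by have [_ ->] := derive_prodf_pg a Q i x.
Qed.

Let pow_gauss_bound (n : nat) (w : R) : exists2 C, 0 <= C & forall y : R,
  (1 + y ^+ 2) ^+ n * expR (- ((y - w) ^+ 2 / (2 * t))) <= C.
Proof.
pose B := 1 + 2 * w ^+ 2 + 4 * t.
have B0 : 0 <= B by have := sqr_ge0 w; rewrite /B; move: t0; lra.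
exists (B ^+ n * n%:R ^+ n); first by rewrite mulr_ge0 ?exprn_ge0.
move=> y; set q := (y - w) ^+ 2 / (2 * t).
have q0 : 0 <= q by rewrite divr_ge0 ?sqr_ge0// mulr_ge0// ltW.
have qE : (y - w) ^+ 2 = 2 * t * q by rewrite /q; field; rewrite gt_eqF.
rewrite expRN ler_pdivrMr ?expR_gt0//.
have h1 : 1 + y ^+ 2 <= B * (1 + q).
  have h : y ^+ 2 <= 2 * w ^+ 2 + 2 * (y - w) ^+ 2.
    have := sqr_ge0 (y - 2 * w); nra.
  rewrite qE in h.
  have tq : 0 <= t * q by rewrite mulr_ge0// ltW.
  have wq : 0 <= w ^+ 2 * q by rewrite mulr_ge0// sqr_ge0.
  rewrite (_ : B * (1 + q) = 1 + 2 * w ^+ 2 + 4 * (t * q) + (4 * t + q + 2 * (w ^+ 2 * q))); last first.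
    by rewrite /B; ring.
  move: h t0; nra.
apply: (@le_trans _ _ ((B * (1 + q)) ^+ n)).
  apply: lerXn2r; rewrite ?nnegrE ?mulr_ge0// ?addr_ge0// sqr_ge0//.
by rewrite exprMn -mulrA ler_wpM2l ?exprn_ge0// pow_le_expR.
Qed.

Let pg_bound P j k : exists2 C, 0 <= C & forall y : R,
  (1 + y ^+ 2) ^+ k * `|pg P j y| <= C.
Proof.
have [m [A A0 hA]] : exists m : nat, exists2 A, 0 <= A & forall y : R, `|(P j).[y]| <= A * (1 + y ^+ 2) ^+ m.
  exists (size (P j)); exists (\sum_(i < size (P j)) `|(P j)`_i|).
    by apply: sumr_ge0.
  move=> y; rewrite horner_coef (le_trans (ler_norm_sum _ _ _))// mulr_suml.
  apply: ler_sum => i _; rewrite normrM ler_wpM2l// normrX.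
  have y1 : 1 <= 1 + y ^+ 2 by rewrite lerDl sqr_ge0.
  apply: (@le_trans _ _ ((1 + y ^+ 2) ^+ i)); last first.
    by apply: ler_weXn2l => //; exact: ltnW (ltn_ord i).
  apply: lerXn2r; [by rewrite nnegrE|by rewrite nnegrE (le_trans ler01)|].
  rewrite -real_normK ?num_real//; have := sqr_ge0 (`|y| - 1).
  by have := normr_ge0 y; nra.
have [C C0 hC] := pow_gauss_bound (k + m) (z ord0 j).
exists (A * C); first exact: mulr_ge0.
move=> y; rewrite /pg normrM (ger0_norm (expR_ge0 _)).
have y1 : 0 <= (1 + y ^+ 2) ^+ k by rewrite exprn_ge0// addr_ge0// sqr_ge0.
apply: (@le_trans _ _ (A * ((1 + y ^+ 2) ^+ (k + m) * expR (- ((y - z ord0 j) ^+ 2 / (2 * t)))))).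
  rewrite exprD mulrA [leRHS]mulrA ler_wpM2r ?expR_ge0//.
  by rewrite [leRHS]mulrCA ler_wpM2l.
by rewrite ler_wpM2l.
Qed.

Let sum_le_prod (I : Type) (r : seq I) (a : I -> R) : (forall i, 0 <= a i) ->
  1 + \sum_(i <- r) a i <= \prod_(i <- r) (1 + a i).
Proof.
move=> a0; elim: r => [|i r IH]; first by rewrite !big_nil addr0.
rewrite !big_cons; apply: (@le_trans _ _ ((1 + a i) * (1 + \sum_(j <- r) a j))).
  have s0 : 0 <= \sum_(j <- r) a j by exact: sumr_ge0.
  by have := mulr_ge0 (a0 i) s0; rewrite mulrDl mul1r mulrDr mulr1; lra.
by rewrite ler_wpM2l// addr_ge0.
Qed.

Let prodf_pg_bound P k : exists C : R, forall x,
  (1 + sqnorm x) ^+ k * `|prodf (pg P) x| <= C.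
Proof.
have /choice[C hC] : forall j, exists C, 0 <= C /\ forall y, (1 + y ^+ 2) ^+ k * `|pg P j y| <= C.
  by move=> j; have [C C0 hC] := pg_bound P j k; exists C.
exists (\prod_(j < d) C j) => x.
apply: (@le_trans _ _ (\prod_(j < d) ((1 + x ord0 j ^+ 2) ^+ k * `|pg P j (x ord0 j)|))).
  rewrite big_split /= /prodf normr_prod ler_wpM2r//; first by apply: prodr_ge0.
  rewrite prodrXl; apply: lerXn2r; rewrite ?nnegrE.
  - by rewrite addr_ge0// sqnorm_ge0.
  - by apply: prodr_ge0 => j _; rewrite addr_ge0// sqr_ge0.
  rewrite /sqnorm /dotv.
  rewrite (eq_bigr (fun i => x ord0 i ^+ 2)); last by move=> i _; rewrite expr2.
  by apply: sum_le_prod => i; exact: sqr_ge0.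
apply: ler_prod => j _; have [C0 h] := hC j; rewrite h andbT.
by rewrite mulr_ge0// exprn_ge0// addr_ge0// sqr_ge0.
Qed.

Lemma schwartz_heat_kernel : schwartz (fun x => heat_kernel t (z - x)).
Proof.
pose a : R := (2 * pi * t) `^ (- (d%:R / 2)).
pose P0 (j : 'I_d) : {poly R} := 1.
have E : (fun x => heat_kernel t (z - x)) = (fun x => a * prodf (pg P0) x).
  apply/funext => x; rewrite /heat_kernel -/a; congr (_ * _).
  rewrite /prodf /pg; under [RHS]eq_bigr do rewrite hornerC mul1r.
  rewrite -expR_sum; congr expR; rewrite sumrN; congr (- _).
  rewrite -mulr_suml; congr (_ / _); apply: eq_bigr => j _.
  by rewrite !mxE -sqrrN opprB expr2.
rewrite E => s; have [Q ->] := partials_pg a s P0; split=> [i x|k].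
  by have [] := derive_prodf_pg a Q i x.
have [C hC] := prodf_pg_bound Q k; exists (`|a| * C) => x.
by rewrite normrM mulrCA ler_wpM2l.
Qed.

End schwartz_heat_kernel.

(** * The spectral measure *)

Section spectral.
Variables (R : realType) (d : nat).
Local Notation Rd := 'rV[R]_d.
Local Notation L := (lebesgue_rV R d).

Lemma tempered_sigma_finite (mu : {measure set Rd -> \bar R}) :
  tempered mu -> sigma_finite setT mu.
Proof.
move=> [l l0 hl]; pose F (n : nat) : set Rd := [set x | sqnorm x <= n%:R].
have mF n : measurable (F n).
  have mb : measurable_fun setT (fun x : Rd => sqnorm x <= n%:R).
    by apply: measurable_fun_ler; [exact: measurable_sqnorm|exact: measurable_cst].
  by have := mb measurableT [set true] I; rewrite setTI.
have mw : measurable_fun setT (fun x : Rd => (1 + sqnorm x) `^ (- l)).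
  by apply: (measurableT_comp (measurable_powR _)); apply: measurable_funD => //;
    exact: measurable_sqnorm.
exists F.
  apply/seteqP; split => // x _; exists (Num.truncn (sqnorm x)).+1 => //=.
  by rewrite /F/= ltW// truncnS_gt.
move=> n; split => //.
have c0 : 0 < (1 + n%:R) `^ (- l) :> R by rewrite powR_gt0// ltr_pwDl.
have : (((1 + n%:R) `^ (- l))%:E * mu (F n) < +oo)%E.
  apply: le_lt_trans hl.
  rewrite -(@integral_cst _ _ _ mu (F n) (mF n)) integral_mkcond.
  apply: ge0_le_integral => //.
  - by move=> x _; rewrite patchE; case: ifP => // _; rewrite lee_fin powR_ge0.
  - exact/(measurable_restrictT _ (mF n)).
  - exact/measurable_EFinP.
  move=> x _; rewrite patchE; case: ifPn => [/set_mem Fx|_]; last by rewrite lee_fin powR_ge0.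
  rewrite lee_fin !powRN lef_pV2 ?posrE ?powR_gt0 ?ltr_pwDl ?sqnorm_ge0//.
  rewrite ge0_ler_powR ?(ltW l0) ?nnegrE ?lerD2l ?addr_ge0 ?sqnorm_ge0//.
rewrite !ltey; apply: contra => /eqP ->.
by rewrite gt0_muley ?lte_fin.
Qed.

Variables (mu : {sigma_finite_measure set Rd -> \bar R}) (f : Rd -> R).
Hypotheses (mu_tempered : tempered mu) (f_ge0 : forall x, 0 <= f x)
  (mu_f : is_fourier_transform mu f).

Lemma tempered_gauss_integrable c : 0 < c ->
  mu.-integrable setT (EFin \o (fun xi : Rd => expR (- (c * sqnorm xi)))).
Proof.
move=> c0; have [l l0 hl] := mu_tempered.
pose n := (Num.truncn l).+1.
have ln : l <= n%:R by rewrite ltW// truncnS_gt.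
have mw : measurable_fun setT (fun x : Rd => (1 + sqnorm x) `^ (- l)).
  by apply: (measurableT_comp (measurable_powR _)); apply: measurable_funD => //;
    exact: measurable_sqnorm.
pose B := 1 + c^-1; have B0 : 0 <= B by rewrite addr_ge0// invr_ge0 ltW.
apply: (@dom_integrable _ _ _ mu _ (fun xi => B ^+ n * n%:R ^+ n * (1 + sqnorm xi) `^ (- l))).
- apply: (measurableT_comp (@measurable_expR R)).
  by apply: measurable_funN; apply: measurable_funM => //; exact: measurable_sqnorm.
- move=> xi; rewrite ger0_norm ?expR_ge0// expRN powRN.
  have q0 := sqnorm_ge0 xi; set q := sqnorm xi in q0 *.
  have q1 : 1 <= 1 + q by rewrite lerDl.
  rewrite ler_pdivlMr ?powR_gt0 ?(lt_le_trans ltr01)//.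
  rewrite mulrC ler_pdivrMr ?expR_gt0//.
  apply: (@le_trans _ _ ((1 + q) ^+ n)).
    rewrite -powR_mulrn ?(le_trans ler01)//; exact: ler_powR.
  apply: (@le_trans _ _ ((B * (1 + c * q)) ^+ n)).
    have h0 : 0 <= 1 + c * q by rewrite addr_ge0// mulr_ge0// ltW.
    have h1 : 1 + q <= B * (1 + c * q).
      have -> : B * (1 + c * q) = 1 + q + (c^-1 + c * q).
        by rewrite /B; field; rewrite gt_eqF.
      by rewrite lerDl addr_ge0 ?invr_ge0 ?mulr_ge0 ?(ltW c0).
    by rewrite lerXn2r// nnegrE ?mulr_ge0// (le_trans ler01).
  by rewrite exprMn -mulrA ler_wpM2l ?exprn_ge0// pow_le_expR// mulr_ge0// ltW.
- apply: Rint_integrableZ; apply: integrable_ge0 => //.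
  by move=> x; exact: powR_ge0.
Qed.

(** The Fourier transform of the heat kernel at time s. *)
Definition hw (s : R) (xi : Rd) : R := expR (- (s * sqnorm xi / 2)).

Lemma hw_ge0 s xi : 0 <= hw s xi. Proof. exact: expR_ge0. Qed.

Lemma measurable_hw s : measurable_fun setT (hw s).
Proof.
apply: (measurableT_comp (@measurable_expR R)).
by apply: measurable_funN; do 2 apply: measurable_funM => //; exact: measurable_sqnorm.
Qed.

Lemma hw_integrable s : 0 < s -> mu.-integrable setT (EFin \o hw s).
Proof.
move=> s0; have s20 : 0 < s / 2 by rewrite divr_gt0.
have := tempered_gauss_integrable s20; apply: eq_integrable => // xi _ /=.
by rewrite /hw mulrAC.
Qed.

Lemma measurable_f : measurable_fun setT f. Proof. by case: mu_f. Qed.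

Definition smooth (s : R) (z : Rd) : R := \int[L]_x (f x * heat_kernel s (z - x)).

(** The defining relation of the spectral measure, tested on heat kernels. *)
Lemma smoothE s z : 0 < s ->
  L.-integrable setT (EFin \o (fun x => f x * heat_kernel s (z - x))) /\
  smooth s z = \int[mu]_xi (cos (dotv xi z) * hw s xi).
Proof.
move=> s0; have [_ hf] := mu_f.
have sch0 : schwartz (fun _ : Rd => 0 : R).
  have p0 r : partials r (fun _ : Rd => 0 : R) = (fun=> 0).
    elim: r => //= i r ->; apply/funext => x; exact: derive_cst.
  move=> r; rewrite p0; split=> [i x|k]; first exact: derivable_cst.
  by exists 0 => x; rewrite normr0 mulr0.
have [] := hf (fun x => (heat_kernel s (z - x))%:C%C).
  by split => /=; [exact: schwartz_heat_kernel|exact: sch0].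
move=> [i1 _] e; split.
  by move: i1; apply: eq_integrable => // x _ /=; rewrite !mul0r subr0.
have ih : L.-integrable setT (EFin \o (fun y => heat_kernel s (z - y))).
  apply: integrable_ge0.
  - by apply: (measurableT_comp (@measurable_heat_kernel _ _ _)); exact: measurable_rVB.
  - by move=> y; exact: heat_kernel_ge0.
  rewrite (@ge0_int_rV_refl R d (fun y => (heat_kernel s y)%:E) z).
  - by rewrite int_heat_kernel// ltry.
  - by apply/measurable_EFinP; exact: measurable_heat_kernel.
  - by move=> y; rewrite lee_fin heat_kernel_ge0.
have := congr1 (@complex.Re R) e; rewrite /cintegral /=.
have -> : \int[L]_x complex.Re ((f x)%:C%C * (heat_kernel s (z - x))%:C%C) = smooth s z.
  by apply: eq_Rintegral => x _ /=; rewrite mul0r subr0.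
move=> ->; apply: eq_Rintegral => xi _.
apply: (etrans (Re_fourier (fun x => heat_kernel s (z - x)) xi)).
by rewrite ftr_heat_kernel// addr0.
Qed.

Lemma cos_hw_integrable s z : 0 < s ->
  mu.-integrable setT (EFin \o (fun xi : Rd => cos (dotv xi z) * hw s xi)).
Proof.
move=> s0; apply: (@dom_integrable _ _ _ mu _ (hw s)); last exact: hw_integrable.
  apply: measurable_funM; last exact: measurable_hw.
  by apply: measurable_cos_comp; exact: measurable_dotv.
by move=> xi; rewrite normrM (ger0_norm (hw_ge0 _ _)) ler_piMl ?hw_ge0// cos_max.
Qed.

Lemma smooth_le0 s z : 0 < s -> smooth s z <= smooth s 0.
Proof.
move=> s0; have [_ ->] := smoothE z s0; have [_ ->] := smoothE 0 s0.
apply: le_Rintegral => //; [exact: cos_hw_integrable|exact: cos_hw_integrable|move=> xi _].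
rewrite ler_wpM2r ?hw_ge0//.
by rewrite (_ : dotv xi 0 = 0) ?cos0 ?cos_le1// /dotv big1// => j _; rewrite mxE mulr0.
Qed.

Lemma smooth_ge0 s z : 0 <= smooth s z.
Proof. by apply: Rintegral_ge0 => x _; rewrite mulr_ge0 ?heat_kernel_ge0. Qed.

Lemma measurable_smooth s : measurable_fun setT (smooth s).
Proof.
suff h : measurable_fun setT (fun p : Rd * Rd => f p.2 * heat_kernel s (p.1 - p.2)).
  exact: (measurable_Rint2 L h).
apply: measurable_funM; first exact: measurableT_comp measurable_f measurable_snd.
by apply: (measurableT_comp (@measurable_heat_kernel _ _ _)); exact: measurable_rVB.
Qed.

Lemma smooth_conv_integrable s psi a : 0 < s -> L.-integrable setT (EFin \o psi) ->
  L.-integrable setT (EFin \o (fun b => psi b * smooth s (a - b))).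
Proof.
move=> s0 i2; apply: (@dom_integrable _ _ _ L _ (fun b => smooth s 0 * `|psi b|)).
- apply: measurable_funM; first exact: integrable_measurable i2.
  by apply: (measurableT_comp (measurable_smooth s)); exact: measurable_rVB.
- move=> b; rewrite normrM (ger0_norm (smooth_ge0 _ _)) mulrC.
  by rewrite ler_wpM2r ?smooth_le0.
- by apply: Rint_integrableZ; exact: integrable_norm.
Qed.

(** The real part of F phi(xi) times the conjugate of F psi(xi). *)
Definition fprod (phi psi : Rd -> R) (xi : Rd) : R :=
  ftr 0 phi xi * ftr 0 psi xi + ftr (sin_phase R) phi xi * ftr (sin_phase R) psi xi.

Lemma measurable_fprod phi psi : measurable_fun setT phi -> measurable_fun setT psi ->
  measurable_fun setT (fprod phi psi).
Proof.
by move=> m1 m2; apply: measurable_funD; apply: measurable_funM; exact: measurable_ftr.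
Qed.

(** Both sides are the double integral of phi(a) psi(b) cos(xi . (a - b)), integrated in
    frequency before or after space; the Gaussian weight makes Fubini's theorem apply. *)
Lemma smooth_parseval s (phi psi : Rd -> R) : 0 < s ->
  L.-integrable setT (EFin \o phi) -> L.-integrable setT (EFin \o psi) ->
  \int[L]_a \int[L]_b (phi a * psi b * smooth s (a - b)) =
  \int[mu]_xi (hw s xi * fprod phi psi xi).
Proof.
move=> s0 i1 i2.
have mphi := integrable_measurable i1; have mpsi := integrable_measurable i2.
pose G (a xi : Rd) := cos (dotv xi a) * ftr 0 psi xi + sin (dotv xi a) * ftr (sin_phase R) psi xi.
have sE z : dotv z z = dotv z z by [].
have cB xi a b : cos (dotv xi (a - b)) =
    cos (dotv xi a) * cos (dotv xi b + 0) + sin (dotv xi a) * cos (dotv xi b + sin_phase R).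
  by rewrite dotvBr cosB addr0 /sin_phase cosBpihalf.
have inner a : \int[L]_b (psi b * smooth s (a - b)) = \int[mu]_xi (hw s xi * G a xi).
  transitivity (\int[L]_b \int[mu]_xi (psi b * (cos (dotv xi (a - b)) * hw s xi))).
    apply: eq_Rintegral => b _; have [_ ->] := smoothE (a - b) s0.
    by rewrite RintegralZl//; exact: cos_hw_integrable.
  pose F (p : Rd * Rd) := psi p.1 * (cos (dotv p.2 (a - p.1)) * hw s p.2).
  have mF : measurable_fun setT F.
    apply: measurable_funM; first exact: measurableT_comp mpsi measurable_fst.
    apply: measurable_funM; last exact: measurableT_comp (measurable_hw s) measurable_snd.
    by apply: measurable_cos_comp; apply: measurable_dotv => //; exact: measurable_rVB.
  have [|_ e1 e2] := @Rint_swap _ _ _ _ R L mu F (fun b => `|psi b|) (hw s) mF _ (integrable_norm i2) (hw_integrable s0).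
    move=> b xi; rewrite /F normrM ler_wpM2l// normrM (ger0_norm (hw_ge0 _ _)).
    by rewrite ler_piMl ?hw_ge0// cos_max.
  rewrite e1 -e2; apply: eq_Rintegral => xi _.
  rewrite /G /ftr -RintegralZl ?measurableT//; last exact: cos_integrable.
  rewrite -[X in _ * (_ + X)]RintegralZl ?measurableT//; last exact: cos_integrable.
  rewrite -RintegralD ?measurableT//; last 2 first.
  - by apply: Rint_integrableZ; exact: cos_integrable.
  - by apply: Rint_integrableZ; exact: cos_integrable.
  rewrite -RintegralZl ?measurableT//; last first.
    by apply: Rint_integrableD; apply: Rint_integrableZ; exact: cos_integrable.
  by apply: eq_Rintegral => b _; rewrite /F/= cB; ring.
pose C := \int[L]_x `|psi x|.
have C0 : 0 <= C by apply: Rintegral_ge0.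
have G_le a xi : `|G a xi| <= C + C.
  apply: le_trans (ler_normD _ _) _; apply: lerD; rewrite normrM.
    by rewrite -[leRHS]mul1r ler_pM ?cos_max ?ftr_le.
  by rewrite -[leRHS]mul1r ler_pM ?sin_max ?ftr_le.
have mG : measurable_fun setT (fun p : Rd * Rd => G p.1 p.2).
  have mp : measurable_fun setT (fun p : Rd * Rd => dotv p.2 p.1) by exact: measurable_dotv.
  apply: measurable_funD; apply: measurable_funM.
  - exact: measurable_cos_comp.
  - exact: measurableT_comp (measurable_ftr _ mpsi) measurable_snd.
  - exact: measurableT_comp (continuous_measurable_fun (@continuous_sin R)) mp.
  - exact: measurableT_comp (measurable_ftr _ mpsi) measurable_snd.
pose F (p : Rd * Rd) := phi p.1 * (hw s p.2 * G p.1 p.2).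
have mF : measurable_fun setT F.
  apply: measurable_funM; first exact: measurableT_comp mphi measurable_fst.
  by apply: measurable_funM => //; exact: measurableT_comp (measurable_hw s) measurable_snd.
have iG a : mu.-integrable setT (EFin \o (fun xi => hw s xi * G a xi)).
  apply: (@dom_integrable _ _ _ mu _ (fun xi => (C + C) * hw s xi)).
  - by apply: measurable_funM; [exact: measurable_hw|exact: (measurable_sec1 a mG)].
  - move=> xi; rewrite normrM (ger0_norm (hw_ge0 _ _)) mulrC.
    by rewrite ler_wpM2r ?hw_ge0.
  - by apply: Rint_integrableZ; exact: hw_integrable.
have [|_ e1 e2] := @Rint_swap _ _ _ _ R L mu F (fun b => `|phi b|)
    (fun xi => (C + C) * hw s xi) mF _ (integrable_norm i1) (Rint_integrableZ (C + C) (hw_integrable s0)).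
  move=> a xi; rewrite /F normrM ler_wpM2l// normrM (ger0_norm (hw_ge0 _ _)) mulrC.
  by rewrite ler_wpM2r ?hw_ge0.
transitivity (\int[L]_a \int[mu]_xi F (a, xi)).
  apply: eq_Rintegral => a _; rewrite /F/= RintegralZl// -inner.
  rewrite -RintegralZl//; first by apply: eq_Rintegral => b _; ring.
  exact: smooth_conv_integrable.
rewrite e1 -e2; apply: eq_Rintegral => xi _.
rewrite /F/= /fprod.
transitivity (\int[L]_a (hw s xi * ((ftr 0 psi xi * (cos (dotv xi a + 0) * phi a)) +
  (ftr (sin_phase R) psi xi * (cos (dotv xi a + sin_phase R) * phi a))))).
  apply: eq_Rintegral => a _; rewrite /G addr0 /sin_phase cosBpihalf; ring.
rewrite RintegralZl//; last first.
  by apply: Rint_integrableD; apply: Rint_integrableZ; exact: cos_integrable.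
rewrite RintegralD//; last 2 first.
- by apply: Rint_integrableZ; exact: cos_integrable.
- by apply: Rint_integrableZ; exact: cos_integrable.
rewrite RintegralZl//; last exact: cos_integrable.
rewrite RintegralZl//; last exact: cos_integrable.
by rewrite -/(ftr 0 phi xi) -/(ftr (sin_phase R) phi xi); ring.
Qed.

End spectral.

(** * The heat kernel as an approximate identity *)

Section approximate_identity.
Variables (R : realType) (d : nat).
Local Notation Rd := 'rV[R]_d.
Local Notation L := (lebesgue_rV R d).

Lemma heat_kernel_refl_integrable t (z : Rd) : 0 < t ->
  L.-integrable setT (EFin \o (fun y => heat_kernel t (z - y))).
Proof.
move=> t0; apply: integrable_ge0.
- by apply: (measurableT_comp (@measurable_heat_kernel _ _ _)); exact: measurable_rVB.
- by move=> y; exact: heat_kernel_ge0.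
rewrite (@ge0_int_rV_refl R d (fun y => (heat_kernel t y)%:E) z).
- by rewrite int_heat_kernel// ltry.
- by apply/measurable_EFinP; exact: measurable_heat_kernel.
- by move=> y; rewrite lee_fin heat_kernel_ge0.
Qed.

Lemma Rint_heat_kernel t : 0 < t -> \int[L]_x heat_kernel t x = 1.
Proof. by move=> t0; rewrite /Rintegral int_heat_kernel. Qed.

(* q e^{-q/2t} <= 4 t e^{-q/4t}, whence a factor 2^{d/2} between the two masses *)
Lemma sqnorm_heat_kernel_le t (x : Rd) : 0 < t ->
  sqnorm x * heat_kernel t x <= 4 * t * 2 `^ (d%:R / 2) * heat_kernel (2 * t) x.
Proof.
move=> t0; rewrite /heat_kernel; have q0 := sqnorm_ge0 x; set q := sqnorm x in q0 *.
have tp : 0 < 2 * pi * t by rewrite !mulr_gt0// pi_gt0.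
have -> : 2 * pi * (2 * t) = 2 * (2 * pi * t) by ring.
rewrite (powRM _ _ (ltW tp))//.
have e2 : 2 `^ (d%:R / 2) * 2 `^ (- (d%:R / 2)) = 1 :> R.
  by rewrite -powRD ?subrr ?powRr0//; apply/implyP => _; rewrite pnatr_eq0.
rewrite [leRHS](_ : _ = (2 `^ (d%:R / 2) * 2 `^ (- (d%:R / 2))) *
  ((2 * pi * t) `^ (- (d%:R / 2)) * (4 * t * expR (- (q / (2 * (2 * t))))))); last by ring.
rewrite e2 mul1r mulrCA ler_wpM2l ?powR_ge0//.
have -> : expR (- (q / (2 * t))) = expR (- (q / (4 * t))) * expR (- (q / (4 * t))).
  by rewrite -expRD; congr expR; field; rewrite gt_eqF.
have -> : 2 * (2 * t) = 4 * t by ring.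
rewrite mulrA ler_wpM2r ?expR_ge0// expRN ler_pdivrMr ?expR_gt0//.
rewrite -ler_pdivrMl ?mulr_gt0// mulrC.
by apply: le_trans (expR_ge1Dx _); rewrite lerDr.
Qed.

Lemma sqnorm_heat_kernel_integrable t : 0 < t ->
  L.-integrable setT (EFin \o (fun x : Rd => sqnorm x * heat_kernel t x)).
Proof.
move=> t0; apply: (@dom_integrable _ _ _ L _ (fun x => 4 * t * 2 `^ (d%:R / 2) * heat_kernel (2 * t) x)).
- by apply: measurable_funM; [exact: measurable_sqnorm|exact: measurable_heat_kernel].
- move=> x; rewrite ger0_norm; first exact: sqnorm_heat_kernel_le.
  by rewrite mulr_ge0 ?sqnorm_ge0 ?heat_kernel_ge0.
- by apply: Rint_integrableZ; apply: heat_kernel_integrable; rewrite mulr_gt0.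
Qed.

Lemma coord_sq_le (x : Rd) i : x ord0 i ^+ 2 <= sqnorm x.
Proof.
rewrite /sqnorm /dotv (bigD1 i)//= expr2 lerDl sumr_ge0// => j _.
by rewrite -expr2 sqr_ge0.
Qed.

Lemma sqnorm_ball (x : Rd) (e : R) : 0 < e -> sqnorm x < e ^+ 2 -> ball 0 e x.
Proof.
move=> e0 xe; split => // i j; rewrite (ord1 i) /ball/= mxE sub0r normrN.
rewrite -(ltr_pXn2r (n := 2))// ?nnegrE ?ltW// real_normK ?num_real//.
exact: le_lt_trans (coord_sq_le _ _) xe.
Qed.

Lemma approximate_identity (Phi : Rd -> R) (M : R) : measurable_fun setT Phi ->
  (forall w, `|Phi w| <= M) ->
  (forall w_ : nat -> Rd, w_ n @[n --> \oo] --> (0 : Rd) -> Phi (w_ n) @[n --> \oo] --> Phi 0) ->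
  \int[L]_w (heat_kernel n.+1%:R^-1 w * Phi w) @[n --> \oo] --> Phi 0.
Proof.
move=> mP PM cP.
have M0 : 0 <= M by exact: le_trans (PM 0).
apply/cvgrPdist_le => e e0; have e20 : 0 < e / 2 by rewrite divr_gt0.
have [D [dl0 dlE]] : exists D : R, 0 < D /\
    forall w, sqnorm w < D -> `|Phi w - Phi 0| <= e / 2.
  apply: contrapT => /forallNP nd.
  have /choice[w wP] : forall n : nat, exists w : Rd,
      sqnorm w < n.+1%:R^-1 ^+ 2 /\ ~ (`|Phi w - Phi 0| <= e / 2).
    move=> n; apply: contrapT => nw; apply: (nd (n.+1%:R^-1 ^+ 2)); split.
      by rewrite exprn_gt0.
    by move=> w hw; apply: contrapT => h; apply: nw; exists w.
  have w0 : w n @[n --> \oo] --> (0 : Rd).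
    apply/cvg_ballP => r r0; have /cvgrPdist_lt/(_ r r0) := @cvg_harmonic R.
    apply: filterS => n; rewrite /harmonic/= sub0r normrN ger0_norm// => nr.
    have [h _] := wP n; apply: le_ball (ltW nr) _ _; exact: sqnorm_ball.
  have /cvgrPdist_le/(_ _ e20)[N _ /(_ N (leqnn N))] := cP _ w0.
  by rewrite distrC; have [_] := wP N.
pose C := 2 * M / D * (4 * 2 `^ (d%:R / 2)).
have C0 : 0 <= C by rewrite !mulr_ge0 ?invr_ge0 ?powR_ge0 ?(ltW dl0).
have key w : `|Phi w - Phi 0| <= e / 2 + 2 * M / D * sqnorm w.
  have [h|h] := ltP (sqnorm w) D.
    by apply: (le_trans (dlE _ h)); rewrite lerDl !mulr_ge0 ?invr_ge0 ?sqnorm_ge0 ?(ltW dl0).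
  apply: (@le_trans _ _ (2 * M)).
    by rewrite mulr_natl mulr2n; apply: le_trans (ler_normB _ _) _; exact: lerD.
  rewrite -[leLHS]add0r lerD ?divr_ge0 ?(ltW e0)//.
  by rewrite -mulrA ler_peMr ?mulr_ge0// mulrC ler_pdivlMr ?mul1r.
have : C * n.+1%:R^-1 @[n --> \oo] --> C * 0.
  by apply: cvgMr; exact: cvg_harmonic.
rewrite mulr0 => /cvgrPdist_le/(_ (e / 2) (divr_gt0 e0 (ltr0Sn _ _))).
apply: filterS => n; rewrite sub0r normrN => hn.
pose s : R := n.+1%:R^-1; have s0 : 0 < s by rewrite invr_gt0.
have ip : L.-integrable setT (EFin \o (fun w => heat_kernel s w * Phi w)).
  apply: (@dom_integrable _ _ _ L _ (fun w => M * heat_kernel s w)).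
  - by apply: measurable_funM => //; exact: measurable_heat_kernel.
  - by move=> w; rewrite normrM ger0_norm ?heat_kernel_ge0// mulrC ler_wpM2r ?heat_kernel_ge0.
  - by apply: Rint_integrableZ; exact: heat_kernel_integrable.
have ic : L.-integrable setT (EFin \o (fun w => Phi 0 * heat_kernel s w)).
  by apply: Rint_integrableZ; exact: heat_kernel_integrable.
have iq : L.-integrable setT (EFin \o (fun w : Rd => 2 * M / D * (sqnorm w * heat_kernel s w))).
  by apply: Rint_integrableZ; exact: sqnorm_heat_kernel_integrable.
have ih : L.-integrable setT (EFin \o (fun w => e / 2 * heat_kernel s w)).
  by apply: Rint_integrableZ; exact: heat_kernel_integrable.
rewrite -/s distrC.
have -> : Phi 0 = \int[L]_w (Phi 0 * heat_kernel s w).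
  by rewrite RintegralZl ?Rint_heat_kernel ?mulr1//; exact: heat_kernel_integrable.
rewrite -RintegralB//; apply: le_trans (le_normr_Rintegral measurableT _) _.
  exact: (Rint_integrableB ip ic).
apply: (@le_trans _ _ (\int[L]_w (e / 2 * heat_kernel s w + 2 * M / D * (sqnorm w * heat_kernel s w)))).
  apply: le_Rintegral => //.
  - by apply: integrable_norm; exact: (Rint_integrableB ip ic).
  - exact: (Rint_integrableD ih iq).
  move=> w _; rewrite (_ : _ - _ = heat_kernel s w * (Phi w - Phi 0)); last by ring.
  rewrite normrM ger0_norm ?heat_kernel_ge0//.
  apply: le_trans (ler_wpM2l (heat_kernel_ge0 _ _) (key w)) _.
  by rewrite le_eqVlt; apply/orP; left; apply/eqP; ring.
rewrite (RintegralD measurableT ih iq).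
have -> : \int[L]_w (e / 2 * heat_kernel s w) = e / 2.
  by rewrite RintegralZl ?Rint_heat_kernel ?mulr1//; exact: heat_kernel_integrable.
have -> : \int[L]_w (2 * M / D * (sqnorm w * heat_kernel s w)) =
    2 * M / D * \int[L]_w (sqnorm w * heat_kernel s w).
  by rewrite RintegralZl//; exact: sqnorm_heat_kernel_integrable.
rewrite [leRHS](splitr e) lerD2l.
apply: le_trans hn; apply: le_trans (ler_norm _).
rewrite /C -!mulrA ler_wpM2l ?ler_wpM2l ?invr_ge0 ?(ltW dl0)// mulrA.
apply: (@le_trans _ _ (\int[L]_w (4 * s * 2 `^ (d%:R / 2) * heat_kernel (2 * s) w))).
  apply: le_Rintegral => //.
  - exact: sqnorm_heat_kernel_integrable.
  - by apply: Rint_integrableZ; apply: heat_kernel_integrable; rewrite mulr_gt0.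
  - by move=> w _; exact: sqnorm_heat_kernel_le.
rewrite RintegralZl//; last by apply: heat_kernel_integrable; rewrite mulr_gt0.
by rewrite Rint_heat_kernel ?mulr_gt0// le_eqVlt; apply/orP; left; apply/eqP; rewrite /s; ring.
Qed.

End approximate_identity.

(** * Parseval's identity for step functions in space *)

Section fubini_iterated.
Context d1 d2 (T1 : measurableType d1) (T2 : measurableType d2) (R : realType).
Variables (m1 : {sigma_finite_measure set T1 -> \bar R})
  (m2 : {sigma_finite_measure set T2 -> \bar R}).

(** Fubini's theorem when only one iterated integral of the absolute value is
    under control. *)
Lemma Rint_swap_iter (F : T1 * T2 -> R) (g : T2 -> R) : measurable_fun setT F ->
  (forall x, m2.-integrable setT (EFin \o (fun y => F (x, y)))) ->
  (forall y, m1.-integrable setT (EFin \o (fun x => F (x, y)))) ->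
  (forall y, \int[m1]_x `|F (x, y)| <= g y) -> m2.-integrable setT (EFin \o g) ->
  (prodm m1 m2).-integrable setT (EFin \o F) /\
  \int[m1]_x \int[m2]_y F (x, y) = \int[m2]_y \int[m1]_x F (x, y).
Proof.
move=> mF Fx Fy Fg ig.
have Fi : (prodm m1 m2).-integrable setT (EFin \o F).
  apply/integrable21ltyP; first exact/measurable_EFinP.
  have g0 y : 0 <= g y by apply: le_trans (Fg y); apply: Rintegral_ge0.
  apply: le_lt_trans (integrable_ge0_lty g0 ig).
  apply: ge0_le_integral => //.
  - by move=> y _; exact: integral_ge0.
  - apply: (@measurable_fun_fubini_tonelli_G _ _ _ _ R m1 (fun p => `|(F p)%:E|)%E) => //.
    by apply: measurableT_comp => //; exact/measurable_EFinP.
  - by apply/measurable_EFinP; exact: integrable_measurable ig.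
  - move=> y _.
    by have := Fg y; rewrite -lee_fin EFin_Rintegral//; exact: integrable_norm (Fy y).
split=> //.
by rewrite (Rint_prod Fi)// (Rint_prod2 Fi).
Qed.

End fubini_iterated.

Section parseval.
Variables (R : realType) (d : nat).
Local Notation Rd := 'rV[R]_d.
Local Notation L := (lebesgue_rV R d).

Lemma Rint_rVD (F : Rd -> R) (w : Rd) : measurable_fun setT F ->
  \int[L]_v F (v + w) = \int[L]_v F v.
Proof.
move=> mF; have mG : measurable_fun setT (fun v : Rd => F (v + w)).
  apply: (measurableT_comp mF).
  by apply: measurable_rVD => //; exact: measurable_cst.
rewrite -(Rint_rV_refl 0 mG) -(Rint_rV_refl w mF).
by apply: eq_Rintegral => v _; congr F; rewrite sub0r addrC.
Qed.

Lemma heat_kernelN t (x : Rd) : heat_kernel t (- x) = heat_kernel t x.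
Proof. by rewrite /heat_kernel sqnormN. Qed.

(** Functions below a multiple of a heat kernel: bounded functions with bounded
    support as well as the heat kernel itself. *)
Definition gdom (t : R) (z : Rd) (phi : Rd -> R) : Prop :=
  measurable_fun setT phi /\ exists C : R, forall x, `|phi x| <= C * heat_kernel t (z - x).

Lemma gdom_integrable t z phi : 0 < t -> gdom t z phi -> L.-integrable setT (EFin \o phi).
Proof.
move=> t0 [mp [C pC]].
apply: (@dom_integrable _ _ _ L _ (fun x => C * heat_kernel t (z - x))) => //.
by apply: Rint_integrableZ; exact: heat_kernel_refl_integrable.
Qed.

Lemma gdomD t z phi psi : gdom t z phi -> gdom t z psi ->
  gdom t z (fun x => phi x + psi x).
Proof.
move=> [mp [C pC]] [mq [D qD]]; split; first exact: measurable_funD.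
exists (C + D) => x; rewrite mulrDl; apply: le_trans (ler_normD _ _) _.
exact: lerD.
Qed.

Lemma gdomZ t z c phi : gdom t z phi -> gdom t z (fun x => c * phi x).
Proof.
move=> [mp [C pC]]; split; first exact: measurable_funM.
by exists (`|c| * C) => x; rewrite normrM -mulrA ler_wpM2l.
Qed.

Lemma gdom_heat_kernel t z : gdom t z (fun x => heat_kernel t (z - x)).
Proof.
split.
  by apply: (measurableT_comp (@measurable_heat_kernel _ _ _)); exact: measurable_rVB.
by exists 1 => x; rewrite mul1r ger0_norm ?heat_kernel_ge0.
Qed.

Lemma gdom_le t z (phi psi : Rd -> R) : measurable_fun setT phi -> gdom t z psi ->
  (forall x, `|phi x| <= `|psi x|) -> gdom t z phi.
Proof. by move=> mp [_ [C pC]] pp; split => //; exists C => x; exact: le_trans (pC x). Qed.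

Lemma gdom_indic t z (A : set Rd) : 0 < t -> measurable A -> bounded_set A ->
  gdom t z (\1_A : Rd -> R).
Proof.
move=> t0 mA /bounded_set_norm[M [M0 AM]]; split; first exact: measurable_indic.
pose q := 2 * sqnorm z + 2 * (d%:R * M ^+ 2).
have tp : 0 < 2 * pi * t by rewrite !mulr_gt0// pi_gt0.
pose K := (2 * pi * t) `^ (- (d%:R / 2)) * expR (- (q / (2 * t))).
have K0 : 0 < K by rewrite mulr_gt0 ?powR_gt0 ?expR_gt0.
exists K^-1 => x; rewrite indicE; case: (boolP (x \in A)) => [/set_mem Ax|_]; last first.
  by rewrite normr0 mulr_ge0 ?heat_kernel_ge0// invr_ge0 ltW.
rewrite normr1 mulrC ler_pdivlMr// mul1r /K /heat_kernel ler_wpM2l ?powR_ge0//.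
rewrite ler_expR lerN2 ler_wpM2r ?invr_ge0 ?mulr_ge0 ?(ltW t0)//.
apply: le_trans (sqnormD_le _ _) _; rewrite sqnormN /q lerD2l ler_wpM2l//.
rewrite /sqnorm /dotv; apply: (@le_trans _ _ (\sum_(i < d) M ^+ 2)); last first.
  by rewrite sumr_const card_ord -[in leLHS]mulr_natl.
apply: ler_sum => i _; rewrite -expr2 -[leLHS]real_normK ?num_real//.
rewrite lerXn2r ?nnegrE ?(ltW M0)//.
exact: le_trans (coord_le_norm _ _) (AM _ Ax).
Qed.

Variables (mu : {sigma_finite_measure set Rd -> \bar R}) (f : Rd -> R).
Hypotheses (mu_tempered : tempered mu) (f_ge0 : forall x, 0 <= f x)
  (mu_f : is_fourier_transform mu f).

Let mf : measurable_fun setT f := measurable_f mu_f.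

Lemma measurable_f_sub dT (T : measurableType dT) (g h : T -> Rd) :
  measurable_fun setT g -> measurable_fun setT h ->
  measurable_fun setT (fun x => f (g x - h x)).
Proof. by move=> mg mh; apply: (measurableT_comp mf); exact: measurable_rVB. Qed.

Definition conv_f (phi : Rd -> R) (a : Rd) : R := \int[L]_b (phi b * f (a - b)).

(** The covariance form of the spatial noise. *)
Definition fform (phi psi : Rd -> R) : R := \int[L]_a (phi a * conv_f psi a).

Lemma conv_heat_kernel t z a : 0 < t ->
  L.-integrable setT (EFin \o (fun b => heat_kernel t (z - b) * f (a - b))) /\
  conv_f (fun b => heat_kernel t (z - b)) a = smooth f t (a - z).
Proof.
move=> t0; pose F b := heat_kernel t (z - b) * f (a - b).
have FE v : F (a - v) = f v * heat_kernel t (a - z - v).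
  have e1 : a - (a - v) = v by rewrite opprB addrC subrK.
  have e2 : z - (a - v) = - (a - z - v) by rewrite !opprB addrCA addrC.
  by rewrite /F e1 e2 heat_kernelN mulrC.
have F0 b : 0 <= F b by rewrite mulr_ge0 ?heat_kernel_ge0.
have mF : measurable_fun setT F.
  apply: measurable_funM; last by apply: measurable_f_sub => //; exact: measurable_cst.
  by case: (gdom_heat_kernel t z).
have [si _] := smoothE mu_f (a - z) t0.
split; last first.
  by rewrite /conv_f -(Rint_rV_refl a mF); apply: eq_Rintegral => v _; exact: FE.
apply: integrable_ge0 => //.
rewrite -(@ge0_int_rV_refl R d (fun b => (F b)%:E) a); last 2 first.
- exact/measurable_EFinP.
- by move=> b; rewrite lee_fin.
have s0 v : 0 <= f v * heat_kernel t (a - z - v) by rewrite mulr_ge0 ?heat_kernel_ge0.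
have := integrable_ge0_lty s0 si.
by congr (_ < _)%E; apply: eq_integral => v _; rewrite FE.
Qed.

Lemma conv_f_integrable t z phi a : 0 < t -> gdom t z phi ->
  L.-integrable setT (EFin \o (fun b => phi b * f (a - b))).
Proof.
move=> t0 [mp [C pC]]; have [hi _] := conv_heat_kernel z a t0.
apply: (@dom_integrable _ _ _ L _ (fun b => C * (heat_kernel t (z - b) * f (a - b)))).
- by apply: measurable_funM => //; apply: measurable_f_sub => //; exact: measurable_cst.
- by move=> b; rewrite normrM (ger0_norm (f_ge0 _)) mulrA ler_wpM2r.
- exact: Rint_integrableZ.
Qed.

(** The smoothed covariance is a positive definite function, so it is maximal at 0; this
    bounds the convolution of f with a heat kernel uniformly in space. *)
Lemma conv_f_le t z phi : 0 < t -> gdom t z phi ->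
  exists K : R, forall a, \int[L]_b `|phi b * f (a - b)| <= K.
Proof.
move=> t0 gp; have [mp [C pC]] := gp; exists (C * smooth f t 0) => a.
have [hi he] := conv_heat_kernel z a t0.
have C0 : 0 <= C.
  have := le_trans (normr_ge0 _) (pC z).
  by rewrite pmulr_lge0// /heat_kernel mulr_gt0 ?expR_gt0// powR_gt0// !mulr_gt0// pi_gt0.
apply: (@le_trans _ _ (C * smooth f t (a - z))); last first.
  apply: (ler_wpM2l C0); exact: (smooth_le0 mu_tempered mu_f (a - z) t0).
rewrite -he /conv_f -RintegralZl//; apply: le_Rintegral => //.
- by apply: integrable_norm; exact: (conv_f_integrable a t0 gp).
- exact: Rint_integrableZ.
- by move=> b _; rewrite normrM (ger0_norm (f_ge0 _)) mulrA ler_wpM2r.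
Qed.

Lemma conv_f_norm_le t z phi : 0 < t -> gdom t z phi ->
  exists K : R, forall a, `|conv_f phi a| <= K.
Proof.
move=> t0 gp; have [K hK] := conv_f_le t0 gp; exists K => a.
apply: le_trans (hK a); apply: le_normr_Rintegral => //.
exact: (conv_f_integrable a t0 gp).
Qed.

Lemma measurable_conv_f phi : measurable_fun setT phi -> measurable_fun setT (conv_f phi).
Proof.
move=> mp; suff h : measurable_fun setT (fun p : Rd * Rd => phi p.2 * f (p.1 - p.2)).
  exact: (measurable_Rint2 L h).
apply: measurable_funM; first exact: measurableT_comp mp measurable_snd.
exact: measurable_f_sub.
Qed.

Lemma fform_integrable t z phi psi : 0 < t -> L.-integrable setT (EFin \o phi) ->
  gdom t z psi -> L.-integrable setT (EFin \o (fun a => phi a * conv_f psi a)).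
Proof.
move=> t0 ip gq; have [K hK] := conv_f_norm_le t0 gq.
apply: (@dom_integrable _ _ _ L _ (fun a => K * `|phi a|)).
- apply: measurable_funM; first exact: integrable_measurable ip.
  by apply: measurable_conv_f; case: gq.
- by move=> a; rewrite normrM mulrC ler_wpM2r.
- by apply: Rint_integrableZ; exact: integrable_norm.
Qed.

(** The smoothing is moved from the covariance f to the translation of one argument. *)
Lemma smooth_convE s t z psi a : 0 < s -> 0 < t -> gdom t z psi ->
  \int[L]_b (psi b * smooth f s (a - b)) =
  \int[L]_w (heat_kernel s w * conv_f psi (a - w)).
Proof.
move=> s0 t0 gq; have [mq _] := gq; have [K hK] := conv_f_le t0 gq.
pose F (p : Rd * Rd) := psi p.1 * (f (a - p.1 - p.2) * heat_kernel s p.2).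
have mF : measurable_fun setT F.
  apply: measurable_funM; first exact: measurableT_comp mq measurable_fst.
  apply: measurable_funM; last exact: measurableT_comp (@measurable_heat_kernel _ _ _) measurable_snd.
  by apply: measurable_f_sub => //; exact: measurable_rVB.
have reflE (b w : Rd) : f (a - b - w) * heat_kernel s w =
    f (a - b - w) * heat_kernel s (a - b - (a - b - w)).
  by have -> : a - b - (a - b - w) = w by rewrite opprB addrC subrK.
pose G (b v : Rd) := f v * heat_kernel s (a - b - v).
have mG b : measurable_fun setT (G b).
  apply: measurable_funM => //; apply: (measurableT_comp (@measurable_heat_kernel _ _ _)).
  exact: measurable_rVB.
have iG b : L.-integrable setT (EFin \o (fun w => f (a - b - w) * heat_kernel s w)).
  apply: integrable_ge0.
  - apply: measurable_funM; last exact: measurable_heat_kernel.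
    by apply: measurable_f_sub => //; exact: measurable_cst.
  - by move=> w; rewrite mulr_ge0 ?heat_kernel_ge0.
  have [si _] := smoothE mu_f (a - b) s0.
  have G0 v : 0 <= G b v by rewrite mulr_ge0 ?heat_kernel_ge0.
  have := integrable_ge0_lty G0 si.
  rewrite -(@ge0_int_rV_refl R d (fun v => (G b v)%:E) (a - b)); last 2 first.
  - exact/measurable_EFinP.
  - by move=> v; rewrite lee_fin.
  rewrite [in X in X -> _](eq_integral (fun w : Rd => (f (a - b - w) * heat_kernel s w)%:E))//.
  by move=> w _; rewrite reflE.
have [|||Fi e] := @Rint_swap_iter _ _ _ _ R L L F (fun w => K * heat_kernel s w) mF _ _ _ (Rint_integrableZ K (heat_kernel_integrable _ s0)).
- by move=> b; rewrite /F/=; apply: Rint_integrableZ.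
- move=> w; have := Rint_integrableZ (heat_kernel s w) (conv_f_integrable (a - w) t0 gq).
  apply: eq_integrable => // b _ /=; congr EFin; rewrite /F/= mulrC -mulrA; congr (_ * (f _ * _)).
  by rewrite addrAC.
- move=> w; rewrite (_ : \int[L]_x _ = \int[L]_b (heat_kernel s w * `|psi b * f (a - w - b)|)).
    rewrite RintegralZl//; first by rewrite mulrC ler_wpM2r ?heat_kernel_ge0.
    by apply: integrable_norm; exact: (conv_f_integrable (a - w) t0 gq).
  apply: eq_Rintegral => b _; rewrite /F/= mulrA normrM mulrC (ger0_norm (heat_kernel_ge0 _ _)).
  by rewrite addrAC.
transitivity (\int[L]_b \int[L]_w F (b, w)).
  apply: eq_Rintegral => b _; apply/esym.
  apply: (etrans (RintegralZl (psi b) measurableT (iG b))); congr (_ * _).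
  apply: etrans (Rint_rV_refl (a - b) (mG b)).
  by apply: eq_Rintegral => w _; rewrite /G reflE.
rewrite e; apply: eq_Rintegral => w _.
apply: etrans (RintegralZl (heat_kernel s w) measurableT (conv_f_integrable (a - w) t0 gq)).
by apply: eq_Rintegral => b _; rewrite /F/= addrAC; ring.
Qed.

End parseval.

Section parseval_sets.
Variables (R : realType) (d : nat).
Local Notation Rd := 'rV[R]_d.
Local Notation L := (lebesgue_rV R d).
Variables (mu : {sigma_finite_measure set Rd -> \bar R}) (f : Rd -> R).
Hypotheses (mu_tempered : tempered mu) (f_ge0 : forall x, 0 <= f x)
  (mu_f : is_fourier_transform mu f).
Local Notation conv_f := (conv_f f).
Local Notation fform := (fform f).

Let mf : measurable_fun setT f := measurable_f mu_f.

Let conv_bound t z phi (t0 : 0 < t) (gp : gdom t z phi) :=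
  conv_f_norm_le mu_tempered f_ge0 mu_f t0 gp.

Let fform_int t z phi psi (t0 : 0 < t) (ip : L.-integrable setT (EFin \o phi))
  (gq : gdom t z psi) := fform_integrable mu_tempered f_ge0 mu_f t0 ip gq.

(** With smooth_convE, smoothing f amounts to averaging the translates of the covariance
    form against an approximate identity. *)
Lemma parseval_heat s t z phi psi : 0 < s -> 0 < t ->
  gdom t z phi -> gdom t z psi ->
  \int[mu]_xi (hw s xi * fprod phi psi xi) =
  \int[L]_w (heat_kernel s w * \int[L]_a (phi a * conv_f psi (a - w))).
Proof.
move=> s0 t0 gp gq; have ip := gdom_integrable t0 gp; have iq := gdom_integrable t0 gq.
have mp := integrable_measurable ip; have mq := integrable_measurable iq.
have [K hK] := conv_bound t0 gq.
rewrite -(smooth_parseval mu_tempered f_ge0 mu_f s0 ip iq).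
pose F (p : Rd * Rd) := phi p.1 * (heat_kernel s p.2 * conv_f psi (p.1 - p.2)).
have mc : measurable_fun setT (fun p : Rd * Rd => conv_f psi (p.1 - p.2)).
  by apply: (measurableT_comp (measurable_conv_f mu_f mq)); exact: measurable_rVB.
have mF : measurable_fun setT F.
  apply: measurable_funM; first exact: measurableT_comp mp measurable_fst.
  by apply: measurable_funM => //; exact: measurableT_comp (@measurable_heat_kernel _ _ _) measurable_snd.
have hF (x y : Rd) : `|F (x, y)| <= `|phi x| * (K * heat_kernel s y).
  rewrite /F normrM ler_wpM2l// normrM (ger0_norm (heat_kernel_ge0 _ _)) mulrC.
  by rewrite ler_wpM2r ?heat_kernel_ge0.
have [_ e1 e2] := @Rint_swap _ _ _ _ R L L F _ _ mF hF (integrable_norm ip)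
  (Rint_integrableZ K (heat_kernel_integrable _ s0)).
have hc (a : Rd) : L.-integrable setT (EFin \o (fun w => heat_kernel s w * conv_f psi (a - w))).
  apply: (@dom_integrable _ _ _ L _ (fun w => K * heat_kernel s w)).
  - apply: measurable_funM; first exact: measurable_heat_kernel.
    exact: (measurable_sec1 a mc).
  - by move=> w; rewrite normrM (ger0_norm (heat_kernel_ge0 _ _)) mulrC ler_wpM2r ?heat_kernel_ge0.
  - by apply: Rint_integrableZ; exact: heat_kernel_integrable.
transitivity (\int[L]_a \int[L]_w F (a, w)).
  apply: eq_Rintegral => a _.
  transitivity (phi a * \int[L]_b (psi b * smooth f s (a - b))).
    rewrite -RintegralZl//; last exact: (smooth_conv_integrable mu_tempered f_ge0 mu_f a s0 iq).
    by apply: eq_Rintegral => b _; rewrite mulrA.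
  by rewrite (smooth_convE mu_tempered f_ge0 mu_f a s0 t0 gq) -RintegralZl.
rewrite e1 -e2; apply: eq_Rintegral => w _.
rewrite -RintegralZl//; first by apply: eq_Rintegral => a _; rewrite /F/=; ring.
apply: (@dom_integrable _ _ _ L _ (fun a => K * `|phi a|)).
- by apply: measurable_funM => //; exact: (measurable_sec2 w mc).
- by move=> a; rewrite normrM mulrC ler_wpM2r.
- by apply: Rint_integrableZ; exact: integrable_norm.
Qed.

(** Translating an indicator changes it on two sets of vanishing measure, and the
    convolution of f with a dominated function is bounded. *)
Lemma conv_indic_cvg t z (A : set Rd) psi (w_ : nat -> Rd) : 0 < t ->
  measurable A -> bounded_set A -> gdom t z psi ->
  w_ n @[n --> \oo] --> (0 : Rd) ->
  \int[L]_a (\1_A a * conv_f psi (a - w_ n)) @[n --> \oo] --> fform \1_A psi.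
Proof.
move=> t0 mA bA gq wc; have [K hK] := conv_bound t0 gq.
have mq : measurable_fun setT psi by case: gq.
have mc := measurable_conv_f mu_f mq.
have K0 : 0 <= K by exact: le_trans (hK 0).
pose X (w : Rd) := excess A (- w); pose Y (w : Rd) := [set x | ~ A x /\ A (x + w)].
have YE (w : Rd) : Y w = [set x | ~ A x /\ A (x - (- w))].
  by apply/seteqP; split => x /=; rewrite opprK.
have mX w : measurable (X w) by exact: measurable_excess.
have mY w : measurable (Y w).
  rewrite YE; apply: measurableI; first exact: measurableC.
  exact: measurable_shift.
have LY w : L (Y w) = L (excess A w).
  by rewrite YE (excess_rev (- w) mA) opprK.
have fin (w : Rd) : (L (excess A w) < +oo)%E.
  apply: le_lt_trans (lebesgue_rV_bounded mA bA).
  by apply: le_measure; rewrite ?inE//; [exact: measurable_excess|move=> x []].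
have i1 (B : set Rd) : measurable B -> (L B < +oo)%E ->
    L.-integrable setT (EFin \o (\1_B : Rd -> R)).
  move=> mB fB; apply: integrable_ge0.
  - exact: measurable_indic.
  - by move=> x; rewrite indicE ler0n.
  - by rewrite integral_indic// setIT.
have Rb (B : set Rd) : measurable B -> \int[L]_x (\1_B x) = fine (L B).
  by move=> mB; rewrite /Rintegral integral_indic// setIT.
have iA := gdom_integrable t0 (gdom_indic z t0 mA bA).
have step (w : Rd) : `|\int[L]_a (\1_A a * conv_f psi (a - w)) - fform \1_A psi| <=
    K * (fine (L (excess A (- w))) + fine (L (excess A w))).
  have m1 : measurable_fun setT (fun a : Rd => \1_A a * conv_f psi (a - w)).
    apply: measurable_funM; first exact: measurable_indic.
    by apply: (measurableT_comp mc); apply: measurable_rVB => //; exact: measurable_cst.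
  have i2 : L.-integrable setT (EFin \o (fun a : Rd => \1_A (a + w) * conv_f psi a)).
    apply: (fform_int (t := t) (z := z) t0 _ gq).
    apply: i1; first by have := measurable_shift (- w) mA; rewrite /=; congr measurable;
      apply/seteqP; split => x /=; rewrite opprK.
    by rewrite lebesgue_rV_shift//; exact: lebesgue_rV_bounded.
  rewrite -(Rint_rVD w m1).
  have -> : \int[L]_v (\1_A (v + w) * conv_f psi (v + w - w)) =
      \int[L]_v (\1_A (v + w) * conv_f psi v).
    by apply: eq_Rintegral => v _; rewrite addrK.
  rewrite /fform -RintegralB//; last exact: (fform_int t0 iA gq).
  apply: le_trans (le_normr_Rintegral measurableT _) _.
    exact: (Rint_integrableB i2 (fform_int t0 iA gq)).
  have iXY := Rint_integrableD (i1 _ (mX w) (fin (- w))) (i1 _ (mY w) (eq_ind_r (fun x => (x < +oo)%E) (fin w) (LY w))).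
  rewrite -(LY w) -[excess A (- w)]/(X w) -(Rb _ (mX w)) -(Rb _ (mY w)).
  rewrite -(RintegralD measurableT (i1 _ (mX w) (fin (- w)))); last by apply: i1 => //; rewrite LY.
  rewrite -(RintegralZl K measurableT iXY); apply: le_Rintegral => //.
  - apply: integrable_norm; exact: (Rint_integrableB i2 (fform_int t0 iA gq)).
  - exact: Rint_integrableZ.
  move=> a _; rewrite -mulrBl normrM mulrC; apply: ler_pM => //.
  rewrite !indicE /X /Y /excess opprK.
  have [Aw|Aw] := boolP (a + w \in A); have [Aa|Aa] := boolP (a \in A).
  - by rewrite subrr normr0 addr_ge0 ?ler0n.
  - rewrite (_ : a \in [set x | ~ A x /\ A (x + w)])//; last first.
      by apply/mem_set; split; [move/mem_set; apply/negP|exact/set_mem].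
    by rewrite subr0 normr1 lerDr ler0n.
  - rewrite (_ : a \in [set x | A x /\ ~ A (x + w)])//; last first.
      by apply/mem_set; split; [exact/set_mem|move/mem_set; apply/negP].
    by rewrite sub0r normrN normr1 lerDl ler0n.
  - by rewrite subrr normr0 addr_ge0 ?ler0n.
have E (v_ : nat -> Rd) : v_ n @[n --> \oo] --> (0 : Rd) ->
    fine (L (excess A (v_ n))) @[n --> \oo] --> (0 : R).
  by move=> vc; have := excess_cvg0 mA bA vc; move=> /fine_cvg.
apply/cvgrPdist_le => e e0.
have : K * (fine (L (excess A (- w_ n))) + fine (L (excess A (w_ n)))) @[n --> \oo] --> K * (0 + 0).
  apply: cvgMr; apply: cvgD; last exact: E.
  by apply: (E (fun n => - w_ n)); rewrite -[X in _ --> X]oppr0; exact: cvgN.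
rewrite addr0 mulr0 => /cvgrPdist_le/(_ e e0); apply: filterS => n.
rewrite sub0r normrN => h; rewrite distrC; apply: le_trans (step _) _.
exact: le_trans (ler_norm _) h.
Qed.

Lemma parseval_heat_cvg t z (A : set Rd) psi : 0 < t ->
  measurable A -> bounded_set A -> gdom t z psi ->
  \int[mu]_xi (hw n.+1%:R^-1 xi * fprod \1_A psi xi) @[n --> \oo] --> fform \1_A psi.
Proof.
move=> t0 mA bA gq; have gA := gdom_indic z t0 mA bA; have iA := gdom_integrable t0 gA.
have mq : measurable_fun setT psi by case: gq.
have mc := measurable_conv_f mu_f mq.
have [K hK] := conv_bound t0 gq.
pose Phi (w : Rd) := \int[L]_a (\1_A a * conv_f psi (a - w)).
have -> : (fun n : nat => \int[mu]_xi (hw n.+1%:R^-1 xi * fprod \1_A psi xi)) =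
    (fun n => \int[L]_w (heat_kernel n.+1%:R^-1 w * Phi w)).
  by apply/funext => n; apply: (parseval_heat _ t0 gA gq); rewrite invr_gt0.
have -> : fform \1_A psi = Phi 0.
  by apply: eq_Rintegral => a _; rewrite subr0.
have mm : measurable_fun setT (fun p : Rd * Rd => \1_A p.2 * conv_f psi (p.2 - p.1)).
  apply: measurable_funM; first exact: measurableT_comp (measurable_indic mA) measurable_snd.
  by apply: (measurableT_comp mc); exact: measurable_rVB.
apply: (@approximate_identity R d Phi (K * \int[L]_a `|\1_A a|)).
- exact: (measurable_Rint2 L mm).
- move=> w; have iw : L.-integrable setT (EFin \o (fun a => \1_A a * conv_f psi (a - w))).
    apply: (@dom_integrable _ _ _ L _ (fun a => K * `|\1_A a|)).
    + exact: (measurable_sec1 w mm).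
    + by move=> a; rewrite normrM mulrC ler_wpM2r.
    + by apply: Rint_integrableZ; exact: integrable_norm.
  apply: le_trans (le_normr_Rintegral measurableT iw) _.
  rewrite -(RintegralZl K measurableT (integrable_norm iA)); apply: le_Rintegral => //.
  + exact: integrable_norm iw.
  + by apply: Rint_integrableZ; exact: integrable_norm iA.
  + by move=> a _; rewrite normrM mulrC ler_wpM2r.
- move=> w_ wc; have -> : Phi 0 = fform \1_A psi.
    by apply: eq_Rintegral => a _; rewrite subr0.
  exact: (conv_indic_cvg t0 mA bA gq wc).
Qed.

Lemma hw_cvg1 (xi : Rd) : hw n.+1%:R^-1 xi @[n --> \oo] --> (1 : R).
Proof.
have e1 : expR (- (0 * sqnorm xi / 2)) = 1 by rewrite !mul0r oppr0 expR0.
have h : - (n.+1%:R^-1 * sqnorm xi / 2) @[n --> \oo] --> - (0 * sqnorm xi / 2).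
  by apply: cvgN; do 2 apply: cvgMl; exact: cvg_harmonic.
by rewrite -[X in _ --> X]e1; apply: continuous_cvg h; exact: continuous_expR.
Qed.

Lemma hw_le1 s (xi : Rd) : 0 < s -> hw s xi <= 1.
Proof.
move=> s0; rewrite /hw -expR0 ler_expR oppr_le0 !mulr_ge0 ?sqnorm_ge0 ?(ltW s0)//.
Qed.

Lemma fprod_ge0 (phi : Rd -> R) xi : 0 <= fprod phi phi xi.
Proof. by rewrite /fprod addr_ge0// -expr2 sqr_ge0. Qed.

(** By Fatou's lemma as the smoothing vanishes: the right-hand side of the smoothed
    identity converges, and the left-hand side has a nonnegative integrand. *)
Lemma fprod_indic_integrable (A : set Rd) : measurable A -> bounded_set A ->
  mu.-integrable setT (EFin \o fprod \1_A \1_A).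
Proof.
move=> mA bA; have gA := gdom_indic 0 (@ltr01 R) mA bA.
have mfp := measurable_fprod (measurable_indic (R := R) mA) (measurable_indic (R := R) mA).
apply: integrable_ge0 => //; first exact: fprod_ge0.
have hc := parseval_heat_cvg (@ltr01 R) mA bA gA.
have hE : ((\int[mu]_xi (hw n.+1%:R^-1 xi * fprod \1_A \1_A xi)%R)%:E @[n --> \oo] --> (fform \1_A \1_A)%:E)%E.
  by apply: cvg_EFin => //; exact: nearW.
apply: le_lt_trans (ltry (fform \1_A \1_A)).
apply: (ge0_fatou (f_ := fun n xi => hw n.+1%:R^-1 xi * fprod \1_A \1_A xi) _ _ _ _ _ hE) => //.
- by move=> n; apply: measurable_funM => //; exact: measurable_hw.
- by move=> n xi; rewrite mulr_ge0 ?hw_ge0 ?fprod_ge0.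
- by apply: aeW => xi; rewrite -[X in _ --> X]mul1r; apply: cvgMl; exact: hw_cvg1.
move=> n; rewrite EFin_Rintegral//.
have ip := gdom_integrable ltr01 gA.
apply: (@dom_integrable _ _ _ mu _ (fun xi => (2 * (\int[L]_x `|\1_A x|) ^+ 2) * hw n.+1%:R^-1 xi)).
- by apply: measurable_funM => //; exact: measurable_hw.
- move=> xi; rewrite normrM (ger0_norm (hw_ge0 _ _)) mulrC ler_wpM2r ?hw_ge0//.
  rewrite ger0_norm ?fprod_ge0// /fprod mulr_natl mulr2n.
  have h th : ftr th \1_A xi * ftr th \1_A xi <= (\int[L]_x `|\1_A x|) ^+ 2.
    rewrite -expr2 -[leLHS]real_normK ?num_real// lerXn2r ?nnegrE ?ftr_le//.
    by apply: Rintegral_ge0.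
  exact: lerD.
- apply: Rint_integrableZ; apply: (hw_integrable mu_tempered); by rewrite invr_gt0.
Qed.

(** The smoothed identity passes to the limit: the diagonal cases dominate the product
    of two transforms by the Cauchy-Schwarz inequality. *)
Lemma parseval_indic (A B : set Rd) : measurable A -> bounded_set A ->
  measurable B -> bounded_set B ->
  mu.-integrable setT (EFin \o fprod \1_A \1_B) /\
  \int[mu]_xi fprod \1_A \1_B xi = fform \1_A \1_B.
Proof.
move=> mA bA mB bB; have iA := fprod_indic_integrable mA bA.
have iB := fprod_indic_integrable mB bB; have iAB := Rint_integrableD iA iB.
have mfp := measurable_fprod (measurable_indic (R := R) mA) (measurable_indic (R := R) mB).
have le xi : `|fprod \1_A \1_B xi| <= fprod \1_A \1_A xi + fprod \1_B \1_B xi.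
  rewrite /fprod; set a := ftr _ _ _; set b := ftr _ _ _; set c := ftr _ _ _; set e := ftr _ _ _.
  have h (u v : R) : `|u| ^+ 2 = u ^+ 2 by rewrite real_normK ?num_real.
  rewrite ler_norml; have := sqr_ge0 (a + b); have := sqr_ge0 (a - b).
  have := sqr_ge0 (c - e); have := sqr_ge0 (c + e).
  have := sqr_ge0 a; have := sqr_ge0 b; have := sqr_ge0 c; have := sqr_ge0 e.
  by move=> *; apply/andP; split; nra.
have hc := parseval_heat_cvg (@ltr01 R) mA bA (gdom_indic 0 (@ltr01 R) mB bB).
have [|||||i c] := @Rint_cvg _ _ R mu (fun n xi => hw n.+1%:R^-1 xi * fprod \1_A \1_B xi)
  (fprod \1_A \1_B) (fun xi => fprod \1_A \1_A xi + fprod \1_B \1_B xi) => //.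
- by move=> n; apply: measurable_funM => //; exact: measurable_hw.
- by apply: aeW => xi; rewrite -[X in _ --> X]mul1r; apply: cvgMl; exact: hw_cvg1.
- move=> n xi; rewrite normrM (ger0_norm (hw_ge0 _ _)); apply: le_trans (le xi).
  by rewrite ler_piMl// hw_le1// invr_gt0.
split => //.
exact: (cvg_unique (@Rhausdorff R) c hc).
Qed.

End parseval_sets.

Section step_approximation.
Import HBNNSimple.
Variables (R : realType) (d : nat).
Local Notation Rd := 'rV[R]_d.
Local Notation L := (lebesgue_rV R d).

(** Formal combinations of cylinders also serve as spatial step functions, whose
    time components are then ignored. *)
Definition space_fun (e : elementary R d) (x : Rd) : R :=
  \sum_(c <- e) c.1 * \1_(cyl_base c.2) x.

(** Dyadic approximation from below, cut off by large balls to get bounded level sets. *)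
Lemma step_approx (p : Rd -> R) : measurable_fun setT p -> (forall x, 0 <= p x) ->
  exists e_ : nat -> elementary R d,
    [/\ forall k x, 0 <= space_fun (e_ k) x, forall k x, space_fun (e_ k) x <= p x &
        forall x, space_fun (e_ k) x @[k --> \oo] --> p x].
Proof.
move=> mp p0.
have mE : measurable_fun setT (EFin \o p) by exact/measurable_EFinP.
have E0 x : [set: Rd] x -> (0 <= (EFin \o p) x)%E by move=> _; rewrite lee_fin.
pose a k := nnsfun_approx measurableT mE k.
pose box (k : nat) : set Rd := [set x | sqnorm x <= k%:R].
have mbox k : measurable (box k).
  have mb : measurable_fun setT (fun x : Rd => sqnorm x <= k%:R).
    by apply: measurable_fun_ler; [exact: measurable_sqnorm|exact: measurable_cst].
  by have := mb measurableT [set true] I; rewrite setTI.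
have bbox k : bounded_set (box k).
  exists (Num.sqrt k%:R); split => [|M kM x /= bx]; first exact: num_real.
  have M0 : 0 <= M by exact: le_trans (sqrtr_ge0 _) (ltW kM).
  apply: (le_trans _ (ltW kM)); rewrite [leLHS]mx_normrE.
  apply: bigmax_le => [|[i j] _]; first exact: sqrtr_ge0.
  rewrite (ord1 i)/= -(ler_pXn2r (n := 2))// ?nnegrE ?sqrtr_ge0//.
  rewrite real_normK ?num_real// sqr_sqrtr ?ler0n//.
  exact: le_trans (coord_sq_le _ _) bx.
have mlev k y : measurable (a k @^-1` [set y] `&` box k).
  by apply: measurableI => //; rewrite -[X in measurable X]setTI; exact: measurable_funPT.
have blev k y : bounded_set (a k @^-1` [set y] `&` box k).
  by have [M [Mr hM]] := bbox k; exists M; split => // N MN x [_ bx]; exact: (hM N MN).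
pose s k := fset_set (range (a k)).
pose cyl k y : cylinder R d := Cylinder (lexx 0) (mlev k y) (blev k y).
pose e_ k : elementary R d := [seq (y, cyl k y) | y <- finmap.enum_fset (s k)].
have eE k x : space_fun (e_ k) x = a k x * \1_(box k) x.
  rewrite /space_fun big_map /=.
  have := fimfunE (a k) x; rewrite fsbig_finite//= => ->.
  rewrite mulr_suml; apply: eq_bigr => y _.
  by rewrite indicI/= mulrA.
exists e_; split.
- by move=> k x; rewrite eE mulr_ge0// indicE ler0n.
- move=> k x; rewrite eE indicE; apply: (@le_trans _ _ (a k x)).
    by case: (x \in box k); rewrite ?mulr1 ?mulr0.
  have := @le_approx _ _ R setT (EFin \o p) k x E0 I; rewrite /a nnsfun_approxE.
  by rewrite lee_fin.
- move=> x.
  have ac : a k x @[k --> \oo] --> p x.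
    have := @cvg_approx _ _ R setT (EFin \o p) x E0 I (ltry _).
    by under eq_fun do rewrite -(nnsfun_approxE measurableT mE).
  apply: cvg_trans ac; apply: near_eq_cvg.
  exists (Num.truncn (sqnorm x)).+1 => // k /= kx.
  rewrite eE indicE mem_set ?mulr1// /box/=.
  by rewrite ltW// (lt_le_trans (truncnS_gt _))// ler_nat.
Qed.

End step_approximation.

Section step_functions.
Variables (R : realType) (d : nat).
Local Notation Rd := 'rV[R]_d.
Local Notation L := (lebesgue_rV R d).

Definition elem_sub (e e' : elementary R d) : elementary R d :=
  e ++ [seq (- c.1, c.2) | c <- e'].

Lemma space_fun_sub e e' (x : Rd) :
  space_fun (elem_sub e e') x = space_fun e x - space_fun e' x.
Proof.
rewrite /space_fun /elem_sub big_cat big_map /= -sumrN; congr (_ + _).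
by apply: eq_bigr => c _; rewrite mulNr.
Qed.

Lemma space_fun_cons c (e : elementary R d) (x : Rd) :
  space_fun (c :: e) x = c.1 * \1_(cyl_base c.2) x + space_fun e x.
Proof. by rewrite /space_fun big_cons. Qed.

Lemma space_fun_nil : space_fun [::] = (fun=> 0 : R) :> (Rd -> R).
Proof. by apply/funext => x; rewrite /space_fun big_nil. Qed.

Lemma gdom0 t z : gdom t z (fun _ : Rd => 0 : R).
Proof. by split => //; exists 0 => x; rewrite normr0 mul0r. Qed.

Lemma gdom_base t z (c : cylinder R d) : 0 < t -> gdom t z (\1_(cyl_base c) : Rd -> R).
Proof. by move=> t0; apply: gdom_indic => //; [exact: cyl_measurable|exact: cyl_bounded]. Qed.

Lemma gdom_space_fun t z (e : elementary R d) : 0 < t -> gdom t z (space_fun e).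
Proof.
move=> t0; elim: e => [|c e IH]; first by rewrite space_fun_nil; exact: gdom0.
have -> : space_fun (c :: e) = (fun x => c.1 * \1_(cyl_base c.2) x + space_fun e x).
  by apply/funext => x; rewrite space_fun_cons.
by apply: gdomD => //; apply: gdomZ; exact: gdom_base.
Qed.

Lemma ftr_lin th c (phi psi : Rd -> R) xi :
  L.-integrable setT (EFin \o phi) -> L.-integrable setT (EFin \o psi) ->
  ftr th (fun x => c * phi x + psi x) xi = c * ftr th phi xi + ftr th psi xi.
Proof.
move=> i1 i2; rewrite -ftrZ// /ftr -RintegralD//; try exact: cos_integrable.
  by apply: eq_Rintegral => x _; ring.
by apply: cos_integrable; exact: Rint_integrableZ.
Qed.

Lemma fprod_linl c (phi phi' psi : Rd -> R) xi :
  L.-integrable setT (EFin \o phi) -> L.-integrable setT (EFin \o phi') ->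
  fprod (fun x => c * phi x + phi' x) psi xi = c * fprod phi psi xi + fprod phi' psi xi.
Proof. by move=> i1 i2; rewrite /fprod !ftr_lin//; ring. Qed.

Lemma fprod_linr c (phi phi' psi : Rd -> R) xi :
  L.-integrable setT (EFin \o phi) -> L.-integrable setT (EFin \o phi') ->
  fprod psi (fun x => c * phi x + phi' x) xi = c * fprod psi phi xi + fprod psi phi' xi.
Proof. by move=> i1 i2; rewrite /fprod !ftr_lin//; ring. Qed.

Variables (mu : {sigma_finite_measure set Rd -> \bar R}) (f : Rd -> R).
Hypotheses (mu_tempered : tempered mu) (f_ge0 : forall x, 0 <= f x)
  (mu_f : is_fourier_transform mu f).
Local Notation conv_f := (conv_f f).
Local Notation fform := (fform f).

Let mf : measurable_fun setT f := measurable_f mu_f.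

Let conv_int t z phi a (t0 : 0 < t) (gp : gdom t z phi) :=
  conv_f_integrable f_ge0 mu_f a t0 gp.

Let fform_int t z phi psi (t0 : 0 < t) (gp : gdom t z phi)
  (gq : gdom t z psi) := fform_integrable mu_tempered f_ge0 mu_f t0 (gdom_integrable t0 gp) gq.

Definition parseval (phi psi : Rd -> R) : Prop :=
  mu.-integrable setT (EFin \o fprod phi psi) /\
  \int[mu]_xi fprod phi psi xi = fform phi psi.

Lemma conv_f_lin t z c phi psi a : 0 < t -> gdom t z phi -> gdom t z psi ->
  conv_f (fun x => c * phi x + psi x) a = c * conv_f phi a + conv_f psi a.
Proof.
move=> t0 gp gq; have ip := conv_int a t0 gp; have iq := conv_int a t0 gq.
rewrite /conv_f -RintegralZl// -RintegralD//; last exact: Rint_integrableZ.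
by apply: eq_Rintegral => b _; ring.
Qed.

Lemma parseval_linl t z c phi phi' psi : 0 < t ->
  gdom t z phi -> gdom t z phi' -> gdom t z psi ->
  parseval phi psi -> parseval phi' psi -> parseval (fun x => c * phi x + phi' x) psi.
Proof.
move=> t0 g1 g2 g3 [i1 e1] [i2 e2].
have E xi : fprod (fun x => c * phi x + phi' x) psi xi = c * fprod phi psi xi + fprod phi' psi xi.
  by apply: fprod_linl; [exact: gdom_integrable t0 g1|exact: gdom_integrable t0 g2].
have i3 := Rint_integrableD (Rint_integrableZ c i1) i2.
split; first by move: i3; apply: eq_integrable => // xi _ /=; rewrite E.
transitivity (\int[mu]_xi (c * fprod phi psi xi + fprod phi' psi xi)).
  by apply: eq_Rintegral => xi _; exact: E.
rewrite (RintegralD measurableT (Rint_integrableZ c i1) i2) (RintegralZl c measurableT i1) e1 e2.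
have j1 := fform_int t0 g1 g3; have j2 := fform_int t0 g2 g3.
rewrite /fform -(RintegralZl c measurableT j1) -(RintegralD measurableT (Rint_integrableZ c j1) j2).
by apply: eq_Rintegral => a _; ring.
Qed.

Lemma parseval_linr t z c phi phi' psi : 0 < t ->
  gdom t z phi -> gdom t z phi' -> gdom t z psi ->
  parseval psi phi -> parseval psi phi' -> parseval psi (fun x => c * phi x + phi' x).
Proof.
move=> t0 g1 g2 g3 [i1 e1] [i2 e2].
have E xi : fprod psi (fun x => c * phi x + phi' x) xi = c * fprod psi phi xi + fprod psi phi' xi.
  by apply: fprod_linr; [exact: gdom_integrable t0 g1|exact: gdom_integrable t0 g2].
have i3 := Rint_integrableD (Rint_integrableZ c i1) i2.
split; first by move: i3; apply: eq_integrable => // xi _ /=; rewrite E.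
transitivity (\int[mu]_xi (c * fprod psi phi xi + fprod psi phi' xi)).
  by apply: eq_Rintegral => xi _; exact: E.
rewrite (RintegralD measurableT (Rint_integrableZ c i1) i2) (RintegralZl c measurableT i1) e1 e2.
have j1 := fform_int t0 g3 g1; have j2 := fform_int t0 g3 g2.
rewrite /fform -(RintegralZl c measurableT j1) -(RintegralD measurableT (Rint_integrableZ c j1) j2).
by apply: eq_Rintegral => a _; rewrite (conv_f_lin c a t0 g1 g2); ring.
Qed.

Lemma parseval0l psi : parseval (fun _ : Rd => 0) psi.
Proof.
have Z (g : Rd -> R) : fprod (fun _ : Rd => 0) g = cst 0.
  have z th xi : ftr th (fun _ : Rd => 0 : R) xi = 0.
    by rewrite /ftr /Rintegral integral0_eq// => x _; rewrite mulr0.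
  by apply/funext => xi; rewrite /fprod !z !mul0r addr0.
rewrite /parseval Z; split; first exact: integrable0.
by rewrite /fform /Rintegral !integral0_eq// => x _; rewrite mul0r.
Qed.

Lemma parseval0r psi : parseval psi (fun _ : Rd => 0).
Proof.
have Z (g : Rd -> R) : fprod g (fun _ : Rd => 0) = cst 0.
  have z th xi : ftr th (fun _ : Rd => 0 : R) xi = 0.
    by rewrite /ftr /Rintegral integral0_eq// => x _; rewrite mulr0.
  by apply/funext => xi; rewrite /fprod !z !mulr0 addr0.
rewrite /parseval Z; split; first exact: integrable0.
rewrite /fform /Rintegral !integral0_eq// => x _.
by rewrite /conv_f /Rintegral integral0_eq ?mulr0// => y _; rewrite mul0r.
Qed.

Lemma parseval_space_fun e e' : parseval (space_fun e) (space_fun e').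
Proof.
have t0 := @ltr01 R; have g e0 := gdom_space_fun 0 e0 t0; have gb c := gdom_base 0 c t0.
elim: e => [|c e IH]; first by rewrite space_fun_nil; exact: parseval0l.
have -> : space_fun (c :: e) = (fun x => c.1 * \1_(cyl_base c.2) x + space_fun e x).
  by apply/funext => x; rewrite space_fun_cons.
apply: (parseval_linl c.1 t0 (gb _) (g e) (g e')) => //.
elim: e' {IH} => [|c' e' IH]; first by rewrite space_fun_nil; exact: parseval0r.
have -> : space_fun (c' :: e') = (fun x => c'.1 * \1_(cyl_base c'.2) x + space_fun e' x).
  by apply/funext => x; rewrite space_fun_cons.
apply: (parseval_linr c'.1 t0 (gb _) (g e') (gb _) _ IH).
by apply: (parseval_indic mu_tempered f_ge0 mu_f); [exact: cyl_measurable|exact: cyl_bounded|exact: cyl_measurable|exact: cyl_bounded].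
Qed.

Lemma fform_cvg t z (phi_ : nat -> Rd -> R) (phi psi : Rd -> R) : 0 < t -> gdom t z psi ->
  (forall k, measurable_fun setT (phi_ k)) -> measurable_fun setT phi ->
  (forall x, phi_ k x @[k --> \oo] --> phi x) ->
  (forall k x, `|phi_ k x| <= psi x) ->
  fform (phi_ k) (phi_ k) @[k --> \oo] --> fform phi phi.
Proof.
move=> t0 gq mp_ mp cp pp.
have psi0 x : 0 <= psi x by apply: le_trans (pp 0 x).
have mq : measurable_fun setT psi by case: gq.
have cc a : conv_f (phi_ k) a @[k --> \oo] --> conv_f phi a.
  have mfa : measurable_fun setT (fun b : Rd => f (a - b)).
    by apply: (measurable_f_sub mu_f) => //; exact: measurable_cst.
  have [|||||_] := @Rint_cvg _ _ R L (fun k b => phi_ k b * f (a - b)) (fun b => phi b * f (a - b))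
    (fun b => psi b * f (a - b)) => //.
  - by move=> k; exact: measurable_funM.
  - exact: measurable_funM.
  - by apply: aeW => b; apply: cvgMl; exact: cp.
  - exact: (conv_int a t0 gq).
  - by move=> k b; rewrite normrM (ger0_norm (f_ge0 _)) ler_wpM2r.
have gk k : gdom t z (phi_ k).
  by apply: (gdom_le (mp_ k) gq) => x; apply: le_trans (pp k x) (ler_norm _).
have [|||||_] := @Rint_cvg _ _ R L (fun k a => phi_ k a * conv_f (phi_ k) a) (fun a => phi a * conv_f phi a)
    (fun a => psi a * conv_f psi a) => //.
- by move=> k; apply: measurable_funM => //; exact: (measurable_conv_f mu_f).
- by apply: measurable_funM => //; exact: (measurable_conv_f mu_f).
- by apply: aeW => a; apply: cvgM; [exact: cp|exact: cc].
- exact: (fform_int t0 gq gq).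
- move=> k a; rewrite normrM ler_pM//.
  apply: le_trans (le_normr_Rintegral measurableT (conv_int a t0 (gk k))) _.
  apply: le_Rintegral => //.
  + by apply: integrable_norm; exact: (conv_int a t0 (gk k)).
  + exact: (conv_int a t0 gq).
  + by move=> b _; rewrite normrM (ger0_norm (f_ge0 _)) ler_wpM2r.
Qed.

(** Step functions are dense: first let the inner index go to infinity, on the
    spectral side by Fatou's lemma, on the spatial side by domination. *)
Lemma heat_kernel_step_approx t z : 0 < t -> exists e_ : nat -> elementary R d,
  (\int[mu]_xi (fprod (fun y => heat_kernel t (z - y) - space_fun (e_ k) y)
     (fun y => heat_kernel t (z - y) - space_fun (e_ k) y) xi)%:E @[k --> \oo] --> 0)%E.
Proof.
move=> t0; pose p (y : Rd) := heat_kernel t (z - y).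
have gp : gdom t z p := gdom_heat_kernel t z; have [mp _] := gp.
have p0 y : 0 <= p y by exact: heat_kernel_ge0.
have [e_ [e0 ep ec]] := step_approx mp p0.
have ge k : gdom t z (space_fun (e_ k)) := gdom_space_fun z (e_ k) t0.
have me k : measurable_fun setT (space_fun (e_ k)) by case: (ge k).
have ip := gdom_integrable t0 gp; have ie k := gdom_integrable t0 (ge k).
exists e_; pose D k y := p y - space_fun (e_ k) y.
have mD k : measurable_fun setT (D k) by exact: measurable_funB.
have gD k : gdom t z (D k).
  have := gdomD (gdomZ (-1) (ge k)) gp.
  by congr gdom; apply/funext => y; rewrite /D mulN1r addrC.
have Dp k y : `|D k y| <= p y.
  by rewrite /D ger0_norm ?subr_ge0// lerBlDr lerDl.
have fc (g_ : nat -> Rd -> R) (g : Rd -> R) : (forall k, measurable_fun setT (g_ k)) ->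
    measurable_fun setT g -> (forall y, g_ k y @[k --> \oo] --> g y) ->
    (forall k y, `|g_ k y| <= p y) -> fform (g_ k) (g_ k) @[k --> \oo] --> fform g g.
  exact: (fform_cvg t0 gp).
have bound k : (\int[mu]_xi (fprod (D k) (D k) xi)%:E <= (fform (D k) (D k))%:E)%E.
  pose B m := space_fun (elem_sub (e_ m) (e_ k)).
  have BE m y : B m y = space_fun (e_ m) y - space_fun (e_ k) y by exact: space_fun_sub.
  have gB m : gdom t z (B m) := gdom_space_fun z _ t0.
  have mB m : measurable_fun setT (B m) by case: (gB m).
  have BD y : B m y @[m --> \oo] --> D k y.
    under eq_fun do rewrite BE; apply: cvgB; [exact: ec|exact: cvg_cst].
  have Bp m y : `|B m y| <= p y.
    rewrite BE ler_norml; have := e0 m y; have := e0 k y; have := ep m y; have := ep k y.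
    by move=> *; apply/andP; split; lra.
  have hc : ((fform (B m) (B m))%:E @[m --> \oo] --> (fform (D k) (D k))%:E)%E.
    by apply: cvg_EFin; [exact: nearW|exact: fc].
  apply: (ge0_fatou (f_ := fun m => fprod (B m) (B m)) _ _ _ _ _ hc).
  - by move=> m; exact: measurable_fprod.
  - by move=> m xi; exact: fprod_ge0.
  - exact: measurable_fprod.
  - apply: aeW => xi; rewrite /fprod.
    have h th : ftr th (B m) xi @[m --> \oo] --> ftr th (D k) xi.
      exact: (ftr_cvg mB (mD k) BD ip Bp).
    by apply: cvgD; apply: cvgM.
  - move=> m; have [iB eB] := parseval_space_fun (elem_sub (e_ m) (e_ k)) (elem_sub (e_ m) (e_ k)).
    by rewrite -/(B m) in iB eB *; rewrite -eB EFin_Rintegral.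
have f0 : fform (fun=> 0) (fun=> 0) = 0.
  by rewrite /fform /Rintegral integral0_eq// => x _; rewrite mul0r.
have hc : ((fform (D k) (D k))%:E @[k --> \oo] --> 0)%E.
  rewrite -[X in _ --> X](congr1 EFin f0); apply: cvg_EFin; first exact: nearW.
  apply: (fc D (fun=> 0)) => // y; rewrite -[X in _ --> X](subrr (p y)).
  by apply: cvgB; [exact: cvg_cst|exact: ec].
apply: squeeze_cvge (cvg_cst 0%E) hc; apply: nearW => k.
by rewrite bound andbT; apply: integral_ge0 => xi _; rewrite lee_fin fprod_ge0.
Qed.

End step_functions.

(** * The seminorm in the frequency domain *)

Section hp_seminorm.
Variables (R : realType) (d : nat) (H : R).
Hypotheses (H_gt : 1 / 2 < H) (H_lt : H < 1).
Local Notation Rd := 'rV[R]_d.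
Local Notation L := (lebesgue_rV R d).
Local Notation leb := (@lebesgue_measure R).
Local Notation energy := (energy H).
Local Notation energy2 := (energy2 H).
Local Notation tbd := (@tbd R).
Implicit Types (phi psi : R -> Rd -> R) (xi : Rd).

(** A real form of admissibility: the two real transforms are jointly measurable,
    supported in a bounded time interval, and bounded at each frequency. *)
Definition admissible phi : Prop :=
  [/\ exists T : R, 0 <= T /\ forall t, ~~ (0 <= t <= T) -> forall x, phi t x = 0,
      forall t, L.-integrable setT (EFin \o phi t),
      forall th, th = 0 \/ th = sin_phase R ->
        measurable_fun setT (fun p : R * Rd => ftr th (phi p.1) p.2) &
      forall xi, exists M : R, forall th t, th = 0 \/ th = sin_phase R ->
        `|ftr th (phi t) xi| <= M].

Lemma spatial_fourierE phi t xi : L.-integrable setT (EFin \o phi t) ->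
  spatial_fourier phi t xi = Complex (ftr 0 (phi t) xi) (- ftr (sin_phase R) (phi t) xi).
Proof.
move=> ip; apply/eqP; rewrite eq_complex; apply/andP; split; apply/eqP.
  exact: Re_fourier.
exact: Im_fourier.
Qed.

Lemma admissibleP phi : hp_admissible phi <-> admissible phi.
Proof.
split=> [[[T hT] ip mR mI hM]|[[T [T0 hT]] ip mf hM]].
  split => //.
  - exists (Num.max T 0); split; first by rewrite le_max lexx orbT.
    move=> t tT; apply: hT; apply: contra tT; rewrite in_itv/= => /andP[-> tT].
    by rewrite le_max tT.
  - move=> th [->|->].
      rewrite (_ : (fun p => _) = (fun p : R * Rd => complex.Re (spatial_fourier phi p.1 p.2)))//.
      by apply/funext => p; rewrite (spatial_fourierE _ (ip p.1)).
    rewrite (_ : (fun p => _) = (fun p : R * Rd => - complex.Im (spatial_fourier phi p.1 p.2))).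
      exact: measurable_funN.
    by apply/funext => p; rewrite (spatial_fourierE _ (ip p.1))/= opprK.
  - move=> xi; have [M MP] := hM xi; exists M => th t; have := MP t.
    rewrite (spatial_fourierE _ (ip t)) normc_def lecR /= => h.
    by case=> ->; apply: le_trans h; rewrite -sqrtr_sqr ler_wsqrtr// ?sqrrN ?lerDl ?lerDr sqr_ge0.
split => //.
- by exists T => t; rewrite in_itv/=; exact: hT.
- rewrite (_ : (fun p => _) = (fun p : R * Rd => ftr 0 (phi p.1) p.2)); first by apply: mf; left.
  by apply/funext => p; rewrite (spatial_fourierE _ (ip p.1)).
- rewrite (_ : (fun p => _) = (fun p : R * Rd => - ftr (sin_phase R) (phi p.1) p.2)).
    by apply: measurable_funN; apply: mf; right.
  by apply/funext => p; rewrite (spatial_fourierE _ (ip p.1)).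
- move=> xi; have [M MP] := hM xi; exists (M + M) => t.
  rewrite (spatial_fourierE _ (ip t)) normc_def lecR /= sqrrN.
  have h1 := MP 0 t (or_introl erefl); have h2 := MP (sin_phase R) t (or_intror erefl).
  set a := ftr _ _ _ in h1 *; set b := ftr _ _ _ in h2 *.
  have M0 : 0 <= M by exact: le_trans h1.
  rewrite -(ger0_norm (addr_ge0 M0 M0)) -sqrtr_sqr ler_wsqrtr//.
  have : a ^+ 2 <= M ^+ 2 by rewrite -[leLHS]real_normK ?num_real// lerXn2r ?nnegrE.
  have : b ^+ 2 <= M ^+ 2 by rewrite -[leLHS]real_normK ?num_real// lerXn2r ?nnegrE.
  by move=> *; nra.
Qed.

Lemma admissible_lin c phi psi : admissible phi -> admissible psi ->
  admissible (fun t x => c * phi t x + psi t x).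
Proof.
move=> [[T [T0 hT]] ip mp hM] [[S [S0 hS]] iq mq hN].
have fE th t xi : ftr th (fun x => c * phi t x + psi t x) xi =
    c * ftr th (phi t) xi + ftr th (psi t) xi by exact: ftr_lin.
split.
- exists (Num.max T S); split; first by rewrite le_max T0.
  move=> t tTS x; rewrite hT ?hS ?mulr0 ?addr0//.
    by apply: contra tTS => /andP[-> h]; rewrite le_max h orbT.
  by apply: contra tTS => /andP[-> h]; rewrite le_max h.
- by move=> t; apply: Rint_integrableD => //; exact: Rint_integrableZ.
- move=> th hth; rewrite (_ : (fun p => _) =
    (fun p : R * Rd => c * ftr th (phi p.1) p.2 + ftr th (psi p.1) p.2)).
    by apply: measurable_funD; [apply: measurable_funM => //; exact: mp|exact: mq].
  by apply/funext => p; exact: fE.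
- move=> xi; have [M MP] := hM xi; have [N NP] := hN xi; exists (`|c| * M + N) => th t hth.
  rewrite fE; apply: le_trans (ler_normD _ _) _; apply: lerD; last exact: NP.
  by rewrite normrM ler_wpM2l// MP.
Qed.

Lemma admissibleB phi psi : admissible phi -> admissible psi ->
  admissible (fun t x => phi t x - psi t x).
Proof.
move=> hp hq; have := admissible_lin (-1) hq hp; congr admissible.
by apply/funext => t; apply/funext => x; rewrite mulN1r addrC.
Qed.

Lemma admissible_tensor T M (h : R -> R) (phi : Rd -> R) : tbd T M h ->
  L.-integrable setT (EFin \o phi) -> admissible (fun t x => h t * phi x).
Proof.
move=> [mh hM] ip; have fE th t xi : ftr th (fun x => h t * phi x) xi = h t * ftr th phi xi.
  by rewrite ftrZ.
split.
- exists (Num.max T 0); split; first by rewrite le_max lexx orbT.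
  move=> t tT x; have := hM t; rewrite /box (_ : (0 <= t <= T) = false).
    by rewrite mulr0 normr_le0 => /eqP ->; rewrite mul0r.
  by apply/negbTE; apply: contra tT => /andP[-> h0]; rewrite le_max h0.
- by move=> t; exact: Rint_integrableZ.
- move=> th _; rewrite (_ : (fun p => _) = (fun p : R * Rd => h p.1 * ftr th phi p.2)).
    apply: measurable_funM; first exact: measurableT_comp mh measurable_fst.
    apply: measurableT_comp measurable_snd; apply: measurable_ftr.
    exact: integrable_measurable ip.
  by apply/funext => p; exact: fE.
- move=> xi; exists (`|M| * \int[L]_x `|phi x|) => th t _; rewrite fE normrM.
  apply: ler_pM => //; last exact: ftr_le.
  apply: le_trans (hM t) _; apply: (@le_trans _ _ (`|M| * box T t)).
    by rewrite ler_wpM2r ?box_ge0 ?ler_norm.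
  by rewrite ler_piMr// box_le1.
Qed.

Lemma admissible0 : admissible (fun _ (_ : Rd) => 0).
Proof.
have i0 : L.-integrable setT (EFin \o (fun _ : Rd => 0 : R)) by exact: integrable0.
have [mb _] := tbd_box (lexx (0 : R)).
have := admissible_tensor (tbd_box (lexx (0 : R))) i0; congr admissible.
by apply/funext => t; apply/funext => x; rewrite mulr0.
Qed.

Lemma box_indic (t u : R) : \1_(`[0, t]%classic) u = box t u :> R.
Proof.
rewrite indicE /box; congr (_%:R); congr nat_of_bool; apply/idP/idP.
  by move=> /set_mem; rewrite /= in_itv.
by move=> h; apply/mem_set; rewrite /= in_itv.
Qed.

Lemma elem_fun_cons c (e : elementary R d) t (x : Rd) :
  elem_fun (c :: e) t x = c.1 * (box (cyl_time c.2) t * \1_(cyl_base c.2) x) + elem_fun e t x.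
Proof. by rewrite /elem_fun big_cons box_indic. Qed.

Lemma base_integrable (c : cylinder R d) :
  L.-integrable setT (EFin \o (\1_(cyl_base c) : Rd -> R)).
Proof. exact: gdom_integrable ltr01 (gdom_base 0 c ltr01). Qed.

Lemma admissible_elem (e : elementary R d) : admissible (elem_fun e).
Proof.
elim: e => [|c e IH].
  have := admissible0; congr admissible.
  by apply/funext => t; apply/funext => x; rewrite /elem_fun big_nil.
have ht := tbd_box (lexx (cyl_time c.2)).
have := admissible_lin c.1 (admissible_tensor ht (base_integrable c.2)) IH.
by congr admissible; apply/funext => t; apply/funext => x; rewrite elem_fun_cons.
Qed.

(** The time interval is common to all frequencies, whereas the bound is not. *)
Lemma admissible_tbd phi : admissible phi ->
  exists T : R, 0 <= T /\ forall xi, exists M : R, forall th, th = 0 \/ th = sin_phase R ->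
    tbd T M (fun t => ftr th (phi t) xi).
Proof.
move=> [[T [T0 hT]] ip mp hM]; exists T; split => // xi; have [M MP] := hM xi.
exists M => th hth; split; first exact: (measurable_sec2 xi (mp th hth)).
move=> t; rewrite /box; have [tT|tT] := boolP (0 <= t <= T); first by rewrite mulr1 MP.
rewrite mulr0 normr_le0 /ftr /Rintegral integral0_eq// => x _.
by rewrite hT// mulr0.
Qed.

Definition freq_energy phi xi : R :=
  energy (fun t => ftr 0 (phi t) xi) + energy (fun t => ftr (sin_phase R) (phi t) xi).

Lemma freq_energy_ge0 phi xi : admissible phi -> 0 <= freq_energy phi xi.
Proof.
move=> /admissible_tbd[T [_ /(_ xi)[M hM]]].
by rewrite addr_ge0//; apply: (energy_ge0 H_gt H_lt); apply: hM; [left|right].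
Qed.

Lemma measurable_freq_energy phi : admissible phi -> measurable_fun setT (freq_energy phi).
Proof.
move=> [_ ip mp _].
have h th : th = 0 \/ th = sin_phase R -> measurable_fun setT (fun xi => energy (fun t => ftr th (phi t) xi)).
  move=> hth; have mF := mp th hth.
  suff m : measurable_fun setT (fun q : Rd * (R * R) =>
      ftr th (phi q.2.1) q.1 * ftr th (phi q.2.2) q.1 * kern H q.2).
    exact: (measurable_Rint2 (prodm leb leb) m).
  apply: measurable_funM; last exact: measurableT_comp (measurable_kern H) measurable_snd.
  have m1 : measurable_fun setT (fun q : Rd * (R * R) => (q.2.1, q.1)) by mfun.
  have m2 : measurable_fun setT (fun q : Rd * (R * R) => (q.2.2, q.1)) by mfun.
  by apply: measurable_funM; [exact: measurableT_comp mF m1|exact: measurableT_comp mF m2].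
by apply: measurable_funD; apply: h; [left|right].
Qed.

Lemma Rint_mkcond (g : R -> R) (T : R) : (forall u, ~~ (0 <= u <= T) -> g u = 0) ->
  \int[leb]_(u in `[0%R, +oo[) g u = \int[leb]_u g u.
Proof.
move=> g0; rewrite /Rintegral (@int_mkcond R `[0, +oo[%classic g (fun u => 0 <= u)).
  congr fine; apply: eq_integral => u _; have [u0|u0] := boolP (0 <= u); first by rewrite mul1r.
  by rewrite mul0r g0// negb_and u0.
by move=> u; rewrite /= in_itv/= andbT.
Qed.

(** Expanding the Hermitian product and discarding its odd imaginary part. *)
Lemma hp_norm2E (mu : {measure set Rd -> \bar R}) phi : admissible phi ->
  hp_norm2 H mu phi = ((alphaH H)%:E * \int[mu]_xi (freq_energy phi xi)%:E)%E.
Proof.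
move=> hp; have [_ ip _ _] := hp; have [T [T0 hT]] := admissible_tbd hp.
rewrite /hp_norm2; congr (_ * _)%E; apply: eq_integral => xi _; congr EFin.
have [M hM] := hT xi; rewrite /cintegral /=.
have h0 := hM 0 (or_introl erefl); have h1 := hM _ (or_intror erefl).
pose A t := ftr 0 (phi t) xi; pose B t := ftr (sin_phase R) (phi t) xi.
have z (g : R -> R) : tbd T M g -> forall u, ~~ (0 <= u <= T) -> g u = 0.
  by move=> [_ gM] u uT; have := gM u; rewrite /box (negbTE uT) mulr0 normr_le0 => /eqP.
have A0 : forall u, ~~ (0 <= u <= T) -> A u = 0 := z _ h0.
have B0 : forall u, ~~ (0 <= u <= T) -> B u = 0 := z _ h1.
have innerE u v : complex.Re (spatial_fourier phi u xi * conjc (spatial_fourier phi v xi) *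
    (`|u - v| `^ (2 * H - 2))%:C%C) = A u * A v * kern H (u, v) + B u * B v * kern H (u, v).
  by rewrite !spatial_fourierE//= -/(A u) -/(A v) -/(B u) -/(B v) /kern/=; ring.
transitivity (\int[leb]_v \int[leb]_u (A u * A v * kern H (u, v) + B u * B v * kern H (u, v))).
  rewrite (_ : Rintegral _ _ _ = \int[leb]_(v in `[0%R, +oo[)
     \int[leb]_u (A u * A v * kern H (u, v) + B u * B v * kern H (u, v))).
    apply: (@Rint_mkcond _ T) => v vT; rewrite /Rintegral integral0_eq// => u _.
    by rewrite (A0 v)// (B0 v)// !mulr0 !mul0r addr0.
  apply: eq_Rintegral => v _; rewrite -(@Rint_mkcond _ T).
    by apply: eq_Rintegral => u _; exact: innerE.
  move=> u uT. by rewrite (A0 u)// (B0 u)// !mul0r addr0.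
have i0 v := energy_sec_integrable H_gt v h0 h0; have i1 v := energy_sec_integrable H_gt v h1 h1.
have j0 := energy_integrable H_gt h0 h0; have j1 := energy_integrable H_gt h1 h1.
apply: (etrans (@Rint_prod2 _ _ _ _ R leb leb (fun p => A p.1 * A p.2 * kern H p + B p.1 * B p.2 * kern H p) _ _)).
- exact: Rint_integrableD j0 j1.
- by move=> v; exact: (Rint_integrableD (i0 v) (i1 v)).
exact: (RintegralD measurableT j0 j1).
Qed.

End hp_seminorm.

Lemma ler_add_double (R : realDomainType) (a b c e x y : R) :
  x <= 2 * a + 2 * c -> y <= 2 * b + 2 * e -> x + y <= 2 * (a + b) + 2 * (c + e).
Proof. by move=> h1 h2; rewrite !mulrDr addrACA lerD. Qed.

Lemma ge0_scale_double (R : realType) (a : R) (x y z : \bar R) : 0 <= a ->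
  (0 <= y)%E -> (0 <= z)%E -> (x <= 2%:E * y + 2%:E * z)%E ->
  (a%:E * x <= 2%:E * (a%:E * y) + 2%:E * (a%:E * z))%E.
Proof.
move=> a0 y0 z0 h; rewrite !(muleCA 2%:E) -ge0_muleDr ?mule_ge0//.
by apply: lee_wpmul2l; rewrite ?lee_fin.
Qed.

Lemma ge0_int_double dT (T : measurableType dT) (R : realType)
  (m : {measure set T -> \bar R}) (f f1 f2 : T -> R) :
  measurable_fun setT f -> measurable_fun setT f1 -> measurable_fun setT f2 ->
  (forall x, 0 <= f x) -> (forall x, 0 <= f1 x) -> (forall x, 0 <= f2 x) ->
  (forall x, f x <= 2 * f1 x + 2 * f2 x) ->
  (\int[m]_x (f x)%:E <= 2%:E * \int[m]_x (f1 x)%:E + 2%:E * \int[m]_x (f2 x)%:E)%E.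
Proof.
move=> mf m1 m2 f0 f10 f20 le; rewrite -!ge0_integralZl//; last 4 first.
- exact/measurable_EFinP.
- by move=> x _; rewrite lee_fin.
- exact/measurable_EFinP.
- by move=> x _; rewrite lee_fin.
rewrite -ge0_integralD//; last 4 first.
- by move=> x _; rewrite lee_fin mulr_ge0.
- by apply/measurable_EFinP; exact: measurable_funM.
- by move=> x _; rewrite lee_fin mulr_ge0.
- by apply/measurable_EFinP; exact: measurable_funM.
apply: ge0_le_integral => //.
- by move=> x _; rewrite lee_fin.
- exact/measurable_EFinP.
- by apply/measurable_EFinP; apply: measurable_funD; exact: measurable_funM.
- by move=> x _; rewrite lee_fin le.
Qed.

Section hp_triangle.
Variables (R : realType) (d : nat) (H : R).
Hypotheses (H_gt : 1 / 2 < H) (H_lt : H < 1).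
Local Notation Rd := 'rV[R]_d.
Local Notation L := (lebesgue_rV R d).
Local Notation leb := (@lebesgue_measure R).
Local Notation energy := (energy H).
Local Notation energy2 := (energy2 H).
Local Notation freq_energy := (freq_energy H).
Variable mu : {measure set Rd -> \bar R}.
Implicit Types (phi psi chi : R -> Rd -> R) (xi : Rd).

Lemma alphaH_gt0 : 0 < alphaH H.
Proof. by move: H_gt => h; rewrite /alphaH mulr_gt0//; lra. Qed.

Lemma hp_norm2_ge0 phi : admissible phi -> (0 <= hp_norm2 H mu phi)%E.
Proof.
move=> hp; rewrite hp_norm2E// mule_ge0 ?lee_fin ?(ltW alphaH_gt0)//.
by apply: integral_ge0 => xi _; rewrite lee_fin freq_energy_ge0.
Qed.

Lemma hp_norm2_lty phi : admissible phi ->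
  (hp_norm2 H mu phi < +oo)%E <-> (\int[mu]_xi (freq_energy phi xi)%:E < +oo)%E.
Proof.
move=> hp; rewrite hp_norm2E//; split => h.
  rewrite ltey; apply: contraTN h => /eqP ->.
  by rewrite gt0_muley ?ltxx// lte_fin alphaH_gt0.
apply: lte_mul_pinfty => //; first by rewrite lee_fin (ltW alphaH_gt0).
Qed.

(** The parallelogram inequality, as the energy is a positive semidefinite form. *)
Lemma freq_energyD_le phi psi xi : admissible phi -> admissible psi ->
  freq_energy (fun t x => phi t x + psi t x) xi <= 2 * freq_energy phi xi + 2 * freq_energy psi xi.
Proof.
move=> hp hq; have [_ ip _ _] := hp; have [_ iq _ _] := hq.
have [T [T0 hT]] := admissible_tbd hp; have [S [S0 hS]] := admissible_tbd hq.
have [M hM] := hT xi; have [N hN] := hS xi.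
have h th : th = 0 \/ th = sin_phase R ->
    energy (fun t => ftr th (fun x => phi t x + psi t x) xi) <=
    2 * energy (fun t => ftr th (phi t) xi) + 2 * energy (fun t => ftr th (psi t) xi).
  move=> hth.
  have -> : (fun t => ftr th (fun x => phi t x + psi t x) xi) =
      (fun t => ftr th (phi t) xi + ftr th (psi t) xi).
    apply/funext => t; have := ftr_lin th 1 xi (ip t) (iq t).
    by rewrite mul1r => <-; congr ftr; apply/funext => x; rewrite mul1r.
  have M0 : 0 <= M.
    have [_ /(_ 0)] := hM th hth; rewrite /box lexx T0 mulr1; exact: le_trans.
  have N0 : 0 <= N.
    have [_ /(_ 0)] := hN th hth; rewrite /box lexx S0 mulr1; exact: le_trans.
  have h1 : tbd (Num.max T S) M (fun t => ftr th (phi t) xi).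
    by apply: tbdW M0 (hM th hth); rewrite le_max lexx.
  have h2 : tbd (Num.max T S) N (fun t => ftr th (psi t) xi).
    by apply: tbdW N0 (hN th hth); rewrite le_max lexx orbT.
  exact: (energyD_le H_gt H_lt h1 h2).
exact: ler_add_double (h _ (or_introl erefl)) (h _ (or_intror erefl)).
Qed.

Lemma freq_energyBC phi psi xi : admissible phi -> admissible psi ->
  freq_energy (fun t x => phi t x - psi t x) xi = freq_energy (fun t x => psi t x - phi t x) xi.
Proof.
move=> hp hq; have [_ ip _ _] := hp; have [_ iq _ _] := hq.
have [T [T0 /(_ xi)[M hM]]] := admissible_tbd (admissibleB hq hp).
have h th : th = 0 \/ th = sin_phase R ->
    energy (fun t => ftr th (fun x => phi t x - psi t x) xi) =
    energy (fun t => ftr th (fun x => psi t x - phi t x) xi).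
  move=> hth; have -> : (fun t => ftr th (fun x => phi t x - psi t x) xi) =
      (fun t => - 1 * ftr th (fun x => psi t x - phi t x) xi).
    by apply/funext => t; rewrite !ftrB//; ring.
  by rewrite (energyZ H_gt (-1) (hM th hth)); ring.
by rewrite /freq_energy !h//; [right|left].
Qed.

Lemma hp_norm2BC phi psi : admissible phi -> admissible psi ->
  hp_norm2 H mu (fun t x => phi t x - psi t x) = hp_norm2 H mu (fun t x => psi t x - phi t x).
Proof.
move=> hp hq; rewrite (hp_norm2E H_gt mu (admissibleB hp hq)) (hp_norm2E H_gt mu (admissibleB hq hp)).
apply: (congr1 (fun z => (alphaH H)%:E * z)%E); apply: eq_integral => xi _.
by apply: (congr1 EFin); exact: freq_energyBC.
Qed.

Lemma hp_norm2D_le phi psi : admissible phi -> admissible psi ->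
  (hp_norm2 H mu (fun t x => phi t x + psi t x)%R <=
   2%:E * hp_norm2 H mu phi + 2%:E * hp_norm2 H mu psi)%E.
Proof.
move=> hp hq; have hpq : admissible (fun t x => phi t x + psi t x).
  have := admissible_lin 1 hp hq; congr admissible.
  by apply/funext => t; apply/funext => x; rewrite mul1r.
have m0 := measurable_freq_energy H hpq.
have m1 := measurable_freq_energy H hp; have m2 := measurable_freq_energy H hq.
have f0 xi := freq_energy_ge0 H_gt H_lt xi hpq.
have f1 xi := freq_energy_ge0 H_gt H_lt xi hp; have f2 xi := freq_energy_ge0 H_gt H_lt xi hq.
rewrite (hp_norm2E H_gt mu hpq) (hp_norm2E H_gt mu hp) (hp_norm2E H_gt mu hq).
apply: (ge0_scale_double (ltW alphaH_gt0)).
- by apply: integral_ge0 => xi _; rewrite lee_fin.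
- by apply: integral_ge0 => xi _; rewrite lee_fin.
exact: (ge0_int_double _ m0 m1 m2 f0 f1 f2 (fun xi => freq_energyD_le xi hp hq)).
Qed.

Lemma hp_norm2B_le phi psi chi : admissible phi -> admissible psi -> admissible chi ->
  (hp_norm2 H mu (fun t x => phi t x - chi t x)%R <=
   2%:E * hp_norm2 H mu (fun t x => phi t x - psi t x)%R +
   2%:E * hp_norm2 H mu (fun t x => psi t x - chi t x)%R)%E.
Proof.
move=> hp hq hr.
have -> : (fun t x => phi t x - chi t x) =
    (fun t x => (phi t x - psi t x) + (psi t x - chi t x)).
  by apply/funext => t; apply/funext => x; rewrite addrA subrK.
exact: hp_norm2D_le (admissibleB hp hq) (admissibleB hq hr).
Qed.

End hp_triangle.

Section elementary_isometry.
Variables (R : realType) (d : nat) (H : R).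
Hypotheses (H_gt : 1 / 2 < H) (H_lt : H < 1).
Local Notation Rd := 'rV[R]_d.
Local Notation L := (lebesgue_rV R d).
Local Notation leb := (@lebesgue_measure R).
Local Notation energy := (energy H).
Local Notation energy2 := (energy2 H).
Local Notation freq_energy := (freq_energy H).
Variables (mu : {sigma_finite_measure set Rd -> \bar R}) (f : Rd -> R).
Hypotheses (mu_tempered : tempered mu) (f_ge0 : forall x, 0 <= f x)
  (mu_f : is_fourier_transform mu f).
Local Notation fform := (fform f).
Implicit Types (e : elementary R d) (c : R * cylinder R d).

Definition elem_form e : R := \sum_(c <- e) \sum_(c' <- e) c.1 * c'.1 *
  (RH H (cyl_time c.2) (cyl_time c'.2) * fform \1_(cyl_base c.2) \1_(cyl_base c'.2)).

Lemma cyl_parseval c c' : parseval mu f \1_(cyl_base c.2) \1_(cyl_base c'.2).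
Proof.
by apply: (parseval_indic mu_tempered f_ge0 mu_f); [exact: cyl_measurable|exact: cyl_bounded|
  exact: cyl_measurable|exact: cyl_bounded].
Qed.

(** The energy of a sum of boxes is a double sum of covariances of fractional Brownian
    motion. *)
Lemma energy_elem_fun e th xi :
  energy (fun t => ftr th (elem_fun e t) xi) = \sum_(c <- e) \sum_(c' <- e)
    c.1 * c'.1 * (energy2 (box (cyl_time c.2)) (box (cyl_time c'.2)) *
      (ftr th \1_(cyl_base c.2) xi * ftr th \1_(cyl_base c'.2) xi)).
Proof.
pose D c t := (c.1 * ftr th \1_(cyl_base c.2) xi) * box (cyl_time c.2) t.
have -> : (fun t => ftr th (elem_fun e t) xi) = (fun t => \sum_(c <- e) D c t).
  apply/funext => t; rewrite /elem_fun ftr_sum; last first.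
    by move=> c; do 2 apply: Rint_integrableZ; exact: base_integrable.
  apply: eq_bigr => c _; rewrite ftrZ; last first.
    by apply: Rint_integrableZ; exact: base_integrable.
  by rewrite ftrZ ?box_indic/D; [ring|exact: base_integrable].
pose c_ := tnth (in_tuple e).
have tE (F : R * cylinder R d -> R) : \sum_(c <- e) F c = \sum_(i < size e) F (c_ i).
  by rewrite big_tnth.
pose S := \sum_(i < size e) cyl_time (c_ i).2.
have hS i : cyl_time (c_ i).2 <= S.
  by rewrite /S (bigD1 i)//= lerDl sumr_ge0// => j _; exact: cyl_time_ge0.
pose a i := (c_ i).1 * ftr th \1_(cyl_base (c_ i).2) xi.
pose B i := box (cyl_time (c_ i).2).
have hB i : tbd S 1 (B i) by exact: tbd_box.
have hD i : tbd S (`|a i| * 1) (D (c_ i)) := tbdZ (a i) (hB i).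
have DD : (fun t => \sum_(c <- e) D c t) = (fun t => \sum_(i < size e) D (c_ i) t).
  by apply/funext => t; rewrite tE.
have [M hM] : exists M : R, tbd S M (fun t => \sum_(i < size e) D (c_ i) t).
  elim: (index_enum _) => [|i r [M IH]].
    exists 0; split => [|u]; last by rewrite big_nil normr0 mul0r.
    rewrite (_ : (fun t => _) = cst 0)//; apply/funext => t; exact: big_nil.
  exists (`|a i| * 1 + M); rewrite (_ : (fun t => _) =
    (fun t => D (c_ i) t + \sum_(j <- r) D (c_ j) t)); first exact: tbdD.
  by apply/funext => t; exact: big_cons.
rewrite DD /energy tE (energy2_suml H_gt _ hD hM); apply: eq_bigr => i _.
rewrite tE (energy2C H_gt (hD i) hM) (energy2_suml H_gt _ hD (hD i)); apply: eq_bigr => j _.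
rewrite (energy2Zl H_gt (a j) (hB j) (hD i)) (energy2C H_gt (hB j) (hD i)).
rewrite (energy2Zl H_gt (a i) (hB i) (hB j)) /B /a; ring.
Qed.

Lemma freq_energy_elem_fun e xi : freq_energy (elem_fun e) xi =
  \sum_(c <- e) \sum_(c' <- e) c.1 * c'.1 * (energy2 (box (cyl_time c.2)) (box (cyl_time c'.2)) *
    fprod \1_(cyl_base c.2) \1_(cyl_base c'.2) xi).
Proof.
rewrite /freq_energy !energy_elem_fun -big_split; apply: eq_bigr => c _ /=.
by rewrite -big_split; apply: eq_bigr => c' _ /=; rewrite /fprod; ring.
Qed.

Lemma Rintegral_sum dT (T : measurableType dT) (m : {measure set T -> \bar R}) (I : Type)
  (r : seq I) (g : I -> T -> R) : (forall i, m.-integrable setT (EFin \o g i)) ->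
  m.-integrable setT (EFin \o (fun x => \sum_(i <- r) g i x)) /\
  \int[m]_x \sum_(i <- r) g i x = \sum_(i <- r) \int[m]_x g i x.
Proof.
move=> ig; elim: r => [|i r [IHi IHe]].
  have E : (fun x => \sum_(i <- [::]) g i x) = cst 0 by apply/funext => x; rewrite big_nil.
  rewrite E big_nil; split; first exact: integrable0.
  by rewrite /Rintegral integral0_eq.
have E : (fun x => \sum_(j <- i :: r) g j x) = (fun x => g i x + \sum_(j <- r) g j x).
  by apply/funext => x; rewrite big_cons.
rewrite E big_cons; split; first exact: Rint_integrableD.
by rewrite RintegralD// IHe.
Qed.

(** Time and space separate on cylinders: the time energies give the covariance of
    fractional Brownian motion, the frequency integrals are Parseval's identity. *)
Lemma hp_norm2_elem_fun e : hp_norm2 H mu (elem_fun e) = (elem_form e)%:E.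
Proof.
rewrite (hp_norm2E H_gt mu (admissible_elem e)).
pose G c c' xi := c.1 * c'.1 * (energy2 (box (cyl_time c.2)) (box (cyl_time c'.2)) *
    fprod \1_(cyl_base c.2) \1_(cyl_base c'.2) xi).
have iG c c' : mu.-integrable setT (EFin \o G c c').
  by do 2 apply: Rint_integrableZ; have [] := cyl_parseval c c'.
have [iS eS] : mu.-integrable setT (EFin \o freq_energy (elem_fun e)) /\
    \int[mu]_xi freq_energy (elem_fun e) xi = \sum_(c <- e) \sum_(c' <- e) \int[mu]_xi G c c' xi.
  have -> : freq_energy (elem_fun e) = (fun xi => \sum_(c <- e) \sum_(c' <- e) G c c' xi).
    by apply/funext => xi; rewrite freq_energy_elem_fun.
  have h c := Rintegral_sum e (iG c).
  have [h1 ->] := Rintegral_sum e (fun c => (h c).1).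
  by split => //; apply: eq_bigr => c _; rewrite (h c).2.
rewrite -EFin_Rintegral// eS -EFinM; congr EFin; rewrite /elem_form mulr_sumr.
apply: eq_bigr => c _; rewrite mulr_sumr; apply: eq_bigr => c' _; have [ip ep] := cyl_parseval c c'.
rewrite -(energy2_box H_gt (cyl_time_ge0 _) (cyl_time_ge0 _)) -ep /G.
by rewrite !RintegralZl//; [ring|exact: Rint_integrableZ].
Qed.


End elementary_isometry.

(** * The isometry on elementary functions *)

Section noise_isometry.
Variables (R : realType) (d : nat) (H : R).
Hypotheses (H_gt : 1 / 2 < H) (H_lt : H < 1).
Local Notation Rd := 'rV[R]_d.
Local Notation L := (lebesgue_rV R d).
Variables (mu : {sigma_finite_measure set Rd -> \bar R}) (f : Rd -> R).
Hypotheses (mu_tempered : tempered mu) (f_ge0 : forall x, 0 <= f x)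
  (mu_f : is_fourier_transform mu f).
Local Notation fform := (fform f).
Implicit Types (e : elementary R d) (c : R * cylinder R d).

Lemma iterated_int_fform c c' :
  (\int[L]_(x in cyl_base c.2) \int[L]_(y in cyl_base c'.2) (f (x - y))%:E =
  (fform \1_(cyl_base c.2) \1_(cyl_base c'.2))%:E)%E.
Proof.
have g0 (c0 : cylinder R d) := gdom_base (0 : Rd) c0 (@ltr01 R).
have mk (A : set Rd) (g : Rd -> R) :
    (\int[L]_(x in A) (g x)%:E = \int[L]_x (\1_A x * g x)%:E)%E.
  rewrite integral_mkcond; apply: eq_integral => x _.
  rewrite patchE indicE; case: ifPn => [xA|/negbTE xA]; first by rewrite mul1r.
  by rewrite mul0r.
have i1 a := conv_f_integrable f_ge0 mu_f a ltr01 (g0 c'.2).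
have i2 := fform_integrable mu_tempered f_ge0 mu_f ltr01 (base_integrable c.2) (g0 c'.2).
transitivity (\int[L]_(x in cyl_base c.2) (conv_f f \1_(cyl_base c'.2) x)%:E)%E.
  by apply: eq_integral => x _; rewrite mk /conv_f (EFin_Rintegral (i1 x)).
by rewrite mk /fform (EFin_Rintegral i2).
Qed.

Context (dO : measure_display) (O : measurableType dO) (P : probability O R).
Variables (W : R -> set Rd -> {RV P >-> R}).
Hypothesis W_noise : gaussian_noise H f W.

Let Wc c : O -> R := W (cyl_time c.2) (cyl_base c.2).

Let mW c : measurable_fun setT (Wc c). Proof. exact: measurable_funPT. Qed.

Let cov c c' : (\int[P]_w (Wc c w * Wc c' w)%:E =
  (RH H (cyl_time c.2) (cyl_time c'.2) * fform \1_(cyl_base c.2) \1_(cyl_base c'.2))%:E)%E.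
Proof.
have [_ h] := W_noise; rewrite EFinM -iterated_int_fform.
have := h _ _ _ _ (cyl_time_ge0 c.2) (cyl_time_ge0 c'.2) (@cyl_measurable _ _ c.2)
  (@cyl_bounded _ _ c.2) (@cyl_measurable _ _ c'.2) (@cyl_bounded _ _ c'.2).
by rewrite unlock.
Qed.

Let iW c c' : P.-integrable setT (EFin \o (fun w => Wc c w * Wc c' w)).
Proof.
have i2 c0 : P.-integrable setT (EFin \o (fun w => Wc c0 w * Wc c0 w)).
  apply: integrable_ge0; first exact: measurable_funM.
    by move=> w; rewrite -expr2 sqr_ge0.
  by rewrite cov ltry.
apply: (@dom_integrable _ _ _ P _ (fun w => Wc c w * Wc c w + Wc c' w * Wc c' w)).
- exact: measurable_funM.
- move=> w; rewrite ler_norml; have := sqr_ge0 (Wc c w + Wc c' w).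
  have := sqr_ge0 (Wc c w - Wc c' w); have := sqr_ge0 (Wc c w); have := sqr_ge0 (Wc c' w).
  by move=> *; apply/andP; split; nra.
- exact: Rint_integrableD.
Qed.

Lemma measurable_elem_noise e : measurable_fun setT (elem_noise W e).
Proof.
apply: measurable_sum => c; apply: measurable_funM => //; exact: (mW c).
Qed.

Lemma elem_noise_isometry e :
  (\int[P]_w (elem_noise W e w ^+ 2)%:E = hp_norm2 H mu (elem_fun e))%E.
Proof.
rewrite (hp_norm2_elem_fun H_gt mu_tempered f_ge0 mu_f).
pose G c c' w := c.1 * c'.1 * (Wc c w * Wc c' w).
have iG c c' : P.-integrable setT (EFin \o G c c') by exact: Rint_integrableZ.
have h c := Rintegral_sum e (iG c).
have [iS eS] := Rintegral_sum e (fun c => (h c).1).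
have E : (fun w => elem_noise W e w ^+ 2) = (fun w => \sum_(c <- e) \sum_(c' <- e) G c c' w).
  apply/funext => w; rewrite expr2 /elem_noise mulr_suml; apply: eq_bigr => c _.
  by rewrite mulr_sumr; apply: eq_bigr => c' _; rewrite /G /Wc; ring.
transitivity (\int[P]_w (\sum_(c <- e) \sum_(c' <- e) G c c' w)%:E)%E.
  by apply: eq_integral => w _; rewrite -(congr1 (fun g => g w) E).
rewrite -(EFin_Rintegral iS) eS /elem_form; congr EFin; apply: eq_bigr => c _.
rewrite (h c).2; apply: eq_bigr => c' _.
by rewrite /G RintegralZl//; congr (_ * _); rewrite /Rintegral cov.
Qed.

Lemma elem_noise_sub e e' w :
  elem_noise W (elem_sub e e') w = elem_noise W e w - elem_noise W e' w.
Proof.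
rewrite /elem_noise /elem_sub big_cat big_map /= -sumrN; congr (_ + _).
by apply: eq_bigr => c _; rewrite mulNr.
Qed.

End noise_isometry.

Lemma elem_fun_sub (R : realType) d (e e' : elementary R d) :
  elem_fun (elem_sub e e') = (fun t x => elem_fun e t x - elem_fun e' t x).
Proof.
apply/funext => t; apply/funext => x; rewrite /elem_fun /elem_sub big_cat big_map /= -sumrN.
by congr (_ + _); apply: eq_bigr => c _; rewrite mulNr.
Qed.

(** * Square-integrable limits *)

Section square_integrable_limits.
Context d (T : measurableType d) (R : realType) (m : {measure set T -> \bar R}).

(** Chebyshev and Borel-Cantelli in one stroke: the series of 4^k D_k^2 has a finite
    integral, hence is finite almost everywhere and bounds each of its terms. *)
Lemma fast_L2_ae (D_ : nat -> T -> R) : (forall k, measurable_fun setT (D_ k)) ->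
  (forall k, \int[m]_x (D_ k x ^+ 2)%:E <= ((1 / 8) ^+ k)%:E)%E ->
  {ae m, forall x, exists C : R, forall k, `|D_ k x| <= C * (1 / 2) ^+ k}.
Proof.
move=> mD hD; pose g k x := 4 ^+ k * D_ k x ^+ 2.
have g0 k x : 0 <= g k x by rewrite mulr_ge0 ?sqr_ge0 ?exprn_ge0.
have mg k : measurable_fun setT (EFin \o g k).
  by apply/measurable_EFinP; apply: measurable_funM => //; exact: measurable_funX.
have mS : measurable_fun setT (fun x => \sum_(0 <= k <oo) (g k x)%:E)%E.
  apply: ge0_emeasurable_sum => [k x _ _|k _]; last exact: mg.
  by rewrite lee_fin.
have hS : (\int[m]_x \sum_(0 <= k <oo) (g k x)%:E < +oo)%E.
  rewrite integral_nneseries//; last by move=> k x _; rewrite lee_fin.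
  apply: (@le_lt_trans _ _ (\sum_(0 <= k <oo) ((1 / 2) ^+ k)%:E)%E).
    apply: lee_nneseries => [k _ _|k _]; first by apply: integral_ge0 => x _; rewrite lee_fin.
    have -> : (\int[m]_x (g k x)%:E = (4 ^+ k)%:E * \int[m]_x (D_ k x ^+ 2)%:E)%E.
      rewrite -ge0_integralZl//.
      all: try by apply: eq_integral => x _; rewrite EFinM.
      - by apply/measurable_EFinP; exact: measurable_funX.
      - by move=> x _; rewrite lee_fin sqr_ge0.
    apply: (@le_trans _ _ ((4 ^+ k)%:E * ((1 / 8) ^+ k)%:E)%E).
      by apply: lee_wpmul2l; rewrite ?lee_fin ?exprn_ge0.
    by rewrite -EFinM lee_fin -exprMn (_ : 4 * (1 / 8) = 1 / 2 :> R)//; field.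
  rewrite (_ : (\sum_(0 <= k <oo) ((1 / 2) ^+ k)%:E)%E = (2 : R)%:E) ?ltry//.
  apply/cvg_lim => //; have := @cvg_geometric_eseries_half R 2 0.
  rewrite expr0 divr1; apply: cvg_trans; apply: near_eq_cvg; apply: nearW => n.
  apply: eq_bigr => k _; congr EFin.
  rewrite addn1 natrX exprS invfM mulrA divff// mul1r.
  by rewrite ?mul1r exprVn.
have iS : m.-integrable setT (fun x => \sum_(0 <= k <oo) (g k x)%:E)%E.
  apply/integrableP; split => //; apply: le_lt_trans hS.
  apply: ge0_le_integral => //; first exact: measurableT_comp.
  by move=> x _; rewrite gee0_abs// nneseries_ge0// => k _ _; rewrite lee_fin.
have := integrable_ae measurableT iS.
apply: filterS => x /(_ I) fS; exists (Num.sqrt (fine (\sum_(0 <= k <oo) (g k x)%:E)%E)) => k.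
have gk : g k x <= fine (\sum_(0 <= j <oo) (g j x)%:E)%E.
  rewrite -lee_fin fineK//.
  apply: le_trans (@nneseries_lim_ge R (fun k => (g k x)%:E) xpredT 0%N k.+1 _).
    by rewrite big_nat_recr//= leeDr// sume_ge0// => i _; rewrite lee_fin.
  by move=> i _ _; rewrite lee_fin.
have p2 : (0 : R) < (1 / 2) ^+ k by rewrite exprn_gt0.
rewrite -ler_pdivrMr//.
have -> : `|D_ k x| / (1 / 2) ^+ k = Num.sqrt (g k x).
  rewrite /g -(ger0_norm (divr_ge0 (normr_ge0 (D_ k x)) (ltW p2))) -sqrtr_sqr; congr Num.sqrt.
  rewrite expr_div_n real_normK ?num_real// mulrC; congr (_ * _).
  by rewrite exprAC (_ : (1 / 2) ^+ 2 = 4^-1 :> R) ?exprVn ?invrK//; field.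
exact: ler_wsqrtr.
Qed.

Lemma L2_ae_subseq (X_ : nat -> T -> R) (X : T -> R) :
  (forall n, measurable_fun setT (X_ n)) -> measurable_fun setT X ->
  (\int[m]_x ((X_ n x - X x) ^+ 2)%:E @[n --> \oo] --> 0)%E ->
  exists s : nat -> nat, {ae m, forall x, X_ (s k) x @[k --> \oo] --> X x}.
Proof.
move=> mX_ mX cX.
have /choice[s sP] : forall k : nat, exists n,
    (\int[m]_x ((X_ n x - X x) ^+ 2)%:E <= ((1 / 8) ^+ k)%:E)%E.
  move=> k; have p0 : (0 : R) < (1 / 8) ^+ k by rewrite exprn_gt0.
  have h0 n : (0 <= \int[m]_x ((X_ n x - X x) ^+ 2)%:E)%E.
    by apply: integral_ge0 => x _; rewrite lee_fin sqr_ge0.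
  have /(_ _ _ p0)[n _ hn] := (cvge0P _ h0).1 cX.
  by exists n; exact: (hn n (leqnn n)).
exists s.
have mD k : measurable_fun setT (fun x => X_ (s k) x - X x) by exact: measurable_funB.
have := fast_L2_ae mD sP.
apply: filterS => x [C hC].
have : C * (1 / 2) ^+ k @[k --> \oo] --> C * 0.
  by apply: cvgMr; apply: cvg_expr; rewrite ger0_norm// ltr_pdivrMr// mul1r ltr1n.
rewrite mulr0 => /cvgrPdist_le h; apply/cvgrPdist_le => e e0; have := h e e0.
apply: filterS => k; rewrite sub0r normrN distrC => /(le_trans (ler_norm _)).
exact: le_trans (hC k).
Qed.

Lemma fast_cvg (x_ : nat -> R) (C : R) :
  (forall k, `|x_ k.+1 - x_ k| <= C * (1 / 2) ^+ k) -> cvgn x_.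
Proof.
move=> hC; have C0 : 0 <= C by have := hC 0%N; rewrite expr0 mulr1; exact: le_trans.
have c1 : cvgn (series (fun k => C * (1 / 2) ^+ k)).
  have := @is_cvg_geometric_series R C (1 / 2).
  by apply; rewrite ger0_norm// ltr_pdivrMr// mul1r ltr1n.
have c2 : cvgn [normed series (telescope x_)].
  apply: (series_le_cvg _ _ _ c1) => k /=; first exact: normr_ge0.
    by rewrite mulr_ge0// exprn_ge0.
  exact: hC.
have c3 := normed_cvg c2.
have -> : x_ = (fun n => x_ 0%N + series (telescope x_) n).
  apply/funext => n; rewrite /series/= telescope_sumr//; ring.
by apply: is_cvgD => //; exact: is_cvg_cst.
Qed.

(** A rapidly Cauchy subsequence converges almost everywhere by fast_L2_ae, and Fatou's
    lemma identifies the limit of the whole sequence. *)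
Lemma L2_complete (X_ : nat -> T -> R) : (forall n, measurable_fun setT (X_ n)) ->
  (forall e : R, 0 < e -> exists N, forall n k, (N <= n)%N -> (N <= k)%N ->
    (\int[m]_x ((X_ n x - X_ k x) ^+ 2)%:E <= e%:E)%E) ->
  exists2 X : T -> R, measurable_fun setT X &
    (\int[m]_x ((X_ n x - X x) ^+ 2)%:E @[n --> \oo] --> 0)%E.
Proof.
move=> mX hX.
have /choice[N NP] : forall k : nat, exists N, forall n n', (N <= n)%N -> (N <= n')%N ->
    (\int[m]_x ((X_ n x - X_ n' x) ^+ 2)%:E <= ((1 / 8) ^+ k)%:E)%E.
  by move=> k; apply: hX; rewrite exprn_gt0.
pose s (k : nat) := (\sum_(0 <= j < k.+1) (N j).+1)%N.
have sS k : s k.+1 = (s k + (N k.+1).+1)%N by rewrite /s big_nat_recr.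
have sN k : (N k <= s k)%N by rewrite /s big_nat_recr//= -addSnnS leq_addl.
have sk k : (k <= s k)%N.
  by elim: k => // k IH; rewrite sS addnS ltnS (leq_trans IH) ?leq_addr.
have mD k : measurable_fun setT (fun x => X_ (s k.+1) x - X_ (s k) x) by exact: measurable_funB.
have hD k : (\int[m]_x ((X_ (s k.+1) x - X_ (s k) x) ^+ 2)%:E <= ((1 / 8) ^+ k)%:E)%E.
  by apply: NP => //; rewrite sS (leq_trans (sN k))// leq_addr.
pose X x := fine (limn_esup (fun k => (X_ (s k) x)%:E)).
have mlX : measurable_fun setT X.
  apply: measurableT_comp; first exact: fine_measurable.
  by apply: measurable_fun_limn_esup => n; exact/measurable_EFinP.
have aeX : {ae m, forall x, X_ (s k) x @[k --> \oo] --> X x}.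
  have := fast_L2_ae mD hD; apply: filterS => x [C hC].
  have cx : cvgn (fun k => X_ (s k) x) := fast_cvg hC.
  have cE : ((X_ (s k) x)%:E @[k --> \oo] --> (limn (fun k => X_ (s k) x))%:E)%E.
    by apply: cvg_EFin => //; exact: nearW.
  by rewrite /X; have [_ ->] := cvg_limn_einf_sup cE.
exists X => //.
have h0 n : (0 <= \int[m]_x ((X_ n x - X x) ^+ 2)%:E)%E.
  by apply: integral_ge0 => x _; rewrite lee_fin sqr_ge0.
apply/(cvge0P _ h0) => e e0; have [K hK] := hX e e0; exists K => // n /= Kn.
apply: (ge0_fatou (f_ := fun k x => (X_ n x - X_ (s (k + K)) x) ^+ 2) (c_ := fun=> e%:E)).
- by move=> k; apply: measurable_funX; exact: measurable_funB.
- by move=> k x; exact: sqr_ge0.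
- by apply: measurable_funX; exact: measurable_funB.
- apply: filterS aeX => x cx.
  have c2 : X_ (s (k + K)) x @[k --> \oo] --> X x
    by have := cx; rewrite -(cvg_shiftn K (fun k => X_ (s k) x)).
  have c3 : X_ n x - X_ (s (k + K)) x @[k --> \oo] --> X_ n x - X x.
    by apply: cvgB => //; exact: cvg_cst.
  by rewrite expr2; under eq_fun do rewrite expr2; exact: (cvgM c3 c3).
- by move=> k; apply: hK => //; rewrite (leq_trans _ (sk _))// leq_addl.
- exact: cvg_cst.
Qed.

End square_integrable_limits.

(** * The heat kernel as an element of the Hilbert space *)

Lemma double_quarter (R : realType) (x y : \bar R) (r : R) :
  (x <= (r / 4)%:E -> y <= (r / 4)%:E -> 2%:E * x + 2%:E * y <= r%:E)%E.
Proof.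
have -> : (r%:E = 2%:E * (r / 4)%:E + 2%:E * (r / 4)%:E)%E.
  by rewrite -!EFinM -EFinD; congr EFin; field.
by move=> hx hy; apply: leeD; apply: lee_wpmul2l.
Qed.

Section approximable.
Variables (R : realType) (d : nat) (H : R).
Hypotheses (H_gt : 1 / 2 < H) (H_lt : H < 1).
Local Notation Rd := 'rV[R]_d.
Local Notation L := (lebesgue_rV R d).
Local Notation energy := (energy H).
Local Notation freq_energy := (freq_energy H).
Variables (mu : {sigma_finite_measure set Rd -> \bar R}) (f : Rd -> R).
Hypotheses (mu_tempered : tempered mu) (f_ge0 : forall x, 0 <= f x)
  (mu_f : is_fourier_transform mu f).
Implicit Types (phi psi : R -> Rd -> R) (xi : Rd) (e : elementary R d).

Definition approximable phi : Prop := admissible phi /\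
  forall r : R, 0 < r -> exists e : elementary R d,
    (hp_norm2 H mu (fun t x => phi t x - elem_fun e t x)%R <= r%:E)%E.

Lemma approximable_in_HP phi : approximable phi -> in_HP H mu phi.
Proof.
move=> [hp ha]; split; first exact/admissibleP.
have /choice[e he] : forall n : nat, exists e : elementary R d,
    (hp_norm2 H mu (fun t x => phi t x - elem_fun e t x)%R <= n.+1%:R^-1%:E)%E.
  by move=> n; apply: ha; rewrite invr_gt0.
exists e; rewrite /approximates.
have hE : (n.+1%:R^-1%:E @[n --> \oo] --> (0 : R)%:E)%E.
  by apply: cvg_EFin; [exact: nearW|exact: cvg_harmonic].
apply: squeeze_cvge (cvg_cst 0%E) hE; apply: nearW => n; rewrite he andbT.
by apply: (hp_norm2_ge0 H_gt H_lt); apply: admissibleB => //; exact: admissible_elem.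
Qed.

Lemma elem_fun_cat e e' t x :
  elem_fun (e ++ e') t x = elem_fun e t x + elem_fun e' t x.
Proof. by rewrite /elem_fun big_cat. Qed.

Lemma admissibleD phi psi : admissible phi -> admissible psi ->
  admissible (fun t x => phi t x + psi t x).
Proof.
move=> hp hq; have := admissible_lin 1 hp hq; congr admissible.
by apply/funext => t; apply/funext => x; rewrite mul1r.
Qed.

Lemma approximableD phi psi : approximable phi -> approximable psi ->
  approximable (fun t x => phi t x + psi t x).
Proof.
move=> [hp ap] [hq aq]; split; first exact: admissibleD.
move=> r r0; have r4 : 0 < r / 4 by rewrite divr_gt0.
have [e he] := ap _ r4; have [e' he'] := aq _ r4; exists (e ++ e').
have -> : (fun t x => phi t x + psi t x - elem_fun (e ++ e') t x) =
   (fun t x => (phi t x - elem_fun e t x) + (psi t x - elem_fun e' t x)).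
  by apply/funext => t; apply/funext => x; rewrite elem_fun_cat; ring.
have h1 := admissibleB hp (admissible_elem e); have h2 := admissibleB hq (admissible_elem e').
exact: le_trans (hp_norm2D_le H_gt H_lt mu h1 h2) (double_quarter he he').
Qed.

Lemma approximable_lim phi (phi_ : nat -> R -> Rd -> R) : admissible phi ->
  (forall n, approximable (phi_ n)) ->
  (hp_norm2 H mu (fun t x => phi t x - phi_ n t x)%R @[n --> \oo] --> 0)%E ->
  approximable phi.
Proof.
move=> hp ha hc; split=> // r r0; have r4 : 0 < r / 4 by rewrite divr_gt0.
have h0 n : (0 <= hp_norm2 H mu (fun t x => phi t x - phi_ n t x)%R)%E.
  by apply: (hp_norm2_ge0 H_gt H_lt); apply: admissibleB => //; case: (ha n).
have [n _ /(_ n (leqnn n)) hn] := (cvge0P _ h0).1 hc _ r4.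
have [hq /(_ _ r4)[e he]] := ha n; exists e.
exact: le_trans (hp_norm2B_le H_gt H_lt mu hp hq (admissible_elem e)) (double_quarter hn he).
Qed.

Definition lift_time (T : R) (T0 : 0 <= T) e : elementary R d :=
  [seq (c.1, Cylinder T0 (@cyl_measurable _ _ c.2) (@cyl_bounded _ _ c.2)) | c <- e].

Lemma elem_fun_lift T (T0 : 0 <= T) e t x :
  elem_fun (lift_time T0 e) t x = box T t * space_fun e x.
Proof.
rewrite /elem_fun /lift_time big_map /space_fun mulr_sumr; apply: eq_bigr => c _ /=.
by rewrite box_indic; ring.
Qed.

Lemma freq_energy_tensor T M h (phi : Rd -> R) xi : tbd T M h ->
  L.-integrable setT (EFin \o phi) ->
  freq_energy (fun t x => h t * phi x) xi = energy h * fprod phi phi xi.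
Proof.
move=> hh ip; have E th : energy (fun t => ftr th (fun x => h t * phi x) xi) =
    ftr th phi xi ^+ 2 * energy h.
  rewrite -(energyZ H_gt _ hh); apply: (congr1 energy); apply/funext => t.
  by rewrite ftrZ// mulrC.
by rewrite /freq_energy !E /fprod; ring.
Qed.

(** The norm of a tensor product is the product of the time energy and of the spatial
    norm, so only the spatial factor has to be approximated. *)
Lemma approximable_tensor (s s' t : R) z : 0 <= s -> 0 <= s' -> 0 < t ->
  approximable (fun u x => (box s' u - box s u) * heat_kernel t (z - x)).
Proof.
move=> s0 s'0 t0; pose p (x : Rd) := heat_kernel t (z - x).
pose h u := box s' u - box s u.
have hh : tbd (Num.max s s') (1 + `|-1| * 1) h.
  have h1 : tbd (Num.max s s') 1 (box s') by apply: tbd_box; rewrite le_max lexx orbT.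
  have h2 : tbd (Num.max s s') 1 (box s) by apply: tbd_box; rewrite le_max lexx.
  have := tbdD h1 (tbdZ (-1) h2); congr tbd.
  by apply/funext => u; rewrite /h mulN1r.
have ip : L.-integrable setT (EFin \o p) by exact: heat_kernel_refl_integrable.
split; first exact: admissible_tensor hh ip.
move=> r r0; have [e_ ce] := heat_kernel_step_approx mu_tempered f_ge0 mu_f z t0.
pose A := alphaH H * energy h.
have A0 : 0 <= A by rewrite mulr_ge0 ?(ltW (alphaH_gt0 H_gt))// (energy_ge0 H_gt H_lt hh).
have A1 : 0 < A + 1 by rewrite ltr_wpDl.
have h0 k : (0 <= \int[mu]_xi (fprod (fun y => heat_kernel t (z - y) - space_fun (e_ k) y)
     (fun y => heat_kernel t (z - y) - space_fun (e_ k) y) xi)%:E)%E.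
  by apply: integral_ge0 => xi _; rewrite lee_fin fprod_ge0.
have [k _ /(_ k (leqnn k)) hk] := (cvge0P _ h0).1 ce _ (divr_gt0 r0 A1).
exists (elem_sub (lift_time s'0 (e_ k)) (lift_time s0 (e_ k))).
pose q y := p y - space_fun (e_ k) y.
have -> : (fun u x => h u * p x - elem_fun (elem_sub (lift_time s'0 (e_ k)) (lift_time s0 (e_ k))) u x) =
    (fun u x => h u * q x).
  apply/funext => u; apply/funext => x; rewrite elem_fun_sub !elem_fun_lift /h /q; ring.
have iq : L.-integrable setT (EFin \o q).
  by apply: Rint_integrableB => //; exact: gdom_integrable ltr01 (gdom_space_fun 0 _ ltr01).
rewrite (hp_norm2E H_gt mu (admissible_tensor hh iq)).
have -> : (\int[mu]_xi (freq_energy (fun u x => h u * q x) xi)%:E =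
    (energy h)%:E * \int[mu]_xi (fprod q q xi)%:E)%E.
  rewrite -ge0_integralZl//.
  - by apply: eq_integral => xi _; rewrite (freq_energy_tensor xi hh iq) EFinM.
  - by apply/measurable_EFinP; apply: measurable_fprod; exact: integrable_measurable iq.
  - by move=> xi _; rewrite lee_fin fprod_ge0.
  - by rewrite lee_fin (energy_ge0 H_gt H_lt hh).
rewrite muleA -EFinM; apply: (@le_trans _ _ (A%:E * (r / (A + 1))%:E)%E).
  by apply: lee_wpmul2l; rewrite ?lee_fin.
rewrite -EFinM lee_fin mulrA ler_pdivrMr// mulrDr mulr1 mulrC.
by rewrite lerDl ltW.
Qed.

End approximable.

(** * Time profiles of the heat integrand *)

Section heat_equation.
Variables (R : realType) (d : nat) (H : R).
Hypotheses (H_gt : 1 / 2 < H) (H_lt : H < 1).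
Local Notation Rd := 'rV[R]_d.
Local Notation L := (lebesgue_rV R d).
Local Notation leb := (@lebesgue_measure R).
Local Notation energy := (energy H).
Local Notation freq_energy := (freq_energy H).
Implicit Types (xi x : Rd) (s t : R).

Lemma ftr_heat_integrand th t x s xi : ftr th (heat_integrand t x s) xi =
  cos (dotv xi x + th) * heat_profile t (sqnorm xi / 2) s.
Proof.
rewrite /heat_integrand /heat_profile; have [/andP[s0 st]|st] := boolP (0 <= s < t).
  rewrite ftr_heat_kernel ?subr_gt0// mul1r; congr (_ * expR _); ring.
rewrite mul0r mulr0 /ftr /Rintegral integral0_eq// => y _.
by rewrite mulr0.
Qed.

Lemma heat_integrand_integrable t x s :
  L.-integrable setT (EFin \o heat_integrand t x s).
Proof.
rewrite /heat_integrand; have [/andP[s0 st]|_] := boolP (0 <= s < t); last exact: integrable0.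
by apply: heat_kernel_refl_integrable; rewrite subr_gt0.
Qed.

Let q2 xi : 0 <= sqnorm xi / 2.
Proof. by rewrite divr_ge0// sqnorm_ge0. Qed.

Lemma admissible_heat t x : 0 <= t -> admissible (heat_integrand t x).
Proof.
move=> t0; split.
- exists t; split => // s st y; rewrite /heat_integrand ifF//.
  by apply/negbTE; apply: contra st => /andP[-> /ltW].
- exact: heat_integrand_integrable.
- move=> th _; rewrite (_ : (fun p => _) = (fun p : R * Rd =>
    cos (dotv p.2 x + th) * ((0 <= p.1 < t)%R%:R * expR (- ((t - p.1) * (sqnorm p.2 / 2)))))).
    apply: measurable_funM.
      apply: measurable_cos_comp; apply: measurable_funD => //; apply: measurable_dotv.
        exact: measurable_snd.
      exact: measurable_cst.
    by mfun; exact: measurableT_comp (@measurable_sqnorm _ _) measurable_snd.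
  by apply/funext => p; rewrite ftr_heat_integrand.
- move=> xi; exists 1 => th s _; rewrite ftr_heat_integrand normrM.
  rewrite mulr_ile1 ?cos_max// ger0_norm ?heat_profile_ge0//.
  apply: le_trans (heat_profile_le _ _ _) _.
  exact: le_trans (decay_le_box _ _ (q2 xi)) (box_le1 _ _).
Qed.

Lemma cos2_phase (a : R) : cos (a + 0) ^+ 2 + cos (a + sin_phase R) ^+ 2 = 1.
Proof. by rewrite addr0 /sin_phase cosBpihalf cos2Dsin2. Qed.

(** As cos^2 + sin^2 = 1, the phase xi . x drops out of the energy. *)
Lemma freq_energy_profile (phi : R -> Rd -> R) x xi (D : R -> R) T M :
  tbd T M D ->
  (forall th t, ftr th (phi t) xi = cos (dotv xi x + th) * D t) ->
  freq_energy phi xi = energy D.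
Proof.
move=> hD fE; have E th : energy (fun t => ftr th (phi t) xi) =
    cos (dotv xi x + th) ^+ 2 * energy D.
  by rewrite -(energyZ H_gt _ hD); apply: (congr1 energy); apply/funext => t; exact: fE.
by rewrite /freq_energy !E -mulrDl cos2_phase mul1r.
Qed.

Lemma freq_energy_heat t x xi :
  freq_energy (heat_integrand t x) xi = energy (heat_profile t (sqnorm xi / 2)).
Proof.
apply: freq_energy_profile (tbd_heat_profile _ (q2 xi)) _ => th s.
exact: ftr_heat_integrand.
Qed.

Definition dalang (xi : Rd) : R := (1 / (1 + sqnorm xi)) `^ (2 * H).

Lemma dalang_ge0 xi : 0 <= dalang xi. Proof. exact: powR_ge0. Qed.

Lemma measurable_dalang : measurable_fun setT dalang.
Proof.
have -> : dalang = (fun xi => (1 + sqnorm xi) `^ (- (2 * H))).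
  apply/funext => xi; rewrite /dalang powRN div1r.
  by rewrite -powR_inv1 ?addr_ge0 ?sqnorm_ge0// -powRrM mulN1r powRN.
apply: (measurableT_comp (measurable_powR _)); apply: measurable_funD => //.
exact: measurable_sqnorm.
Qed.

Lemma dalang_weight xi :
  dalang xi <= (1 + sqnorm xi / 2) `^ (- (2 * H)) <= 2 `^ (2 * H) * dalang xi.
Proof.
have q0 := sqnorm_ge0 xi; set q := sqnorm xi in q0 *.
have H2 : 0 <= 2 * H by move: H_gt; lra.
have dE : dalang xi = (1 + q) `^ (- (2 * H)).
  rewrite /dalang powRN div1r -powR_inv1 ?addr_ge0// -powRrM mulN1r powRN//.
have q1 : 0 < 1 + q by rewrite ltr_pwDl.
have q21 : 0 < 1 + q / 2 by rewrite ltr_pwDl ?divr_ge0.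
rewrite dE !powRN; apply/andP; split.
  by rewrite lef_pV2 ?posrE ?powR_gt0// ge0_ler_powR ?nnegrE ?(ltW q1) ?(ltW q21)//; lra.
rewrite -[leLHS]mul1r ler_pdivrMr ?powR_gt0//.
rewrite mulrAC ler_pdivlMr ?powR_gt0// mul1r -powRM ?(ltW q21)//.
by rewrite ge0_ler_powR ?nnegrE ?mulr_ge0 ?(ltW q1) ?(ltW q21)//; lra.
Qed.

(** The first half of the equivalence: at time 1 the energy at frequency xi is at
    least a multiple of the weight, and elements of the space have finite norm. *)
Lemma in_HP_dalang (mu : {sigma_finite_measure set Rd -> \bar R}) (f : Rd -> R) :
  tempered mu -> (forall x, 0 <= f x) -> is_fourier_transform mu f ->
  in_HP H mu (heat_integrand 1 0) -> (\int[mu]_xi (dalang xi)%:E < +oo)%E.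
Proof.
move=> mu_tempered f_ge0 mu_f [_ [e ae]]; pose g := heat_integrand 1 (0 : Rd).
have hg : admissible g by exact: admissible_heat.
have he n : admissible (elem_fun (e n)) by exact: admissible_elem.
have h0 n : (0 <= hp_norm2 H mu (fun t x => g t x - elem_fun (e n) t x)%R)%E.
  exact: (hp_norm2_ge0 H_gt H_lt mu (admissibleB hg (he n))).
have [n _ /(_ n (leqnn n)) hn] := (cvge0P _ h0).1 ae _ ltr01.
have gE : g = (fun t x => (g t x - elem_fun (e n) t x) + elem_fun (e n) t x).
  by apply/funext => t; apply/funext => x; rewrite subrK.
have fin : (hp_norm2 H mu g < +oo)%E.
  rewrite gE; apply: le_lt_trans (hp_norm2D_le H_gt H_lt mu (admissibleB hg (he n)) (he n)) _.
  rewrite (hp_norm2_elem_fun H_gt mu_tempered f_ge0 mu_f).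
  have d2 (z : \bar R) : (z < +oo -> 2%:E * z < +oo)%E by move=> hz; rewrite lte_mul_pinfty// lee_fin.
  apply: lte_add_pinfty; apply: d2; last exact: ltry.
  exact: le_lt_trans hn (ltry _).
have /(hp_norm2_lty H_gt mu hg) fin2 := fin.
pose C := expR 2 : R.
have m1 := measurable_freq_energy H hg.
have f1 xi := freq_energy_ge0 H_gt H_lt xi hg.
apply: (@le_lt_trans _ _ (\int[mu]_xi (C * freq_energy g xi)%:E)%E).
  apply: ge0_le_int.
  - exact: measurable_dalang.
  - exact: measurable_funM.
  - exact: dalang_ge0.
  move=> xi; have /andP[h _] := dalang_weight xi; apply: (le_trans h).
  have := energy_heat_profile_ge H_gt H_lt (q2 xi).
  rewrite -(freq_energy_heat 1 0 xi) -ler_pdivlMl ?expR_gt0// -expRN opprK.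
  exact.
under eq_integral do rewrite EFinM; rewrite ge0_integralZl//.
- by rewrite lte_mul_pinfty// lee_fin expR_ge0.
- exact/measurable_EFinP.
- by move=> xi _; rewrite lee_fin.
- by rewrite lee_fin expR_ge0.
Qed.

(** Intervals are written as differences of boxes, because the cylinders only provide
    the indicators of the intervals [0, t]. *)
Definition time_step (s_ : nat -> R) (c_ : nat -> R) n u : R :=
  \sum_(0 <= k < n) (box (s_ k.+1) u - box (s_ k) u) * c_ k.

Lemma time_step_value (s_ c_ : nat -> R) n u : 0 < u -> s_ 0%N = 0 -> (forall k, s_ k <= s_ k.+1) ->
  (s_ n < u -> time_step s_ c_ n u = 0) /\
  (u <= s_ n -> exists2 k, (k < n)%N & s_ k < u <= s_ k.+1 /\ time_step s_ c_ n u = c_ k).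
Proof.
move=> u0 s00 nd; have bE k : box (s_ k) u = (u <= s_ k)%R%:R by rewrite /box (ltW u0).
elim: n => [|n [IH1 IH2]].
  rewrite /time_step big_nil; split => // h; exfalso.
  by move: h; rewrite s00 leNgt u0.
rewrite /time_step big_nat_recr//= -/(time_step s_ c_ n u) !bE; split => h.
  rewrite IH1 ?(le_lt_trans (nd n))// !leNgt h (le_lt_trans (nd n) h)/= subrr mul0r addr0//.
have [un|nu] := leP u (s_ n).
  have [k kn [hk e]] := IH2 un; exists k; first exact: leqW.
  by split => //; rewrite h subrr mul0r addr0.
exists n => //; split; first by rewrite nu.
by rewrite IH1// h subr0 mul1r add0r.
Qed.

Lemma time_step_out (s_ c_ : nat -> R) n u : (forall k, 0 <= s_ k) -> u <= 0 -> time_step s_ c_ n u = 0.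
Proof.
move=> s0 u0; rewrite /time_step big1_seq// => k _; rewrite /box.
have [->|nu] := eqVneq u 0; first by rewrite lexx !s0 subrr mul0r.
by rewrite leNgt lt_neqAle nu u0/= subrr mul0r.
Qed.


Definition grid (t : R) (n : nat) (k : nat) : R := t * k%:R / n.+1%:R.

(** On each cell of the subdivision the heat kernel is frozen at the left end point,
    where its age is the largest: hence its transform stays below that of the exact
    kernel, which provides the domination. *)
Definition heat_step t x n u (y : Rd) : R :=
  \sum_(0 <= k < n.+1) (box (grid t n k.+1) u - box (grid t n k) u) *
    heat_kernel (t - grid t n k) (x - y).

Lemma grid_ge0 t n k : 0 <= t -> 0 <= grid t n k.
Proof. by move=> t0; rewrite /grid divr_ge0 ?mulr_ge0. Qed.

Lemma grid_lt t n k : 0 < t -> (k < n.+1)%N -> grid t n k < t.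
Proof.
by move=> t0 kn; rewrite /grid ltr_pdivrMr ?ltr0n// ltr_pM2l// ltr_nat.
Qed.

Lemma gridS t n k : grid t n k.+1 = grid t n k + t / n.+1%:R.
Proof. by rewrite /grid -natr1; ring. Qed.

Lemma ftr_heat_step th t x n u xi : 0 < t -> ftr th (heat_step t x n u) xi =
  cos (dotv xi x + th) * time_step (grid t n)
    (fun k => expR (- ((t - grid t n k) * (sqnorm xi / 2)))) n.+1 u.
Proof.
move=> t0; rewrite /heat_step /time_step !big_mkord mulr_sumr.
pose p (k : 'I_n.+1) (y : Rd) := heat_kernel (t - grid t n k) (x - y).
have tk (k : 'I_n.+1) : 0 < t - grid t n k by rewrite subr_gt0 grid_lt.
have ip k : L.-integrable setT (EFin \o p k) by exact: heat_kernel_refl_integrable.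
transitivity (ftr th (fun y => \sum_(k < n.+1) (box (grid t n k.+1) u - box (grid t n k) u) * p k y) xi).
  by congr ftr; apply/funext => y; rewrite big_mkord.
rewrite ftr_sum; last by move=> k; exact: Rint_integrableZ.
apply: eq_bigr => k _; rewrite ftrZ// /p ftr_heat_kernel//.
by rewrite (_ : (t - grid t n k) * sqnorm xi / 2 = (t - grid t n k) * (sqnorm xi / 2)); ring.
Qed.

Lemma approximable_heat_step (mu : {sigma_finite_measure set Rd -> \bar R}) (f : Rd -> R) t x n :
  tempered mu -> (forall x, 0 <= f x) -> is_fourier_transform mu f ->
  0 < t -> approximable H mu (heat_step t x n).
Proof.
move=> mu_tempered f_ge0 mu_f t0.
have tens k : (k < n.+1)%N -> approximable H mu (fun u y =>
    (box (grid t n k.+1) u - box (grid t n k) u) * heat_kernel (t - grid t n k) (x - y)).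
  move=> kn; apply: (approximable_tensor H_gt H_lt mu_tempered f_ge0 mu_f);
    by rewrite ?grid_ge0 ?(ltW t0)// subr_gt0 grid_lt.
suff h m : (m <= n.+1)%N -> approximable H mu (fun u y => \sum_(0 <= k < m)
    (box (grid t n k.+1) u - box (grid t n k) u) * heat_kernel (t - grid t n k) (x - y)).
  exact: (h n.+1 (leqnn _)).
elim: m => [_|m IH mn].
  have -> : (fun (u : R) (y : Rd) => \sum_(0 <= k < 0)
      (box (grid t n k.+1) u - box (grid t n k) u) * heat_kernel (t - grid t n k) (x - y)) =
      (fun u y => (box 0 u - box 0 u) * heat_kernel 1 (0 - y)).
    by apply/funext => u; apply/funext => y; rewrite big_nil subrr mul0r.
  by apply: (approximable_tensor H_gt H_lt mu_tempered f_ge0 mu_f).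
have -> : (fun (u : R) (y : Rd) => \sum_(0 <= k < m.+1)
    (box (grid t n k.+1) u - box (grid t n k) u) * heat_kernel (t - grid t n k) (x - y)) =
    (fun u y => \sum_(0 <= k < m)
    (box (grid t n k.+1) u - box (grid t n k) u) * heat_kernel (t - grid t n k) (x - y) +
    (box (grid t n m.+1) u - box (grid t n m) u) * heat_kernel (t - grid t n m) (x - y)).
  by apply/funext => u; apply/funext => y; rewrite big_nat_recr.
by apply: (approximableD H_gt H_lt); [exact: IH (ltnW mn)|exact: tens].
Qed.

End heat_equation.

(** * Dominated convergence in frequency *)

Section heat_convergence.
Variables (R : realType) (d : nat) (H : R).
Hypotheses (H_gt : 1 / 2 < H) (H_lt : H < 1).
Local Notation Rd := 'rV[R]_d.
Local Notation L := (lebesgue_rV R d).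
Local Notation leb := (@lebesgue_measure R).
Local Notation energy := (energy H).
Local Notation freq_energy := (freq_energy H).
Local Notation dalang := (@dalang R d H).
Variables (mu : {sigma_finite_measure set Rd -> \bar R}).
Hypothesis mu_dalang : (\int[mu]_xi (dalang xi)%:E < +oo)%E.
Implicit Types (xi x : Rd) (s t u : R).

Let q2 xi : 0 <= sqnorm xi / 2.
Proof. by rewrite divr_ge0// sqnorm_ge0. Qed.

Lemma dalang_integrable : mu.-integrable setT (EFin \o dalang).
Proof. by apply: integrable_ge0 => //; [exact: measurable_dalang|exact: dalang_ge0]. Qed.

Lemma hp_norm2_cvg0 (phi_ : nat -> R -> Rd -> R) (C : R) :
  (forall n, admissible (phi_ n)) ->
  (forall n xi, freq_energy (phi_ n) xi <= C * dalang xi) ->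
  (forall xi, freq_energy (phi_ n) xi @[n --> \oo] --> 0) ->
  (hp_norm2 H mu (phi_ n) @[n --> \oo] --> 0)%E.
Proof.
move=> hp le cv.
have c := @ge0_int_cvg _ _ R mu (fun n => freq_energy (phi_ n)) (fun=> 0) (fun xi => C * dalang xi).
have -> : (fun n => hp_norm2 H mu (phi_ n)) =
    (fun n => ((alphaH H)%:E * \int[mu]_xi (freq_energy (phi_ n) xi)%:E)%E).
  by apply/funext => n; exact: (hp_norm2E H_gt mu (hp n)).
rewrite -(mule0 (alphaH H)%:E); apply: cvgeZl => //.
rewrite -(@integral0 _ _ R mu setT); apply: c.
- by move=> n; exact: measurable_freq_energy.
- exact: measurable_cst.
- exact: aeW.
- by apply: Rint_integrableZ; exact: dalang_integrable.
- by move=> n xi; rewrite ger0_norm ?(freq_energy_ge0 H_gt H_lt).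
Qed.

Definition weight_const (T : R) : R :=
  expR (2 * T) * (2 / (2 * H - 1) + 1) * 2 `^ (2 * H).

(** Every profile below the decaying exponential has energy of the order of the
    weight, locally uniformly in the final time. *)
Lemma energy_decay_dalang T t (M : R) xi (D : R -> R) : measurable_fun setT D -> 0 <= M -> t <= T ->
  (forall u, `|D u| <= M * decay t (sqnorm xi / 2) u) ->
  energy D <= M ^+ 2 * weight_const T * dalang xi.
Proof.
move=> mD M0 tT hD; apply: le_trans (energy_decay_le H_gt H_lt mD M0 (q2 xi) tT hD) _.
have /andP[_ h] := dalang_weight H_gt xi.
have b0 : 0 <= 2 * H - 1 by move: H_gt; lra.
have c0 : 0 <= M ^+ 2 * expR (2 * T) * (2 / (2 * H - 1) + 1).
  by rewrite mulr_ge0 ?mulr_ge0 ?exprn_ge0 ?expR_ge0// addr_ge0// divr_ge0.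
apply: le_trans (ler_wpM2l c0 h) _.
by rewrite /weight_const !mulrA.
Qed.

Lemma freq_energy_heat_le T t x xi : t <= T ->
  freq_energy (heat_integrand t x) xi <= weight_const T * dalang xi.
Proof.
move=> tT; rewrite freq_energy_heat//.
have hle u : `|heat_profile t (sqnorm xi / 2) u| <= 1 * decay t (sqnorm xi / 2) u.
  by rewrite mul1r ger0_norm ?heat_profile_ge0// heat_profile_le.
have := energy_decay_dalang (measurable_heat_profile _ _) ler01 tT hle.
by rewrite expr1n mul1r.
Qed.

Lemma expRN_lip (a b : R) : 0 <= a -> a <= b -> `|expR (- a) - expR (- b)| <= b - a.
Proof.
move=> a0 ab; have -> : expR (- b) = expR (- a) * expR (- (b - a)).
  by rewrite -expRD; congr expR; ring.
have h1 : expR (- (b - a)) <= 1 by rewrite -expR0 ler_expR oppr_le0 subr_ge0.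
have h2 := expR_ge1Dx (- (b - a)).
have h3 : 0 < expR (- a) <= 1 by rewrite expR_gt0/= -expR0 ler_expR oppr_le0.
set z := expR (- (b - a)) in h1 h2 *; set y := expR (- a) in h3 *.
case/andP: h3 => y0 y1.
rewrite (_ : y - y * z = y * (1 - z)); last by ring.
rewrite ger0_norm ?mulr_ge0 ?subr_ge0 ?(ltW y0)//.
apply: (@le_trans _ _ (1 - z)); first by rewrite ler_piMl// subr_ge0.
by move: h2; lra.
Qed.

Let step t n xi u := time_step (grid t n) (fun k => expR (- ((t - grid t n k) * (sqnorm xi / 2)))) n.+1 u.

Let grid0 t n : grid t n 0 = 0. Proof. by rewrite /grid mulr0 mul0r. Qed.
Let gridT t n : grid t n n.+1 = t.
Proof. by rewrite /grid mulfK// pnatr_eq0. Qed.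
Let grid_mono t n k : 0 <= t -> grid t n k <= grid t n k.+1.
Proof. by move=> t0; rewrite gridS lerDl divr_ge0. Qed.

Let step_le t n xi u : 0 < t -> 0 <= step t n xi u <= decay t (sqnorm xi / 2) u.
Proof.
move=> t0; have t0' := ltW t0; have [u0|u0] := leP u 0.
  by rewrite /step time_step_out ?lexx ?decay_ge0// => k; exact: grid_ge0.
have [h1 h2] := time_step_value (fun k => expR (- ((t - grid t n k) * (sqnorm xi / 2)))) n.+1 u0 (grid0 t n) (fun k => grid_mono n k t0').
have [ut|tu] := leP u t; last first.
  by rewrite /step h1 ?gridT// lexx decay_ge0.
have [|k kn [/andP[ku uk] e]] := h2; first by rewrite gridT.
rewrite /step e expR_ge0 /decay /box (ltW u0) ut mul1r ler_expR lerN2.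
by rewrite ler_wpM2r// lerD2l lerN2 ltW.
Qed.

Let measurable_step t n xi : measurable_fun setT (step t n xi).
Proof.
rewrite /step /time_step; apply: measurable_sum => k.
apply: measurable_funM => //; apply: measurable_funB; exact: measurable_box.
Qed.

Let step_cvg t xi u : 0 < t -> u != 0 -> u != t ->
  heat_profile t (sqnorm xi / 2) u - step t n xi u @[n --> \oo] --> 0.
Proof.
move=> t0 u0 ut; have t0' := ltW t0; have b0 := q2 xi; set b := sqnorm xi / 2 in b0 *.
have key n : `|heat_profile t b u - step t n xi u| <= b * t * n.+1%:R^-1.
  have r0 : 0 <= b * t * n.+1%:R^-1 by apply: mulr_ge0; [exact: mulr_ge0 b0 t0'|rewrite invr_ge0].
  have [ule|ugt] := leP u 0.
    rewrite /step time_step_out ?subr0//; last by move=> k; exact: grid_ge0.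
    have ul0 : u < 0 by rewrite lt_neqAle u0 ule.
    by rewrite /heat_profile (leNgt 0 u) ul0/= mul0r normr0.
  have [h1 h2] := time_step_value (fun k => expR (- ((t - grid t n k) * b))) n.+1 ugt (grid0 t n) (fun k => grid_mono n k t0').
  have [tu|uet] := ltP t u.
    by rewrite /step h1 ?gridT// /heat_profile (ltNge u) (ltW tu) andbF mul0r subrr normr0.
  have [|k kn [/andP[ku uk] e]] := h2; first by rewrite gridT.
  rewrite /step e /heat_profile (ltW ugt) lt_neqAle ut uet/= mul1r.
  apply: le_trans (expRN_lip _ _) _.
  - by rewrite mulr_ge0 ?subr_ge0.
  - by rewrite ler_wpM2r// lerD2l lerN2 ltW.
  rewrite -mulrBl (_ : t - grid t n k - (t - u) = u - grid t n k); last by ring.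
  rewrite mulrC -mulrA ler_wpM2l// lerBlDl -gridS//.
apply/cvgrPdist_le => e e0.
have : b * t * n.+1%:R^-1 @[n --> \oo] --> b * t * 0 by apply: cvgMr; exact: cvg_harmonic.
rewrite mulr0 => /cvgrPdist_le/(_ e e0); apply: filterS => n.
by rewrite !sub0r !normrN => /(le_trans (ler_norm _)); exact: le_trans.
Qed.

Lemma ae_neq2 (a b : R) (P : R -> Prop) : (forall u, u != a -> u != b -> P u) ->
  {ae leb, forall u, P u}.
Proof.
move=> h; exists [set a; b]; split.
- by apply: measurableU; exact: measurable_set1.
- apply: countable_lebesgue_measure0; apply: finite_set_countable.
  by apply: finite_set2.
- move=> u /= nP; apply: contrapT => /not_orP[ua ub]; apply: nP; apply: h; exact/eqP.
Qed.

(** Freezing the kernel on a fine time grid converges pointwise in time at each frequency;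
    the time energies then tend to 0, dominated by the integrable weight, and each
    frozen kernel is a finite sum of tensor products. *)
Lemma approximable_heat (f : Rd -> R) t x : tempered mu -> (forall x, 0 <= f x) ->
  is_fourier_transform mu f -> 0 <= t -> approximable H mu (heat_integrand t x).
Proof.
move=> mu_tempered f_ge0 mu_f; rewrite le_eqVlt => /predU1P[<-|t0].
  have -> : heat_integrand 0 x = (fun u y => (box 0 u - box 0 u) * heat_kernel 1 (0 - y)).
    apply/funext => u; apply/funext => y; rewrite subrr mul0r /heat_integrand.
    by rewrite leNgt; case: ltP; rewrite // andbF.
  by apply: (approximable_tensor H_gt H_lt mu_tempered f_ge0 mu_f).
have hs n : approximable H mu (heat_step t x n).
  exact: (approximable_heat_step H_gt H_lt x n mu_tempered f_ge0 mu_f t0).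
have hh : admissible (heat_integrand t x) by apply: admissible_heat; exact: ltW.
apply: (approximable_lim H_gt H_lt hh hs).
have has n : admissible (heat_step t x n) by case: (hs n).
pose D n xi u := heat_profile t (sqnorm xi / 2) u - step t n xi u.
have mD n xi : measurable_fun setT (D n xi).
  by apply: measurable_funB; [exact: measurable_heat_profile|exact: measurable_step].
have D_le n xi u : `|D n xi u| <= 1 * decay t (sqnorm xi / 2) u.
  rewrite mul1r ler_norml /D; have := heat_profile_ge0 t (sqnorm xi / 2) u.
  have := heat_profile_le t (sqnorm xi / 2) u; have /andP[] := step_le n xi u t0.
  by move=> *; apply/andP; split; lra.
have tD n xi : tbd t 1 (D n xi).
  split => // u; apply: le_trans (D_le n xi u) _; rewrite !mul1r.
  exact: decay_le_box.
have fE n xi : freq_energy (fun u y => heat_integrand t x u y - heat_step t x n u y) xi =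
    energy (D n xi).
  apply: (freq_energy_profile H_gt (x := x) (tD n xi)) => th u.
  have [_ ia _ _] := hh; have [_ ib _ _] := has n.
  by rewrite ftrB// ftr_heat_integrand ftr_heat_step// /D /step; ring.
apply: (hp_norm2_cvg0 (C := weight_const t)) => [n|n xi|xi].
- exact: admissibleB.
- rewrite fE; have := energy_decay_dalang (mD n xi) ler01 (lexx t) (D_le n xi).
  by rewrite expr1n mul1r.
under eq_fun do rewrite fE.
apply: (energy_cvg0 H_gt H_lt (T := t) (M := 1)); first by move=> n; exact: tD.
by apply: (@ae_neq2 0 t) => u u0 ut; exact: step_cvg.
Qed.

End heat_convergence.

Lemma ler_double4 (R : realDomainType) (a b w : R) :
  a <= w -> b <= w -> 2 * a + 2 * b <= 4 * w.
Proof. by lra. Qed.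

Section heat_continuity.
Variables (R : realType) (d : nat) (H : R).
Hypotheses (H_gt : 1 / 2 < H) (H_lt : H < 1).
Local Notation Rd := 'rV[R]_d.
Local Notation leb := (@lebesgue_measure R).
Local Notation energy := (energy H).
Local Notation freq_energy := (freq_energy H).
Variables (mu : {sigma_finite_measure set Rd -> \bar R}).
Hypothesis mu_dalang : (\int[mu]_xi (dalang H xi)%:E < +oo)%E.
Implicit Types (xi x : Rd) (s t u : R) (phi psi : R -> Rd -> R).

Let q2 xi : 0 <= sqnorm xi / 2.
Proof. by rewrite divr_ge0// sqnorm_ge0. Qed.

Lemma freq_energyB_le phi psi xi : admissible phi -> admissible psi ->
  freq_energy (fun t x => phi t x - psi t x) xi <= 2 * freq_energy phi xi + 2 * freq_energy psi xi.
Proof.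
move=> hp hq; have [_ ip _ _] := hp; have [_ iq _ _] := hq.
have [T [T0 hT]] := admissible_tbd hp; have [S [S0 hS]] := admissible_tbd hq.
have [M hM] := hT xi; have [N hN] := hS xi.
have h th : th = 0 \/ th = sin_phase R ->
    energy (fun t => ftr th (fun x => phi t x - psi t x) xi) <=
    2 * energy (fun t => ftr th (phi t) xi) + 2 * energy (fun t => ftr th (psi t) xi).
  move=> hth.
  have -> : (fun t => ftr th (fun x => phi t x - psi t x) xi) =
      (fun t => ftr th (phi t) xi + - 1 * ftr th (psi t) xi).
    by apply/funext => t; rewrite ftrB// mulN1r.
  have M0 : 0 <= M.
    have [_ /(_ 0)] := hM th hth; rewrite /box lexx T0 mulr1; exact: le_trans.
  have N0 : 0 <= N.
    have [_ /(_ 0)] := hN th hth; rewrite /box lexx S0 mulr1; exact: le_trans.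
  have h1 : tbd (Num.max T S) M (fun t => ftr th (phi t) xi).
    by apply: tbdW M0 (hM th hth); rewrite le_max lexx.
  have h2 : tbd (Num.max T S) N (fun t => ftr th (psi t) xi).
    by apply: tbdW N0 (hN th hth); rewrite le_max lexx orbT.
  have e1 : energy (fun t => - 1 * ftr th (psi t) xi) = energy (fun t => ftr th (psi t) xi).
    by rewrite (energyZ H_gt _ h2) sqrrN expr1n mul1r.
  by rewrite -e1; exact: (energyD_le H_gt H_lt h1 (tbdZ (-1) h2)).
exact: ler_add_double (h _ (or_introl erefl)) (h _ (or_intror erefl)).
Qed.

Lemma dotv_cvg xi (x_ : nat -> Rd) x : x_ n @[n --> \oo] --> x ->
  dotv xi (x_ n) @[n --> \oo] --> dotv xi x.
Proof.
move=> xc; apply/cvgrPdist_le => e e0.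
pose S := 1 + \sum_(i < d) `|xi ord0 i|.
have S0 : 0 < S by rewrite ltr_pwDl// sumr_ge0.
have /cvgrPdist_le/(_ (e / S) (divr_gt0 e0 S0)) := xc.
apply: filterS => n hn; rewrite -dotvBr /dotv.
apply: le_trans (ler_norm_sum _ _ _) _.
apply: (@le_trans _ _ (\sum_(i < d) `|xi ord0 i| * `|x - x_ n|)).
  by apply: ler_sum => i _; rewrite normrM ler_wpM2l// coord_le_norm.
rewrite -mulr_suml; apply: (@le_trans _ _ (S * `|x - x_ n|)).
  by rewrite ler_wpM2r// lerDr.
by rewrite mulrC -ler_pdivlMr.
Qed.

Lemma heat_profile_cvg (t_ : nat -> R) t b u : t_ n @[n --> \oo] --> t -> u != t ->
  heat_profile (t_ n) b u @[n --> \oo] --> heat_profile t b u.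
Proof.
move=> tc ut; rewrite /heat_profile.
have [u0|u0] := leP 0 u; last first.
  by under eq_fun do rewrite /= mul0r; rewrite mul0r; exact: cvg_cst.
have [lt|gt] := ltP u t.
  have ev : \forall n \near \oo, u < t_ n.
    have tu0 : 0 < t - u by rewrite subr_gt0.
    have /cvgrPdist_lt/(_ _ tu0) := tc; apply: filterS => n.
    by rewrite ltr_norml => /andP[_]; lra.
  have c2 : expR (- ((t_ n - u) * b)) @[n --> \oo] --> expR (- ((t - u) * b)).
    apply: continuous_cvg; first exact: continuous_expR.
    by apply: cvgN; apply: cvgMl; apply: cvgB => //; exact: cvg_cst.
  rewrite mul1r; apply: cvg_trans c2; apply: near_eq_cvg.
  by apply: filterS ev => n h; rewrite h mul1r.
rewrite mul0r; have tu : t < u by rewrite lt_neqAle eq_sym ut gt.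
apply: cvg_near_cst.
have ev : \forall n \near \oo, t_ n < u.
  have tu0 : 0 < u - t by rewrite subr_gt0.
  have /cvgrPdist_lt/(_ _ tu0) := tc; apply: filterS => n.
  by rewrite ltr_norml => /andP[+ _]; lra.
by apply: filterS ev => n h; rewrite ltNge (ltW h) mul0r.
Qed.

(** Dominated convergence twice: in time at a fixed frequency, where the profiles
    converge except at the final time t, and then in frequency. *)
Lemma hp_heat_cvg (t_ : nat -> R) (x_ : nat -> Rd) t x : (forall n, 0 <= t_ n) -> 0 <= t ->
  t_ n @[n --> \oo] --> t -> x_ n @[n --> \oo] --> x ->
  (hp_norm2 H mu (fun u y => heat_integrand (t_ n) (x_ n) u y - heat_integrand t x u y)%R
    @[n --> \oo] --> 0)%E.
Proof.
move=> tn0 t0 tc xc.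
have [T hT] : exists T : R, t <= T /\ forall n, t_ n <= T.
  have [M [_ hM]] := @cvg_seq_bounded _ _ t_ (cvgP _ tc).
  exists (Num.max t (M + 1)); split; first by rewrite le_max lexx.
  have M1 : M < M + 1 by rewrite ltrDl.
  by move=> n; rewrite le_max (le_trans (ler_norm _) (hM _ M1 n I)) orbT.
have [tT tnT] := hT.
pose A n := heat_integrand (t_ n) (x_ n); pose B := heat_integrand t x.
have hA n : admissible (A n) by exact: admissible_heat.
have hB : admissible B by exact: admissible_heat.
have hAB n := admissibleB (hA n) hB.
apply: (hp_norm2_cvg0 H_gt H_lt mu_dalang (C := 4 * weight_const H T)) => // [n|] xi.
- have h1 := freq_energy_heat_le H_gt H_lt (x_ n) xi (tnT n).
  have h2 := freq_energy_heat_le H_gt H_lt x xi tT.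
  rewrite -mulrA; exact: le_trans (freq_energyB_le xi (hA n) hB) (ler_double4 h1 h2).
have E th : energy (fun u => ftr th (fun y => A n u y - B u y) xi) @[n --> \oo] --> 0.
  have fE n u : ftr th (fun y => A n u y - B u y) xi =
      cos (dotv xi (x_ n) + th) * heat_profile (t_ n) (sqnorm xi / 2) u -
      cos (dotv xi x + th) * heat_profile t (sqnorm xi / 2) u.
    have [_ ia _ _] := hA n; have [_ ib _ _] := hB.
    by rewrite ftrB// !ftr_heat_integrand.
  have p_le s u : s <= T -> heat_profile s (sqnorm xi / 2) u <= box T u.
    move=> sT; apply: le_trans (heat_profile_le _ _ _) _.
    exact: le_trans (decay_le_box _ _ (q2 xi)) (box_le _ sT).
  apply: (energy_cvg0 H_gt H_lt (T := T) (M := 2)) => [n|].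
    have -> : (fun u => ftr th (fun y => A n u y - B u y) xi) = (fun u =>
      cos (dotv xi (x_ n) + th) * heat_profile (t_ n) (sqnorm xi / 2) u -
      cos (dotv xi x + th) * heat_profile t (sqnorm xi / 2) u) by apply/funext => u; exact: fE.
    split.
      by apply: measurable_funB; apply: measurable_funM => //; exact: measurable_heat_profile.
    move=> u; apply: le_trans (ler_normB _ _) _.
    have bd a s : s <= T -> `|cos a * heat_profile s (sqnorm xi / 2) u| <= box T u.
      move=> sT; rewrite normrM (ger0_norm (heat_profile_ge0 _ _ _)).
      apply: le_trans (p_le s u sT).
      by rewrite ler_piMl ?heat_profile_ge0 ?cos_max.
    rewrite (_ : 2 * box T u = box T u + box T u); last by ring.
    exact: lerD (bd _ _ (tnT n)) (bd _ _ tT).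
  apply: (@ae_neq2 _ t t) => u ut _; under eq_fun do rewrite fE.
  rewrite -(subrr (cos (dotv xi x + th) * heat_profile t (sqnorm xi / 2) u)).
  apply: cvgB; last exact: cvg_cst.
  apply: cvgM; last exact: heat_profile_cvg.
  apply: continuous_cvg; first exact: continuous_cos.
  by apply: cvgD; [exact: dotv_cvg|exact: cvg_cst].
by rewrite -(addr0 0); apply: cvgD; exact: E.
Qed.

End heat_continuity.

(** * Gaussian moments *)

Section gaussian_moments.
Import HBNNSimple.
Variable R : realType.
Local Notation leb := (@lebesgue_measure R).

(** The law is only given on sets; simple functions below g transfer it to integrals. *)
Lemma ge0_int_density_le dO (O : measurableType dO) (P : {finite_measure set O -> \bar R})
  (Y : O -> R) (h : R -> R) (g : R -> R) : measurable_fun setT Y ->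
  (forall x, 0 <= h x) -> leb.-integrable setT (EFin \o h) ->
  (forall B, measurable B -> P (Y @^-1` B) = \int[leb]_(x in B) (h x)%:E)%E ->
  measurable_fun setT g -> (forall x, 0 <= g x) ->
  (\int[P]_w (g (Y w))%:E <= \int[leb]_x (g x * h x)%:E)%E.
Proof.
move=> mY h0 ih PY mg g0; have mh := integrable_measurable ih.
have mE : measurable_fun setT (EFin \o g) by exact/measurable_EFinP.
have E0 x : [set: R] x -> (0 <= (EFin \o g) x)%E by move=> _; rewrite lee_fin.
pose a k := nnsfun_approx measurableT mE k.
have ag k (x : R) : a k x <= g x.
  have := @le_approx _ _ R setT (EFin \o g) k x E0 I; rewrite /a nnsfun_approxE.
  by rewrite lee_fin.
have ac x : a k x @[k --> \oo] --> g x.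
  have := @cvg_approx _ _ R setT (EFin \o g) x E0 I (ltry _).
  by under eq_fun do rewrite -(nnsfun_approxE measurableT mE).
have simple k : (\int[P]_w (a k (Y w))%:E = \int[leb]_x (a k x * h x)%:E)%E.
  pose r := finmap.enum_fset (fset_set (range (a k))).
  pose A y := a k @^-1` [set y].
  have fE x : a k x = \sum_(y <- r) y * \1_(A y) x.
    by have := fimfunE (a k) x; rewrite fsbig_finite.
  have mA y : measurable (A y).
    by rewrite -[X in measurable X]setTI; exact: measurable_funPT.
  have i1 y : P.-integrable setT (EFin \o (fun w => \1_(A y) (Y w) : R)).
    apply: (@dom_integrable _ _ _ P _ (cst 1)).
    - exact: measurableT_comp (measurable_indic (mA y)) mY.
    - by move=> w; rewrite indicE ger0_norm ?ler0n//; case: (_ \in _).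
    - exact: finite_measure_integrable_cst.
  have i2 y : leb.-integrable setT (EFin \o (fun x => \1_(A y) x * h x)).
    apply: (@dom_integrable _ _ _ leb _ h) => //.
    - by apply: measurable_funM => //; exact: (measurable_indic (mA y)).
    - move=> x; rewrite indicE normrM (ger0_norm (h0 _)) ger0_norm ?ler0n//.
      by case: (_ \in _); rewrite ?mul1r ?mul0r.
  have [iG eG] := Rintegral_sum r (fun y => Rint_integrableZ y (i1 y)).
  have [iK eK] := Rintegral_sum r (fun y => Rint_integrableZ y (i2 y)).
  transitivity (\int[P]_w (\sum_(y <- r) y * \1_(A y) (Y w))%:E)%E.
    by apply: eq_integral => w _; rewrite fE.
  rewrite -(EFin_Rintegral iG) eG.
  transitivity (\int[leb]_x (\sum_(y <- r) y * (\1_(A y) x * h x))%:E)%E; last first.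
    apply: eq_integral => x _; rewrite fE mulr_suml; congr EFin.
    by apply: eq_bigr => y _; rewrite mulrA.
  rewrite -(EFin_Rintegral iK) eK; congr EFin; apply: eq_bigr => y _.
  rewrite (RintegralZl _ measurableT (i1 y)) (RintegralZl _ measurableT (i2 y)); congr (_ * _).
  rewrite /Rintegral; congr fine.
  transitivity (P (Y @^-1` A y)).
    have mYA : measurable (Y @^-1` A y) by rewrite -[X in measurable X]setTI; exact: mY.
    by rewrite -[RHS](congr1 P (setIT _)) -(integral_indic P measurableT mYA).
  rewrite (PY _ (mA y)) [LHS]integral_mkcond; apply: eq_integral => x _.
  by rewrite patchE indicE; case: ifPn => [xA|/negbTE xA]; rewrite ?mul1r ?mul0r.
apply: (ge0_fatou (f_ := fun k w => a k (Y w)) (c_ := fun=> (\int[leb]_x (g x * h x)%:E)%E)).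
- by move=> k; apply: measurableT_comp mY.
- by move=> k w.
- exact: measurableT_comp mg mY.
- by apply: aeW => w; exact: ac.
- move=> k; rewrite simple.
  have ma : measurable_fun setT (a k) by exact: measurable_funPT.
  have mah : measurable_fun setT (fun x : R => a k x * h x) by exact: (measurable_funM ma mh).
  have mgh : measurable_fun setT (fun x : R => g x * h x) by exact: (measurable_funM mg mh).
  apply: (@ge0_le_int _ _ _ leb _ _ mah mgh) => x; first by rewrite mulr_ge0.
  by rewrite ler_wpM2r.
- exact: cvg_cst.
Qed.

(** Part of the Gaussian decay is spent on an exponential factor; what is left is again
    a Gaussian density, of twice the scale. *)
Lemma normal_pdf_double (s x : R) : 0 < s ->
  expR (3 / 8 * (x / s) ^+ 2) * normal_pdf 0 s x = 2 * normal_pdf 0 (2 * s) x.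
Proof.
move=> s0; have s20 : 0 < 2 * s by rewrite mulr_gt0.
rewrite !normal_pdfE ?gt_eqF// /normal_peak /normal_fun !subr0.
have -> : Num.sqrt ((2 * s) ^+ 2 * pi *+ 2) = 2 * Num.sqrt (s ^+ 2 * pi *+ 2).
  rewrite (_ : (2 * s) ^+ 2 * pi *+ 2 = 2 ^+ 2 * (s ^+ 2 * pi *+ 2)); last by ring.
  by rewrite sqrtrM ?exprn_ge0// sqrtr_sqr ger0_norm.
rewrite invfM mulrCA -expRD !mulrA divff// mul1r; congr (_ * expR _).
by field; rewrite gt_eqF.
Qed.

Lemma powR_le_expR (p s x : R) (n : nat) : 0 <= p -> p <= n%:R -> 0 < s ->
  `|x| `^ p <= (2 * s) `^ p * n%:R ^+ n * expR (3 / 8 * (x / s) ^+ 2).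
Proof.
move=> p0 pn s0; have s20 : 0 < 2 * s by rewrite mulr_gt0.
pose w := `|x| / (2 * s); have w0 : 0 <= w by rewrite divr_ge0// ltW.
have -> : `|x| = 2 * s * w by rewrite /w mulrC divfK// gt_eqF.
rewrite powRM ?(ltW s20)// -mulrA ler_wpM2l ?powR_ge0//.
pose q := 3 / 8 * (x / s) ^+ 2.
have q0 : 0 <= q by rewrite mulr_ge0 ?sqr_ge0// divr_ge0.
have wq : w ^+ 2 <= q.
  rewrite /w /q expr_div_n real_normK ?num_real// expr_div_n.
  rewrite (_ : x ^+ 2 / (2 * s) ^+ 2 = 1 / 4 * (x ^+ 2 / s ^+ 2)); last by field; rewrite gt_eqF.
  by rewrite ler_wpM2r ?divr_ge0 ?sqr_ge0//; lra.
have w1 : w <= 1 + q by have := sqr_ge0 (w - 1); nra.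
apply: le_trans (pow_le_expR n q0); rewrite -powR_mulrn ?addr_ge0//.
apply: (@le_trans _ _ ((1 + q) `^ p)).
  by rewrite ge0_ler_powR ?nnegrE ?addr_ge0.
by rewrite ler_powR// lerDl.
Qed.

Section random_variable.
Context dO (O : measurableType dO) (P : probability O R).
Variables (Y : O -> R).
Hypotheses (mY : measurable_fun setT Y) (gY : centered_gaussian P Y).

(** The density is at most 1 / (2 s), so half of the mass lies beyond s / 2: this
    bounds the scale of a Gaussian variable by its second moment. *)
Lemma gaussian_scale_le s : 0 < s ->
  (forall B, measurable B -> P (Y @^-1` B) = normal_prob 0 s B) ->
  ((s ^+ 2 / 8)%:E <= \int[P]_w (Y w ^+ 2)%:E)%E.
Proof.
move=> s0 hY; pose I := `[- (s / 2), s / 2]%classic : set R.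
have mI : measurable I by exact: measurable_itv.
have mYI : measurable (Y @^-1` I) by rewrite -[X in measurable X]setTI; exact: mY.
have PI : (P (Y @^-1` I) <= (1 / 2)%:E)%E.
  rewrite hY// /normal_prob; apply: (@le_trans _ _ (\int[leb]_(x in I) (s^-1 / 2)%:E)%E).
    apply: ge0_le_integral => //.
    - by move=> x _; rewrite lee_fin normal_pdf_ge0.
    - by apply: measurable_funTS; apply/measurable_EFinP; exact: measurable_normal_pdf.
    move=> x _; rewrite lee_fin; apply: le_trans (normal_pdf_ub _ _ _) _; rewrite ?gt_eqF//.
    rewrite /normal_peak -invfM lef_pV2 ?posrE ?mulr_gt0//; last first.
      by rewrite sqrtr_gt0 mulrn_wgt0// mulr_gt0 ?exprn_gt0 ?pi_gt0.
    have s20 : 0 <= s * 2 by rewrite mulr_ge0// ltW.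
    rewrite -(ger0_norm s20) -sqrtr_sqr; apply: ler_wsqrtr.
    rewrite (_ : s ^+ 2 * pi *+ 2 = s ^+ 2 * (2 * pi)); last by ring.
    rewrite exprMn; apply: ler_wpM2l; first exact: sqr_ge0.
    by have := pi_ge2 R; lra.
  have hs : - (s / 2) < s / 2 by move: s0; lra.
  have LI : (leb I = s%:E)%E.
    by rewrite /I lebesgue_measure_itv/= lte_fin hs -EFinB; congr EFin; field.
  have -> : (\int[leb]_(x in I) (s^-1 / 2)%:E = (s^-1 / 2)%:E * leb I)%E by exact: integral_cst.
  rewrite LI -EFinM lee_fin.
  by rewrite le_eqVlt; apply/orP; left; apply/eqP; field; rewrite gt_eqF.
have PC : ((1 / 2)%:E <= P (~` (Y @^-1` I)))%E.
  have pf : P (Y @^-1` I) \is a fin_num by exact: fin_num_measure.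
  rewrite probability_setC//; move: PI; rewrite -(fineK pf) -EFinB !lee_fin; lra.
have mY2 : measurable_fun setT (fun w => Y w ^+ 2) by exact: measurable_funX.
have mC : measurable (~` (Y @^-1` I)) by exact: measurableC.
apply: (@le_trans _ _ (\int[P]_w (s ^+ 2 / 4 * \1_(~` (Y @^-1` I)) w)%:E)%E).
  rewrite (_ : (\int[P]_w _ = (s ^+ 2 / 4)%:E * P (~` (Y @^-1` I)))%E).
    apply: (@le_trans _ _ ((s ^+ 2 / 4)%:E * (1 / 2)%:E)%E).
      by rewrite -EFinM lee_fin; lra.
    by apply: lee_wpmul2l => //; rewrite lee_fin divr_ge0 ?sqr_ge0.
  under eq_integral do rewrite EFinM.
  rewrite ge0_integralZl//.
  - by rewrite integral_indic// setIT.
  - by apply/measurable_EFinP; exact: measurable_indic.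
  - by rewrite lee_fin divr_ge0 ?sqr_ge0.
apply: ge0_le_int => //.
- by apply: measurable_funM => //; exact: measurable_indic.
- by move=> w; rewrite indicE mulr_ge0 ?ler0n// divr_ge0 ?sqr_ge0.
move=> w; rewrite indicE; case: (boolP (_ \in _)) => [/set_mem|_]; last by rewrite mulr0 sqr_ge0.
rewrite mulr1 /I /= in_itv/= => /negP; rewrite negb_and -!ltNge => /orP[h|h].
  by rewrite (_ : s ^+ 2 / 4 = (s / 2) ^+ 2); [nra|field].
by rewrite (_ : s ^+ 2 / 4 = (s / 2) ^+ 2); [nra|field].
Qed.

Definition moment_const (p B : R) : R :=
  (2 * Num.sqrt (8 * B)) `^ p * (Num.truncn p).+1%:R ^+ (Num.truncn p).+1 * 2.

Lemma gaussian_moment_le p B : 2 <= p -> (\int[P]_w (Y w ^+ 2)%:E <= B%:E)%E ->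
  (\int[P]_w (`|Y w| `^ p)%:E <= (moment_const p B)%:E)%E.
Proof.
move=> p2 hB; have p0 : 0 < p by move: p2; lra.
have mp : measurable_fun setT (fun x : R => `|x| `^ p).
  by apply: (measurableT_comp (measurable_powR _)); exact: normr_measurable.
have K0 : 0 <= moment_const p B by rewrite !mulr_ge0 ?powR_ge0 ?exprn_ge0.
have [s s0 hs] := gY; move: hs; have [s_eq0|sn0] := eqVneq s 0 => hs.
  apply: (@le_trans _ _ 0%E); last by rewrite lee_fin.
  have mY1 : measurable (Y @^-1` [set 0]).
    by rewrite -[X in measurable X]setTI; apply: mY => //; exact: measurable_set1.
  apply: (ge0_fatou (f_ := fun _ _ => 0) (c_ := fun=> 0%E)) => //.
  - exact: measurableT_comp mp mY.
  - exists (~` (Y @^-1` [set 0])); split; first exact: measurableC.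
      have e0 := hs (~` [set 0]) (measurableC (measurable_set1 0)).
      by rewrite preimage_setC; apply: (etrans e0); rewrite diracE memNset// => /(_ erefl).
    move=> w /= h Y0; apply: h; rewrite Y0 normr0 powR0 ?gt_eqF//; exact: cvg_cst.
  - by move=> n; rewrite integral0.
  - exact: cvg_cst.
have {s0} s0 : 0 < s by rewrite lt_neqAle eq_sym sn0.
have {}hs B0 : measurable B0 -> P (Y @^-1` B0) = normal_prob 0 s B0.
  by move=> mB0; rewrite hs.
have sB : s <= Num.sqrt (8 * B).
  have := le_trans (gaussian_scale_le s0 hs) hB; rewrite lee_fin => h.
  by rewrite -[leLHS](ger0_norm (ltW s0)) -sqrtr_sqr ler_wsqrtr//; lra.
have s2 : 2 * s != 0 by rewrite mulf_neq0// gt_eqF.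
pose n := (Num.truncn p).+1.
have pn : p <= n%:R by rewrite ltW// truncnS_gt.
have mpdf t : measurable_fun setT (normal_pdf 0 t : R -> R) by exact: measurable_normal_pdf.
have hd : (\int[P]_w (`|Y w| `^ p)%:E <= \int[leb]_x (`|x| `^ p * normal_pdf 0 s x)%:E)%E.
  apply: (@ge0_int_density_le _ O P Y (normal_pdf 0 s) (fun x => `|x| `^ p) mY).
  - exact: normal_pdf_ge0.
  - exact: integrable_normal_pdf.
  - exact: hs.
  - exact: mp.
  - by move=> x; exact: powR_ge0.
apply: (le_trans hd).
pose C := (2 * s) `^ p * n%:R ^+ n * 2.
have C0 : 0 <= C by rewrite !mulr_ge0 ?powR_ge0 ?exprn_ge0.
apply: (@le_trans _ _ (\int[leb]_x (C * normal_pdf 0 (2 * s) x)%:E)%E).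
  have m2 : measurable_fun setT (fun x : R => C * normal_pdf 0 (2 * s) x).
    by apply: measurable_funM => //; exact: mpdf.
  apply: (@ge0_le_int _ _ _ leb _ _ (measurable_funM mp (mpdf s)) m2).
  - by move=> x; rewrite mulr_ge0 ?powR_ge0 ?normal_pdf_ge0.
  - move=> x; have h := powR_le_expR x (ltW p0) pn s0.
    apply: le_trans (ler_wpM2r (normal_pdf_ge0 0 s x) h) _.
    apply: eq_ler; transitivity ((2 * s) `^ p * n%:R ^+ n *
      (expR (3 / 8 * (x / s) ^+ 2) * normal_pdf 0 s x)); first by rewrite -[LHS]mulrA.
    by rewrite normal_pdf_double// /C mulrA.
under eq_integral do rewrite EFinM; rewrite ge0_integralZl//; last 2 first.
- by apply/measurable_EFinP; exact: mpdf.
- by move=> x _; rewrite lee_fin normal_pdf_ge0.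
rewrite integral_normal_pdf// mule1 lee_fin /C /moment_const -/n ler_wpM2r// ler_wpM2r ?exprn_ge0//.
by rewrite ge0_ler_powR ?nnegrE ?(ltW p0) ?mulr_ge0 ?(ltW s0) ?sqrtr_ge0// ler_wpM2l.
Qed.

End random_variable.
End gaussian_moments.

(** * The Wiener integral *)

Lemma eq_lee (R : realType) (x y : \bar R) : x = y -> (x <= y)%E.
Proof. by move=> ->. Qed.

Lemma lee_double (R : realType) (x y : \bar R) (a b : R) :
  (x <= a%:E -> y <= b%:E -> 2%:E * x + 2%:E * y <= (2 * a + 2 * b)%R%:E)%E.
Proof. by move=> hx hy; rewrite (EFinD (2 * a)) (EFinM 2 a) (EFinM 2 b); apply: leeD; apply: lee_wpmul2l. Qed.

Section wiener_integral.
Variables (R : realType) (d : nat) (H : R).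
Hypotheses (H_gt : 1 / 2 < H) (H_lt : H < 1).
Local Notation Rd := 'rV[R]_d.
Variables (mu : {sigma_finite_measure set Rd -> \bar R}) (f : Rd -> R).
Hypotheses (mu_tempered : tempered mu) (f_ge0 : forall x, 0 <= f x)
  (mu_f : is_fourier_transform mu f).
Context (dO : measure_display) (O : measurableType dO) (P : probability O R).
Variables (W : R -> set Rd -> {RV P >-> R}).
Hypothesis W_noise : gaussian_noise H f W.
Implicit Types (phi psi : R -> Rd -> R) (e : elementary R d).

Let In e : O -> R := elem_noise W e.

Let mI e : measurable_fun setT (In e) := measurable_elem_noise W e.

Let iso e : (\int[P]_w (In e w ^+ 2)%:E = hp_norm2 H mu (elem_fun e))%E.
Proof. exact: (elem_noise_isometry H_gt mu_tempered f_ge0 mu_f W_noise). Qed.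

Lemma int_sqr_ge0 (Z : O -> R) : (0 <= \int[P]_w (Z w ^+ 2)%:E)%E.
Proof. by apply: integral_ge0 => w _; rewrite lee_fin sqr_ge0. Qed.

Lemma elem_noise_dist_le phi e e' : admissible phi ->
  (\int[P]_w ((In e w - In e' w) ^+ 2)%:E <=
   2%:E * hp_norm2 H mu (fun t x => phi t x - elem_fun e t x)%R +
   2%:E * hp_norm2 H mu (fun t x => phi t x - elem_fun e' t x)%R)%E.
Proof.
move=> hp; have he := admissible_elem e; have he' := admissible_elem e'.
have -> : (\int[P]_w ((In e w - In e' w) ^+ 2)%:E = hp_norm2 H mu
    (fun t x => elem_fun e t x - elem_fun e' t x)%R)%E.
  rewrite -elem_fun_sub -iso; apply: eq_integral => w _.
  by rewrite /In elem_noise_sub.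
rewrite (hp_norm2BC H_gt mu hp he).
exact: (hp_norm2B_le H_gt H_lt mu he hp he').
Qed.

Lemma cvge0_double (a b c : nat -> \bar R) :
  (forall n, 0 <= a n)%E -> (forall n, 0 <= b n)%E -> (forall n, 0 <= c n)%E ->
  (forall n, c n <= 2%:E * a n + 2%:E * b n)%E ->
  (a n @[n --> \oo] --> 0)%E -> (b n @[n --> \oo] --> 0)%E -> (c n @[n --> \oo] --> 0)%E.
Proof.
move=> a0 b0 c0 le ca cb; apply/(cvge0P _ c0) => r r0.
have r4 : 0 < r / 4 by rewrite divr_gt0.
have ha := (cvge0P _ a0).1 ca _ r4; have hb := (cvge0P _ b0).1 cb _ r4.
have [N1 _ h1] := ha; have [N2 _ h2] := hb; exists (maxn N1 N2) => // n /= hn.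
exact: le_trans (le n) (double_quarter (h1 n (leq_trans (leq_maxl _ _) hn))
  (h2 n (leq_trans (leq_maxr _ _) hn))).
Qed.

(** By the isometry the images of an approximating sequence are a Cauchy sequence, and
    two approximating sequences are close to each other. *)
Lemma wiener_integral_exists phi : in_HP H mu phi ->
  exists X : {RV P >-> R}, is_wiener_integral H mu W phi X.
Proof.
move=> hin; have [/admissibleP hp [e ae]] := hin.
pose a e0 := hp_norm2 H mu (fun t x => phi t x - elem_fun e0 t x)%R.
have a0 e0 : (0 <= a e0)%E.
  exact: (hp_norm2_ge0 H_gt H_lt mu (admissibleB hp (admissible_elem e0))).
have [X mX cX] : exists2 X : O -> R, measurable_fun setT X &
    (\int[P]_w ((In (e n) w - X w) ^+ 2)%:E @[n --> \oo] --> 0)%E.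
  apply: L2_complete => [n|r r0]; first exact: mI.
  have r4 : 0 < r / 4 by rewrite divr_gt0.
  have [N _ hN] := (cvge0P _ (fun n => a0 (e n))).1 ae _ r4.
  exists N => n k Nn Nk.
  exact: le_trans (elem_noise_dist_le _ _ hp) (double_quarter (hN _ Nn) (hN _ Nk)).
pose X' : {RV P >-> R} := HB.pack X (isMeasurableFun.Build _ _ _ _ X mX).
exists X'; split => //.
- rewrite unlock; have [n _ /(_ n (leqnn n)) hn] := (cvge0P _ (fun n => int_sqr_ge0 _)).1 cX _ ltr01.
  have mD : measurable_fun setT (fun w => X w - In (e n) w) by exact: measurable_funB (mI _).
  have := ge0_int_sqrD P mD (mI (e n)).
  have -> : (\int[P]_w ((X w - In (e n) w + In (e n) w) ^+ 2)%:E = \int[P]_w (X w ^+ 2)%:E)%E.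
    by apply: eq_integral => w _; rewrite subrK.
  move=> /le_lt_trans; apply.
  have d2 (z : \bar R) : (z < +oo -> 2%:E * z < +oo)%E by move=> hz; rewrite lte_mul_pinfty// lee_fin.
  apply: lte_add_pinfty; apply: d2.
    apply: le_lt_trans (ltry 1); apply: le_trans hn; apply: eq_lee.
    by apply: eq_integral => w _; rewrite -sqrrN opprB.
  by rewrite iso (hp_norm2_elem_fun H_gt mu_tempered f_ge0 mu_f) ltry.
- move=> e' ae'; rewrite unlock.
  have c1 : (\int[P]_w ((In (e' n) w - In (e n) w) ^+ 2)%:E @[n --> \oo] --> 0)%E.
    apply: (cvge0_double (fun n => a0 (e' n)) (fun n => a0 (e n)) _ _ ae' ae).
      by move=> n; exact: int_sqr_ge0.
    by move=> n; exact: elem_noise_dist_le.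
  apply: (cvge0_double _ _ _ _ c1 cX) => n; try exact: int_sqr_ge0.
  have := ge0_int_sqrD P (measurable_funB (mI (e' n)) (mI (e n))) (measurable_funB (mI (e n)) mX).
  apply: le_trans; apply: eq_lee; apply: eq_integral => w _.
  by rewrite addrA subrK.
Qed.

Section properties.
Variables (phi : R -> Rd -> R) (X : {RV P >-> R}).
Hypothesis X_phi : is_wiener_integral H mu W phi X.

Let mX : measurable_fun setT (X : O -> R). Proof. exact: measurable_funPT. Qed.

(** Moments are bounded along the approximating Gaussian variables, and survive
    the limit by Fatou's lemma along an almost surely convergent subsequence. *)
Lemma wiener_integral_moment (n0 : nat) B : (2 <= n0)%N -> (hp_norm2 H mu phi <= B%:E)%E ->
  (\int[P]_w (`|X w| ^+ n0)%:E <= (moment_const n0%:R (2 * B + 2))%:E)%E.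
Proof.
move=> n2 hB; have [[/admissibleP hp [e ae]] _ hX] := X_phi.
have a0 n : (0 <= hp_norm2 H mu (fun t x => phi t x - elem_fun (e n) t x)%R)%E.
  exact: (hp_norm2_ge0 H_gt H_lt mu (admissibleB hp (admissible_elem (e n)))).
have [N _ hN] := (cvge0P _ a0).1 ae _ ltr01.
have vE n : (N <= n)%N -> (\int[P]_w (In (e n) w ^+ 2)%:E <= (2 * B + 2)%:E)%E.
  move=> Nn; rewrite iso.
  have E : elem_fun (e n) = (fun t x => (elem_fun (e n) t x - phi t x) + phi t x).
    by apply/funext => t; apply/funext => x; rewrite subrK.
  have he := admissible_elem (e n).
  have h := hp_norm2D_le H_gt H_lt mu (admissibleB he hp) hp.
  rewrite -E -(hp_norm2BC H_gt mu hp he) in h.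
  apply: (le_trans h); rewrite (_ : 2 * B + 2 = 2 * 1 + 2 * B); last by ring.
  exact: lee_double (hN n Nn) hB.
have := hX e ae; rewrite unlock => cX.
have cXN : (\int[P]_w ((In (e (n + N)%N) w - X w) ^+ 2)%:E @[n --> \oo] --> 0)%E.
  have := cX; rewrite -(cvg_shiftn N (fun n => (\int[P]_w ((In (e n) w - X w) ^+ 2)%:E)%E)).
  exact.
have [s sX] := L2_ae_subseq (fun n => mI (e (n + N)%N)) mX cXN.
have mp : measurable_fun setT (fun x : R => `|x| ^+ n0).
  by apply: measurable_funX; exact: normr_measurable.
apply: (ge0_fatou (f_ := fun k w => `|In (e (s k + N)%N) w| ^+ n0)
  (c_ := fun=> (moment_const n0%:R (2 * B + 2))%:E)).
- by move=> k; exact: measurableT_comp mp (mI _).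
- by move=> k w; exact: exprn_ge0.
- exact: measurableT_comp mp mX.
- apply: filterS sX => w cw.
  have c1 : `|In (e (s k + N)%N) w| @[k --> \oo] --> `|X w| by exact: cvg_norm cw.
  have c2 := @exprn_continuous R n0 `|X w|.
  exact: (cvg_comp _ _ c1 c2).
- move=> k; have [hG _] := W_noise.
  have p2 : 2 <= n0%:R :> R by rewrite ler_nat.
  have := gaussian_moment_le (mI _) (hG _) p2 (vE (s k + N)%N (leq_addl _ _)).
  apply: le_trans; apply: eq_lee; apply: eq_integral => w _.
  by rewrite powR_mulrn.
- exact: cvg_cst.
Qed.

(** Both integrands are replaced by terms of their approximating sequences; the constant 46 comes from repeated
    use of (a + b)^2 <= 2 a^2 + 2 b^2. *)
Lemma wiener_integral_dist psi (Y : {RV P >-> R}) r : is_wiener_integral H mu W psi Y ->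
  0 < r -> (hp_norm2 H mu (fun t x => phi t x - psi t x)%R <= r%:E)%E ->
  (\int[P]_w ((X w - Y w) ^+ 2)%:E <= (46 * r)%:E)%E.
Proof.
move=> Y_psi r0 hr; have [[/admissibleP hp [e ae]] _ hX] := X_phi.
have [[/admissibleP hq [e' ae']] _ hY] := Y_psi.
have mY : measurable_fun setT (Y : O -> R) by exact: measurable_funPT.
have he n := admissible_elem (e n); have he' n := admissible_elem (e' n).
have := hX e ae; have := hY e' ae'; rewrite unlock => cY cX.
have [N1 _ h1] := (cvge0P _ (fun n => hp_norm2_ge0 H_gt H_lt mu (admissibleB hp (he n)))).1 ae _ r0.
have [N2 _ h2] := (cvge0P _ (fun n => hp_norm2_ge0 H_gt H_lt mu (admissibleB hq (he' n)))).1 ae' _ r0.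
have [N3 _ h3] := (cvge0P _ (fun n => int_sqr_ge0 _)).1 cX _ r0.
have [N4 _ h4] := (cvge0P _ (fun n => int_sqr_ge0 _)).1 cY _ r0.
pose n := maxn (maxn N1 N2) (maxn N3 N4).
have l1 : (N1 <= n)%N by rewrite (leq_trans (leq_maxl N1 N2))// leq_maxl.
have l2 : (N2 <= n)%N by rewrite (leq_trans (leq_maxr N1 N2))// leq_maxl.
have l3 : (N3 <= n)%N by rewrite (leq_trans (leq_maxl N3 N4))// leq_maxr.
have l4 : (N4 <= n)%N by rewrite (leq_trans (leq_maxr N3 N4))// leq_maxr.
have g1 := h1 n l1; have g2 := h2 n l2; have g3 := h3 n l3; have g4 := h4 n l4.
have d1 := le_trans (hp_norm2B_le H_gt H_lt mu hp hq (he' n)) (lee_double hr g2).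
have d2 := le_trans (elem_noise_dist_le (e n) (e' n) hp) (lee_double g1 d1).
have d3 : (\int[P]_w ((In (e n) w - Y w) ^+ 2)%:E <= (2 * (2 * r + 2 * (2 * r + 2 * r)) + 2 * r)%:E)%E.
  apply: le_trans (lee_double d2 g4).
  have := ge0_int_sqrD P (measurable_funB (mI (e n)) (mI (e' n))) (measurable_funB (mI (e' n)) mY).
  apply: le_trans; apply: eq_lee; apply: eq_integral => w _.
  by rewrite addrA subrK.
have g3' : (\int[P]_w ((X w - In (e n) w) ^+ 2)%:E <= r%:E)%E.
  apply: le_trans g3; apply: eq_lee; apply: eq_integral => w _.
  by rewrite -sqrrN opprB.
have d4 := lee_double g3' d3.
have -> : 46 * r = 2 * r + 2 * (2 * (2 * r + 2 * (2 * r + 2 * r)) + 2 * r) by ring.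
apply: le_trans d4.
have := ge0_int_sqrD P (measurable_funB mX (mI (e n))) (measurable_funB (mI (e n)) mY).
apply: le_trans; apply: eq_lee; apply: eq_integral => w _.
by rewrite addrA subrK.
Qed.

End properties.
End wiener_integral.

Section sigma_finite_copy.
Context dT (T : measurableType dT) (R : realType) (m : {measure set T -> \bar R}).

(** A proof of sigma-finiteness turned into an instance of the structure, as the
    product measure theory requires. *)
Definition sigma_finite_copy (h : sigma_finite setT m) : set T -> \bar R := m.

Variable h : sigma_finite setT m.

Let copy0 : sigma_finite_copy h set0 = 0%E. Proof. exact: measure0. Qed.

Let copy_ge0 A : (0 <= sigma_finite_copy h A)%E. Proof. exact: measure_ge0. Qed.

Let copy_sigma_additive : semi_sigma_additive (sigma_finite_copy h).
Proof. exact: measure_semi_sigma_additive. Qed.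

HB.instance Definition _ := isMeasure.Build _ _ _ (sigma_finite_copy h)
  copy0 copy_ge0 copy_sigma_additive.

HB.instance Definition _ := Measure_isSigmaFinite.Build _ _ _ (sigma_finite_copy h) h.

Lemma sigma_finite_pack : exists m' : {sigma_finite_measure set T -> \bar R},
  (m' : {measure set T -> \bar R}) = m.
Proof. by exists (sigma_finite_copy h); apply: eq_measure. Qed.

End sigma_finite_copy.

Lemma powR_le_exprn (R : realType) (p x : R) (n : nat) : 0 <= p -> p <= n%:R -> 0 <= x ->
  x `^ p <= 1 + x ^+ n.
Proof.
move=> p0 pn x0; have [x1|x1] := leP x 1.
  have : x `^ p <= 1 `^ p by rewrite ge0_ler_powR ?nnegrE.
  rewrite powR1.
  by move=> h; apply: (le_trans h); rewrite lerDl exprn_ge0.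
rewrite -(powR_mulrn n x0); apply: (@le_trans _ _ (x `^ n%:R)); last by rewrite lerDr.
by rewrite ler_powR// ltW.
Qed.

(** * The linear stochastic heat equation *)

Section heat_solution.
Variables (R : realType) (d : nat) (H : R).
Hypotheses (H_gt : 1 / 2 < H) (H_lt : H < 1).
Local Notation Rd := 'rV[R]_d.
Variables (mu : {sigma_finite_measure set Rd -> \bar R}) (f : Rd -> R).
Hypotheses (mu_tempered : tempered mu) (f_ge0 : forall x, 0 <= f x)
  (mu_f : is_fourier_transform mu f).
Context (dO : measure_display) (O : measurableType dO) (P : probability O R).
Variables (W : R -> set Rd -> {RV P >-> R}).
Hypothesis W_noise : gaussian_noise H f W.
Hypothesis mu_dalang : (\int[mu]_xi (dalang H xi)%:E < +oo)%E.

Lemma heat_in_HP t x : 0 <= t -> in_HP H mu (heat_integrand t x).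
Proof.
move=> t0; apply: (approximable_in_HP H_gt H_lt).
exact: (approximable_heat H_gt H_lt mu_dalang x mu_tempered f_ge0 mu_f t0).
Qed.

Lemma solution_constructed :
  exists u : R -> Rd -> {RV P >-> R}, is_solution H mu W u.
Proof.
have /choice[v hv] : forall q : R * Rd, exists X : {RV P >-> R},
    0 <= q.1 -> is_wiener_integral H mu W (heat_integrand q.1 q.2) X.
  move=> q; have [q0|q0] := leP 0 q.1; last by exists (W 0 set0).
  have [X hX] := wiener_integral_exists H_gt H_lt mu_tempered f_ge0 mu_f W_noise (heat_in_HP q.2 q0).
  by exists X.
by exists (fun t x => v (t, x)) => t x t0; exact: (hv (t, x)).
Qed.

Variable u : R -> Rd -> {RV P >-> R}.
Hypothesis u_sol : is_solution H mu W u.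

Definition hp_bound (T : R) : R :=
  alphaH H * (weight_const H T * fine (\int[mu]_xi (dalang H xi)%:E)).

Lemma hp_heat_le T t x : 0 <= t <= T ->
  (hp_norm2 H mu (heat_integrand t x) <= (hp_bound T)%:E)%E.
Proof.
move=> /andP[t0 tT]; have hh := admissible_heat x t0.
rewrite (hp_norm2E H_gt mu hh) /hp_bound (EFinM (alphaH H)).
apply: lee_wpmul2l; first by rewrite lee_fin (ltW (alphaH_gt0 H_gt)).
have idal := dalang_integrable mu_dalang.
have -> : fine (\int[mu]_xi (dalang H xi)%:E) = \int[mu]_xi (dalang H xi) by [].
rewrite -(RintegralZl _ measurableT idal) (EFin_Rintegral (Rint_integrableZ _ idal)).
apply: ge0_le_int.
- exact: measurable_freq_energy.
- by apply: measurable_funM => //; exact: measurable_dalang.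
- by move=> xi; exact: freq_energy_ge0.
- by move=> xi; exact: freq_energy_heat_le.
Qed.

Lemma solution_moments (p T : R) : 2 <= p -> (sup_moment u p T < +oo)%E.
Proof.
move=> p2; pose n := (Num.truncn p).+1.
have p0 : 0 <= p by move: p2; lra.
have pn : p <= n%:R by rewrite ltW// truncnS_gt.
have n2 : (2 <= n)%N by rewrite -(ler_nat R); exact: le_trans pn.
pose K := moment_const n%:R (2 * hp_bound T + 2).
apply: (@le_lt_trans _ _ (1 + K)%:E); last exact: ltry.
apply: ge_ereal_sup => _ [[t x] /= tT <-]; have /andP[t0 _] := tT.
have mX : measurable_fun setT (u t x : O -> R) by exact: measurable_funPT.
have mn : measurable_fun setT (fun w => `|u t x w|).
  exact: measurableT_comp (@normr_measurable R setT) mX.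
have h := wiener_integral_moment H_gt H_lt mu_tempered f_ge0 mu_f W_noise (u_sol x t0) n2 (hp_heat_le x tT).
rewrite unlock EFinD.
apply: (@le_trans _ _ (\int[P]_w (1 + `|u t x w| ^+ n)%:E)%E).
  apply: ge0_le_int.
  - exact: (measurableT_comp (measurable_powR _) mn).
  - by apply: measurable_funD => //; exact: measurable_funX.
  - by move=> w; exact: powR_ge0.
  - by move=> w; exact: powR_le_exprn.
have g0 w : [set: O] w -> (0 <= (`|u t x w| ^+ n)%:E)%E by move=> _; rewrite lee_fin exprn_ge0.
have mg : measurable_fun setT (fun w => (`|u t x w| ^+ n)%:E).
  by apply/measurable_EFinP; exact: measurable_funX.
have -> : (\int[P]_w (1 + `|u t x w| ^+ n)%:E = \int[P]_w 1 + \int[P]_w (`|u t x w| ^+ n)%:E)%E.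
  by apply: (ge0_integralD P measurableT (f1 := fun=> 1%E) _ _ g0 mg).
apply: leeD; last exact: h.
have -> : (\int[P]_w 1 = 1%:E * P setT)%E by exact: integral_cst.
by rewrite mul1e; exact: probability_le1.
Qed.

Lemma solution_L2_continuous : L2_continuous u.
Proof.
move=> t x t0; apply: cvg_within_seq => q q0 qc.
have tc : (q n).1 @[n --> \oo] --> t by exact: (cvg_comp _ _ qc cvg_fst).
have xc : (q n).2 @[n --> \oo] --> x by exact: (cvg_comp _ _ qc cvg_snd).
have hc := hp_heat_cvg H_gt H_lt mu_dalang q0 t0 tc xc.
have hA n := admissible_heat (q n).2 (q0 n); have hB := admissible_heat x t0.
have h0 n := hp_norm2_ge0 H_gt H_lt mu (admissibleB (hA n) hB).
have E0 n : (0 <= 'E_P[(fun w => (u (q n).1 (q n).2 w - u t x w) ^+ 2)%R])%E.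
  by rewrite unlock; exact: int_sqr_ge0.
apply/(cvge0P _ E0) => r r0; have r46 : 0 < r / 46 by rewrite divr_gt0.
have [N _ hN] := (cvge0P _ h0).1 hc _ r46; exists N => // n /= Nn.
have := wiener_integral_dist H_gt H_lt mu_tempered f_ge0 mu_f W_noise
  (u_sol (q n).2 (q0 n)) (u_sol x t0) r46 (hN n Nn).
by rewrite unlock (_ : 46 * (r / 46) = r)//; field.
Qed.

End heat_solution.

Theorem theorem4p1 (R : realType) (d : nat) (d_gt0 : (0 < d)%N)
  (H : R) (H_gt : 1 / 2 < H) (H_lt : H < 1)
  (mu : {measure set 'rV[R]_d -> \bar R}) (mu_tempered : tempered mu)
  (f : 'rV[R]_d -> R) (f_ge0 : forall x, 0 <= f x)
  (mu_f : is_fourier_transform mu f)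
  (dO : measure_display) (O : measurableType dO) (P : probability O R)
  (P_complete : measure_is_complete P)
  (W : R -> set 'rV[R]_d -> {RV P >-> R}) (W_noise : gaussian_noise H f W) :
  (solution_exists H mu <->
    (\int[mu]_xi ((1 / (1 + sqnorm xi)) `^ (2 * H))%:E < +oo)%E) /\
  ((\int[mu]_xi ((1 / (1 + sqnorm xi)) `^ (2 * H))%:E < +oo)%E ->
    (exists u : R -> 'rV[R]_d -> {RV P >-> R}, is_solution H mu W u) /\
    (forall u : R -> 'rV[R]_d -> {RV P >-> R}, is_solution H mu W u ->
      (forall p T : R, 2 <= p -> 0 < T -> (sup_moment u p T < +oo)%E) /\
      L2_continuous u)).
Proof.
have [nu nuE] := sigma_finite_pack (tempered_sigma_finite mu_tempered).
subst mu; split; first split.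
- move=> ex; exact: (in_HP_dalang H_gt H_lt mu_tempered f_ge0 mu_f (ex 1 0 ler01)).
- by move=> hd t x; exact: (heat_in_HP H_gt H_lt mu_tempered f_ge0 mu_f hd).
move=> hd; split.
  exact: (solution_constructed H_gt H_lt mu_tempered f_ge0 mu_f W_noise hd).
move=> u hu; split.
  by move=> p T p2 _; exact: (solution_moments H_gt H_lt mu_tempered f_ge0 mu_f W_noise hd hu).
exact: (solution_L2_continuous H_gt H_lt mu_tempered f_ge0 mu_f W_noise hd hu).
Qed.
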